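(* Fix $d\geq 3$, and let $G_n$ be a uniformly random simple $d$-regular graph on $n$ vertices with adjacency matrix $A_n$. Let $\lambda_1\geq\cdots\geq\lambda_n$ be the eigenvalues of $(d-1)^{-1/2}A_n$. Suppose $f$ is a function defined on $\mathbb{C}$, analytic inside a Bernstein ellipse of radius $2\rho$, where $\rho=(d-1)^{\alpha}$ for some $\alpha>3/2$, and such that $|f(z)|$ is bounded inside this ellipse. Then $f$ can be expanded on $[-2,2]$ as \[ f(x)=\sum_{k=0}^\infty a_k\Gamma_k(x), \] and $Y^{(n)}_f:=\sum_{i=1}^n f(\lambda_i)-na_0$ converges in law as $n\to\infty$ (along $n$ even if $d$ is odd) to the infinitely divisible random variable \[ Y_f:=\sum_{k=1}^\infty \frac{a_k}{(d-1)^{k/2}}\mathrm{CNBW}^{(\infty)}_k. \]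
   Context: A random $d$-regular graph on $n$ vertices is chosen uniformly from all simple $d$-regular graphs on $\{1,\dots,n\}$ (with $n$ even when $d$ is odd). Bernstein ellipse: for $\rho>1$, the Bernstein ellipse of radius $\rho$ is the image of the circle $\{|z|=\rho\}$ under $z\mapsto (z+z^{-1})/2$; it has foci $\pm1$ and the sum of its semiaxes is $\rho$. Polynomials: with $T_n$ the Chebyshev polynomials of the first kind ($T_n(\cos\theta)=\cos n\theta$), define $\Gamma_0(x)=1$, $\Gamma_{2k}(x)=2T_{2k}(x/2)+\frac{d-2}{(d-1)^k}$ for $k\geq1$, and $\Gamma_{2k+1}(x)=2T_{2k+1}(x/2)$ for $k\geq 0$. Limit variables: $(C^{(\infty)}_k,\ k\geq 3)$ are independent Poisson random variables with $\mathbb{E}C^{(\infty)}_k=(d-1)^k/(2k)$, $C^{(\infty)}_1=C^{(\infty)}_2=0$, and $\mathrm{CNBW}^{(\infty)}_k=\sum_{j\mid k}2jC^{(\infty)}_j$. *)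

(* Defs.v *)
From HB Require Import structures.
From mathcomp Require Import all_boot all_order all_algebra.
From mathcomp Require Import all_classical all_reals all_analysis.
From mathcomp Require Import complex polyrcf.

Set Implicit Arguments.
Unset Strict Implicit.
Unset Printing Implicit Defensive.

Import Order.TTheory GRing.Theory Num.Theory.
Import numFieldNormedType.Exports.

Local Open Scope classical_set_scope.
Local Open Scope complex_scope.
Local Open Scope ring_scope.

(* [R[i]] carries no canonical topology; through this alias it receives the
   usual one, as every numClosedFieldType does. *)
Definition Cplx (R : realType) : numClosedFieldType := R[i].

(* A simple graph on n vertices is a symmetric irreflexive boolean matrix. *)
Definition regular_graphs (n d : nat) : {set 'M[bool]_n} :=
  [set G : 'M[bool]_n | [&& [forall i, ~~ G i i],
                            [forall i, forall j, G i j == G j i]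
                          & [forall i, #|[set j | G i j]| == d]]]%SET.

Definition adjacency (R : realType) (n : nat) (G : 'M[bool]_n) : 'M[R]_n :=
  \matrix_(i, j) (G i j)%:R.

(* [rootsR] lists the distinct real roots in increasing order. *)
Definition eigenvalues (R : realType) (n : nat) (M : 'M[R]_n) : seq R :=
  flatten [seq nseq (mup x (char_poly M)) x | x <- rev (rootsR (char_poly M))].

Lemma char_poly_sym_split (R : realType) (n : nat) (M : 'M[R]_n) : M^T = M ->
  exists s : seq R, char_poly M = \prod_(x <- s) ('X - x%:P).
Proof.
move=> symM; pose A := map_mx (real_complex R) M.
have hA : A \is hermsymmx.
  apply: realsym_hermsym.
    apply/is_hermitianmxP; rewrite expr0 scale1r map_mx_id // /A.
    by apply/matrixP => i j; rewrite !mxE -{1}symM mxE.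
  apply/mxOverP => i j; by rewrite mxE; apply/complex_realP; exists (M i j).
have /orthomx_spectralP AE := hermitian_normalmx hA.
have /mxOverP Dreal := hermitian_spectral_diag_real hA.
have Punit := spectral_unit A.
pose D := spectral_diag A.
exists [seq complex.Re (D 0 i) | i <- enum 'I_n].
apply: (map_inj_poly (fmorph_inj (real_complex R))); first by rewrite rmorph0.
rewrite map_char_poly -/A rmorph_prod big_map big_enum /=.
have -> : char_poly A = char_poly (diag_mx D).
  rewrite /char_poly [in LHS]/char_poly_mx {1}AE.
  have -> : 'X%:M - map_mx polyC (invmx (spectralmx A) *m diag_mx D *m spectralmx A)
     = map_mx polyC (invmx (spectralmx A)) *m char_poly_mx (diag_mx D) *m map_mx polyC (spectralmx A).
    rewrite !map_mxM /char_poly_mx mulmxBr mulmxBl; congr (_ - _).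
    by rewrite mul_mx_scalar -scalemxAl -map_mxM mulVmx // map_mx1 scalemx1.
  rewrite !det_mulmx mulrAC -det_mulmx -map_mxM mulVmx // map_mx1 det1.
  by rewrite mul1r.
rewrite char_poly_trig ?diag_mx_is_trig //; apply: eq_bigr => i _.
rewrite rmorphB /= map_polyX map_polyC /= mxE eqxx mulr1n.
by rewrite -[in LHS](RRe_real (Dreal 0 i)).
Qed.

Lemma eigenvaluesP (R : realType) (n : nat) (M : 'M[R]_n) : M^T = M ->
  sorted >=%R (eigenvalues M) /\
  char_poly M = \prod_(x <- eigenvalues M) ('X - x%:P).
Proof.
move=> /char_poly_sym_split[s sE].
have p0 : char_poly M != 0 by rewrite monic_neq0 ?char_poly_monic.
have cnt (r : seq R) x : uniq r ->
    count_mem x (flatten [seq nseq (mup y (char_poly M)) y | y <- r]) =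
    ((x \in r) * mup x (char_poly M))%N.
  elim: r => //= y r IH /andP[yr ur]; rewrite count_cat IH // count_nseq /= in_cons.
  rewrite eq_sym; case: (eqVneq x y) => [->|] //=.
  by rewrite (negbTE yr) addn0.
have sortR : sorted <%R (rootsR (char_poly M)) by exact: sorted_roots.
split.
  rewrite /eigenvalues.
  have : sorted >%R (rev (rootsR (char_poly M))) by rewrite rev_sorted.
  elim: (rev _) => //= y r IH; rewrite (path_sortedE (rev_trans lt_trans)).
  move=> /andP[/allP yr /IH {}IH].
  elim: (mup y _) => //= m IHm; rewrite (path_sortedE (rev_trans le_trans)) IHm.
  rewrite andbT all_cat all_nseq lexx orbT /=; apply/allP => z /flattenP[l /mapP[w wr ->]].
  by rewrite mem_nseq => /andP[_ /eqP ->]; exact/ltW/yr.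
rewrite {1}sE; apply: perm_big; rewrite /perm_eq; apply/allP => x _ /=; apply/eqP.
rewrite cnt ?rev_uniq ?(sorted_uniq lt_trans ltxx) // mem_rev.
have <- := roots_on_rootsR p0 x; rewrite in_itv /= {2}sE mu_prod_XsubC.
case: (boolP (root _ _)); first by rewrite mul1n.
by rewrite sE root_prod_XsubC => /count_memPn.
Qed.

Definition regular_mean (R : realType) (n d : nat) (h : 'M[bool]_n -> R) : R :=
  (\sum_(G in regular_graphs n d) h G) / #|regular_graphs n d|%:R.

Definition bernstein_ellipse (R : realType) (rho : R) : set (Cplx R) :=
  [set (w + w^-1) / 2 | w in [set w : Cplx R | `|w| = rho%:C]].

(* An ellipse centred at 0 bounds a convex region, so the points inside it are
   the t * w with w on the ellipse and 0 <= t < 1. *)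
Definition inside_bernstein_ellipse (R : realType) (rho : R) : set (Cplx R) :=
  [set z | exists t : R, exists2 w, bernstein_ellipse rho w &
             0 <= t < 1 /\ z = t%:C * w].

Definition analytic_on (R : realType) (D : set (Cplx R))
    (f : Cplx R -> Cplx R) : Prop :=
  forall z0, D z0 -> exists (c : nat -> Cplx R) (r : R), 0 < r /\
    forall z, `|z - z0| < r%:C ->
      (\sum_(0 <= k < N) c k * (z - z0) ^+ k) @[N --> \oo] --> f z.

Fixpoint chebyshev (R : realType) (n : nat) : {poly R} :=
  if n is m.+1 then
    if m is p.+1 then 2%:P * 'X * chebyshev R m - chebyshev R p else 'X
  else 1.

Lemma chebyshev_cos (R : realType) (n : nat) (theta : R) :
  (chebyshev R n).[cos theta] = cos (n%:R * theta).
Proof.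
suff: (chebyshev R n).[cos theta] = cos (n%:R * theta) /\
      (chebyshev R n.+1).[cos theta] = cos (n.+1%:R * theta) by case.
elim: n => [|n [IH0 IH1]]; first by rewrite /= hornerC hornerX mul0r cos0 mul1r.
split=> //; rewrite [chebyshev R n.+2]/= -/(chebyshev R n.+1).
rewrite !(hornerD, hornerN, hornerM, hornerC, hornerX) IH0 IH1.
have -> : n.+2%:R * theta = n.+1%:R * theta + theta.
  by rewrite -addn1 natrD mulrDl mul1r.
have -> : n%:R * theta = n.+1%:R * theta - theta.
  by rewrite -[n.+1]addn1 natrD mulrDl mul1r addrK.
rewrite cosB cosD opprD addrA mulrC mulrA mulr2n mulrDr mulr1 mulrDl.
by rewrite addrK.
Qed.

Definition Gamma (R : realType) (d k : nat) (x : R) : R :=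
  if k == 0%N then 1
  else 2 * (chebyshev R k).[x / 2] +
       (if odd k then 0 else (d%:R - 2) / (d%:R - 1) ^+ k./2).

Definition linear_statistic (R : realType) (f : Cplx R -> Cplx R)
    (a0 : Cplx R) (d n : nat) (G : 'M[bool]_n) : Cplx R :=
  \sum_(l <- eigenvalues ((Num.sqrt (d%:R - 1))^-1 *: adjacency R G)) f l%:C
  - n%:R * a0.

Section Probability.
Context {R : realType} {disp : measure_display} {T : measurableType disp}.
Variable P : probability T R.

Definition mutually_independent (I : eqType) (U : Type) (S : set (set U))
    (D : set I) (X : I -> T -> U) : Prop :=
  forall s : seq I, uniq s -> {in s, forall i, D i} ->
  forall B : I -> set U, (forall i, S (B i)) ->
    P (\bigcap_(i in [set` s]) X i @^-1` B i) =
    (\prod_(i <- s) P (X i @^-1` B i))%E.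

Definition borel : set (set (Cplx R)) := <<s [set U : set (Cplx R) | open U] >>.

Definition complex_RV (Y : T -> Cplx R) : Prop :=
  forall B, borel B -> measurable (Y @^-1` B).

Definition limit_cycle_counts (d : nat) (C : nat -> {RV P >-> nat}) : Prop :=
  [/\ mutually_independent measurable [set k | (3 <= k)%N] C,
      forall k m, (3 <= k)%N -> P (C k @^-1` [set m]) =
        (poisson_pmf ((d%:R - 1) ^+ k / (2 * k)%:R) m)%:E,
      forall t, C 1%N t = 0%N & forall t, C 2%N t = 0%N].

Definition CNBW (C : nat -> {RV P >-> nat}) (k : nat) (t : T) : nat :=
  (\sum_(j <- divisors k) 2 * j * C j t)%N.

End Probability.
Arguments borel R : clear implicits.

Definition infinitely_divisible (R : realType) (disp : measure_display)
    (T : measurableType disp) (P : probability T R) (Y : T -> Cplx R) : Prop :=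
  forall m : nat, (0 < m)%N ->
  exists (disp' : measure_display) (T' : measurableType disp')
         (P' : probability T' R) (X : 'I_m -> T' -> Cplx R),
    [/\ forall i, complex_RV (X i),
        mutually_independent P' (borel R) setT X,
        forall i j B, borel R B -> P' (X i @^-1` B) = P' (X j @^-1` B)
      & forall B, borel R B ->
          P (Y @^-1` B) = P' ((fun t => \sum_(i < m) X i t) @^-1` B)].

(* Convergence in law, along the n for which d-regular graphs exist, of
   [X n G], with G uniform among the d-regular graphs on n vertices. *)
Definition regular_cvg_in_law (R : realType) (d : nat)
    (X : forall n, 'M[bool]_n -> Cplx R) (disp : measure_display)
    (T : measurableType disp) (P : probability T R) (Y : T -> Cplx R) : Prop :=
  forall g : Cplx R -> R, continuous g -> (exists M, forall z, `|g z| <= M) ->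
    (regular_mean d (fun G => g (X n G)))%:E
      @[n --> within [set n | odd d ==> ~~ odd n] \oo]
    --> ('E_P[fun t => g (Y t)])%E.

(* Main.v *)
(* Write q = d - 1, and let CNBW_k(G) be the number of closed walks of length k in G
   that never backtrack, not even at their base point.  The traces of the powers of the
   non-backtracking matrix of a d-regular graph give CNBW_k(G) = q^(k/2) * (sum of Gamma_k
   over the eigenvalues), so the statistic is exactly the sum over k >= 1 of
   a_k q^(-k/2) CNBW_k(G_n).

   The ellipse contains a disc of radius larger than q + 1/q around 0; regrouping the Taylor
   series of f there into Chebyshev polynomials gives a_k = O(q^-k).  Switchings of edges
   compare the number of regular graphs containing a given edge set with and without one
   more edge; they yield E CNBW_k(G_n) = O(k^2 q^k) uniformly in n, so the sum over k can be
   truncated uniformly in n, and they show that the joint factorial moments of the short cycle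
   counts converge to those of independent Poisson variables.  Up to walks of expected number
   O(1/n), CNBW_k is the sum over j | k of 2 j times the number of j-cycles, and Bonferroni's
   inequalities turn the convergence of factorial moments into convergence of the joint law
   of these counts.

   For infinite divisibility, Y_f is an additive function of a sequence of independent Poisson
   variables, and each of them is a sum of m independent ones with parameter divided by m;
   such sequences live on [0, 1[ through nested subdivisions into intervals. *)
Require Import Defs.
From mathcomp Require Import all_boot all_order all_algebra.
From mathcomp Require Import all_classical all_reals all_analysis.
From mathcomp Require Import complex polyrcf perm.
From mathcomp Require Import ring lra zify.
Import Order.TTheory GRing.Theory Num.Theory.
Import numFieldNormedType.Exports.
Set Implicit Arguments.
Unset Strict Implicit.
Unset Printing Implicit Defensive.
From mathcomp Require Import fintype finset.

(** * Switchings *)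

Section Switching.
Variables (n d : nat).
Implicit Types (G : 'M[bool]_n) (E : {set 'I_n * 'I_n}) (u v x y i j : 'I_n).

(** Eigenvalues may be as large as d / sqrt q = sqrt q + 1 / sqrt q > 2, so an expansion on [-2, 2]
    alone would not evaluate the statistic: the series has to converge up to that point, where
    [Gamma d k] grows like q^(k/2). The decay of the a_k comes from positivity: the coefficients of
    x^m in the Chebyshev basis are nonnegative, and evaluation at x = s + 1/s bounds their sum
    against s^k by (s + 1/s)^m. The choice s = q asks for a disc of radius above q + 1/q, and alpha
    > 3/2 makes the minor semiaxis rho - 1/(4 rho) of the ellipse that large. The bound on E CNBW_k
    has to hold for all k at once, also for k beyond n, where the switching bounds do not apply;
    there n d is itself O(k), and the trivial count n d q^k of walks is enough. Test functions are
    bounded and continuous but not uniformly continuous. Closeness in mean is turned into closeness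
    of laws by a modulus of continuity that pays for large arguments with a first moment, and this
    moment is again bounded uniformly in n. *)

Lemma regular_graphsP G :
  reflect [/\ forall i, G i i = false, forall i j, G i j = G j i
            & forall i, #|[set j | G i j]%SET| = d]
          (G \in regular_graphs n d).
Proof.
rewrite inE; apply: (iffP and3P) => -[h1 h2 h3]; split.
- by move=> i; apply/negbTE/(forallP h1).
- by move=> i j; apply/eqP; move/forallP/(_ i)/forallP: h2; apply.
- by move=> i; apply/eqP/(forallP h3).
- by apply/forallP => i; rewrite h1.
- by apply/forallP => i; apply/forallP => j; rewrite h2.
- by apply/forallP => i; rewrite h3.
Qed.

(** Edges are ordered pairs, so every undirected edge counts twice; hence the cardinalities [2 * e]
    below. *)
Definition edge_set G : {set 'I_n * 'I_n} := [set p | G p.1 p.2]%SET.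

Definition deg E u : nat := #|[set v | (u, v) \in E]%SET|.

Definition is_graph E : Prop :=
  (forall u v, (u, v) \in E -> (v, u) \in E) /\ (forall u, (u, u) \notin E).

Definition add_edge E u v : {set 'I_n * 'I_n} := ((u, v) |: ((v, u) |: E))%SET.

Definition containing E : {set 'M[bool]_n} :=
  [set G in regular_graphs n d | E \subset edge_set G]%SET.

(** The probability that the random graph contains [E] is [cnt E / cnt set0]; with counts the
    switching bounds stay in [nat]. *)
Definition cnt E : nat := #|containing E|.

Lemma in_add_edge E u v p :
  (p \in add_edge E u v) = [|| p == (u, v), p == (v, u) | p \in E].
Proof. by rewrite !in_setU !in_set1. Qed.

Lemma is_graph_add_edge E u v : is_graph E -> u != v -> is_graph (add_edge E u v).
Proof.
move=> [sE lE] uv; split=> [a b|a]; rewrite !in_add_edge !xpair_eqE.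
  case/or3P => [/andP[-> ->]|/andP[-> ->]|/sE ->]; rewrite ?orbT //.
rewrite (negbTE (lE a)) orbF; apply/negP => /orP[]/andP[/eqP e1 /eqP e2];
  by rewrite -e1 -e2 eqxx in uv.
Qed.

Lemma card_add_edge E u v : u != v -> (u, v) \notin E -> (v, u) \notin E ->
  #|add_edge E u v| = #|E|.+2.
Proof.
move=> uv h1 h2; rewrite !cardsU1 in_setU1 negb_or h1 h2 xpair_eqE.
by rewrite (negbTE uv) /=.
Qed.

Lemma add_edge_sub G E u v : G \in regular_graphs n d ->
  (add_edge E u v \subset edge_set G) = G u v && (E \subset edge_set G).
Proof.
move=> /regular_graphsP[_ sG _].
by rewrite /add_edge !subUset !sub1set !inE /= [G v u]sG andbA andbb.
Qed.

Lemma in_containing E G :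
  (G \in containing E) = (G \in regular_graphs n d) && (E \subset edge_set G).
Proof. by rewrite [LHS]in_set. Qed.

Lemma containing_add E u v G :
  (G \in containing (add_edge E u v)) = (G \in containing E) && G u v.
Proof.
rewrite !in_containing; case: (boolP (G \in regular_graphs _ _)) => //= hG.
by rewrite add_edge_sub // andbC.
Qed.

Lemma deg_add_edge E u v w : is_graph E -> u != v -> (u, v) \notin E ->
  deg (add_edge E u v) w = (deg E w + ((w == u) || (w == v)))%N.
Proof.
move=> [sE lE] uv nE.
have nE' : (v, u) \notin E by apply: contra nE => /sE.
rewrite /deg; case: (eqVneq w u) => [->|wu].
  rewrite (_ : [set _ | _]%SET = v |: [set z | (u, z) \in E])%SET.
    by rewrite cardsU1 !inE nE addnC.
  by apply/setP => z; rewrite !inE !xpair_eqE eqxx (negbTE uv).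
case: (eqVneq w v) => [->|wv].
  rewrite (_ : [set _ | _]%SET = u |: [set z | (v, z) \in E])%SET.
    by rewrite cardsU1 !inE nE' addnC.
  by apply/setP => z; rewrite !inE !xpair_eqE eqxx [v == u]eq_sym (negbTE uv).
rewrite addn0; apply: eq_card => z.
by rewrite !inE !xpair_eqE (negbTE wu) (negbTE wv).
Qed.

(** The pairs uv, ux, vy and xy in both orientations: switching exchanges the edges uv, xy for ux,
    vy, or back. *)
Definition flipped u v x y i j : bool :=
  [|| (i == u) && ((j == v) || (j == x)), (i == v) && ((j == u) || (j == y)),
      (i == x) && ((j == y) || (j == u)) | (i == y) && ((j == x) || (j == v))].

Definition switch u v x y G : 'M[bool]_n :=
  \matrix_(i, j) (G i j (+) flipped u v x y i j).

Lemma switchK u v x y : involutive (switch u v x y).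
Proof. by move=> G; apply/matrixP => i j; rewrite !mxE addbK. Qed.

(* Two flipped entries of opposite values amount to a transposition of the row. *)
Lemma card_flip_row (r : pred 'I_n) (r' : pred 'I_n) (a b : 'I_n) :
  r a = ~~ r b -> (forall j, r' j = r j (+) ((j == a) || (j == b))) ->
  #|[set j | r' j]%SET| = #|[set j | r j]%SET|.
Proof.
move=> rab e; rewrite -(card_preimset [set j | r j]%SET (@perm_inj _ (tperm a b))).
apply: eq_card => j; rewrite !inE e.
case: tpermP => [->|->|/eqP/negbTE-> /eqP/negbTE->]; rewrite ?eqxx ?orbT ?addbT ?addbF ?rab ?negbK //.
Qed.

(** The closed path u, v, y, x alternates between edges and non-edges, so each of its vertices loses
    one neighbour and gains one. *)
Lemma switch_regular u v x y G : G \in regular_graphs n d ->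
  u != v -> x != y -> u != x -> v != y -> u != y -> v != x ->
  G u x = ~~ G u v -> G v y = ~~ G u v -> G x y = G u v ->
  switch u v x y G \in regular_graphs n d.
Proof.
move=> /regular_graphsP[lG sG rG] uv xy ux vy uy vx e1 e2 e3.
have N (a b : 'I_n) : a != b -> ((a == b) = false) * ((b == a) = false).
  by move=> h; rewrite [b == a]eq_sym (negbTE h).
have := (N _ _ uv, N _ _ xy, N _ _ ux, N _ _ vy, N _ _ uy, N _ _ vx) => {}N.
apply/regular_graphsP; split=> [i|i j|i].
- rewrite mxE lG /flipped /=.
  have [->|iu] := eqVneq i u; first by rewrite !N.
  have [->|iv] := eqVneq i v; first by rewrite !N.
  have [->|ix] := eqVneq i x; first by rewrite !N.
  by case: (i == y).
- rewrite !mxE sG; congr (_ (+) _); rewrite /flipped.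
  by case: (i == u); case: (i == v); case: (i == x); case: (i == y);
     case: (j == u); case: (j == v); case: (j == x); case: (j == y).
- have [->|iu] := eqVneq i u.
    rewrite -(rG u); apply: (@card_flip_row _ _ v x); first by rewrite e1 negbK.
    by move=> j; rewrite mxE /flipped eqxx !N /= orbF.
  have [->|iv] := eqVneq i v.
    rewrite -(rG v); apply: (@card_flip_row _ _ u y); first by rewrite sG e2 negbK.
    by move=> j; rewrite mxE /flipped eqxx !N /= orbF.
  have [->|ix] := eqVneq i x.
    rewrite -(rG x); apply: (@card_flip_row _ _ y u); first by rewrite e3 [G x u]sG e1 negbK.
    by move=> j; rewrite mxE /flipped eqxx !N /= orbF.
  have [->|iy] := eqVneq i y.
    rewrite -(rG y); apply: (@card_flip_row _ _ x v); first by rewrite sG e3 [G y v]sG e2 negbK.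
    by move=> j; rewrite mxE /flipped eqxx !N /=.
  rewrite -(rG i); apply: eq_card => j; rewrite !inE mxE /flipped.
  by rewrite (negbTE iu) (negbTE iv) (negbTE ix) (negbTE iy) addbF.
Qed.

Lemma card_pairs (T U : finType) (A : {set T * U}) :
  #|A| = (\sum_i #|[set j | (i, j) \in A]%SET|)%N.
Proof.
rewrite -sum1_card (eq_bigl (fun p => true && ((p.1, p.2) \in A))); last by case.
rewrite -(pair_big_dep xpredT (fun (i : T) (j : U) => (i, j) \in A) (fun _ _ => 1%N)) /=.
by apply: eq_bigr => i _; rewrite -sum1_card; apply: eq_bigl => j; rewrite inE.
Qed.

Lemma card_pairs_swap (T U : finType) (A : {set T * U}) :
  #|A| = (\sum_j #|[set i | (i, j) \in A]%SET|)%N.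
Proof.
rewrite card_pairs; under eq_bigr do rewrite -sum1_card.
rewrite (exchange_big_dep xpredT) //=; apply: eq_bigr => j _.
by rewrite -sum1_card; apply: eq_bigl => i; rewrite !inE.
Qed.

Lemma card_edge_set G : G \in regular_graphs n d -> #|edge_set G| = (n * d)%N.
Proof.
move=> /regular_graphsP[_ _ rG]; rewrite card_pairs.
rewrite (eq_bigr (fun=> d)) ?sum_nat_const ?card_ord // => i _.
by rewrite -(rG i); apply: eq_card => j; rewrite !inE.
Qed.

Section OneEdge.
Variables (E : {set 'I_n * 'I_n}) (u v : 'I_n).
Hypotheses (gE : is_graph E) (uv : u != v) (nE : (u, v) \notin E).

(** Choices of an edge xy outside [E] that can be exchanged together with uv: the new pairs ux and
    vy must be neither loops nor edges. *)
Definition forward_switchings : {set 'M[bool]_n * ('I_n * 'I_n)} :=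
  [set t | [&& t.1 \in containing E, t.1 u v, t.1 t.2.1 t.2.2, t.2 \notin E,
     t.2.1 != u, t.2.2 != v, ~~ t.1 u t.2.1 & ~~ t.1 v t.2.2]]%SET.

(** What forward switchings produce: ux and vy are edges outside [E], while uv and xy are not
    edges. *)
Definition backward_switchings : {set 'M[bool]_n * ('I_n * 'I_n)} :=
  [set t | [&& t.1 \in containing E, ~~ t.1 u v, t.1 u t.2.1, (u, t.2.1) \notin E,
     t.1 v t.2.2, (v, t.2.2) \notin E, t.2.1 != t.2.2 & ~~ t.1 t.2.1 t.2.2]]%SET.

(** New neighbours x of u and y of v from which no backward switching starts; they are the error of
    the lower bound and have to be shown rare. *)
Definition blocked_switchings : {set 'M[bool]_n * ('I_n * 'I_n)} :=
  [set t | [&& t.1 \in containing E, t.1 u t.2.1, (u, t.2.1) \notin E,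
     t.1 v t.2.2, (v, t.2.2) \notin E &
     [|| t.1 u v, t.2.1 == t.2.2 | t.1 t.2.1 t.2.2]]]%SET.

Lemma containingP G : reflect (G \in regular_graphs n d /\
  forall a b, (a, b) \in E -> G a b) (G \in containing E).
Proof.
rewrite in_containing; apply: (iffP andP) => -[-> h]; split=> //.
  by move=> a b /(subsetP h); rewrite inE.
by apply/subsetP => -[a b] /h; rewrite inE.
Qed.

Lemma switch_containing x y G : G \in containing E ->
  switch u v x y G \in regular_graphs n d ->
  (x, y) \notin E -> (u, x) \notin E -> (v, y) \notin E ->
  switch u v x y G \in containing E.
Proof.
move=> /containingP[rG sG] rS xyE uxE vyE; apply/containingP; split=> // a b abE.
rewrite mxE sG //; suff -> : flipped u v x y a b = false by [].
apply/negP; rewrite /flipped => h.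
have S (p q : 'I_n) : (p, q) \notin E -> (q, p) \notin E.
  by apply: contra => /(gE.1).
case/or4P: h => /andP[/eqP e /orP[]/eqP e']; move: abE; rewrite e e'; apply/negP => //; exact: S.
Qed.

(** Switching keeps the pair (x, y), is an involution on matrices, and carries each set into the
    other; two injections force equality. *)
Lemma card_forward_backward : #|forward_switchings| = #|backward_switchings|.
Proof.
pose phi (t : 'M[bool]_n * ('I_n * 'I_n)) := (switch u v t.2.1 t.2.2 t.1, t.2).
have phiI : injective phi.
  by move=> [G [x y]] [G' [x' y']] [+ e1 e2]; rewrite e1 e2 => /(can_inj (switchK _ _ _ _)) ->.
have le (A B : {set 'M[bool]_n * ('I_n * 'I_n)}) :
    (forall t, t \in A -> phi t \in B) -> (#|A| <= #|B|)%N.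
  move=> h; rewrite -(card_imset (mem A) phiI); apply: subset_leq_card.
  by apply/subsetP => _ /imsetP[t tA ->]; exact: h.
apply/eqP; rewrite eqn_leq; apply/andP; split; apply: le => -[G [x y]].
  rewrite in_set => /and5P[Gc Guv Gxy xyE /and4P[xu yv Gux Gvy]].
  have /containingP[rG sG] := Gc; have /regular_graphsP[lG symG _] := rG.
  have xy : x != y by apply: contraTneq Gxy => ->; rewrite lG.
  have uy : u != y by apply: contraNneq Gvy => <-; rewrite symG.
  have vx : v != x by apply: contraNneq Gux => <-.
  have ux : u != x by rewrite eq_sym.
  have vy : v != y by rewrite eq_sym.
  have uxE : (u, x) \notin E by apply: contra Gux; exact: sG.
  have vyE : (v, y) \notin E by apply: contra Gvy; exact: sG.
  rewrite in_set /= switch_containing ?switch_regular ?Guv ?Gxy ?(negbTE Gux) ?(negbTE Gvy) //=.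
  rewrite !mxE /flipped !eqxx ?orbT ?Guv ?(negbTE Gux) ?(negbTE Gvy) ?Gxy /=.
  by rewrite uxE vyE xy ?orbT.
rewrite in_set => /and5P[Gc Guv Gux uxE /and4P[Gvy vyE xy Gxy]].
have /containingP[rG sG] := Gc; have /regular_graphsP[lG symG _] := rG.
have uy : u != y by apply: contraNneq Guv => ->; rewrite symG.
have vx : v != x by apply: contraNneq Guv => ->.
have ux : u != x by apply: contraTneq Gux => <-; rewrite lG.
have vy : v != y by apply: contraTneq Gvy => <-; rewrite lG.
have xyE : (x, y) \notin E by apply: contra Gxy; exact: sG.
rewrite in_set /= switch_containing ?switch_regular ?Gux ?Gvy ?(negbTE Guv) ?(negbTE Gxy) //=.
rewrite !mxE /flipped !eqxx ?orbT ?Gux ?Gvy ?(negbTE Guv) ?(negbTE Gxy) /=.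
by rewrite xyE [x == u]eq_sym ux [y == v]eq_sym vy ?orbT.
Qed.

Lemma card_new_neighbours G w : G \in containing E ->
  #|[set x | G w x && ((w, x) \notin E)]%SET| = (d - deg E w)%N.
Proof.
move=> /containingP[/regular_graphsP[_ _ rG] sG].
rewrite -(rG w) /deg; set A := [set j | G w j]; set B := [set _ | _ \in E].
have BA : B \subset A by apply/subsetP => x; rewrite !inE; exact: sG.
by rewrite -(setIidPr BA) -cardsD; apply: eq_card => x; rewrite !inE andbC.
Qed.

Lemma sum_containing (F : 'M[bool]_n -> nat) (A : {set 'M[bool]_n * ('I_n * 'I_n)}) E' :
  (forall G, G \in containing E' -> #|[set p | (G, p) \in A]| <= F G)%N ->
  (forall t, t \in A -> t.1 \in containing E') ->
  (#|A| <= \sum_(G in containing E') F G)%N.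
Proof.
move=> h1 h2; rewrite card_pairs [X in (_ <= X)%N]big_mkcond /=.
apply: leq_sum => G _; case: ifP => [/h1 //|/negbT nG].
rewrite leqn0 cards_eq0; apply/eqP/setP => p; rewrite !inE.
by apply/negbTE; apply: contra nG => /h2.
Qed.

Lemma card_forward_le : (#|forward_switchings| <= cnt (add_edge E u v) * (n * d))%N.
Proof.
rewrite -sum_nat_const; apply: sum_containing => [G|[G p]]; last first.
  by rewrite in_set containing_add => /and3P[-> ->].
rewrite in_containing => /andP[rG _]; rewrite -(card_edge_set rG).
by apply: subset_leq_card; apply/subsetP => p; rewrite !inE => /and4P[].
Qed.

(** An oriented edge of [G] is unsuitable only if it lies in [E], starts at u or a neighbour of u,
    or ends at v or a neighbour of v; each of the last two kinds has at most [d.+1 * d] members. *)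
Lemma card_forward_ge : (cnt (add_edge E u v) * (n * d) <=
  #|forward_switchings| + cnt (add_edge E u v) * (#|E| + 2 * (d.+1 * d)))%N.
Proof.
rewrite card_pairs (bigID (mem (containing (add_edge E u v)))) /=.
rewrite -addnA addnCA; apply: leq_trans (leq_addl _ _).
rewrite -!sum_nat_const -big_split /=; apply: leq_sum => G.
rewrite containing_add => /andP[Gc Guv].
have /containingP[rG sG] := Gc; have /regular_graphsP[lG symG dG] := rG.
rewrite -{1}(card_edge_set rG).
pose F1 : {set 'I_n * 'I_n} := [set p | G p.1 p.2 && ((p.1 == u) || G u p.1)].
pose F2 : {set 'I_n * 'I_n} := [set p | G p.1 p.2 && ((p.2 == v) || G v p.2)].
have nbr w : (#|[set x | (x == w) || G w x]| <= d.+1)%N.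
  rewrite -(dG w) (_ : [set x | _] = w |: [set x | G w x]); last first.
    by apply/setP => x; rewrite !inE.
  by rewrite cardsU1; case: (w \notin _); rewrite ?leqnSn.
have c1 : (#|F1| <= d.+1 * d)%N.
  rewrite card_pairs (bigID (fun x => (x == u) || G u x)) /= [X in (_ + X)%N]big1 ?addn0.
    apply: (@leq_trans (\sum_(i | (i == u) || G u i) d)).
      apply: leq_sum => i _; rewrite -(dG i); apply: subset_leq_card.
      by apply/subsetP => j; rewrite !inE => /andP[].
    by rewrite sum_nat_const leq_mul2r -cardsE nbr orbT.
  move=> i /negbTE h; apply/eqP; rewrite cards_eq0; apply/eqP/setP => j.
  by rewrite !inE /= h andbF.
have c2 : (#|F2| <= d.+1 * d)%N.
  rewrite card_pairs_swap (bigID (fun x => (x == v) || G v x)) /= [X in (_ + X)%N]big1 ?addn0.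
    apply: (@leq_trans (\sum_(i | (i == v) || G v i) d)).
      apply: leq_sum => i _; rewrite -(dG i); apply: subset_leq_card.
      by apply/subsetP => j; rewrite !inE symG => /andP[].
    by rewrite sum_nat_const leq_mul2r -cardsE nbr orbT.
  move=> i /negbTE h; apply/eqP; rewrite cards_eq0; apply/eqP/setP => j.
  by rewrite !inE /= h andbF.
set S := [set p | _ \in _].
apply: (@leq_trans #|S :|: (E :|: (F1 :|: F2))|).
  apply: subset_leq_card; apply/subsetP => -[x y]; rewrite in_set /= => Gxy.
  rewrite !in_setU [_ \in F1]in_set [_ \in F2]in_set [_ \in S]in_set.
  rewrite [_ \in forward_switchings]in_set /= Gxy Gc Guv /=; case: (boolP ((x, y) \in E)) => //=; rewrite ?orbT // => _.
  case: (x == u) => //=; rewrite ?orbT //; case: (y == v) => //=; rewrite ?orbT //.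
  by case: (G u x); case: (G v y); rewrite ?orbT.
apply: leq_trans (leq_card_setU _ _) _; rewrite leq_add2l.
apply: leq_trans (leq_card_setU _ _) _; rewrite leq_add2l.
by apply: leq_trans (leq_card_setU _ _) _; rewrite mul2n -addnn leq_add.
Qed.

Lemma card_backward_le :
  (#|backward_switchings| <= (d - deg E u) * (d - deg E v) * cnt E)%N.
Proof.
rewrite mulnC -sum_nat_const; apply: sum_containing => [G Gc|[G p]]; last first.
  by rewrite in_set => /andP[].
rewrite -(card_new_neighbours u Gc) -(card_new_neighbours v Gc) -cardsX.
apply: subset_leq_card; apply/subsetP => -[x y]; rewrite !inE /=.
by case/and5P => _ _ -> -> /and3P[-> ->].
Qed.

Lemma card_backward_ge : ((d - deg E u) * (d - deg E v) * cnt E <=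
  #|backward_switchings| + #|blocked_switchings|)%N.
Proof.
rewrite mulnC -sum_nat_const !card_pairs -big_split /= big_mkcond /=.
apply: leq_sum => G _; case: ifP => // Gc.
rewrite -(card_new_neighbours u Gc) -(card_new_neighbours v Gc) -cardsX.
apply: leq_trans (leq_card_setU _ _); apply: subset_leq_card.
apply/subsetP => -[x y] /setXP[]; rewrite /= [x \in _]in_set [y \in _]in_set.
move=> /andP[a1 a2] /andP[b1 b2]; rewrite in_setU; apply/orP.
case: (boolP [|| G u v, x == y | G x y]) => h; [right|left];
  rewrite in_set [_ \in _]in_set /= Gc a1 a2 b1 b2 //=.
by move: h; rewrite !negb_or.
Qed.

Lemma switch_upper : (cnt (add_edge E u v) * (n * d) <=
  (d - deg E u) * (d - deg E v) * cnt E +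
  cnt (add_edge E u v) * (#|E| + 2 * (d.+1 * d)))%N.
Proof.
apply: leq_trans card_forward_ge _; rewrite leq_add2r.
by rewrite card_forward_backward card_backward_le.
Qed.

Lemma switch_lower : ((d - deg E u) * (d - deg E v) * cnt E <=
  cnt (add_edge E u v) * (n * d) + #|blocked_switchings|)%N.
Proof.
apply: leq_trans card_backward_ge _; rewrite leq_add2r.
by rewrite -card_forward_backward card_forward_le.
Qed.

(** The hypothesis makes the error in [switch_upper] at most half of n d, and the other half stays
    on the left. *)
Lemma cnt_add_edge_le : (0 < d)%N -> (2 * (#|E| + 2 * (d.+1 * d)) <= n * d)%N ->
  (cnt (add_edge E u v) * n <= 2 * d * cnt E)%N.
Proof.
move=> d0 h; have := switch_upper.
have m1 := leq_subr (deg E u) d; have m2 := leq_subr (deg E v) d.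
have := leq_mul (leq_mul m1 m2) (leqnn (cnt E)).
move=> h1 h2; rewrite -(leq_pmul2r d0).
nia.
Qed.

End OneEdge.

Lemma remove_edge E u v : is_graph E -> (u, v) \in E ->
  exists E', [/\ is_graph E', E = add_edge E' u v, (u, v) \notin E' & u != v].
Proof.
move=> [sE lE] uvE; exists (E :\ (u, v) :\ (v, u)).
have uv : u != v by apply: contraTneq uvE => ->; exact: lE.
split=> //; last by rewrite !inE eqxx andbF.
- split=> [a b|a]; last by rewrite !inE (negbTE (lE a)) !andbF.
  rewrite !inE !xpair_eqE => /and3P[h1 h2 /sE ->].
  by rewrite andbT [(b == _) && _]andbC h2 [(b == _) && _]andbC h1.
- apply/setP => -[a b]; rewrite in_add_edge !inE.
  case: eqP => [->|] //=; case: eqP => [->|] //=; by rewrite sE.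
Qed.

Hypothesis d_gt0 : (0 < d)%N.

(** One use of [cnt_add_edge_le] per edge: each costs a factor 2 d / n in probability. *)
Lemma cnt_le e E : is_graph E -> #|E| = (2 * e)%N ->
  (2 * (#|E| + 2 * (d.+1 * d)) <= n * d)%N ->
  (cnt E * n ^ e <= (2 * d) ^ e * cnt set0)%N.
Proof.
elim: e E => [|e IH] E gE cE h.
  by move: cE; rewrite muln0 => /eqP; rewrite cards_eq0 => /eqP ->; rewrite muln1 mul1n.
have /card_gt0P[[u v] uvE] : (0 < #|E|)%N by rewrite cE.
have [E' [gE' eE nE uv]] := remove_edge gE uvE.
have nE' : (v, u) \notin E' by apply: contra nE => /(gE'.1).
move: cE h; rewrite eE card_add_edge // => cE h.
have h' : (2 * (#|E'| + 2 * (d.+1 * d)) <= n * d)%N by lia.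
have := cnt_add_edge_le gE' uv nE d_gt0 h'.
have := IH E' gE' _ h'; rewrite !expnS => /(_ ltac:(lia)).
nia.
Qed.

Lemma cnt_add_le e E u v : is_graph E -> #|E| = (2 * e)%N -> u != v ->
  (u, v) \notin E -> (2 * (#|E|.+2 + 2 * (d.+1 * d)) <= n * d)%N ->
  (cnt (add_edge E u v) * n ^ e.+1 <= (2 * d) ^ e.+1 * cnt set0)%N.
Proof.
move=> gE cE uv nE h; have nE' : (v, u) \notin E by apply: contra nE => /(gE.1).
by apply: cnt_le; rewrite ?card_add_edge ?cE //; [exact: is_graph_add_edge|lia|rewrite -cE].
Qed.

(** One summand for each reason of being blocked: uv is an edge, x = y, xy is an edge outside [E],
    xy is in [E]. *)
Definition block_const e : nat :=
  ((2 * d) ^ e.+1 * (d * d) + (2 * d) ^ e.+2 + (2 * d) ^ e.+3 + 2 * e * (2 * d) ^ e.+2)%N.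

(** Beyond [E], a blocked configuration has more edges than free vertices: the edge uv with x and y
    among d neighbours each; ux and vx with x free; three edges with x and y free; two edges with xy
    one of the 2 e pairs of [E]. Every edge costs a factor O(1/n) and every free vertex gains n, so
    at most O(n^-(e+1)) remains. *)
Lemma card_blocked_le e E u v : is_graph E -> #|E| = (2 * e)%N -> u != v ->
  (u, v) \notin E -> (2 * (2 * e + 6 + 2 * (d.+1 * d)) <= n * d)%N ->
  (#|blocked_switchings E u v| * n ^ e.+1 <= block_const e * cnt set0)%N.
Proof.
move=> gE cE uv nE h.
have n0 : (0 < n)%N by exact: leq_ltn_trans (ltn_ord u).
pose ok (t : 'M[bool]_n * ('I_n * 'I_n)) :=
  [&& t.1 \in containing E, t.1 u t.2.1, (u, t.2.1) \notin E, t.1 v t.2.2 & (v, t.2.2) \notin E].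
pose B1 := [set t | ok t && t.1 u v].
pose B2 := [set t | [&& ok t, ~~ t.1 u v & t.2.1 == t.2.2]].
pose B3 := [set t | [&& ok t, ~~ t.1 u v, t.2.1 != t.2.2, t.1 t.2.1 t.2.2 & t.2 \notin E]].
pose B4 := [set t | [&& ok t, ~~ t.1 u v, t.2.1 != t.2.2, t.1 t.2.1 t.2.2 & t.2 \in E]].
have sub : blocked_switchings E u v \subset (B1 :|: B2) :|: (B3 :|: B4).
  apply/subsetP => -[G [x y]]; rewrite !in_setU [_ \in blocked_switchings _ _ _]in_set.
  rewrite [_ \in B1]in_set [_ \in B2]in_set [_ \in B3]in_set [_ \in B4]in_set /ok /=.
  case/and5P => -> -> -> -> /andP[-> /=].
  by case: (G u v); case: (x == y); case: (G x y); case: (_ \in E).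
have b1 : (#|B1| * n ^ e.+1 <= (2 * d) ^ e.+1 * (d * d) * cnt set0)%N.
  have : (#|B1| <= cnt (add_edge E u v) * (d * d))%N.
    rewrite -sum_nat_const; apply: sum_containing => [G|[G p]]; last first.
      by rewrite in_set containing_add => /andP[/and5P[-> _ _ _ _] ->].
    rewrite containing_add => /andP[/containingP[/regular_graphsP[_ _ rG] _] _].
    rewrite -{1}(rG u) -(rG v) -cardsX; apply: subset_leq_card; apply/subsetP => -[x y].
    by rewrite in_set [_ \in B1]in_set in_setX !inE /= => /andP[/and5P[_ -> _ -> _]].
  have := cnt_add_le gE cE uv nE ltac:(lia); nia.
have b2 : (#|B2| * n ^ e.+1 <= (2 * d) ^ e.+2 * cnt set0)%N.
  rewrite -(leq_pmul2r n0) -mulnA -expnSr.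
  rewrite card_pairs_swap big_distrl /=.
  apply: (@leq_trans (\sum_(p : 'I_n * 'I_n | p.1 == p.2) (2 * d) ^ e.+2 * cnt set0)); last first.
    rewrite sum_nat_const mulnC leq_mul2l; apply/orP; right.
    rewrite -cardsE card_pairs (eq_bigr (fun=> 1%N)); first by rewrite sum1_card card_ord.
    by move=> x _; rewrite -(cards1 x); apply: eq_card => y; rewrite !inE eq_sym.
  rewrite [X in (_ <= X)%N]big_mkcond /=; apply: leq_sum => -[x y] _ /=.
  (* An empty fibre is trivial; otherwise a graph [G0] in it shows that the vertices are distinct
     and the edges new. *)
  case: (posnP #|[set i | (i, (x, y)) \in B2]|) => [->//|/card_gt0P[G0]].
  rewrite in_set [_ \in B2]in_set /ok /= => /and3P[/and5P[G0c G0ux uxE G0vy vyE] G0uv /eqP exy].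
  have /containingP[/regular_graphsP[lG sG _] _] := G0c; rewrite exy eqxx -exy in vyE G0vy *.
  have ux : u != x by apply: contraTneq G0ux => <-; rewrite lG.
  have vx : v != x by apply: contraTneq G0vy => <-; rewrite lG.
  have xuE : (x, u) \notin E by apply: contra uxE => /(gE.1).
  have vxE : (v, x) \notin add_edge E u x.
    by rewrite in_add_edge !xpair_eqE (negbTE vyE) [v == u]eq_sym (negbTE uv) /= (negbTE vx).
  apply: leq_trans (cnt_add_le (e := e.+1) (is_graph_add_edge gE ux) _ vx vxE _); last 2 first.
  - by rewrite card_add_edge // cE; move: h; clear; lia.
  - by rewrite card_add_edge // cE; move: h; clear; lia.
  rewrite leq_mul2r; apply/orP; right; apply: subset_leq_card; apply/subsetP => G.
  by rewrite in_set [_ \in B2]in_set /ok /= !containing_add => /andP[/and5P[-> -> _ -> _] _].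
have b3 : (#|B3| * n ^ e.+1 <= (2 * d) ^ e.+3 * cnt set0)%N.
  rewrite -(leq_pmul2r n0) -mulnA -expnSr -(leq_pmul2r n0) -mulnA -expnSr.
  rewrite card_pairs_swap big_distrl /=.
  apply: (@leq_trans (\sum_(p : 'I_n * 'I_n) (2 * d) ^ e.+3 * cnt set0)); last first.
    by rewrite sum_nat_const card_prod card_ord; lia.
  apply: leq_sum => -[x y] _ /=.
  case: (posnP #|[set i | (i, (x, y)) \in B3]|) => [->//|/card_gt0P[G0]].
  rewrite in_set [_ \in B3]in_set /ok /= => /and5P[/and5P[G0c G0ux uxE G0vy vyE] G0uv xy G0xy xyE].
  have /containingP[/regular_graphsP[lG sG _] _] := G0c.
  have ux : u != x by apply: contraTneq G0ux => <-; rewrite lG.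
  have vy : v != y by apply: contraTneq G0vy => <-; rewrite lG.
  have uy : u != y by apply: contraTneq G0vy => <-; rewrite sG.
  have xv : x != v by apply: contraTneq G0ux => ->.
  have xuE : (x, u) \notin E by apply: contra uxE => /(gE.1).
  have yvE : (y, v) \notin E by apply: contra vyE => /(gE.1).
  have vu : v != u by rewrite eq_sym.
  have vyE1 : (v, y) \notin add_edge E u x.
    by rewrite in_add_edge !xpair_eqE (negbTE vyE) (negbTE vu) /= [v == x]eq_sym (negbTE xv).
  have yvE1 : (y, v) \notin add_edge E u x.
    rewrite in_add_edge !xpair_eqE (negbTE yvE) (negbTE vu) /= [y == u]eq_sym (negbTE uy).
    by rewrite andbF.
  have xyE1 : (x, y) \notin add_edge (add_edge E u x) v y.
    rewrite !in_add_edge !xpair_eqE (negbTE xyE) (negbTE xv) (negbTE xy) /=.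
    by rewrite [x == u]eq_sym (negbTE ux) [y == u]eq_sym (negbTE uy) andbF.
  apply: leq_trans (cnt_add_le (e := e.+2) (is_graph_add_edge (is_graph_add_edge gE ux) vy) _ xy xyE1 _); last 2 first.
  - by rewrite !card_add_edge // cE; move: h; clear; lia.
  - by rewrite !card_add_edge // cE; move: h; clear; lia.
  rewrite leq_mul2r; apply/orP; right; apply: subset_leq_card; apply/subsetP => G.
  by rewrite in_set [_ \in B3]in_set /ok /= !containing_add => /and5P[/and5P[-> -> _ -> _] _ _ -> _].
have b4 : (#|B4| * n ^ e.+1 <= 2 * e * (2 * d) ^ e.+2 * cnt set0)%N.
  (* Two new edges and no free vertex: a whole power of n is given away. *)
  apply: (@leq_trans (#|B4| * n ^ e.+2)).
    by rewrite leq_mul2l leq_pexp2l ?orbT.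
  rewrite -cE card_pairs_swap big_distrl /= -mulnA.
  rewrite -sum_nat_const [X in (_ <= X)%N]big_mkcond /=; apply: leq_sum => -[x y] _ /=.
  case: (posnP #|[set i | (i, (x, y)) \in B4]|) => [->//|/card_gt0P[G0]].
  rewrite in_set [_ \in B4]in_set /ok /= => /and5P[/and5P[G0c G0ux uxE G0vy vyE] G0uv xy G0xy ->].
  have /containingP[/regular_graphsP[lG sG _] _] := G0c.
  have ux : u != x by apply: contraTneq G0ux => <-; rewrite lG.
  have vy : v != y by apply: contraTneq G0vy => <-; rewrite lG.
  have xv : x != v by apply: contraTneq G0ux => ->.
  have xuE : (x, u) \notin E by apply: contra uxE => /(gE.1).
  have vu : v != u by rewrite eq_sym.
  have vyE1 : (v, y) \notin add_edge E u x.
    by rewrite in_add_edge !xpair_eqE (negbTE vyE) (negbTE vu) /= [v == x]eq_sym (negbTE xv).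
  apply: leq_trans (cnt_add_le (e := e.+1) (is_graph_add_edge gE ux) _ vy vyE1 _); last 2 first.
  - by rewrite !card_add_edge // cE; move: h; clear; lia.
  - by rewrite !card_add_edge // cE; move: h; clear; lia.
  rewrite leq_mul2r; apply/orP; right; apply: subset_leq_card; apply/subsetP => G.
  by rewrite in_set [_ \in B4]in_set /ok /= !containing_add => /and5P[/and5P[-> -> _ -> _] _ _ _ _].
have : (#|blocked_switchings E u v| <= (#|B1| + #|B2|) + (#|B3| + #|B4|))%N.
  apply: leq_trans (subset_leq_card sub) _; apply: leq_trans (leq_card_setU _ _) _.
  by apply: leq_add; apply: leq_trans (leq_card_setU _ _) _.
move=> /leq_mul/(_ (leqnn (n ^ e.+1))) hB; apply: leq_trans hB _.
apply: leq_trans (leq_trans (leq_add (leq_add b1 b2) (leq_add b3 b4)) _).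
  by rewrite !mulnDl.
by rewrite /block_const; clear; lia.
Qed.

(** The number of ways to attach the edges of [E] to half-edges, d at each vertex; divided by (n
    d)^e it is, to first order, the probability of containing [E]. *)
Definition degree_weight E : nat := (\prod_w d ^_ (deg E w))%N.

Lemma degree_weight_add E u v : is_graph E -> u != v -> (u, v) \notin E ->
  degree_weight (add_edge E u v) = (degree_weight E * ((d - deg E u) * (d - deg E v)))%N.
Proof.
move=> gE uv nE; rewrite /degree_weight (bigD1 u) //= (bigD1 v) 1?eq_sym //=.
rewrite [in RHS](bigD1 u) //= [in RHS](bigD1 v) 1?eq_sym //=.
rewrite !deg_add_edge // !eqxx orbT /= !addn1 !ffactnSr.
rewrite (eq_bigr (fun w => (d ^_ deg E w)%N)); first by lia.
by move=> w /andP[wu wv]; rewrite deg_add_edge // (negbTE wu) (negbTE wv) addn0.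
Qed.

(** Independent of n: the error terms of the two switching inequalities, plus the previous error
    times the largest possible factor d^2. *)
Fixpoint weight_error e : nat :=
  if e is e'.+1 then
    (d ^ e' * ((2 * e' + 2 * (d.+1 * d)) * (2 * d) ^ e'.+1 + block_const e') +
     d * d * weight_error e')%N
  else 0%N.

(** Adding uv multiplies the count by (d - deg u) (d - deg v) / (n d), up to lower order, and these
    factors multiply up to [degree_weight]. Denominators are cleared. *)
Lemma cnt_asymptotic e E : is_graph E -> #|E| = (2 * e)%N ->
  (2 * (2 * e + 6 + 2 * (d.+1 * d)) <= n * d)%N ->
  (cnt E * (n * d) ^ e * n <= (degree_weight E * n + weight_error e) * cnt set0)%N /\
  (degree_weight E * n * cnt set0 <= cnt E * (n * d) ^ e * n + weight_error e * cnt set0)%N.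
Proof.
elim: e E => [|e IH] E gE cE h.
  move: cE; rewrite muln0 => /eqP; rewrite cards_eq0 => /eqP ->.
  rewrite /degree_weight big1; last first.
    move=> w _; have -> : deg set0 w = 0%N by apply: eq_card0 => x; rewrite !inE.
    by rewrite ffactn0.
  by rewrite !mul1n /= !muln1 !addn0; split; rewrite mulnC.
have /card_gt0P[[u v] uvE] : (0 < #|E|)%N by rewrite cE.
have [E' [gE' eE nE uv]] := remove_edge gE uvE.
have nE' : (v, u) \notin E' by apply: contra nE => /(gE'.1).
move: cE; rewrite eE card_add_edge // => cE.
have cE' : #|E'| = (2 * e)%N by lia.
have [|IH1 IH2] := IH E' gE' cE'; first by lia.
have up := switch_upper gE' uv nE; have lo := switch_lower gE' uv nE.
have bl := card_blocked_le gE' cE' uv nE ltac:(lia).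
have ca := cnt_add_le gE' cE' uv nE ltac:(lia).
rewrite degree_weight_add //; rewrite cE' in up.
have m_le : ((d - deg E' u) * (d - deg E' v) <= d * d)%N by rewrite leq_mul // leq_subr.
move: up lo bl ca m_le IH1 IH2 => /=.
set m := ((d - deg E' u) * _)%N; set a := cnt (add_edge _ _ _); set a' := cnt E'.
set N := cnt set0; set W := degree_weight _; set p := weight_error e.
set c := (2 * e + _)%N; set B := #|_|; set bc := block_const e.
have -> : ((n * d) ^ e.+1 = n * d * (d ^ e * n ^ e))%N by rewrite expnS expnMn; lia.
have -> : ((n * d) ^ e = d ^ e * n ^ e)%N by rewrite expnMn mulnC.
rewrite [(n ^ e.+1)%N]expnS; set X := (n ^ e)%N; set Y := (d ^ e)%N; set Z := ((2 * d) ^ e.+1)%N.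
move=> up lo bl ca m_le IH1 IH2; split.
  (* The switching inequality times (n d)^e n, the induction hypothesis times the degree factor, and
     the crude bound [ca] for the error term: after this the claim is linear in the products. *)
  have h1 := leq_mul up (leqnn (Y * X * n)).
  have h2 := leq_mul (leqnn m) IH1.
  have h3 := leq_mul (leqnn (c * Y)) ca.
  have h4 := leq_mul m_le (leqnn (p * N)).
  have := leq_add (leq_add h1 h2) (leq_add h3 h4).
  by clear; lia.
have h1 := leq_mul lo (leqnn (Y * X * n)).
have h2 := leq_mul (leqnn m) IH2.
have h3 := leq_mul (leqnn Y) bl.
have h4 := leq_mul m_le (leqnn (p * N)).
have := leq_add (leq_add h1 h2) (leq_add h3 h4).
by clear; lia.
Qed.

End Switching.

(** * Walks *)

Lemma big_tuple_cons (R : Type) (idx : R) (op : Monoid.com_law idx) (T : finType) k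
    (F : seq T -> R) :
  \big[op/idx]_(t : k.+1.-tuple T) F t =
  \big[op/idx]_(p : k.-tuple T) \big[op/idx]_(x : T) F (x :: p).
Proof.
rewrite pair_bigA /= (reindex (fun q : k.-tuple T * T => [tuple of q.2 :: q.1])) //=.
exists (fun t : k.+1.-tuple T => (behead_tuple t, thead t)) => [[p x] _|t _] /=.
  by congr pair; apply: val_inj.
by rewrite -tuple_eta.
Qed.

Lemma big_tuple_cat (R : Type) (idx : R) (op : Monoid.com_law idx) (T : finType) k m
    (F : seq T -> R) :
  \big[op/idx]_(t : (k + m).-tuple T) F t =
  \big[op/idx]_(x : k.-tuple T) \big[op/idx]_(y : m.-tuple T) F (x ++ y).
Proof.
elim: k F => [|k IH] F.
  by rewrite (big_pred1 [tuple]) // => t; apply/esym/eqP; exact: tuple0.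
rewrite (big_tuple_cons op (k + m)) (IH (fun s => \big[op/idx]_x F (x :: s))).
rewrite (big_tuple_cons op k (fun s => \big[op/idx]_(y : m.-tuple T) F (s ++ y))).
by apply: eq_bigr => p _; rewrite exchange_big.
Qed.

Lemma big_tuple_rcons (R : Type) (idx : R) (op : Monoid.com_law idx) (T : finType) k
    (F : seq T -> R) :
  \big[op/idx]_(t : k.+1.-tuple T) F t =
  \big[op/idx]_(p : k.-tuple T) \big[op/idx]_(x : T) F (rcons p x).
Proof.
elim: k F => [|k IH] F.
  rewrite big_tuple_cons; apply: eq_bigr => p _; apply: eq_bigr => x _.
  by rewrite tuple0.
rewrite big_tuple_cons exchange_big /=.
rewrite (eq_bigr (fun x => \big[op/idx]_(p : k.-tuple T) \big[op/idx]_(y : T) F (x :: rcons p y))).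
  rewrite [LHS]exchange_big [RHS](big_tuple_cons op k (fun p => \big[op/idx]_(x : T) F (rcons p x))).
  by [].
by move=> x _; rewrite (IH (fun s => F (x :: s))).
Qed.

Section Walks.
Variables (n d : nat).
Implicit Types (G : 'M[bool]_n) (s p t : seq 'I_n) (x y z : 'I_n).

Definition tcount k (P : pred (seq 'I_n)) : nat := (\sum_(t : k.-tuple 'I_n) P t)%N.

Lemma tcountS k (P : pred (seq 'I_n)) :
  tcount k.+1 P = (\sum_(p : k.-tuple 'I_n) \sum_x P (x :: p))%N.
Proof. exact: (big_tuple_cons _ k (fun s => nat_of_bool (P s))). Qed.

Lemma tcount_le k (P Q : pred (seq 'I_n)) :
  (forall t, size t = k -> P t -> Q t) -> (tcount k P <= tcount k Q)%N.
Proof.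
move=> h; apply: leq_sum => t _; move: (h t (size_tuple t)).
by case: (P t) => // ->.
Qed.

Fixpoint nbw G s : bool :=
  if s is x :: s' then
    if s' is y :: s'' then
      [&& G x y, (if s'' is z :: _ then x != z else true) & nbw G s']
    else true
  else true.

Lemma nbw_behead G x s : nbw G (x :: s) -> nbw G s.
Proof. by case: s => [|y [|z s]] //= /and3P[]. Qed.

Lemma nbw_catl G s p : nbw G (s ++ p) -> nbw G s.
Proof.
elim: s => [//|x [|y [|z s]] IH] //=; first by case: p IH => [|w p] //= _ /andP[->].
by move=> /and3P[-> -> /IH].
Qed.

Lemma nbw_sorted G s : nbw G s -> sorted (fun x y => G x y) s.
Proof. by elim: s => [|x [|y s] IH] //= /and3P[-> _ /IH]. Qed.

Lemma uniq_sorted_nbw G s : uniq s -> sorted (fun x y => G x y) s -> nbw G s.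
Proof.
elim: s => [//|a [//|b s] IH] us ss.
have {}IH : nbw G (b :: s) by apply: IH; [case/andP: us|case/andP: ss].
rewrite -[nbw G _]/[&& G a b, (if s is z :: _ then a != z else true) & nbw G (b :: s)].
rewrite IH andbT; have -> /= : G a b by case/andP: ss.
case: s us {ss IH} => [//|c s] /andP[aN _]; apply: contraNneq aN => ->.
by rewrite !inE eqxx orbT.
Qed.

(** The new first vertex is a neighbour of the head of [p] other than the vertex after it. *)
Lemma sum_nbw_cons G p : G \in regular_graphs n d -> (1 < size p)%N ->
  (\sum_x nbw G (x :: p) <= d.-1 * nbw G p)%N.
Proof.
move=> /regular_graphsP[lG sG rG]; case: p => [|y [|z r]] // _.
case: (boolP (nbw G [:: y, z & r])) => [h|/negbTE h]; last first.
  by rewrite big1 // => x _; rewrite -[nbw _ _]/[&& _, _ & nbw G [:: y, z & r]] h !andbF.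
rewrite muln1 -(rG y) (cardD1 z) inE.
have -> : G y z by case/andP: h.
rewrite add1n /= -sum1_card [X in (_ <= X)%N]big_mkcond /=; apply: leq_sum => x _.
rewrite !inE sG; case: (x != z); case: (G y x) => //=.
by case: (_ && _).
Qed.

(** Each vertex after the second multiplies the count by at most d - 1; surplus powers of d - 1 are
    kept so that one formula covers all k. *)
Lemma tcount_nbw_le G k : (1 < d)%N -> G \in regular_graphs n d -> (0 < k)%N ->
  (tcount k (nbw G) <= n * d * d.-1 ^ k)%N.
Proof.
move=> d_gt1 rG; have q0 : (0 < d.-1)%N by case: d d_gt1 => [|[]].
have d0 : (0 < d)%N by apply: ltnW.
elim: k => [//|[|k] IH _].
  apply: (@leq_trans (\sum_(t : 1.-tuple 'I_n) 1)).
    by apply: leq_sum => t _; case: (nbw _ _).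
  rewrite sum1_card card_tuple card_ord !expn1 -mulnA leq_pmulr //.
  by rewrite muln_gt0 d0.
case: k IH => [_|k IH].
  rewrite tcountS.
  rewrite -(card_edge_set rG) card_pairs big_distrl /=.
  rewrite (big_tuple_cons _ 0 (fun p => \sum_x nbw G (x :: p)))%N.
  rewrite (big_pred1 [tuple]) /=; last by move=> t; apply/esym/eqP; exact: tuple0.
  rewrite exchange_big /=; apply: leq_sum => x _.
  apply: (@leq_trans #|[set j | (x, j) \in edge_set G]|).
    rewrite -sum1_card [X in (_ <= X)%N]big_mkcond /=; apply: leq_sum => y _.
    by rewrite !inE /= andbT; case: (G x y).
  by rewrite leq_pmulr // expn_gt0 q0.
rewrite expnS mulnCA; apply: (@leq_trans (d.-1 * tcount k.+2 (nbw G))).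
  rewrite tcountS [X in (_ <= _ * X)%N]/tcount big_distrr /=; apply: leq_sum => p _.
  by apply: sum_nbw_cons; rewrite ?size_tuple.
by rewrite leq_mul2l IH // orbT.
Qed.

Fixpoint path_edges s : {set 'I_n * 'I_n} :=
  if s is x :: s' then
    if s' is y :: _ then add_edge (path_edges s') x y else set0
  else set0.

Lemma path_edges_cons a b s :
  path_edges [:: a, b & s] = add_edge (path_edges (b :: s)) a b.
Proof. by []. Qed.

Lemma path_edges_mem s x y : (x, y) \in path_edges s -> x \in s /\ y \in s.
Proof.
elim: s => [|a [|b s] IH]; try by rewrite inE.
rewrite path_edges_cons in_add_edge !xpair_eqE.
case/or3P => [/andP[/eqP-> /eqP->]|/andP[/eqP-> /eqP->]|h].
- by rewrite !inE !eqxx orbT.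
- by rewrite !inE !eqxx orbT.
- by case: (IH h) => h1 h2; rewrite in_cons h1 in_cons h2 !orbT.
Qed.

Lemma path_edges_uniq s : uniq s ->
  is_graph (path_edges s) /\ #|path_edges s| = (2 * (size s).-1)%N.
Proof.
elim: s => [|a [|b s] IH]; try by move=> _; split; [split=> [u v|u]; rewrite inE|rewrite cards0].
move=> /andP[aN ub]; have [g c] := IH ub.
have ab : a != b by apply: contraNneq aN => ->; rewrite mem_head.
rewrite path_edges_cons.
split; first exact: is_graph_add_edge.
rewrite card_add_edge ?c //; first by rewrite /=; lia.
  by apply: contra aN => h; case: (path_edges_mem h).
by apply: contra aN => h; case: (path_edges_mem h).
Qed.

(** The first vertex of a duplicate-free path has one edge on it, so a non-backtracking step that
    enters there comes along a new edge. *)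
Lemma path_edges_head s x y z r : s = [:: y, z & r] -> uniq s ->
  (x, y) \in path_edges s -> x = z.
Proof.
move=> -> /andP[yN _].
rewrite path_edges_cons in_add_edge !xpair_eqE.
have yz : y != z by apply: contraNneq yN => ->; rewrite mem_head.
rewrite (negbTE yz) andbF orFb => /orP[/andP[/eqP->]//|h].
by case: (path_edges_mem h); rewrite (negbTE yN).
Qed.

Lemma containing_path s G : (G \in containing d (path_edges s)) =
  (G \in regular_graphs n d) && sorted (fun x y => G x y) s.
Proof.
elim: s => [|a [|b s] IH]; rewrite ?in_containing ?sub0set ?andbT //.
rewrite -in_containing path_edges_cons.
by rewrite containing_add IH /= andbAC andbA.
Qed.

Lemma cnt_path s : cnt d (path_edges s) =
  (\sum_(G in regular_graphs n d) sorted (fun x y => G x y) s)%N.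
Proof.
rewrite /cnt -sum1_card [RHS](eq_bigr (fun G => if sorted (fun x y => G x y) s then 1 else 0)%N).
  by rewrite -big_mkcondr; apply: eq_bigl => G; rewrite containing_path.
by move=> G _; case: sorted.
Qed.

(** A lollipop: [p] is duplicate-free and x, placed in front, lies on it. The edge from x to the
    head of [p] is new and costs 2 d / n, x has m positions, and the at most n d (d - 1)^m walks [p]
    compensate the 1/n. *)
Lemma sum_lollipop m : (1 < d)%N -> (2 * (2 * m + 2 * (d.+1 * d)) <= n * d)%N ->
  (\sum_(G in regular_graphs n d)
     tcount m.+1 (fun s => [&& nbw G s, uniq (behead s) & ~~ uniq s])
   <= 2 * d * d * m * d.-1 ^ m * cnt d (set0 : {set 'I_n * 'I_n}))%N.
Proof.
move=> d_gt1 h; case: (posnP n) => [n0|n0].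
  case: m h => [|m] h.
    rewrite muln0 !mul0n big1 // => G _; rewrite tcountS big1 // => p _.
    by rewrite big1 // => x _; rewrite tuple0 /=.
  by exfalso; move: h; rewrite n0 mul0n; clear; lia.
rewrite -(leq_pmul2r n0).
apply: (@leq_trans (\sum_(p : m.-tuple 'I_n | uniq p)
    \sum_(x | x \in (p : seq _)) 2 * d * cnt d (path_edges p))%N); last first.
  rewrite (eq_bigr (fun p : m.-tuple 'I_n =>
     2 * d * m * \sum_(G in regular_graphs n d) sorted (fun x y => G x y) p)%N); last first.
    by move=> p up; rewrite cnt_path sum_nat_const (card_uniqP up) size_tuple; lia.
  rewrite -big_distrr exchange_big /=.
  apply: (@leq_trans (2 * d * m * \sum_(G in regular_graphs n d) n * d * d.-1 ^ m)%N); last first.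
    by rewrite sum_nat_const /cnt (eq_card (B := regular_graphs n d)) ?(sub0set, in_containing);
      [lia|move=> G; rewrite in_containing sub0set andbT].
  rewrite leq_mul2l; case: (posnP m) => [->|m0]; first by rewrite muln0.
  apply/orP; right; apply: leq_sum => G rG; apply: leq_trans (tcount_nbw_le d_gt1 rG m0).
  rewrite big_mkcond /=; apply: leq_sum => p _.
  case: ifP => // up; case: (boolP (sorted _ _)) => // sp.
  by rewrite uniq_sorted_nbw.
rewrite [X in (X * _)%N](eq_bigr (fun G => \sum_(p : m.-tuple 'I_n) \sum_x
   [&& nbw G (x :: p), uniq p & x \in (p : seq _)])%N); last first.
  move=> G _; rewrite tcountS; apply: eq_bigr => p _.
  by apply: eq_bigr => x _ /=; case: (uniq p); rewrite ?andbT ?andbF ?negbK.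
rewrite exchange_big big_distrl /= [X in (_ <= X)%N]big_mkcond /=; apply: leq_sum => p _.
case: ifP => up; last by rewrite big1 // => G _; rewrite big1 // => x _; rewrite !andbF.
rewrite exchange_big big_distrl /= [X in (_ <= X)%N]big_mkcond /=; apply: leq_sum => x _.
case: ifP => xp; last by rewrite big1 // => G _; rewrite !andbF.
rewrite (eq_bigr (fun G => nat_of_bool (nbw G (x :: p)))); last first.
  by move=> G _; rewrite !andbT.
have [gE cE] := path_edges_uniq up.
(* A graph containing the walk shows that x differs from the head [y] and that the edge between them
   is not on the path. *)
case: (boolP [exists G in regular_graphs n d, nbw G (x :: p)]) => [/existsP[G0]|]; last first.
  rewrite negb_exists => /forallP N; rewrite big1 // => G rG.
  by move: (N G); rewrite rG /= => /negbTE ->.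
case/andP => /regular_graphsP[lG _ _].
case e : (val p) xp (up) => [//|y [|z r]].
  by rewrite inE => /eqP -> _ /=; rewrite lG.
move=> xp up' /and3P[G0xy xz _].
have xy : x != y by apply: contraTneq G0xy => ->; rewrite lG.
have xyE : (x, y) \notin path_edges p.
  by apply: contra xz => /(path_edges_head e up) ->.
have h' : (2 * (#|path_edges p| + 2 * (d.+1 * d)) <= n * d)%N.
  rewrite cE size_tuple; move: h; case: (m) => [|m'] /=; lia.
have := cnt_add_edge_le gE xy xyE (ltnW d_gt1) h'.
have -> : tval p = [:: y, z & r] by exact: e.
apply: leq_trans; rewrite leq_mul2r /cnt -sum1_card; apply/orP; right.
rewrite [X in (_ <= X)%N](eq_bigl (fun G => (G \in regular_graphs n d) &&
   (sorted (fun x y => G x y) [:: y, z & r] && G x y))); last first.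
  by move=> G; rewrite containing_add containing_path andbA.
rewrite big_mkcondr; apply: leq_sum => G rG.
case: (boolP (nbw _ _)) => // h1; rewrite (nbw_sorted (nbw_behead h1)).
by move: h1 => /andP[->].
Qed.

(** Either the tail already has a repetition and is prolonged in at most d - 1 ways, or the walk is
    a lollipop; the m lollipop terms, each linear in the length, add up to m^2. *)
Lemma sum_nonuniq_nbw m : (1 < d)%N -> (2 * (2 * m + 2 * (d.+1 * d)) <= n * d)%N ->
  (\sum_(G in regular_graphs n d) tcount m (fun s => nbw G s && ~~ uniq s)
   <= 2 * d * d * m ^ 2 * d.-1 ^ m * cnt d (set0 : {set 'I_n * 'I_n}))%N.
Proof.
move=> d_gt1; have q0 : (0 < d.-1)%N by case: d d_gt1 => [|[]].
elim: m => [|m IH] h.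
  rewrite big1 // => G _; rewrite /tcount big1 // => t _.
  by rewrite tuple0.
apply: (@leq_trans (\sum_(G in regular_graphs n d)
   (d.-1 * tcount m (fun s => nbw G s && ~~ uniq s) +
    tcount m.+1 (fun s => [&& nbw G s, uniq (behead s) & ~~ uniq s])))%N).
  apply: leq_sum => G rG; rewrite !tcountS [X in (_ <= _ * X + _)%N]/tcount big_distrr -big_split /=.
  apply: leq_sum => p _; case: (boolP (uniq p)) => up.
    rewrite andbF muln0 add0n; apply: leq_sum => x _.
    by rewrite andTb.
  rewrite andbT [X in (_ + X)%N]big1 ?addn0; last by move=> x _; rewrite /= andbF.
  have sp : (1 < size p)%N by case: (val p) up => [|? [|]].
  by apply: leq_trans (sum_nbw_cons rG sp); apply: leq_sum => x _; rewrite !andbF !andbT.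
rewrite big_split /= -big_distrr /=.
have := sum_lollipop (m := m) d_gt1 ltac:(lia); have := IH ltac:(lia).
set N := cnt _ _; move=> h1 h2.
apply: leq_trans (leq_add (leq_mul (leqnn d.-1) h1) h2) _.
pose A := (2 * d * d * (d.-1 * d.-1 ^ m) * N)%N.
have -> : (d.-1 * (2 * d * d * m ^ 2 * d.-1 ^ m * N) = A * (m * m))%N.
  by rewrite /A -mulnn; lia.
have -> : (2 * d * d * m.+1 ^ 2 * d.-1 ^ m.+1 * N = A * (m.+1 * m.+1))%N.
  by rewrite /A -mulnn expnS; lia.
have : (2 * d * d * m * d.-1 ^ m * N <= A * m)%N.
  rewrite (_ : (A * m = 2 * d * d * m * (d.-1 * d.-1 ^ m) * N)%N); last by rewrite /A; lia.
  by rewrite leq_mul2r leq_mul2l leq_pmull ?orbT.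
move=> h3; apply: leq_trans (leq_add (leqnn _) h3) _.
by rewrite -mulnDr leq_mul2l; apply/orP; right; lia.
Qed.

End Walks.

(** * Closed non-backtracking walks *)

Section ClosedWalks.
Variables (n d : nat).
Implicit Types (G : 'M[bool]_n) (s p t c : seq 'I_n) (x y z u v : 'I_n).
Implicit Types (E : {set 'I_n * 'I_n}).

(** A closed walk is listed without its return to the base point; the two vertices appended impose
    the conditions across the base point, and [t ++ t] supplies them when [t] has a single
    vertex. *)
Definition cnbw G t : bool := nbw G (t ++ take 2 (t ++ t)).

Lemma tcount_rcons k (P : pred (seq 'I_n)) :
  tcount k.+1 P = (\sum_(p : k.-tuple 'I_n) \sum_x P (rcons p x))%N.
Proof. exact: (big_tuple_rcons _ k (fun s => nat_of_bool (P s))). Qed.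

(** Appending the base point gives, injectively, a walk with a repetition. *)
Lemma tcount_cnbw_le G k : (0 < k)%N ->
  (tcount k (cnbw G) <= tcount k.+1 (fun s => nbw G s && ~~ uniq s))%N.
Proof.
move=> k0; rewrite tcount_rcons; apply: leq_sum => t _.
case e : (val t) => [|a p]; first by move: (size_tuple t); rewrite e /= => h; rewrite -h in k0.
rewrite (bigD1 a) //; case: (boolP (cnbw G (a :: p))) => // h.
suff -> : nbw G (rcons (a :: p) a) && ~~ uniq (rcons (a :: p) a) by rewrite leq_addr.
have e2 : (a :: p) ++ take 2 ((a :: p) ++ (a :: p)) = rcons (a :: p) a ++ take 1 (p ++ a :: p).
  by rewrite cat_rcons.
by move: h; rewrite /cnbw e2 => /nbw_catl -> /=; rewrite mem_rcons mem_head.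
Qed.

(** If k is small compared with n, the repetition costs a factor O(1/n); otherwise n d < 4 (k + 1) +
    4 (d + 1) d, and the count of all walks is small enough. The summands belong to these two
    cases. *)
Lemma sum_cnbw_le k : (1 < d)%N -> (0 < k)%N ->
  (\sum_(G in regular_graphs n d) tcount k (cnbw G) <=
   (2 * d * d * k.+1 ^ 2 * d.-1 + 4 * k.+1 + 4 * (d.+1 * d)) * d.-1 ^ k *
   #|regular_graphs n d|)%N.
Proof.
move=> d_gt1 k0.
have cE : cnt d (set0 : {set 'I_n * 'I_n}) = #|regular_graphs n d|.
  by apply: eq_card => G; rewrite in_containing sub0set andbT.
case: (leqP (2 * (2 * k.+1 + 2 * (d.+1 * d))) (n * d)) => h.
  apply: (@leq_trans (\sum_(G in regular_graphs n d)
     tcount k.+1 (fun s => nbw G s && ~~ uniq s))%N).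
    by apply: leq_sum => G _; exact: tcount_cnbw_le.
  apply: leq_trans (sum_nonuniq_nbw d_gt1 h) _.
  rewrite cE leq_mul2r; apply/orP; right; rewrite [(d.-1 ^ k.+1)%N]expnS mulnA leq_mul2r.
  by rewrite -addnA leq_addr orbT.
apply: (@leq_trans (\sum_(G in regular_graphs n d) n * d * d.-1 ^ k)%N).
  apply: leq_sum => G rG; apply: leq_trans (tcount_nbw_le d_gt1 rG k0).
  by apply: tcount_le => t _ /nbw_catl.
rewrite sum_nat_const mulnC leq_mul2r leq_mul2r; apply/orP; right; apply/orP; right.
by rewrite -addnA; apply: leq_trans (leq_addl _ _); lia.
Qed.

Lemma nbwP x0 G s : reflect
  ((forall i, i.+1 < size s -> G (nth x0 s i) (nth x0 s i.+1)) /\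
   (forall i, i.+2 < size s -> nth x0 s i != nth x0 s i.+2))%N (nbw G s).
Proof.
apply: (iffP idP).
  elim: s => [|x [|y s] IH] //= /and3P[Gxy xz /IH[h1 h2]].
  split=> [[|i]|[|i]] // hi; first exact: h1.
    by case: s xz hi {IH h1 h2}.
  exact: h2.
elim: s => [//|x [//|y s] IH] [h1 h2].
rewrite -[nbw G _]/[&& G x y, (if s is z :: _ then x != z else true) & nbw G (y :: s)].
rewrite (h1 0%N) // IH ?andbT /=.
  by case: s h1 h2 {IH} => // z s _ h2; exact: (h2 0%N).
by split=> [i hi|i hi]; [exact: (h1 i.+1)|exact: (h2 i.+1)].
Qed.

Section Base.
Variable x0 : 'I_n.

(** Periodic extension of a cyclic list, which removes the special cases at the base point. *)
Definition around c i : 'I_n := nth x0 c (i %% size c).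

Lemma aroundE c i : around c i = nth x0 c (i %% size c).
Proof. by []. Qed.

Lemma around_small c i : (i < size c)%N -> around c i = nth x0 c i.
Proof. by move=> h; rewrite /around modn_small. Qed.

Lemma around_addl c i j : around c (i + j * size c) = around c i.
Proof. by rewrite /around addnC modnMDl. Qed.

Lemma around_mem c i : (0 < size c)%N -> around c i \in c.
Proof. by move=> h; rewrite mem_nth // ltn_mod. Qed.

Lemma around_onto c v : v \in c -> exists2 i, (i < size c)%N & around c i = v.
Proof.
by move=> vc; exists (index v c); rewrite ?index_mem // around_small ?index_mem // nth_index.
Qed.

Lemma cnbwP G t : (0 < size t)%N -> reflect
  (forall i, G (around t i) (around t i.+1) /\ around t i != around t i.+2) (cnbw G t).
Proof.
move=> t0; have sz : (size (t ++ take 2 (t ++ t)) = size t + 2)%N.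
  by rewrite size_cat size_take size_cat; case: ltnP => //; lia.
have nt i : (i < size t + 2)%N -> nth x0 (t ++ take 2 (t ++ t)) i = around t i.
  move=> hi; rewrite nth_cat; case: ltnP => hi'; first by rewrite around_small.
  rewrite nth_take; last by lia.
  rewrite nth_cat /around; case: ltnP => h2.
    rewrite -{2}(subnK hi') -modnDmr modnn addn0 modn_small //.
  have t1 : size t = 1%N by lia.
  by rewrite t1 modn1; congr nth; lia.
have per i : around t i = around t (i %% size t) by rewrite /around modn_mod.
have per1 i : around t i.+1 = around t (i %% size t).+1.
  by rewrite /around -[i.+1]addn1 -modnDml addn1.
have per2 i : around t i.+2 = around t (i %% size t).+2.
  by rewrite /around -[i.+2]addn2 -modnDml addn2.
apply: (iffP (nbwP x0 _ _)) => [[h1 h2] i|h]; last rewrite sz.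
  rewrite sz in h1 h2.
  have hi : (i %% size t < size t)%N by rewrite ltn_mod.
  rewrite per per1 per2 -(nt (i %% size t)%N); try lia.
  rewrite -(nt (i %% size t).+1) -?(nt (i %% size t).+2); try lia.
  by split; [apply: h1|apply: h2]; lia.
by split=> i hi; rewrite !nt; try exact: (h i).1; try exact: (h i).2; lia.
Qed.

Definition cyc_edges c : {set 'I_n * 'I_n} :=
  if c is x :: _ then path_edges (rcons c x) else set0.

Lemma path_edgesP s u v : reflect
  (exists2 i, (i.+1 < size s)%N &
     (u, v) = (nth x0 s i, nth x0 s i.+1) \/ (v, u) = (nth x0 s i, nth x0 s i.+1))
  ((u, v) \in path_edges s).
Proof.
elim: s => [|a [|b s] IH]; try by rewrite inE; right => -[].
rewrite path_edges_cons in_add_edge; apply: (iffP or3P).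
  case=> [/eqP ->|/eqP[-> ->]|/IH[i hi h]]; first by exists 0%N; [|left].
    by exists 0%N; [|right].
  by exists i.+1.
case=> -[|i] hi [e|e]; first by constructor 1; rewrite e.
- by constructor 2; case: e => -> ->.
- by constructor 3; apply/IH; exists i; [|left].
- by constructor 3; apply/IH; exists i; [|right].
Qed.

Lemma cyc_edgesP c u v : (0 < size c)%N -> reflect
  (exists i, (u, v) = (around c i, around c i.+1) \/ (v, u) = (around c i, around c i.+1))
  ((u, v) \in cyc_edges c).
Proof.
case: c => [//|x p] _; rewrite -[cyc_edges _]/(path_edges (rcons (x :: p) x)).
set c := x :: p.
have nt i : (i < size c + 1)%N -> nth x0 (rcons c x) i = around c i.
  rewrite nth_rcons; case: (ltngtP i (size c)) => [hi _|hi|-> _]; first by rewrite around_small.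
    by lia.
  by rewrite /around modnn.
apply: (iffP (path_edgesP _ _ _)).
  case=> i; rewrite size_rcons => hi h; exists i.
  have e1 := nt i ltac:(lia); have e2 := nt i.+1 ltac:(lia).
  by rewrite e1 e2 in h.
case=> i h; exists (i %% size c); first by rewrite size_rcons ltnS ltn_mod.
have hi : (i %% size c < size c)%N by rewrite ltn_mod.
rewrite !nt; try lia.
have -> : around c (i %% size c) = around c i by rewrite /around modn_mod.
have -> // : around c (i %% size c).+1 = around c i.+1.
by rewrite /around -[i.+1]addn1 -modnDml addn1.
Qed.

Lemma cycle_around G c : (0 < size c)%N ->
  (cycle (fun x y => G x y) c <-> forall i, G (around c i) (around c i.+1)).
Proof.
case: c => [//|x p] _; set c := x :: p; rewrite /cycle.
have nt i : (i < size c + 1)%N -> nth x0 (rcons c x) i = around c i.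
  rewrite nth_rcons; case: (ltngtP i (size c)) => [hi _|hi|-> _]; first by rewrite around_small.
    by lia.
  by rewrite /around modnn.
split=> [/(pathP x0) h i|h].
  have hi : (i %% size c < size c)%N by rewrite ltn_mod.
  have := h (i %% size c)%N; rewrite size_rcons -/(size c) => /(_ hi).
  have -> : nth x0 (x :: rcons p x) (i %% size c) = nth x0 (rcons c x) (i %% size c) by [].
  have -> : nth x0 (rcons p x) (i %% size c) = nth x0 (rcons c x) (i %% size c).+1 by [].
  rewrite !nt; try lia.
  have -> : around c (i %% size c) = around c i by rewrite /around modn_mod.
  have -> // : around c (i %% size c).+1 = around c i.+1.
  by rewrite /around -[i.+1]addn1 -modnDml addn1.
apply/(pathP x0) => i; rewrite size_rcons => hi.
have -> : nth x0 (x :: rcons p x) i = nth x0 (rcons c x) i by [].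
have -> : nth x0 (rcons p x) i = nth x0 (rcons c x) i.+1 by [].
by rewrite !nt; [exact: h| rewrite /= in hi *; lia ..].
Qed.

Lemma containing_cyc c G : (G \in containing d (cyc_edges c)) =
  (G \in regular_graphs n d) && cycle (fun x y => G x y) c.
Proof.
case: c => [|x p]; first by rewrite in_containing sub0set.
by rewrite -[cyc_edges _]/(path_edges (rcons (x :: p) x)) containing_path.
Qed.

Lemma cyc_edges_graph c : (0 < size c)%N -> (forall i, around c i != around c i.+1) ->
  is_graph (cyc_edges c).
Proof.
move=> c0 h; split=> [u v|u].
  by move=> /(cyc_edgesP _ _ c0)[i hi]; apply/cyc_edgesP => //; exists i; tauto.
apply/negP => /(cyc_edgesP _ _ c0)[i [[e1 e2]|[e1 e2]]];
  by move: (h i); rewrite -e1 -e2 eqxx.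
Qed.

Lemma cyc_edges_next c i : (0 < size c)%N -> (around c i, around c i.+1) \in cyc_edges c.
Proof. by move=> c0; apply/cyc_edgesP => //; exists i; left. Qed.

Lemma cyc_edges_prev c i : (0 < size c)%N -> (around c i.+1, around c i) \in cyc_edges c.
Proof. by move=> c0; apply/cyc_edgesP => //; exists i; right. Qed.

Lemma three_le_deg E v a b e : (v, a) \in E -> (v, b) \in E -> (v, e) \in E ->
  a != b -> a != e -> b != e -> (2 < deg E v)%N.
Proof.
move=> h1 h2 h3 ab ae be; rewrite /deg.
have <- : #|[set a; b; e]| = 3 by rewrite -setUA cardsU1 !inE negb_or ab ae cards2 be.
by apply: subset_leq_card; apply/subsetP => z; rewrite !inE => /orP[/orP[]|] /eqP ->.
Qed.

(** With degrees at most two, the next vertex of a non-backtracking walk is determined by the last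
    two. *)
Lemma nb_walk_unique E (f g : nat -> 'I_n) :
  (forall v, deg E v <= 2)%N ->
  is_graph E ->
  (forall i, (f i, f i.+1) \in E) -> (forall i, f i != f i.+2) ->
  (forall i, (g i, g i.+1) \in E) -> (forall i, g i != g i.+2) ->
  f 0%N = g 0%N -> f 1%N = g 1%N -> f =1 g.
Proof.
move=> dE [sE _] fE fnb gE gnb e0 e1 i.
suff: f i = g i /\ f i.+1 = g i.+1 by case.
elim: i => [//|i [IH0 IH1]]; split=> //; apply/eqP; apply/negP => /negP ne.
have := dE (f i.+1); rewrite leqNgt => /negP; apply.
apply: (@three_le_deg _ _ (f i) (f i.+2) (g i.+2)) => //; first exact: sE.
  by rewrite IH1.
by rewrite IH0.
Qed.

Lemma deg_ge2 c i : (0 < size c)%N -> (forall i, around c i != around c i.+2) ->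
  (1 < deg (cyc_edges c) (around c i))%N.
Proof.
move=> c0 h.
(* [j] is i - 1 modulo the length. *)
pose j := (i + (size c).-1)%N.
have ej : around c j.+1 = around c i.
  by rewrite /j -addnS prednK // -{1}[size c]mul1n around_addl.
have e2 : around c j.+2 = around c i.+1.
  by rewrite /j -addnS prednK // -addSn -{1}[size c]mul1n around_addl.
have <- : #|[set around c j; around c i.+1]| = 2 by rewrite cards2 -e2 h.
apply: subset_leq_card; apply/subsetP => z; rewrite !inE => /orP[] /eqP ->.
  by rewrite -ej cyc_edges_prev.
by rewrite cyc_edges_next.
Qed.

(* Without a vertex of degree three the walk has to close up at its start
   and then follows the same cycle over and over. *)
Lemma good_cnbw_periodic G t : (0 < size t)%N -> G \in regular_graphs n d ->
  cnbw G t -> (forall v, deg (cyc_edges t) v <= 2)%N ->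
  exists c, [/\ (2 < size c)%N, (size c %| size t)%N, uniq c,
     cycle (fun x y => G x y) c & forall i, around t i = around c i].
Proof.
move=> t0 /regular_graphsP[lG sG _] /(cnbwP _ t0) h dE.
set f := around t in h *.
have lf i : f i != f i.+1 by apply: contraTneq (h i).1 => <-; rewrite lG.
have gE : is_graph (cyc_edges t) by apply: cyc_edges_graph.
have fE i : (f i, f i.+1) \in cyc_edges t by apply: cyc_edges_next.
have fE' i : (f i.+1, f i) \in cyc_edges t by apply: cyc_edges_prev.
(* The least such [j] is the time of the first return to a visited vertex. *)
have ex : exists j, ~~ uniq (mkseq f j.+1).
  exists (size t); rewrite /mkseq (iotaD 0 1 (size t)) map_cat /= negb_and negbK.
  apply/orP; left; apply/mapP; exists (size t); first by rewrite mem_iota; lia.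
  by rewrite /f /around mod0n modnn.
case: (ex_minnP ex) => j nj minj.
have uj : uniq (mkseq f j).
  case: j nj minj => [//|j] _ minj; apply/negbNE/negP => N.
  by have := minj j N; rewrite ltnn.
have inj a b : (a < j)%N -> (b < j)%N -> f a = f b -> a = b.
  move=> ha hb e; apply/eqP; rewrite -(nth_uniq (f 0%N) _ _ uj) ?size_mkseq //.
  by rewrite !nth_mkseq // e.
have [a ha fa] : exists2 a, (a < j)%N & f a = f j.
  move: nj; rewrite /mkseq -addn1 iotaD map_cat cats1 rcons_uniq uj andbT negbK.
  by case/mapP => a; rewrite mem_iota => /andP[_ ha] ->; exists a.
have ja1 : j != a.+1 by apply/eqP => e; move: (lf a); rewrite fa e eqxx.
have ja2 : j != a.+2 by apply/eqP => e; move: (h a).2; rewrite fa e eqxx.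
(* The return is to the base point, because an interior vertex would get f (j - 1) as a third
   neighbour. *)
have a0 : a = 0%N.
  case: a ha fa ja1 ja2 => [//|a] ha fa ja1 ja2.
  have := dE (f a.+1); rewrite leqNgt => /negP[].
  case: j ha fa ja1 ja2 inj {nj minj uj} => [//|j] ha fa ja1 ja2 inj.
  apply: (@three_le_deg _ _ (f a) (f a.+2) (f j)) => //; first by rewrite fa.
  - exact: (h a).2.
  - by apply/eqP => /inj; lia.
  - by apply/eqP => /inj; lia.
subst a; have j3 : (2 < j)%N by move: ha ja1 ja2; case: j {nj minj uj inj fa} => [|[|[]]].
(* Having returned, the walk cannot go back to f (j - 1), and a vertex other than f 1 would be a
   third neighbour of f 0. *)
have fj1 : f j.+1 = f 1%N.
  apply/eqP; apply/negP => /negP ne; have := dE (f 0%N); rewrite leqNgt => /negP[].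
  apply: (@three_le_deg _ _ (f 1%N) (f j.-1) (f j.+1)).
  - exact: fE.
  - by rewrite fa -{1}(prednK ha).
  - by rewrite fa.
  - by apply/eqP => /inj; lia.
  - by rewrite eq_sym.
  - by have := (h j.-1).2; rewrite prednK.
have perj i : f (j + i)%N = f i.
  apply: (@nb_walk_unique (cyc_edges t) (fun i => f (j + i)%N) f) => //.
  - by move=> k; rewrite addnS.
  - by move=> k; rewrite !addnS; exact: (h _).2.
  - by move=> k; exact: (h _).2.
  - by rewrite addn0 fa.
  - by rewrite addn1.
have perM m i : f (m * j + i)%N = f i.
  by elim: m => [|m IH] //; rewrite mulSn -addnA perj.
have fmod i : f i = f (i %% j)%N by rewrite {1}(divn_eq i j) perM.
(* The walk is at f 0 at time [size t], which no nonzero residue below j allows. *)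
have jd : (j %| size t)%N.
  apply/eqP; apply: inj; rewrite ?ltn_mod //; try lia.
  by rewrite -fmod /f /around modnn mod0n.
have ac i : around (mkseq f j) i = f i.
  by rewrite /around size_mkseq nth_mkseq -?fmod // ltn_mod; lia.
exists (mkseq f j); split; rewrite ?size_mkseq //.
apply/cycle_around; rewrite ?size_mkseq //.
by move=> i; rewrite !ac; exact: (h i).1.
Qed.

End Base.
End ClosedWalks.

(** * Cycles and their moments *)

Section SimpleCycles.
Variables (n d : nat).
Implicit Types (G : 'M[bool]_n) (s p t c : seq 'I_n) (x y z u v : 'I_n).
Implicit Types (E : {set 'I_n * 'I_n}).

Lemma card_deg E : #|E| = (\sum_v deg E v)%N.
Proof. exact: card_pairs. Qed.

Lemma is_graph_even E : is_graph E -> exists e, #|E| = (2 * e)%N.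
Proof.
move: {2}#|E| (leqnn #|E|) => m; elim: m E => [|m IH] E hm gE.
  by exists 0%N; apply/eqP; rewrite muln0 -leqn0.
case: (posnP #|E|) => [->|/card_gt0P[[u v] uvE]]; first by exists 0%N.
have [E' [gE' eE nE uv]] := remove_edge gE uvE.
have nE' : (v, u) \notin E' by apply: contra nE => /(gE'.1).
move: hm; rewrite eE card_add_edge // => hm.
have [|e ->] := IH E' _ gE'; first by lia.
by exists e.+1; lia.
Qed.

Section Base.
Variable x0 : 'I_n.
Local Notation around := (around x0).

Lemma around_eq c i j : uniq c -> (0 < size c)%N ->
  (around c i == around c j) = (i == j %[mod size c]).
Proof. by move=> uc c0; rewrite /around nth_uniq // ltn_mod. Qed.

Lemma around_succ_neq c i : uniq c -> (1 < size c)%N -> around c i != around c i.+1.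
Proof.
move=> uc c1; rewrite around_eq //; last by lia.
by rewrite eq_sym eqn_mod_dvd // subSnn dvdn1; lia.
Qed.

Lemma around_succ2_neq c i : uniq c -> (2 < size c)%N -> around c i != around c i.+2.
Proof.
move=> uc c1; rewrite around_eq //; last by lia.
rewrite eq_sym eqn_mod_dvd; last by lia.
by rewrite (_ : i.+2 - i = 2)%N; [apply/negP => /dvdn_leq; lia|lia].
Qed.

Lemma cyc_edges_graph_uniq c : uniq c -> (2 < size c)%N -> is_graph (cyc_edges c).
Proof.
move=> uc c2; apply: (@cyc_edges_graph _ x0); first by lia.
by move=> i; apply: around_succ_neq => //; lia.
Qed.

Lemma cyc_edges_mem c u v : (u, v) \in cyc_edges c -> u \in c /\ v \in c.
Proof.
case: c => [|x p]; first by rewrite inE.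
move=> /path_edges_mem; rewrite !mem_rcons !in_cons.
by case=> /orP[->|->] /orP[->|->]; rewrite ?orbT.
Qed.

Lemma deg_cyc_edges c v : uniq c -> (2 < size c)%N ->
  deg (cyc_edges c) v = (2 * (v \in c))%N.
Proof.
move=> uc c2; have c0 : (0 < size c)%N by lia.
case: (boolP (v \in c)) => [vc|vc]; last first.
  by apply: eq_card0 => u; rewrite inE; apply: contraNF vc => /cyc_edges_mem[].
rewrite muln1; have [i _ <-] := around_onto x0 vc.
have bnd := deg_ge2 (x0 := x0) i c0 (fun i => around_succ2_neq i uc c2).
apply/eqP; rewrite eqn_leq bnd andbT.
apply: (@leq_trans #|[set around c i.+1; around c (i + (size c).-1)]|); last first.
  by rewrite cards2; case: (_ != _).
apply: subset_leq_card; apply/subsetP => u; rewrite inE => /(cyc_edgesP x0 _ _ c0)[j [[e1 ->]|[-> e1]]].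
  move/eqP: e1; rewrite around_eq // => /eqP e1; rewrite !inE; apply/orP; left.
  by rewrite around_eq // -[i.+1]addn1 -[j.+1]addn1 eqn_modDr e1.
move/eqP: e1; rewrite around_eq // => /eqP e1; rewrite !inE; apply/orP; right.
rewrite around_eq // -(eqn_modDr 1) -addnA addn1 [((size c).-1 + 1)%N]addn1 prednK //.
by rewrite modnDr e1.
Qed.

Lemma card_cyc_edges c : uniq c -> (2 < size c)%N -> #|cyc_edges c| = (2 * size c)%N.
Proof.
move=> uc c2; rewrite card_deg (eq_bigr (fun v => (2 * (v \in c))%N)).
  rewrite -big_distrr /=; congr (_ * _)%N.
  by rewrite -(card_uniqP uc) -sum1_card [RHS]big_mkcond /=; apply: eq_bigr => v _; case: (v \in c).
by move=> v _; exact: deg_cyc_edges.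
Qed.

(** Steps of the length minus one are steps of -1 modulo the length, so [true] reverses the
    orientation. *)
Definition dih_step c (b : bool) : nat := if b then (size c).-1 else 1%N.

(** The dihedral images of a cyclic list: a starting point r and one of two directions. *)
Definition dih c (r : nat) (b : bool) : seq 'I_n :=
  mkseq (fun i => around c (r + dih_step c b * i)) (size c).

Lemma around_mod_eq c i j : i = j %[mod size c] -> around c i = around c j.
Proof. by rewrite /around => ->. Qed.

Lemma size_dih c r b : size (dih c r b) = size c.
Proof. by rewrite size_mkseq. Qed.

Lemma around_dih c r b i : (0 < size c)%N ->
  around (dih c r b) i = around c (r + dih_step c b * i).
Proof.
move=> c0; rewrite aroundE size_dih nth_mkseq ?ltn_mod //.
by apply: around_mod_eq; rewrite -modnDmr modnMmr modnDmr.
Qed.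

Lemma seq_around c : c = mkseq (around c) (size c).
Proof.
apply: (@eq_from_nth _ x0); first by rewrite size_mkseq.
by move=> i hi; rewrite nth_mkseq // around_small.
Qed.

Lemma around_ext c c' : size c = size c' -> around c =1 around c' -> c = c'.
Proof.
move=> sc e; rewrite [LHS]seq_around [RHS]seq_around sc.
by apply: eq_map => i; rewrite e.
Qed.

Lemma dih_step_dvd c b i : (2 < size c)%N ->
  (dih_step c b * i == 0 %[mod size c]) = (size c %| i)%N.
Proof.
move=> c2; rewrite mod0n -/(dvdn _ _) /dih_step; case: b; rewrite ?mul1n //.
rewrite Gauss_dvdr //; case: (size c) c2 => // k _.
by rewrite coprimeSn.
Qed.

Lemma dih_uniq c r b : uniq c -> (2 < size c)%N -> uniq (dih c r b).
Proof.
move=> uc c2; rewrite map_inj_in_uniq ?iota_uniq // => i j.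
rewrite !mem_iota /= !add0n => hi hj /eqP; rewrite around_eq //; last by lia.
rewrite eqn_modDl.
wlog ij : i j hi hj / (i <= j)%N => [W|].
  by case/orP: (leq_total i j) => h /eqP e; [|apply/esym]; apply: W => //; rewrite e.
rewrite eq_sym eqn_mod_dvd ?leq_mul2l ?ij ?orbT // -mulnBr.
have := dih_step_dvd b (j - i) c2; rewrite mod0n -/(dvdn _ _) => -> /dvdn_leq; lia.
Qed.

Lemma dih_inj c r r' b b' : uniq c -> (2 < size c)%N -> (r < size c)%N -> (r' < size c)%N ->
  dih c r b = dih c r' b' -> r = r' /\ b = b'.
Proof.
move=> uc c2 hr hr' e; have c0 : (0 < size c)%N by lia.
have E i : around c (r + dih_step c b * i) = around c (r' + dih_step c b' * i).
  by rewrite -!around_dih // e.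
have er : r = r'.
  have /eqP := E 0%N; rewrite !muln0 !addn0 around_eq // !modn_small // => /eqP //.
subst r'; split=> //; have /eqP := E 1%N; rewrite !muln1 around_eq // eqn_modDl.
by rewrite /dih_step; case: b {e E}; case: b' => //;
  rewrite !modn_small; try lia; move/eqP; lia.
Qed.

Lemma cyc_edges_dih_sub c r b : (2 < size c)%N ->
  cyc_edges (dih c r b) \subset cyc_edges c.
Proof.
move=> c2; have c0 : (0 < size c)%N by lia.
have c0' : (0 < size (dih c r b))%N by rewrite size_dih.
apply/subsetP => -[u v] /(cyc_edgesP x0 _ _ c0') H.
case: H => i; rewrite !around_dih // mulnS => h; apply/(cyc_edgesP x0) => //.
move: h; rewrite /dih_step; case: b {c0'} => h; last first.
  by exists (r + i)%N; move: h; rewrite !mul1n add1n addnS.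
exists (r + ((size c).-1 + (size c).-1 * i))%N; move: h.
have -> : around c (r + ((size c).-1 + (size c).-1 * i)).+1 = around c (r + (size c).-1 * i).
  rewrite addnCA -addSn prednK // addnC.
  by have := around_addl x0 c (r + (size c).-1 * i) 1; rewrite mul1n.
by case=> -[-> ->]; [right|left].
Qed.

Lemma cyc_edges_dih c r b : uniq c -> (2 < size c)%N ->
  cyc_edges (dih c r b) = cyc_edges c.
Proof.
move=> uc c2; apply/eqP; rewrite eqEcard cyc_edges_dih_sub //.
rewrite andTb (card_cyc_edges uc c2) card_cyc_edges ?size_dih //.
exact: dih_uniq.
Qed.

(** From a common vertex, the first step of [c2] is the first step of [c1] in one of its two
    directions, for want of a third neighbour. After that the walks coincide, and equal periods give
    equal lengths. *)
Lemma cycles_meet E c1 c2 v : is_graph E -> (forall u, deg E u <= 2)%N ->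
  uniq c1 -> (2 < size c1)%N -> uniq c2 -> (2 < size c2)%N ->
  cyc_edges c1 \subset E -> cyc_edges c2 \subset E -> v \in c1 -> v \in c2 ->
  size c1 = size c2 /\ exists b, exists2 r, (r < size c1)%N & c2 = dih c1 r b.
Proof.
move=> gE dE u1 s1 u2 s2 E1 E2 v1 v2.
have c10 : (0 < size c1)%N by lia. have c20 : (0 < size c2)%N by lia.
have [i1 _ e1] := around_onto x0 v1; have [i2 _ e2] := around_onto x0 v2.
pose g b i := around c1 (i1 + dih_step c1 b * i).
pose f i := around c2 (i2 + i).
have gd b i : g b i = around (dih c1 i1 b) i by rewrite around_dih.
have fE i : (f i, f i.+1) \in E.
  by rewrite /f addnS; apply: (subsetP E2); apply: cyc_edges_next.
have fnb i : f i != f i.+2 by rewrite /f !addnS around_succ2_neq.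
have gE' b i : (g b i, g b i.+1) \in E.
  rewrite !gd; apply: (subsetP E1); apply: (subsetP (cyc_edges_dih_sub i1 b s1)).
  by apply: cyc_edges_next; rewrite size_dih.
have gnb b i : g b i != g b i.+2.
  by rewrite !gd around_succ2_neq ?dih_uniq ?size_dih.
have [b fg] : exists b, f =1 g b.
  have f0 b : f 0%N = g b 0%N by rewrite /f /g muln0 !addn0 e1 e2.
  suff [b e] : exists b, f 1%N = g b 1%N.
    by exists b; apply: (nb_walk_unique dE gE) => //; exact: gnb.
  case: (eqVneq (f 1%N) (g false 1%N)) => [|n1]; first by exists false.
  case: (eqVneq (f 1%N) (g true 1%N)) => [|n2]; first by exists true.
  have := dE (f 0%N); rewrite leqNgt => /negP[].
  apply: (@three_le_deg _ _ _ (f 1%N) (g false 1%N) (g true 1%N)) => //.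
  - by rewrite (f0 false).
  - by rewrite (f0 true).
  - rewrite /g !muln1 around_eq // eqn_modDl /dih_step !modn_small; lia.
have pf i : (f i == f 0%N) = (size c2 %| i)%N.
  rewrite /f addn0 around_eq // -{2}[i2]addn0 eqn_modDl mod0n //.
have pg i : (g b i == g b 0%N) = (size c1 %| i)%N.
  rewrite /g muln0 around_eq // eqn_modDl dih_step_dvd //.
have sz : size c1 = size c2.
  by apply/eqP; rewrite eqn_dvd -pg -fg -(fg 0%N) pf dvdnn -pf !fg pg dvdnn.
split=> //; exists b; set k := size c1 in sz *.
(* [f] reaches the start of [c2] after k - i2 steps modulo k; as many steps of [c1] from [i1] in
   direction b give the starting point. *)
exists ((i1 + dih_step c1 b * (k - i2 %% k)) %% k)%N; first by rewrite ltn_mod.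
apply: around_ext; first by rewrite size_dih; exact/esym.
move=> j; rewrite around_dih //.
transitivity (g b (j + (k - i2 %% k))%N).
  rewrite -fg /f; apply: around_mod_eq; rewrite -sz -/k -modnDml addnCA.
  rewrite subnKC ?modnDr //; apply: ltnW; rewrite ltn_mod //.
apply: around_mod_eq; rewrite -/k modnDml; congr (_ %% _)%N.
by rewrite mulnDr addnA addnAC.
Qed.

Definition is_cycle G c : bool := uniq c && cycle (fun x y => G x y) c.

(** The 2 k dihedral images of [c] are different. Any listing with the same edges meets [c] in a
    graph of degrees at most two, so [cycles_meet] makes it one of them. *)
Lemma cyc_fiber k c : uniq c -> size c = k -> (2 < k)%N ->
  #|[set t : k.-tuple 'I_n | uniq t && (cyc_edges t == cyc_edges c)]| = (2 * k)%N.
Proof.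
move=> uc sc k2.
have st (p : nat * bool) : size (dih c p.1 p.2) == k by rewrite size_dih sc.
pose h (p : 'I_k * bool) : k.-tuple 'I_n := @Tuple _ _ (dih c p.1 p.2) (st (nat_of_ord p.1, p.2)).
have hI : injective h.
  move=> [r b] [r' b'] /(congr1 val) /= e; have := dih_inj uc _ _ _ e.
  by rewrite sc => /(_ k2 (ltn_ord _) (ltn_ord _))[/val_inj -> ->].
have -> : [set t : k.-tuple 'I_n | uniq t && (cyc_edges t == cyc_edges c)] = h @: [set: 'I_k * bool].
  apply/setP => t; rewrite inE; apply/idP/imsetP => [/andP[ut /eqP et]|[[r b] _ ->]]; last first.
    by rewrite /= dih_uniq ?sc // cyc_edges_dih ?sc ?eqxx.
  have t0 : (0 < size t)%N by rewrite size_tuple; lia.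
  have dE v : (deg (cyc_edges c) v <= 2)%N.
    by rewrite deg_cyc_edges ?sc //; case: (v \in c).
  have c2 : (2 < size c)%N by rewrite sc.
  have t2 : (2 < size t)%N by rewrite size_tuple.
  have vc : around t 0 \in c by have := cyc_edges_next x0 0 t0; rewrite et => /cyc_edges_mem[].
  have tE : cyc_edges t \subset cyc_edges c by rewrite et.
  have [_ [b [r hr er]]] := cycles_meet (cyc_edges_graph_uniq uc c2) dE uc c2 ut t2 (subxx _) tE
     vc (around_mem x0 0 t0).
  rewrite sc in hr; exists (Ordinal hr, b) => //.
  by apply: val_inj; rewrite /= er.
by rewrite card_imset // cardsT card_prod card_ord card_bool mulnC.
Qed.

End Base.

(** An edge set forgets base point and orientation, so each cycle is counted once. *)
Definition cycle_sets G k : {set {set 'I_n * 'I_n}} :=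
  [set cyc_edges t | t : k.-tuple 'I_n & is_cycle G t].

Definition cycle_number G k : nat := #|cycle_sets G k|.

Lemma cycle_edges_eq G (c c' : seq 'I_n) : G \in regular_graphs n d ->
  cyc_edges c = cyc_edges c' ->
  cycle (fun x y => G x y) c = cycle (fun x y => G x y) c'.
Proof.
move=> rG e; have := containing_cyc d c G; have := containing_cyc d c' G.
by rewrite e rG /= => -> .
Qed.

Lemma tcountE k (P : pred (seq 'I_n)) : tcount k P = #|[set t : k.-tuple 'I_n | P t]|.
Proof.
rewrite -sum1_card [RHS]big_mkcond /=; apply: eq_bigr => t _.
by rewrite inE; case: (P t).
Qed.

Lemma tcount_cycles_outside G k (L : {set {set 'I_n * 'I_n}}) :
  G \in regular_graphs n d -> (2 < k)%N ->
  tcount k (fun c => is_cycle G c && (cyc_edges c \notin L)) =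
  (2 * k * #|cycle_sets G k :\: L|)%N.
Proof.
move=> rG k2; rewrite tcountE -sum1_card.
rewrite (partition_big (fun t : k.-tuple 'I_n => cyc_edges t) (mem (cycle_sets G k :\: L))) /=.
  rewrite (eq_bigr (fun=> (2 * k)%N)) ?sum_nat_const ?[(_ * (2 * k))%N]mulnC //.
  move=> E; rewrite inE => /andP[EL /imsetP[t]]; rewrite inE => /andP[ut ct] eE.
  have x0 : 'I_n.
    by case: (tval t) (size_tuple t) => [h|x p _]; [exfalso; move: h k2 => /= <-|exact: x].
  rewrite -(cyc_fiber x0 ut (size_tuple t) k2) -sum1_card; apply: eq_bigl => t'.
  rewrite !inE -eE; case: (boolP (uniq t')) => ut'; rewrite /is_cycle ?(negbTE ut') //= ut'.
  case: eqP => [e'|]; rewrite ?andbF //= ?andbT.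
  by rewrite e' EL (cycle_edges_eq rG (etrans e' eE)) ct.
move=> t; rewrite inE => /andP[ct cL]; rewrite inE cL /=.
by apply/imsetP; exists t; rewrite ?inE.
Qed.

Lemma tcount_cycles G k : G \in regular_graphs n d -> (2 < k)%N ->
  tcount k (is_cycle G) = (2 * k * cycle_number G k)%N.
Proof.
move=> rG k2; rewrite /cycle_number -[cycle_sets G k]setD0 -tcount_cycles_outside //.
by apply: eq_bigr => t _; rewrite in_set0 andbT.
Qed.

(** [w] concatenates listings of different cycles of lengths [ks]; with one flat tuple, the number
    of visited vertices is a property of a single list. *)
Fixpoint distinct_cycles G (ks : seq nat) (w : seq 'I_n) : bool :=
  if ks is k :: ks' then
    [&& is_cycle G (take k w),
        cyc_edges (take k w) \notin [seq cyc_edges c | c <- reshape ks' (drop k w)]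
      & distinct_cycles G ks' (drop k w)]
  else true.

(** The number of such lists: factors 2 k for the listings of a cycle and, for repeated lengths, a
    falling factorial of the number of k-cycles. *)
Fixpoint falling_counts G (ks : seq nat) : nat :=
  if ks is k :: ks' then
    (2 * k * (cycle_number G k - count_mem k ks') * falling_counts G ks')%N
  else 1%N.

Lemma distinct_cycles_sets G ks w : all (fun k => 2 < k)%N ks -> size w = sumn ks ->
  distinct_cycles G ks w ->
  uniq [seq cyc_edges c | c <- reshape ks w] /\
  forall k, (2 < k)%N -> #|cycle_sets G k :&: [set E in [seq cyc_edges c | c <- reshape ks w]]| = count_mem k ks.
Proof.
elim: ks w => [|k ks IH] w /=.
  move=> _ _ _; split=> // k _; apply: eq_card0 => E; rewrite !inE.
  by rewrite andbF.
move=> /andP[k2 ks2] sw /and3P[cw nw dw].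
have sd : size (drop k w) = sumn ks by rewrite size_drop sw addKn.
have [u IHk] := IH _ ks2 sd dw; split; first by rewrite nw u.
have st : size (take k w) = k by rewrite size_takel // sw leq_addr.
move=> k' k'2; rewrite -(IHk k' k'2).
set L := [set E in [seq cyc_edges c | c <- reshape ks _]].
have -> : [set E in cyc_edges (take k w) :: [seq cyc_edges c | c <- reshape ks (drop k w)]]
   = cyc_edges (take k w) |: L by apply/setP => E; rewrite !inE.
have nL : cyc_edges (take k w) \notin L by rewrite inE.
rewrite setIUr; case: (eqVneq k k') => [<-|kk'].
  have -> : cycle_sets G k :&: [set cyc_edges (take k w)] = [set cyc_edges (take k w)].
    apply/setIidPr; rewrite sub1set; apply/imsetP.
    by exists (Tuple (introT eqP st)); rewrite ?inE.
  by rewrite cardsU1 inE (negbTE nL) andbF.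
(* The number of edges reveals the length of a cycle. *)
have -> : cycle_sets G k' :&: [set cyc_edges (take k w)] = set0.
  apply/setP => E; rewrite !inE; apply/negP => /andP[/imsetP[t]]; rewrite inE => ct -> /eqP e.
  have t2 : (size (take k w) > 2)%N by rewrite st.
  case/andP: cw => uw _; case/andP: ct => ut _.
  have x0 : 'I_n by case: (take k w) t2 => // x.
  have := card_cyc_edges x0 uw t2; rewrite -e st.
  rewrite (card_cyc_edges x0 ut) size_tuple // => /eqP.
  by rewrite eqn_pmul2l // eq_sym (negbTE kk').
by rewrite set0U.
Qed.

Lemma tcount_distinct_cycles G ks : G \in regular_graphs n d -> all (fun k => 2 < k)%N ks ->
  tcount (sumn ks) (distinct_cycles G ks) = falling_counts G ks.
Proof.
move=> rG; elim: ks => [|k ks IH] /=.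
  by rewrite /tcount (big_pred1 [tuple]) // => t; apply/esym/eqP; exact: tuple0.
move=> /andP[k2 ks2]; rewrite -(IH ks2) /tcount.
rewrite (big_tuple_cat _ k (sumn ks) (fun w => nat_of_bool (distinct_cycles G (k :: ks) w))).
rewrite exchange_big big_distrr /=; apply: eq_bigr => y _.
rewrite (eq_bigr (fun x : k.-tuple 'I_n => (is_cycle G x &&
   (cyc_edges x \notin [seq cyc_edges c | c <- reshape ks y])) * distinct_cycles G ks y)%N); last first.
  move=> x _; rewrite take_size_cat ?size_tuple // drop_size_cat ?size_tuple //.
  by rewrite andbA mulnb.
rewrite -big_distrl /=; case: (boolP (distinct_cycles G ks y)) => dy; last by rewrite !muln0.
rewrite !muln1; have [_ /(_ k k2) cL] := distinct_cycles_sets ks2 (size_tuple y) dy.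
have := tcount_cycles_outside [set E in [seq cyc_edges c | c <- reshape ks y]] rG k2.
rewrite cardsD cL -/(cycle_number G k) /tcount => <-.
by apply: eq_bigr => x _; rewrite inE.
Qed.

End SimpleCycles.

(** * Placements with more edges than vertices, and disjoint cycles *)

Section SparseSums.
Variables (n d : nat).
Implicit Types (G : 'M[bool]_n) (s p t c w : seq 'I_n) (x y z u v : 'I_n).
Implicit Types (E : {set 'I_n * 'I_n}).

(** A new first entry is one of at most m old values, with one more factor n, or one of at most n
    new values, with the weight unchanged: a factor (m + 1) n in all. *)
Lemma sum_support_pow m : (0 < n)%N ->
  (\sum_(t : m.-tuple 'I_n) n ^ (m - size (undup t)) <= m`! * n ^ m)%N.
Proof.
move=> n0; elim: m => [|m IH].
  by rewrite (big_pred1 [tuple]) // => t; apply/esym/eqP; exact: tuple0.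
rewrite (big_tuple_cons _ m (fun s => n ^ (m.+1 - size (undup s)))%N) /=.
apply: (@leq_trans (\sum_(p : m.-tuple 'I_n) (m.+1 * n) * n ^ (m - size (undup p)))%N); last first.
  rewrite -big_distrr /= factS expnS; apply: leq_trans (leq_mul (leqnn _) IH) _.
  by clear; lia.
apply: leq_sum => p _; have sp : (size (undup p) <= m)%N.
  by rewrite -{2}(size_tuple p) size_undup.
rewrite (bigID (fun x => x \in (p : seq _))) /=.
have h1 : (\sum_(x | x \in (p : seq 'I_n)) n ^ (m.+1 - size (undup (x :: p))) <=
    m * (n * n ^ (m - size (undup p))))%N.
  rewrite (eq_bigr (fun=> (n * n ^ (m - size (undup p)))%N)); last first.
    by move=> x /= ->; rewrite subSn // expnS.
  rewrite sum_nat_const leq_mul2r; apply/orP; right.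
  by rewrite -{2}(size_tuple p) card_size.
have h2 : (\sum_(x | x \notin (p : seq 'I_n)) n ^ (m.+1 - size (undup (x :: p))) <=
    n * n ^ (m - size (undup p)))%N.
  rewrite (eq_bigr (fun=> (n ^ (m - size (undup p)))%N)); last first.
    by move=> x /= /negbTE ->; rewrite /= subSS.
  rewrite sum_nat_const leq_mul2r; apply/orP; right.
  by rewrite -[X in (_ <= X)%N](card_ord n) max_card.
by apply: leq_trans (leq_add h1 h2) _; rewrite -mulSnr mulnA.
Qed.

(* A graph with more edges than vertices has [n^v] placements of probability
   [O(n^-(v+1))] each. *)
Lemma sum_dense_le m M (P : pred (seq 'I_n)) (F : seq 'I_n -> {set 'I_n * 'I_n}) :
  (0 < d)%N -> (0 < n)%N -> (2 * (2 * M + 2 * (d.+1 * d)) <= n * d)%N ->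
  (forall t, size t = m -> P t ->
     [/\ is_graph (F t), (#|F t| <= 2 * M)%N & (2 * size (undup t) < #|F t|)%N]) ->
  ((\sum_(t : m.-tuple 'I_n) P t * cnt d (F t)) * n <=
   (2 * d) ^ M * m`! * cnt d (set0 : {set 'I_n * 'I_n}))%N.
Proof.
move=> d0 n0 h hP; have nm : (0 < n ^ m)%N by rewrite expn_gt0 n0.
rewrite -(leq_pmul2r nm).
apply: (@leq_trans (\sum_(t : m.-tuple 'I_n) (2 * d) ^ M * cnt d (set0 : {set 'I_n * 'I_n}) *
    n ^ (m - size (undup t)))%N); last first.
  rewrite -big_distrr /=; apply: leq_trans (leq_mul (leqnn _) (sum_support_pow m n0)) _.
  by clear; lia.
rewrite !big_distrl /=; apply: leq_sum => t _.
case: (boolP (P t)) => // Pt; rewrite mul1n.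
have [gF lF uF] := hP _ (size_tuple t) Pt.
have su : (size (undup t) <= m)%N by rewrite -{2}(size_tuple t) size_undup.
have [e ce] := is_graph_even gF.
have := cnt_le d0 gF ce; rewrite ce => /(_ ltac:(lia)) hc.
have d2 : (0 < 2 * d)%N by lia.
have h1 : (cnt d (F t) * n ^ (size (undup t)).+1 <= (2 * d) ^ M * cnt d (set0 : {set 'I_n * 'I_n}))%N.
  apply: (@leq_trans (cnt d (F t) * n ^ e)%N).
    by rewrite leq_mul2l leq_pexp2l ?orbT //; lia.
  apply: leq_trans hc _; rewrite leq_mul2r leq_pexp2l ?orbT //; lia.
rewrite -mulnA -expnS (_ : m.+1 = (size (undup t)).+1 + (m - size (undup t)))%N; last by lia.
by rewrite expnD mulnA leq_mul2r h1 orbT.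
Qed.

Lemma card_path_edges_le s : (#|path_edges s| <= 2 * (size s).-1)%N.
Proof.
elim: s => [|a [|b s] IH]; rewrite ?cards0 //.
rewrite path_edges_cons; apply: leq_trans (leq_card_setU _ _) _; rewrite cards1.
apply: (@leq_trans (1 + (1 + #|path_edges (b :: s)|))%N).
  rewrite leq_add2l; apply: leq_trans (leq_card_setU _ _) _.
  by rewrite cards1.
by move: IH => /=; lia.
Qed.

Lemma deg_sum_ge E t v : (forall u, u \in t -> 1 < deg E u)%N -> (2 < deg E v)%N ->
  v \in t -> (2 * size (undup t) < #|E|)%N.
Proof.
move=> h hv vt; rewrite card_deg (bigID (fun u => u \in t)) /=.
apply: leq_trans (leq_addr _ _); rewrite (bigD1 v) //=.
have -> : (2 * size (undup t) = 2 + \sum_(u | (u \in t) && (u != v)) 2)%N.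
  have -> : size (undup t) = #|[set u in t]|.
    by rewrite -(card_uniqP (undup_uniq t)); apply: eq_card => u; rewrite mem_undup inE.
  rewrite sum_nat_const (cardsD1 v) inE vt mulnDr muln1 mulnC; congr (_ + _ * _)%N.
  by apply: eq_card => u; rewrite !inE andbC.
by rewrite -addSn leq_add //; apply: leq_sum => u /andP[/h].
Qed.

Definition branching t : bool := [exists v, 2 < deg (cyc_edges t) v]%N.

(** In a closed non-backtracking walk every vertex has degree at least two, so a third neighbour
    somewhere means more edges than vertices, and [sum_dense_le] applies. *)
Lemma sum_branching_le k : (0 < d)%N -> (0 < n)%N -> (0 < k)%N ->
  (2 * (2 * k + 2 * (d.+1 * d)) <= n * d)%N ->
  ((\sum_(G in regular_graphs n d) tcount k (fun t => cnbw G t && branching t)) * n <=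
   (2 * d) ^ k * k`! * cnt d (set0 : {set 'I_n * 'I_n}))%N.
Proof.
move=> d0 n0 k0 h.
(* Only tuples that are walks in some regular graph are kept; such a graph shows that there is no
   loop and no vertex of degree one. *)
pose P (t : seq 'I_n) := branching t && [exists G in regular_graphs n d, cnbw G t].
apply: leq_trans (@sum_dense_le k k P (@cyc_edges n) d0 n0 h _).
  rewrite leq_mul2r; apply/orP; right; rewrite exchange_big /=; apply: leq_sum => t _.
  rewrite /P; case: (boolP (branching t)) => bt; last first.
    by rewrite big1 // => G _; rewrite andbF.
  case: (boolP [exists G in _, _]) => [_|/existsPn N]; last first.
    by rewrite big1 // => G rG; move: (N G); rewrite rG /= => /negbTE ->.
  rewrite mul1n /cnt -sum1_card [X in (_ <= X)%N](eq_bigl (fun G => (G \in regular_graphs n d) &&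
     cycle (fun x y => G x y) t)); last by move=> G; rewrite containing_cyc.
  rewrite big_mkcondr; apply: leq_sum => G rG; rewrite andbT.
  case: (boolP (cnbw G t)) => // ct; have t0 : (0 < size t)%N by rewrite size_tuple.
  have x0 : 'I_n by case: (tval t) t0.
  suff -> : cycle (fun x y => G x y) t by [].
  by apply/(cycle_around x0) => // i; have /(cnbwP x0 _ t0)/(_ i)[] := ct.
move=> t st /andP[/existsP[v hv] /existsP[G /andP[rG ct]]].
have t0 : (0 < size t)%N by rewrite st.
have x0 : 'I_n by case: t t0 {st hv ct} => // x.
have /(cnbwP x0 _ t0) hc := ct; have /regular_graphsP[lG _ _] := rG.
have gE : is_graph (cyc_edges t).
  apply: (@cyc_edges_graph _ x0) => // i; apply: contraTneq (hc i).1 => <-.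
  by rewrite lG.
split=> //.
  case: t t0 {hv ct hc gE} st => // x p _ st; rewrite -[cyc_edges _]/(path_edges (rcons (x :: p) x)).
  by apply: leq_trans (card_path_edges_le _) _; rewrite size_rcons st.
apply: (@deg_sum_ge _ _ v) => //.
  move=> u /(around_onto x0)[i _ <-]; apply: deg_ge2 => // j; exact: (hc j).2.
have : (0 < deg (cyc_edges t) v)%N by lia.
by move=> /card_gt0P[u]; rewrite inE => /cyc_edges_mem[].
Qed.

Section Periodic.
Variable x0 : 'I_n.

Definition repeats G k j (t : seq 'I_n) : bool :=
  is_cycle G (take j t) && (t == mkseq (around x0 (take j t)) k).

Lemma tcount_repeats G k j : (0 < j)%N -> (j <= k)%N ->
  tcount k (repeats G k j) = tcount j (is_cycle G).
Proof.
move=> j0 jk; rewrite !tcountE.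
have st (c : j.-tuple 'I_n) : size (mkseq (around x0 c) k) == k by rewrite size_mkseq.
pose h (c : j.-tuple 'I_n) : k.-tuple 'I_n := Tuple (st c).
have th (c : j.-tuple 'I_n) : take j (h c) = c.
  rewrite /= /mkseq -map_take take_iota (minn_idPl jk).
  by rewrite [RHS](seq_around x0) size_tuple.
have hI : injective h by move=> c c' e; apply: val_inj; rewrite /= -(th c) -(th c') e.
rewrite -(card_imset _ hI); apply: eq_card => t; rewrite inE; apply/idP/imsetP.
  move=> /andP[ct /eqP et]; have sj : size (take j t) == j by rewrite size_takel ?size_tuple.
  by exists (Tuple sj); rewrite ?inE //; apply: val_inj.
by move=> [c]; rewrite inE => cc ->; rewrite /repeats th cc /=.
Qed.

Lemma repeats_cnbw G k j t : (2 < j)%N -> (j %| k)%N -> (0 < k)%N -> size t = k ->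
  repeats G k j t -> cnbw G t.
Proof.
move=> j2 jk k0 st /andP[/andP[ut ct] /eqP et].
have jle : (j <= k)%N by exact: dvdn_leq.
have sj : size (take j t) = j by rewrite size_takel // st.
have at_ i : around x0 t i = around x0 (take j t) i.
  rewrite {1}/around st [in LHS]et nth_mkseq ?ltn_mod // /around sj modn_dvdm //.
apply/(cnbwP x0); rewrite ?st // => i; rewrite !at_; split.
  by move: i; apply/(cycle_around x0); rewrite ?sj //; lia.
by apply: around_succ2_neq => //; rewrite sj.
Qed.

(** For j < j' the entry at j would repeat the entry at 0 among the first j', which are distinct. *)
Lemma repeats_unique G k j j' t : (2 < j)%N -> (2 < j')%N -> (j <= k)%N -> (j' <= k)%N ->
  size t = k -> repeats G k j t -> repeats G k j' t -> j = j'.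
Proof.
wlog jj' : j j' / (j <= j')%N => [W|].
  by case/orP: (leq_total j j') => h *; [|apply/esym]; apply: W.
move=> j2 j'2 jk j'k st /andP[_ /eqP et] /andP[/andP[ut _] _].
apply/eqP; rewrite eqn_leq jj' leqNgt; apply/negP => lt.
have e : nth x0 t j = nth x0 t 0.
  rewrite {1 2}et !nth_mkseq; try lia.
  by rewrite /around size_takel ?st // modnn mod0n.
have := nth_uniq x0 (i := j) (j := 0) _ _ ut; rewrite size_takel ?st //.
by rewrite !nth_take ?e ?eqxx; [|lia..] => /(_ lt ltac:(lia)) /esym/eqP; lia.
Qed.

(** Without branching, a closed walk runs around a cycle whose length divides k, and this length is
    unique; only branching walks escape. *)
Lemma cnbw_decomp G k : (0 < k)%N -> G \in regular_graphs n d ->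
  (\sum_(j <- divisors k | 2 < j) tcount j (is_cycle G) <= tcount k (cnbw G))%N /\
  (tcount k (cnbw G) <= \sum_(j <- divisors k | 2 < j) tcount j (is_cycle G) +
     tcount k (fun t => cnbw G t && branching t))%N.
Proof.
move=> k0 rG.
have dv j : j \in divisors k -> (j %| k)%N by rewrite -dvdn_divisors.
have -> : (\sum_(j <- divisors k | 2 < j) tcount j (is_cycle G) =
    \sum_(t : k.-tuple 'I_n) \sum_(j <- divisors k | 2 < j) repeats G k j t)%N.
  rewrite exchange_big /= big_seq_cond [RHS]big_seq_cond; apply: eq_bigr => j.
  move=> /andP[/dv jk j2]; rewrite -(@tcount_repeats G k j) //; last exact: dvdn_leq.
  by lia.
have le1 (t : k.-tuple 'I_n) :
    (\sum_(j <- divisors k | 2 < j) repeats G k j t <= cnbw G t)%N.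
  case: (boolP (has (fun j => (2 < j) && repeats G k j t)%N (divisors k))) => [/hasP[j jk /andP[j2 rj]]|/hasPn N].
    rewrite (repeats_cnbw j2 (dv _ jk) k0 (size_tuple t) rj).
    rewrite big_mkcond (bigD1_seq j) ?divisors_uniq //= j2 rj big1_seq ?addn0 // => j' /andP[j'j j'k].
    case: ifP => // j'2; case: (boolP (repeats _ _ _ _)) => // rj'.
    have := repeats_unique j2 j'2 (dvdn_leq k0 (dv _ jk)) (dvdn_leq k0 (dv _ j'k)) (size_tuple t) rj rj'.
    by move=> e; rewrite e eqxx in j'j.
  rewrite big_seq_cond big1 // => j /andP[jk j2].
  by move: (N j jk); rewrite j2 /= => /negbTE ->.
split; first by apply: leq_sum => t _.
rewrite /tcount -big_split /=; apply: leq_sum => t _.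
case: (boolP (cnbw G t)) => //= ct; case: (boolP (branching t)) => [|/existsPn N].
  by rewrite addn1.
rewrite addn0; have t0 : (0 < size t)%N by rewrite size_tuple.
have [|c [c2 ck uc cc ac]] := good_cnbw_periodic x0 t0 rG ct.
  by move=> v; rewrite leqNgt N.
rewrite size_tuple in ck; have cle : (size c <= k)%N by exact: dvdn_leq.
have tc : take (size c) t = c.
  apply: (@eq_from_nth _ x0); first by rewrite size_takel ?size_tuple.
  rewrite size_takel ?size_tuple // => i hi; rewrite nth_take //.
  by rewrite -(around_small x0 hi) -ac around_small // size_tuple; lia.
have rt : repeats G k (size c) t.
  rewrite /repeats tc /is_cycle uc cc /=; apply/eqP.
  rewrite [LHS](seq_around x0) size_tuple; apply: eq_map => i; exact: ac.
rewrite big_mkcond (bigD1_seq (size c)) ?divisors_uniq -?dvdn_divisors //= c2 rt.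
by rewrite leq_addr.
Qed.

End Periodic.

Fixpoint union_edges (ss : seq (seq 'I_n)) : {set 'I_n * 'I_n} :=
  if ss is c :: ss' then cyc_edges c :|: union_edges ss' else set0.

Definition simple_cycles (ss : seq (seq 'I_n)) : bool :=
  all (fun c => uniq c && (2 < size c)%N) ss.

Lemma union_edges_sub c ss : c \in ss -> cyc_edges c \subset union_edges ss.
Proof.
elim: ss => //= a ss IH; rewrite in_cons => /orP[/eqP <-|/IH h]; first exact: subsetUl.
exact: subset_trans h (subsetUr _ _).
Qed.

Lemma union_edges_mem u v ss : (u, v) \in union_edges ss -> u \in flatten ss.
Proof.
elim: ss => [|c ss IH] /=; first by rewrite inE.
by rewrite in_setU mem_cat => /orP[/cyc_edges_mem[->]|/IH ->] //; rewrite orbT.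
Qed.

Lemma seq_inhabited c : (2 < size c)%N -> 'I_n.
Proof. by case: c. Qed.

Lemma union_edges_graph ss : simple_cycles ss -> is_graph (union_edges ss).
Proof.
elim: ss => [|c ss IH] /=; first by move=> _; split=> [u v|u]; rewrite inE.
move=> /andP[/andP[uc c2] /IH[s1 l1]].
have [s2 l2] := cyc_edges_graph_uniq (seq_inhabited c2) uc c2.
split=> [u v|u]; rewrite !in_setU; last by rewrite negb_or l1 l2.
by move=> /orP[/s2 ->|/s1 ->]; rewrite ?orbT.
Qed.

Lemma card_union_edges ss : simple_cycles ss -> (#|union_edges ss| <= 2 * size (flatten ss))%N.
Proof.
elim: ss => [|c ss IH] /=; first by rewrite cards0.
move=> /andP[/andP[uc c2] /IH h]; apply: leq_trans (leq_card_setU _ _) _.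
by rewrite (card_cyc_edges (seq_inhabited c2) uc c2) size_cat mulnDr leq_add2l.
Qed.

Lemma deg_le_sub E E' v : E \subset E' -> (deg E v <= deg E' v)%N.
Proof.
by move=> s; apply: subset_leq_card; apply/subsetP => u; rewrite !inE => /(subsetP s).
Qed.

Lemma deg_union_ge ss v : simple_cycles ss -> v \in flatten ss -> (1 < deg (union_edges ss) v)%N.
Proof.
move=> /allP sc /flattenP[c cs vc]; have /andP[uc c2] := sc c cs.
apply: leq_trans (deg_le_sub v (union_edges_sub cs)).
by rewrite (deg_cyc_edges (seq_inhabited c2) v uc c2) vc.
Qed.

Lemma deg_union_uniq ss v : simple_cycles ss -> uniq (flatten ss) ->
  deg (union_edges ss) v = (2 * (v \in flatten ss))%N.
Proof.
elim: ss => [|c ss IH] /=.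
  by move=> _ _; rewrite muln0; apply: eq_card0 => u; rewrite !inE.
move=> /andP[/andP[uc c2] sc]; rewrite cat_uniq => /and3P[_ dis us].
rewrite mem_cat; case: (boolP (v \in c)) => vc /=.
  have vn : v \notin flatten ss by apply: contra dis => h; apply/hasP; exists v.
  have := deg_cyc_edges (seq_inhabited c2) v uc c2; rewrite vc => <-.
  apply: eq_card => u; rewrite !inE; case: ((v, u) \in cyc_edges c) => //=.
  by apply: contraNF vn => /union_edges_mem.
rewrite -(IH sc us); apply: eq_card => u; rewrite !inE.
by case: (boolP ((v, u) \in cyc_edges c)) => // /cyc_edges_mem[h]; rewrite h in vc.
Qed.

(** Cycles sharing a vertex would be dihedral images of each other and so have the same edges. *)
Lemma uniq_flatten_deg2 E ss : simple_cycles ss -> is_graph E -> (forall u, deg E u <= 2)%N ->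
  union_edges ss \subset E -> uniq [seq cyc_edges c | c <- ss] -> uniq (flatten ss).
Proof.
move=> + gE dE; elim: ss => [//|c ss IH] /= /andP[/andP[uc c2] sc].
rewrite subUset => /andP[cE sE] /andP[nc us].
rewrite cat_uniq uc (IH sc sE us) andbT /=; apply: contra nc => /hasP[v /flattenP[c' c's vc'] vc].
have /andP[uc' c'2] := allP sc _ c's.
have [_ [b [r _ e]]] := cycles_meet (seq_inhabited c2) gE dE uc c2 uc' c'2 cE
   (subset_trans (union_edges_sub c's) sE) vc vc'.
by apply/mapP; exists c' => //; rewrite e cyc_edges_dih.
Qed.

Lemma uniq_flatten_edges ss : simple_cycles ss -> uniq (flatten ss) ->
  uniq [seq cyc_edges c | c <- ss].
Proof.
elim: ss => [//|c ss IH] /= /andP[/andP[uc c2] sc]; rewrite cat_uniq => /and3P[_ dis us].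
rewrite (IH sc us) andbT; apply: contra dis => /mapP[c' c's e].
have x0 := seq_inhabited c2; have c0 : (0 < size c)%N by apply: leq_trans c2.
have := cyc_edges_next x0 0 c0; rewrite e => /cyc_edges_mem[h _].
apply/hasP; exists (around x0 c 0); first by apply/flattenP; exists c'.
exact: around_mem.
Qed.

Definition cycle_shape (ks : seq nat) w : bool :=
  all uniq (reshape ks w) && uniq [seq cyc_edges c | c <- reshape ks w].

(** Separates a condition on [w] alone from the containment of one edge set, which [cnt] counts over
    the graphs. *)
Lemma distinct_cyclesE G ks w : G \in regular_graphs n d ->
  distinct_cycles G ks w =
  cycle_shape ks w && (G \in containing d (union_edges (reshape ks w))).
Proof.
move=> rG; elim: ks w => [|k ks IH] w; first by rewrite in_containing sub0set rG.
rewrite /= IH /cycle_shape /= !in_containing subUset rG /=.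
rewrite /is_cycle; have := containing_cyc d (take k w) G; rewrite in_containing rG /= => ->.
by case: (uniq (take k w)); case: (cycle _ (take k w)); case: (cyc_edges (take k w) \in _);
  case: (all uniq _); case: (uniq _); case: (_ \subset _).
Qed.

Lemma sum_falling_counts ks : all (fun k => 2 < k)%N ks ->
  (\sum_(G in regular_graphs n d) falling_counts G ks =
   \sum_(w : (sumn ks).-tuple 'I_n) cycle_shape ks w * cnt d (union_edges (reshape ks w)))%N.
Proof.
move=> k2; rewrite (eq_bigr (fun G => \sum_(w : (sumn ks).-tuple 'I_n) distinct_cycles G ks w)%N).
  rewrite exchange_big /=; apply: eq_bigr => w _; rewrite /cnt -sum1_card big_distrr /=.
  rewrite big_mkcond [RHS]big_mkcond /=; apply: eq_bigr => G _.
  case: (boolP (G \in regular_graphs n d)) => rG; last by rewrite in_containing (negbTE rG).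
  rewrite distinct_cyclesE //; case: (G \in containing _ _); rewrite ?andbT ?andbF //.
  by rewrite muln1.
by move=> G rG; rewrite -(tcount_distinct_cycles rG k2).
Qed.

Lemma simple_cycles_reshape ks w : all (fun k => 2 < k)%N ks -> size w = sumn ks ->
  all uniq (reshape ks w) -> simple_cycles (reshape ks w).
Proof.
elim: ks w => [//|k ks IH] w /= /andP[k2 ks2] sw /andP[u us].
have st : size (take k w) = k by rewrite size_takel // sw leq_addr.
rewrite u st k2 /=; apply: IH => //.
by rewrite size_drop sw addKn.
Qed.

(** Different cycles with a common vertex force a vertex of degree at least three, and so more edges
    than vertices. *)
Lemma sum_overlapping_le ks : (0 < d)%N -> (0 < n)%N -> all (fun k => 2 < k)%N ks ->
  (2 * (2 * sumn ks + 2 * (d.+1 * d)) <= n * d)%N ->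
  ((\sum_(w : (sumn ks).-tuple 'I_n) (cycle_shape ks w && ~~ uniq w) *
      cnt d (union_edges (reshape ks w))) * n <=
   (2 * d) ^ sumn ks * (sumn ks)`! * cnt d (set0 : {set 'I_n * 'I_n}))%N.
Proof.
move=> d0 n0 k2 h.
apply: (@sum_dense_le _ _ (fun w => cycle_shape ks w && ~~ uniq w)
   (fun w => union_edges (reshape ks w))) => // w sw /andP[/andP[u ue] nu].
have sc := simple_cycles_reshape k2 sw u.
have fw : flatten (reshape ks w) = w by apply: reshapeKr; rewrite sw.
have gE := union_edges_graph sc; split=> //.
  by have := card_union_edges sc; rewrite fw sw.
have [v hv] : exists v, (2 < deg (union_edges (reshape ks w)) v)%N.
  apply/existsP; apply: contraR nu => /existsPn N; rewrite -fw.
  by apply: (uniq_flatten_deg2 sc gE) => // v; rewrite leqNgt.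
apply: (deg_sum_ge _ hv).
  by move=> v'; rewrite -{1}fw; exact: deg_union_ge.
have /card_gt0P[v'] : (0 < deg (union_edges (reshape ks w)) v)%N by lia.
by rewrite inE => /union_edges_mem; rewrite fw.
Qed.

(** Disjoint cycles give each of the [sumn ks] vertices degree two, with d (d - 1) choices of
    half-edges. *)
Lemma uniq_cycle_weight ks w : all (fun k => 2 < k)%N ks -> size w = sumn ks -> uniq w ->
  [/\ cycle_shape ks w, is_graph (union_edges (reshape ks w)),
      #|union_edges (reshape ks w)| = (2 * sumn ks)%N &
      degree_weight d (union_edges (reshape ks w)) = ((d * d.-1) ^ sumn ks)%N].
Proof.
move=> k2 sw uw; have fw : flatten (reshape ks w) = w by apply: reshapeKr; rewrite sw.
have u : all uniq (reshape ks w).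
  move: uw; rewrite -{1}fw; elim: (reshape ks w) => //= c ss IH.
  by rewrite cat_uniq => /and3P[-> _ /IH].
have sc := simple_cycles_reshape k2 sw u.
have uf : uniq (flatten (reshape ks w)) by rewrite fw.
have dg v := deg_union_uniq v sc uf.
split; first by rewrite /cycle_shape u uniq_flatten_edges.
- exact: union_edges_graph.
- rewrite card_deg (eq_bigr (fun v => 2 * (v \in w))%N) => [|v _]; last by rewrite dg fw.
  rewrite -big_distrr /= -sw -(card_uniqP uw) -sum1_card [in RHS]big_mkcond /=.
  by congr (_ * _)%N; apply: eq_bigr => v _; case: (v \in w).
rewrite /degree_weight (eq_bigr (fun v => if v \in w then d * d.-1 else 1)%N) => [|v _].
  by rewrite -big_mkcond prod_nat_const (card_uniqP uw) sw.
by rewrite dg fw; case: (v \in w); rewrite ?ffactn0 // ffactnS ffactn1.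
Qed.

End SparseSums.

(** * Existence of regular graphs *)

Lemma count_near_or_opposite (n h h2 : nat) (b : bool) : (h < h2)%N -> (h2 + h < n)%N ->
  (\sum_(0 <= r < n) ((0 < r < n) && [|| r <= h, n - h <= r | b && (r == h2)]) = h + h + b)%N.
Proof.
move=> h1 hn; set P := fun r : nat => (0 < r < n)%N && [|| (r <= h)%N, (n - h <= r)%N | b && (r == h2)].
rewrite (eq_bigr (fun r => nat_of_bool (P r))) //.
have seg a c v : (a <= c)%N -> (forall r, a <= r < c -> nat_of_bool (P r) = v)%N ->
    (\sum_(a <= r < c) P r = (c - a) * v)%N.
  by move=> ac h'; rewrite (eq_big_nat _ _ h') sum_nat_const_nat.
have T r : (0 < r < n)%N -> (r <= h)%N || (n - h <= r)%N -> nat_of_bool (P r) = 1%N.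
  by rewrite /P => -> /orP[->|->]; rewrite ?orbT.
have F r : (h < r)%N -> (r < n - h)%N -> r != h2 -> nat_of_bool (P r) = 0%N.
  move=> h3 h4 /negbTE h5; rewrite /P h5 andbF orbF.
  by rewrite [(r <= h)%N]leqNgt h3 [(n - h <= r)%N]leqNgt h4 andbF.
rewrite (@big_cat_nat _ _ _ 1%N) //=; last by lia.
rewrite (seg 0%N 1%N 0%N) //; last by case.
rewrite (@big_cat_nat _ _ _ h.+1) //=; last by lia.
rewrite (seg 1%N h.+1 1%N) //; last by move=> r hr; apply: T; lia.
rewrite (@big_cat_nat _ _ _ (n - h)) //=; [|lia..].
rewrite [X in (_ + (_ + (_ + X)))%N](seg (n - h)%N n 1%N); [|lia|by move=> r hr; apply: T; lia].
rewrite (@big_cat_nat _ _ _ h2) //=; [|lia..].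
rewrite (seg h.+1 h2 0%N) //; last by move=> r hr; apply: F; lia.
rewrite big_ltn; last by lia.
rewrite (seg h2.+1 (n - h)%N 0%N); [|lia|by move=> r hr; apply: F; lia].
have -> : P h2 = b.
  rewrite /P eqxx andbT (_ : (0 < h2 < n)%N); last by lia.
  by rewrite [(h2 <= h)%N]leqNgt h1 (_ : (n - h <= h2)%N = false) //; lia.
by case: b {P seg T F}; lia.
Qed.

Section Circulant.
Variables (m d : nat).
Let n := m.+1.
Hypotheses (d_gt0 : (0 < d)%N) (big : (2 * d < n)%N) (par : odd d ==> ~~ odd n).

(** A circulant graph: the neighbours are the d/2 nearest residues on either side and, for odd d,
    the antipode, for which n has to be even. *)
Let near_or_opposite (r : nat) : bool :=
  (0 < r < n)%N && [|| (r <= d./2)%N, (n - d./2 <= r)%N | odd d && (r == n./2)].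

Definition circulant : 'M[bool]_n := \matrix_(i, j) near_or_opposite (j - i : 'I_m.+1)%R.

Lemma circulant_regular : circulant \in regular_graphs n d.
Proof.
have nE : odd d -> (n = n./2 + n./2)%N.
  move=> od; move: par; rewrite od implyTb => /negbTE on.
  by have := odd_double_half n; rewrite on add0n -addnn => ->.
have := odd_double_half d; have := odd_double_half n; rewrite -!addnn => hE dE.
apply/regular_graphsP; split=> [i|i j|i].
- by rewrite mxE subrr.
- rewrite !mxE -(opprB i j); move: (i - j)%R => x; rewrite /near_or_opposite.
  have -> : nat_of_ord (- x)%R = ((n - x) %% n)%N by [].
  have [x0|xv] := posnP x; first by rewrite x0 subn0 modnn.
  have xn := ltn_ord x; rewrite modn_small; last by rewrite /n; lia.
  have -> : (0 < n - x < n)%N by rewrite /n; lia.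
  have -> : (x < n)%N by rewrite /n.
  rewrite !andTb; case: (boolP (odd d)) => od; rewrite ?andTb ?andFb.
    by have := nE od => h; apply/idP/idP => /or3P[H|H|/eqP H]; apply/or3P;
      [constructor 2|constructor 1|constructor 3|constructor 2|constructor 1|constructor 3]; lia.
  by rewrite !orbF; apply/idP/idP => /orP[H|H]; apply/orP; [right|left|right|left]; move: H; rewrite /n; lia.
have -> : #|[set j | circulant i j]%SET| = #|[set r : 'I_m.+1 | near_or_opposite r]%SET|.
  rewrite -(card_preimset _ (@addIr _ (- i)%R)); apply: eq_card => j; by rewrite !inE mxE.
rewrite -sum1_card big_mkcond /= (eq_bigr (fun r : 'I_n => nat_of_bool (near_or_opposite r))); last first.
  by move=> r _; rewrite inE; case: (near_or_opposite r).
rewrite -(big_mkord xpredT (fun r => nat_of_bool (near_or_opposite r))) /=.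
have h1 : (d./2 < n./2)%N.
  have := half_leq (ltnW big); rewrite mul2n doubleK; apply: leq_trans.
  by rewrite -divn2 ltn_Pdiv.
rewrite (count_near_or_opposite (odd d) h1); last by move: hE h1; clear; lia.
by rewrite -{4}dE addnC.
Qed.

End Circulant.

Lemma regular_graphs_gt0 n d : (0 < d)%N -> (2 * d < n)%N -> odd d ==> ~~ odd n ->
  (0 < #|regular_graphs n d|)%N.
Proof.
case: n => [//|m] d0 h p; apply/card_gt0P; exists (circulant m d).
exact: circulant_regular.
Qed.

(** The product loses at most a fraction N / n at each of its N factors, hence at most N^2 / n in
    all. *)
Lemma ffact_ge (n N : nat) : (n ^ N * n <= n ^_ N * n + N * N * n ^ N)%N.
Proof.
elim: N => [|N IH]; first by rewrite ffactn0 expn0 leq_addr.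
rewrite ffactnSr expnS.
have h2 : (n ^_ N * n <= n ^_ N * (n - N) + n ^_ N * N)%N by rewrite -mulnDr leq_mul2l; lia.
have h3 : (n ^_ N <= n ^ N)%N.
  elim: N {IH h2} => // N IH; rewrite ffactnSr expnSr; apply: leq_mul => //.
  exact: leq_subr.
move: IH h2 h3; set A := (n ^_ N)%N; set B := (n ^ N)%N; set C := (A * (n - N))%N => IH h2 h3.
have h4 := leq_mul (leqnn n) IH; have h5 := leq_mul h2 (leqnn n).
have h6 := leq_mul h3 (leqnn (N * n)%N).
have := leq_add h4 (leq_add h5 h6); nia.
Qed.

Lemma ffact_le (n N : nat) : (n ^_ N <= n ^ N)%N.
Proof.
elim: N => // N IH; rewrite ffactnSr expnSr; apply: leq_mul => //; exact: leq_subr.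
Qed.

(** * Means over random regular graphs *)

Section Means.
Variables (R : realType) (d : nat).
Hypothesis d_gt2 : (2 < d)%N.
Local Open Scope ring_scope.

Lemma regular_mean_le n (f g : 'M[bool]_n -> R) :
  (forall G, G \in regular_graphs n d -> f G <= g G) -> regular_mean d f <= regular_mean d g.
Proof.
by move=> h; rewrite /regular_mean ler_wpM2r ?invr_ge0 ?ler0n // ler_sum.
Qed.

Lemma regular_mean_nat n (f : 'M[bool]_n -> nat) :
  regular_mean d (fun G => (f G)%:R : R) =
  (\sum_(G in regular_graphs n d) f G)%:R / #|regular_graphs n d|%:R.
Proof. by rewrite /regular_mean natr_sum. Qed.

Lemma cnt_set0 n : cnt d (set0 : {set 'I_n * 'I_n}) = #|regular_graphs n d|.
Proof. by apply: eq_card => G; rewrite in_containing sub0set andbT. Qed.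

Lemma mean_le_of_nat n (f : 'M[bool]_n -> nat) C : (0 < n)%N ->
  (0 < #|regular_graphs n d|)%N ->
  ((\sum_(G in regular_graphs n d) f G) * n <= C * #|regular_graphs n d|)%N ->
  regular_mean d (fun G => (f G)%:R : R) <= C%:R / n%:R.
Proof.
move=> n0 N0 h; rewrite regular_mean_nat ler_pdivrMr ?ltr0n // mulrAC ler_pdivlMr ?ltr0n //.
by rewrite -!natrM ler_nat.
Qed.

Lemma mean_cnbw_le n k : (0 < k)%N -> (0 < #|regular_graphs n d|)%N ->
  regular_mean d (fun G : 'M[bool]_n => (tcount k (cnbw G))%:R : R) <=
  (2 * d * d * k.+1 ^ 2 * d.-1 + 4 * k.+1 + 4 * (d.+1 * d))%:R * (d%:R - 1) ^+ k.
Proof.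
move=> k0 N0; rewrite regular_mean_nat ler_pdivrMr ?ltr0n //.
have -> : d%:R - 1 = d.-1%:R :> R by rewrite -subn1 natrB // ltnW // ltnW.
rewrite -natrX -!natrM ler_nat; apply: sum_cnbw_le => //; exact: ltnW.
Qed.

Lemma mean_branching_le n k : (0 < n)%N -> (0 < k)%N -> (0 < #|regular_graphs n d|)%N ->
  (2 * (2 * k + 2 * (d.+1 * d)) <= n * d)%N ->
  regular_mean d (fun G : 'M[bool]_n => (tcount k (fun t => cnbw G t && branching t))%:R : R) <=
  ((2 * d) ^ k * k`!)%:R / n%:R.
Proof.
move=> n0 k0 N0 h; apply: mean_le_of_nat => //; rewrite -cnt_set0.
by apply: sum_branching_le => //; lia.
Qed.

(** There are n^_N disjoint placements, each of probability (d (d - 1))^N / (n d)^N up to lower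
    order, and the overlapping ones contribute O(1/n). *)
Lemma mean_falling_close ks : all (fun k => 2 < k)%N ks -> exists C : R, forall n : nat,
  (0 < n)%N -> (0 < #|regular_graphs n d|)%N ->
  (2 * (2 * sumn ks + 6 + 2 * (d.+1 * d)) <= n * d)%N ->
  `|regular_mean d (fun G : 'M[bool]_n => (falling_counts G ks)%:R) - (d%:R - 1) ^+ sumn ks| <=
  C / n%:R.
Proof.
move=> k2; set N := sumn ks.
pose K := ((2 * d) ^ N * N`!)%N; pose e := weight_error d N.
(* The errors of the probabilities of disjoint placements, of the overlapping placements, and of
   replacing n^_N by n^N. *)
exists (e%:R + K%:R + (N * N)%:R * (d%:R - 1) ^+ N) => n n0 N0 h.
have q_nat : d%:R - 1 = d.-1%:R :> R by rewrite -subn1 natrB // ltnW // ltnW.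
have q0 : 0 <= d%:R - 1 :> R by rewrite q_nat ler0n.
have nR : 0 < n%:R :> R by rewrite ltr0n.
have dR : 0 < d%:R :> R by rewrite ltr0n; lia.
have NR : 0 < #|regular_graphs n d|%:R :> R by rewrite ltr0n.
rewrite regular_mean_nat sum_falling_counts // -/N.
pose p (w : seq 'I_n) : R := (cnt d (union_edges (reshape ks w)))%:R / #|regular_graphs n d|%:R.
have -> : (\sum_(w : N.-tuple 'I_n) cycle_shape ks w * cnt d (union_edges (reshape ks w)))%:R
   / #|regular_graphs n d|%:R =
   \sum_(w : N.-tuple 'I_n | uniq w) p w +
   (\sum_(w : N.-tuple 'I_n) (cycle_shape ks w && ~~ uniq w) *
      cnt d (union_edges (reshape ks w)))%:R / #|regular_graphs n d|%:R.
  rewrite (bigID (fun w : N.-tuple 'I_n => uniq w)) /= natrD mulrDl; congr (_ + _).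
    rewrite natr_sum mulr_suml; apply: eq_bigr => w uw.
    by have [-> _ _ _] := uniq_cycle_weight d k2 (size_tuple w) uw; rewrite mul1n.
  congr (_%:R / _); rewrite [RHS](bigID (fun w : N.-tuple 'I_n => uniq w)) /=.
  rewrite [X in (_ = X + _)%N]big1 ?add0n; last by move=> w ->; rewrite andbF.
  by apply: eq_bigr => w ->; rewrite andbT.
set S2 := (_%:R / _).
have S2le : `|S2| <= K%:R / n%:R.
  rewrite ger0_norm ?divr_ge0 // /S2 ler_pdivrMr // mulrAC ler_pdivlMr // -!natrM ler_nat -cnt_set0.
  by apply: sum_overlapping_le => //; lia.
have pE w : w \in [pred w : N.-tuple 'I_n | uniq w] ->
    `|p w - (d%:R - 1) ^+ N / n%:R ^+ N| <= e%:R / (n%:R * n%:R ^+ N).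
  move=> uw; have [_ gE cE wE] := uniq_cycle_weight d k2 (size_tuple w) uw.
  have [|up lo] := cnt_asymptotic (ltnW (ltnW d_gt2)) gE cE; first by move: h; rewrite -/N; lia.
  move: up lo; rewrite wE cnt_set0 -/N -/e.
  move=> up lo; rewrite -(ler_nat R) in up; rewrite -(ler_nat R) in lo.
  rewrite !(natrM, natrD, natrX) -q_nat in up lo.
  rewrite /p; set c := (cnt _ _)%:R in up lo *; set N1 := #|_|%:R in up lo NR *.
  set q := d%:R - 1 in up lo q0 *.
  have dN : 0 < d%:R ^+ N :> R by rewrite exprn_gt0.
  have nN : 0 < n%:R ^+ N :> R by rewrite exprn_gt0.
  have d1 : 1 <= d%:R ^+ N :> R by rewrite -natrX ler1n expn_gt0 (ltnW (ltnW d_gt2)).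
  have e0 : 0 <= e%:R :> R by rewrite ler0n.
  move: up lo; rewrite !exprMn; set D := d%:R ^+ N in dN d1 *; set X := n%:R ^+ N in nN *.
  set Q := q ^+ N; set x := n%:R in nR *; set er := e%:R in e0 *; move=> up lo.
  have D0 : D != 0 by rewrite gt_eqF. have X0 : X != 0 by rewrite gt_eqF.
  have x00 : x != 0 by rewrite gt_eqF. have N10 : N1 != 0 by rewrite gt_eqF.
  have -> : c / N1 - Q / X = (c * (X * D) * x - D * Q * x * N1) / (N1 * X * D * x).
    by field; rewrite D0 X0 x00 N10.
  have den0 : 0 <= N1 * X * D * x by rewrite !mulr_ge0 // ltW.
  rewrite normrM normfV (ger0_norm den0).
  rewrite ler_pdivrMr ?mulr_gt0 //.
  have -> : er / (x * X) * (N1 * X * D * x) = er * N1 * D by field; rewrite X0 x00.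
  apply: (@le_trans _ _ (er * N1)); last by rewrite ler_peMr // mulr_ge0 // ltW.
  rewrite ler_norml; apply/andP; split; lra.
have card_u : #|[pred w : N.-tuple 'I_n | uniq w]| = (n ^_ N)%N.
  have := card_uniq_tuples N (predT : pred 'I_n); rewrite card_ord => <-.
  by apply: eq_card => w; rewrite !inE all_predT.
set q := d%:R - 1 in q0 pE *.
have nN : 0 < n%:R ^+ N :> R by rewrite exprn_gt0.
have F1 : (n ^_ N)%:R / n%:R ^+ N <= 1 :> R.
  by rewrite ler_pdivrMr // mul1r -natrX ler_nat ffact_le.
have F2 : 1 - (N * N)%:R / n%:R <= (n ^_ N)%:R / n%:R ^+ N :> R.
  rewrite ler_pdivlMr // -subr_ge0.
  rewrite (_ : _ - _ = ((n ^_ N)%:R * n%:R + (N * N)%:R * n%:R ^+ N - n%:R ^+ N * n%:R) / n%:R).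
    apply: divr_ge0; last exact: ltW.
    by rewrite subr_ge0 -natrX -!natrM -natrD ler_nat; exact: ffact_ge.
  by field; rewrite !gt_eqF.
have S1 : `|\sum_(w : N.-tuple 'I_n | uniq w) p w - (n ^_ N)%:R / n%:R ^+ N * q ^+ N| <= e%:R / n%:R.
  have -> : (n ^_ N)%:R / n%:R ^+ N * q ^+ N =
      \sum_(w : N.-tuple 'I_n | uniq w) q ^+ N / n%:R ^+ N.
    by rewrite sumr_const card_u -mulr_natl; ring.
  rewrite -sumrB; apply: le_trans (ler_norm_sum _ _ _) _.
  apply: (@le_trans _ _ (\sum_(w : N.-tuple 'I_n | uniq w) e%:R / (n%:R * n%:R ^+ N))).
    by apply: ler_sum => w uw; exact: pE.
  rewrite sumr_const card_u -[X in X <= _]mulr_natl.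
  have -> : (n ^_ N)%:R * (e%:R / (n%:R * n%:R ^+ N)) = (n ^_ N)%:R / n%:R ^+ N * (e%:R / n%:R) :> R.
    by field; rewrite !gt_eqF.
  by rewrite ler_piMl // divr_ge0.
have Q0 : 0 <= q ^+ N by rewrite exprn_ge0.
set S := \sum_(w | _) _ in S1 *; set A := (n ^_ N)%:R / _ in S1 F1 F2.
have -> : S + S2 - q ^+ N = (S - A * q ^+ N) + S2 + (A - 1) * q ^+ N by ring.
apply: le_trans (ler_normD _ _) _.
have -> : (e%:R + K%:R + (N * N)%:R * q ^+ N) / n%:R =
   (e%:R / n%:R + K%:R / n%:R) + (N * N)%:R / n%:R * q ^+ N by ring.
apply: lerD.
  apply: le_trans (ler_normD _ _) _; exact: lerD.
rewrite normrM (ger0_norm Q0) ler_wpM2r // ler_norml; apply/andP; split; last first.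
  by apply: (@le_trans _ _ 0); [rewrite subr_le0|rewrite divr_ge0].
by rewrite lerNl opprB lerBlDr -lerBlDl.
Qed.

End Means.

(** * Traces and eigenvalues *)

Section Trace.
Variables (R : realType) (n d : nat) (G : 'M[bool]_n).
Hypothesis rG : G \in regular_graphs n d.
Local Open Scope ring_scope.

Let K := #|edge_set G|.
Let ev (e : 'I_K) : 'I_n * 'I_n := enum_val e.

Lemma enum_edge e : G (ev e).1 (ev e).2.
Proof. by have := enum_valP e; rewrite inE. Qed.

Lemma sum_edges (F : 'I_n * 'I_n -> R) :
  \sum_(e < K) F (ev e) = \sum_u \sum_v (G u v)%:R * F (u, v).
Proof.
have -> : \sum_(e < K) F (ev e) = \sum_(p in edge_set G) F p by rewrite [RHS]big_enum_val.
rewrite pair_bigA /= big_mkcond /=.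
by apply: eq_bigr => -[u v] _; rewrite inE /=; case: (G u v); rewrite ?mul1r ?mul0r.
Qed.

(** Incidence of oriented edges with their starts and ends; together with the reversal these
    matrices express both the adjacency matrix and the non-backtracking matrix as products. *)
Definition start_mx : 'M[R]_(n, K) := \matrix_(w, e) ((ev e).1 == w)%:R.
Definition end_mx : 'M[R]_(n, K) := \matrix_(w, e) ((ev e).2 == w)%:R.
Definition reverse_mx : 'M[R]_K :=
  \matrix_(e, f) (((ev f).1 == (ev e).2) && ((ev f).2 == (ev e).1))%:R.
(** Hashimoto's matrix; the boolean form serves to count closed walks, [nb_mx] to take traces. *)
Definition nb_rel : 'M[bool]_K :=
  \matrix_(e, f) (((ev e).2 == (ev f).1) && ((ev f).2 != (ev e).1)).
Definition nb_mx : 'M[R]_K := map_mx (fun b : bool => b%:R) nb_rel.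

Local Notation A := (adjacency R G).
Local Notation S := start_mx.
Local Notation T := end_mx.
Local Notation J := reverse_mx.
Local Notation B := nb_mx.

Lemma sum_delta (I : finType) (i : I) (F : I -> R) : \sum_j (i == j)%:R * F j = F i.
Proof.
rewrite (bigD1 i) //= eqxx mul1r big1 ?addr0 // => j ji.
by rewrite eq_sym (negbTE ji) mul0r.
Qed.

Lemma nb_mxE : B = T^T *m S - J.
Proof.
apply/matrixP => e f; rewrite !mxE (eq_bigr (fun w => ((ev e).2 == w)%:R * ((ev f).1 == w)%:R)).
  rewrite sum_delta [(ev f).1 == _]eq_sym; case: ((ev e).2 == _) => /=; last by rewrite subr0.
  by case: ((ev f).2 == _); rewrite ?subrr ?subr0.
by move=> w _; rewrite !mxE.
Qed.

Lemma reverse_sum (F : 'I_n * 'I_n -> R) f :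
  \sum_(e < K) F (ev e) * (((ev f).1 == (ev e).2) && ((ev f).2 == (ev e).1))%:R =
  F ((ev f).2, (ev f).1).
Proof.
have /regular_graphsP[_ sG _] := rG; have Gf := enum_edge f.
rewrite (sum_edges (fun p => F p * (((ev f).1 == p.2) && ((ev f).2 == p.1))%:R)) /=.
rewrite (bigD1 (ev f).2) //= [X in _ + X]big1 ?addr0.
  rewrite (bigD1 (ev f).1) //= [X in _ + X]big1 ?addr0.
    by rewrite sG Gf !eqxx mul1r mulr1.
  by move=> v vf; rewrite [_ == v]eq_sym (negbTE vf) !mulr0.
by move=> u uf; rewrite big1 // => v _; rewrite [_ == u]eq_sym (negbTE uf) andbF !mulr0.
Qed.

Lemma start_reverse : S *m J = T.
Proof.
apply/matrixP => w f; rewrite !mxE.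
rewrite (eq_bigr (fun e => ((ev e).1 == w)%:R * (((ev f).1 == (ev e).2) && ((ev f).2 == (ev e).1))%:R)).
  by rewrite (reverse_sum (fun p => (p.1 == w)%:R)).
by move=> e _; rewrite !mxE.
Qed.

Lemma end_reverse : T *m J = S.
Proof.
apply/matrixP => w f; rewrite !mxE.
rewrite (eq_bigr (fun e => ((ev e).2 == w)%:R * (((ev f).1 == (ev e).2) && ((ev f).2 == (ev e).1))%:R)).
  by rewrite (reverse_sum (fun p => (p.2 == w)%:R)).
by move=> e _; rewrite !mxE.
Qed.

Lemma reverse_reverse : J *m J = 1%:M.
Proof.
apply/matrixP => g f; rewrite !mxE.
rewrite (eq_bigr (fun e => (((ev e).1 == (ev g).2) && ((ev e).2 == (ev g).1))%:R *
   (((ev f).1 == (ev e).2) && ((ev f).2 == (ev e).1))%:R)).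
  rewrite (reverse_sum (fun p => ((p.1 == (ev g).2) && (p.2 == (ev g).1))%:R)) /=.
  rewrite andbC -xpair_eqE -!surjective_pairing (inj_eq enum_val_inj) eq_sym.
  by case: (g == f).
by move=> e _; rewrite !mxE.
Qed.

Lemma trmx_reverse : J^T = J.
Proof.
apply/matrixP => e f; rewrite !mxE; congr (_%:R); congr nat_of_bool.
by rewrite [(ev f).1 == _]eq_sym [(ev f).2 == _]eq_sym andbC.
Qed.

Lemma trace_reverse : \tr J = 0.
Proof.
have /regular_graphsP[lG _ _] := rG.
rewrite /mxtrace big1 // => e _; rewrite mxE; case: eqP => //= h.
by have := enum_edge e; rewrite h lG.
Qed.

Lemma deg_sum u : \sum_v (G u v)%:R = d%:R :> R.
Proof.
have /regular_graphsP[_ _ dG] := rG; rewrite -(dG u) -sum1_card natr_sum.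
rewrite [RHS]big_mkcond /=; apply: eq_bigr => v _.
by rewrite inE; case: (G u v).
Qed.

Lemma start_end : S *m T^T = A.
Proof.
apply/matrixP => w w'; rewrite !mxE.
rewrite (eq_bigr (fun e => ((ev e).1 == w)%:R * ((ev e).2 == w')%:R)).
  rewrite (sum_edges (fun p => (p.1 == w)%:R * (p.2 == w')%:R)) /=.
  rewrite (bigD1 w) //= [X in _ + X]big1 ?addr0.
    rewrite (bigD1 w') //= !eqxx !mulr1 big1 ?addr0 // => v vw.
    by rewrite (negbTE vw) !mulr0.
  by move=> u uw; rewrite big1 // => v _; rewrite (negbTE uw) mul0r mulr0.
by move=> e _; rewrite !mxE.
Qed.

Lemma start_start : S *m S^T = d%:R%:M.
Proof.
apply/matrixP => w w'; rewrite !mxE.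
rewrite (eq_bigr (fun e => ((ev e).1 == w)%:R * ((ev e).1 == w')%:R)).
  rewrite (sum_edges (fun p => (p.1 == w)%:R * (p.1 == w')%:R)) /=.
  rewrite (bigD1 w) //= [X in _ + X]big1 ?addr0.
    rewrite eqxx mul1r -mulr_suml deg_sum; case: (w == w').
      by rewrite mulr1 mulr1n.
    by rewrite mulr0 mulr0n.
  by move=> u uw; rewrite big1 // => v _; rewrite (negbTE uw) mul0r mulr0.
by move=> e _; rewrite !mxE.
Qed.

Lemma end_end : T *m T^T = d%:R%:M.
Proof.
rewrite -start_reverse trmx_mul trmx_reverse mulmxA -[S *m J *m J]mulmxA.
by rewrite reverse_reverse mulmx1 start_start.
Qed.

Local Notation q := (d%:R - 1 : R).

Lemma start_nb : S *m B = A *m S - T.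
Proof. by rewrite nb_mxE mulmxBr mulmxA start_end start_reverse. Qed.

Lemma end_nb : T *m B = q *: S.
Proof.
by rewrite nb_mxE mulmxBr mulmxA end_end end_reverse mul_scalar_mx scalerBl scale1r.
Qed.

Definition nb_pow k : 'M[R]_K := iter k (fun M => M *m B) 1%:M.

Lemma nb_powS k : nb_pow k.+1 = nb_pow k *m B. Proof. by []. Qed.

Lemma nb_pow_comm k : B *m nb_pow k = nb_pow k *m B.
Proof.
by elim: k => [|k IH]; rewrite ?mulmx1 ?mul1mx // nb_powS mulmxA IH.
Qed.

(** q^(k/2) U_k(A / (2 sqrt q)), with U the Chebyshev polynomials of the second kind. *)
Fixpoint cheb2 k : 'M[R]_n :=
  if k is k'.+1 then
    if k' is k''.+1 then cheb2 k' *m A - q *: cheb2 k'' else A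
  else 1%:M.

Definition cheb2_pred k : 'M[R]_n := if k is k'.+1 then cheb2 k' else 0.

Lemma cheb2S k : cheb2 k.+1 = cheb2 k *m A - q *: cheb2_pred k.
Proof. by case: k => [|k] //=; rewrite mul1mx scaler0 subr0. Qed.

(** 2 q^(k/2) T_k(A / (2 sqrt q)), with T the Chebyshev polynomials of the first kind. *)
Fixpoint cheb1 k : 'M[R]_n :=
  if k is k'.+1 then
    if k' is k''.+1 then cheb1 k' *m A - q *: cheb1 k'' else A
  else 2%:M.

(** The identity 2 T_(k+1) = U_(k+1) - U_(k-1). *)
Lemma cheb1E k : cheb1 k.+1 = cheb2 k.+1 - q *: cheb2_pred k.
Proof.
suff: cheb1 k.+1 = cheb2 k.+1 - q *: cheb2_pred k /\
      cheb1 k.+2 = cheb2 k.+2 - q *: cheb2_pred k.+1 by case.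
elim: k => [|k [IH0 IH1]].
  rewrite /= scaler0 subr0; split=> //.
  by rewrite -[2%:M]/((1 + 1)%:M) raddfD /= scalerDr opprD addrA.
split=> //.
have -> : cheb1 k.+3 = cheb1 k.+2 *m A - q *: cheb1 k.+1 by [].
rewrite IH1 IH0 mulmxBl -scalemxAl scalerBr opprB [cheb2 k.+3]cheb2S.
have -> : cheb2_pred k.+2 = cheb2 k.+1 by [].
rewrite {3}[cheb2 k.+1]cheb2S /= scalerBr opprB.
set X := cheb2 k.+2 *m A; set Y := q *: (cheb2 k *m A); set Z := q *: (q *: cheb2_pred k).
set W := q *: cheb2 k.+1.
rewrite -!addrA; congr (_ + _); rewrite addrCA [RHS]addrCA; congr (_ + _).
by rewrite addrC.
Qed.

(** By [start_nb] and [end_nb], combinations of S and T with polynomials in A as coefficients are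
    stable under multiplication by B, and the coefficients follow the recurrence of [cheb2]. *)
Lemma start_nb_pow k : S *m nb_pow k = cheb2 k *m S - cheb2_pred k *m T.
Proof.
elim: k => [|k IH]; first by rewrite /= mulmx1 mul1mx mul0mx subr0.
rewrite nb_powS mulmxA IH mulmxBl -!mulmxA start_nb end_nb mulmxBr mulmxA.
rewrite -scalemxAr scalemxAl [cheb2 k.+1]cheb2S mulmxBl /= -scalemxAl.
by rewrite addrAC scalemxAl.
Qed.

(** Writing one factor as B = T^T S - J splits off the trace of B^(k+1) J, and there J B = S^T S - 1
    leads back to the trace of B^k. *)
Lemma trace_nb_pow_rec k : \tr (nb_pow k.+2) - \tr (nb_pow k) =
  \tr (cheb1 k.+2) - \tr (cheb1 k).
Proof.
have tA : \tr (S *m nb_pow k.+1 *m T^T) = \tr (cheb2 k.+1 *m A) - d%:R * \tr (cheb2 k).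
  rewrite start_nb_pow mulmxBl -!mulmxA start_end end_end raddfB /=.
  by rewrite mul_mx_scalar mxtraceZ.
have tB : \tr (S *m nb_pow k *m S^T) = d%:R * \tr (cheb2 k) - \tr (cheb2_pred k *m A).
  have eT : T *m S^T = A.
    have /regular_graphsP[_ sG _] := rG.
    rewrite -[LHS]trmxK trmx_mul trmxK start_end; apply/matrixP => i j.
    by rewrite !mxE sG.
  rewrite start_nb_pow mulmxBl -!mulmxA start_start eT raddfB /=.
  by rewrite mul_mx_scalar mxtraceZ.
have t2 : \tr (nb_pow k.+2) = \tr (S *m nb_pow k.+1 *m T^T) - \tr (S *m nb_pow k *m S^T) + \tr (nb_pow k).
  rewrite nb_powS [X in _ *m X]nb_mxE mulmxBr raddfB /=.
  have -> : \tr (nb_pow k.+1 *m (T^T *m S)) = \tr (S *m nb_pow k.+1 *m T^T).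
    by rewrite mulmxA mxtrace_mulC mulmxA.
  rewrite -[RHS]addrA; congr (_ + _).
  rewrite -nb_pow_comm [\tr (_ *m J)]mxtrace_mulC mulmxA [X in J *m X]nb_mxE.
  rewrite mulmxBr reverse_reverse mulmxBl mul1mx raddfB /= opprB addrC; congr (_ - _).
  rewrite mulmxA -{1}trmx_reverse -trmx_mul end_reverse -mulmxA mxtrace_mulC.
  by rewrite [RHS]mxtrace_mulC mulmxA.
rewrite t2 tA tB addrK cheb1E.
case: k {tA tB t2} => [|k].
  rewrite [cheb2 2]cheb2S /= mul0mx !mxtrace0 subr0 !raddfB /= !mxtraceZ mxtrace_scalar.
  rewrite [\tr 2%:M]mxtrace_scalar -mulr_natr; ring.
rewrite cheb1E [cheb2 k.+3]cheb2S !raddfB /= !mxtraceZ.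
have -> : \tr (cheb2 k *m A) = \tr (cheb2 k.+1) + q * \tr (cheb2_pred k).
  by rewrite cheb2S raddfB /= mxtraceZ subrK.
ring.
Qed.

(** Steps of two preserve the difference between the traces. It is n d - 2 n at k = 0 and 0 at k =
    1, which is where the constant in [Gamma] for even k comes from. *)
Lemma trace_nb_pow k : \tr (nb_pow k) = \tr (cheb1 k) + (if odd k then 0 else (d%:R - 2) * n%:R).
Proof.
suff: \tr (nb_pow k) = \tr (cheb1 k) + (if odd k then 0 else (d%:R - 2) * n%:R) /\
   \tr (nb_pow k.+1) = \tr (cheb1 k.+1) + (if odd k.+1 then 0 else (d%:R - 2) * n%:R) by case.
elim: k => [|k [IH0 IH1]].
  split.
    rewrite /= mxtrace1 mxtrace_scalar /K (card_edge_set rG) natrM -mulr_natr; ring.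
  rewrite /= addr0 mul1mx nb_mxE raddfB /= trace_reverse subr0 mxtrace_mulC start_end //.
split=> //; have /eqP := trace_nb_pow_rec k; rewrite subr_eq => /eqP ->.
rewrite IH0 /= negbK; ring.
Qed.

Lemma nb_pow_entry k e f : nb_pow k e f =
  (\sum_(p : k.-tuple 'I_K) (path (fun x y => nb_rel x y) e p && (last e p == f)))%:R.
Proof.
elim: k f => [|k IH] f.
  rewrite (big_pred1 [tuple]) /=; last by move=> t; apply/esym/eqP; exact: tuple0.
  by rewrite mxE; case: (e == f).
rewrite nb_powS mxE (big_tuple_rcons _ k (fun p => nat_of_bool (path (fun x y => nb_rel x y) e p && (last e p == f)))).
rewrite (eq_bigr (fun p : k.-tuple 'I_K =>
   (path (fun x y => nb_rel x y) e p && nb_rel (last e p) f) : nat)); last first.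
  move=> p _; rewrite (bigD1 f) //= rcons_path last_rcons eqxx andbT big1 ?addn0 //.
  by move=> x xf; rewrite last_rcons (negbTE xf) andbF.
rewrite (eq_bigr (fun g => \sum_(p : k.-tuple 'I_K)
   ((path (fun x y => nb_rel x y) e p && (last e p == g))%:R * (nb_rel g f)%:R) : R)); last first.
  by move=> g _; rewrite IH natr_sum mulr_suml mxE.
rewrite exchange_big natr_sum /=; apply: eq_bigr => p _.
case: (path _ e p) => /=; last by rewrite big1 // => g _; rewrite mul0r.
by rewrite sum_delta.
Qed.

Lemma trace_nb_pow_cycles k : (0 < k)%N ->
  \tr (nb_pow k) = (tcount k (cycle (fun x y => nb_rel x y)))%:R.
Proof.
case: k => [//|k] _; rewrite /mxtrace.
under eq_bigr do rewrite nb_pow_entry natr_sum.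
rewrite exchange_big /= /tcount natr_sum; apply: eq_bigr => p _.
case: p => -[//|x p] hp; rewrite -[tval _]/(x :: p) (cycle_path x) /=.
rewrite (bigD1 (last x p)) //= eqxx andbT big1 ?addr0 // => e ne.
by rewrite [last x p == e]eq_sym (negbTE ne) andbF.
Qed.

(** A cyclic list of oriented edges is sent to the list of their starts; consecutive vertices of a
    closed walk recover the edges. *)
Lemma cycles_nb_rel k : (0 < k)%N ->
  tcount k (cycle (fun x y => nb_rel x y)) = tcount k (cnbw G).
Proof.
move=> k0; rewrite !tcountE.
pose h (p : k.-tuple 'I_K) : k.-tuple 'I_n := [tuple of map (fun e => (ev e).1) p].
have ar (e0 : 'I_K) (p : k.-tuple 'I_K) i : around (ev e0).1 (h p) i = (ev (around e0 p i)).1.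
  rewrite /around size_map (nth_map e0) // size_tuple ltn_mod //.
have cyP (e0 : 'I_K) (p : k.-tuple 'I_K) : cycle (fun x y => nb_rel x y) p -> forall i,
   ((ev (around e0 p i)).2 = (ev (around e0 p i.+1)).1) /\
   ((ev (around e0 p i.+1)).2 != (ev (around e0 p i)).1).
  move=> /(cycle_around e0); rewrite size_tuple => /(_ k0) hc i.
  by have := hc i; rewrite mxE => /andP[/eqP].
have ev_e (e0 : 'I_K) (p : k.-tuple 'I_K) : cycle (fun x y => nb_rel x y) p -> forall i,
    ev (around e0 p i) = (around (ev e0).1 (h p) i, around (ev e0).1 (h p) i.+1).
  by move=> cp i; rewrite !ar -(cyP e0 p cp i).1 -surjective_pairing.
have hI : {in [set p : k.-tuple 'I_K | cycle (fun x y => nb_rel x y) p] &, injective h}.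
  move=> p p'; rewrite !inE => cp cp' e.
  have e0 : 'I_K by case: p {cp e} => -[|x s] //=; rewrite eq_sym (gtn_eqF k0).
  apply: val_inj; apply: (around_ext (x0 := e0)); first by rewrite !size_tuple.
  by move=> i; apply: enum_val_inj; rewrite -!/(ev _) (ev_e e0 p cp) (ev_e e0 p' cp') e.
rewrite -(card_in_imset hI); apply: eq_card => t; rewrite inE; apply/imsetP/idP.
  move=> [p]; rewrite inE => cp ->.
  have e0 : 'I_K by case: p {cp} => -[|x s] //=; rewrite eq_sym (gtn_eqF k0).
  apply/(cnbwP (ev e0).1); rewrite ?size_tuple // => i; rewrite !ar.
  have [e1 n1] := cyP e0 p cp i; have [e2 n2] := cyP e0 p cp i.+1.
  by rewrite -e1 enum_edge -e2 eq_sym.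
move=> ct; have t0 : (0 < size t)%N by rewrite size_tuple.
have x0 : 'I_n by case: t {ct t0} => -[|x s] //=; rewrite eq_sym (gtn_eqF k0).
have /(cnbwP x0 _ t0) hc := ct.
have inE' i : (around x0 t i, around x0 t i.+1) \in edge_set G by rewrite inE /=; exact: (hc i).1.
pose g i : 'I_K := enum_rank_in (inE' 0%N) (around x0 t i, around x0 t i.+1).
have gE i : ev (g i) = (around x0 t i, around x0 t i.+1) by rewrite /ev /g enum_rankK_in.
have sg : size (mkseq g k) == k by rewrite size_mkseq.
have ag i : around (g 0%N) (mkseq g k) i = g i.
  rewrite /around size_mkseq nth_mkseq ?ltn_mod //; apply: enum_val_inj.
  rewrite -!/(ev _) !gE; congr (_, _); rewrite /around size_tuple ?modn_mod //.
  by rewrite -[(i %% k).+1]addn1 modnDml addn1.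
exists (Tuple sg).
  rewrite inE; apply/(cycle_around (g 0%N)) => [|i]; first by rewrite size_mkseq.
  by rewrite !ag mxE !gE /= eqxx eq_sym (hc i).2.
apply: val_inj; rewrite /= [LHS](seq_around x0) size_tuple -map_comp.
by apply: eq_map => i /=; rewrite gE.
Qed.

Lemma count_cnbw_trace k : (0 < k)%N ->
  (tcount k (cnbw G))%:R = \tr (cheb1 k) + (if odd k then 0 else (d%:R - 2) * n%:R).
Proof. by move=> k0; rewrite -cycles_nb_rel // -trace_nb_pow_cycles // trace_nb_pow. Qed.

End Trace.

(** * Spectral side of the trace formula *)

Section Spectrum.
Variable (R : realType).
Local Open Scope ring_scope.

Fixpoint gamma_mx n (M : 'M[R]_n) k : 'M[R]_n :=
  if k is k'.+1 then
    if k' is k''.+1 then gamma_mx M k' *m M - gamma_mx M k'' else M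
  else 2%:M.

Definition gamma (x : R) k : R := 2 * (Defs.chebyshev R k).[x / 2].

Lemma gamma0 x : gamma x 0 = 2. Proof. by rewrite /gamma /= hornerC mulr1. Qed.

Lemma gamma1 x : gamma x 1 = x.
Proof. by rewrite /gamma /= hornerX mulrC divfK // pnatr_eq0. Qed.

Lemma gammaSS x k : gamma x k.+2 = x * gamma x k.+1 - gamma x k.
Proof.
rewrite /gamma [Defs.chebyshev R k.+2]/= -/(Defs.chebyshev R k.+1).
by rewrite !(hornerD, hornerN, hornerM, hornerC, hornerX); field.
Qed.

Lemma perm_eq_prod_XsubC (F : fieldType) (s t : seq F) :
  \prod_(x <- s) ('X - x%:P) = \prod_(x <- t) ('X - x%:P) -> perm_eq s t.
Proof.
move=> e; apply/allP => x _ /=; apply/eqP.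
by rewrite -!mu_prod_XsubC e.
Qed.

Lemma conj_mulmxB (F : comUnitRingType) n (U D0 D1 D : 'M[F]_n) : U \in unitmx ->
  invmx U *m D1 *m U *m (invmx U *m D *m U) - invmx U *m D0 *m U =
  invmx U *m (D1 *m D - D0) *m U.
Proof. by move=> uU; rewrite !mulmxA mulmxK // mulmxBr mulmxBl !mulmxA. Qed.

Lemma gamma_mx_conj n (M : 'M[R]_n) (U : 'M[R[i]]_n) (r : 'I_n -> R) : U \in unitmx ->
  map_mx (real_complex R) M = invmx U *m diag_mx (\row_i real_complex R (r i)) *m U ->
  forall j, map_mx (real_complex R) (gamma_mx M j) =
    invmx U *m diag_mx (\row_i real_complex R (gamma (r i) j)) *m U.
Proof.
move=> uU ME j.
suff: map_mx (real_complex R) (gamma_mx M j) =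
    invmx U *m diag_mx (\row_i real_complex R (gamma (r i) j)) *m U /\
  map_mx (real_complex R) (gamma_mx M j.+1) =
    invmx U *m diag_mx (\row_i real_complex R (gamma (r i) j.+1)) *m U by case.
have DE : diag_mx (\row_i real_complex R (gamma (r i) 1)) = diag_mx (\row_i real_complex R (r i)).
  by congr diag_mx; apply/rowP => i; rewrite !mxE gamma1.
elim: j => [|j [IH0 IH1]].
  split; last by rewrite DE -ME.
  have -> : diag_mx (\row_i real_complex R (gamma (r i) 0)) = (real_complex R 2)%:M.
    by apply/matrixP => i i'; rewrite !mxE gamma0.
  by rewrite mul_mx_scalar -scalemxAl mulVmx // scalemx1 -[gamma_mx M 0]/(2%:M) map_scalar_mx.
split; first exact: IH1.
have -> : gamma_mx M j.+2 = gamma_mx M j.+1 *m M - gamma_mx M j by [].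
rewrite map_mxB map_mxM IH0 IH1 ME.
apply: etrans (conj_mulmxB _ _ _ uU) (congr1 (fun X => invmx U *m X *m U) _).
rewrite mulmx_diag; apply/matrixP => i i'; rewrite !mxE -mulrnBl -!rmorphM -rmorphB.
by congr (_ *+ _); congr (real_complex R _); rewrite gammaSS mulrC.
Qed.

(** Over the complex numbers [M] is unitarily diagonalisable with a real diagonal, which agrees with
    [eigenvalues M] up to order because the characteristic polynomials agree; the trace does not see
    the conjugation. *)
Lemma sum_eigenvalues_gamma n (M : 'M[R]_n) k : M^T = M ->
  \sum_(l <- eigenvalues M) gamma l k = \tr (gamma_mx M k).
Proof.
move=> symM; pose A := map_mx (real_complex R) M.
have hA : A \is hermsymmx.
  apply: realsym_hermsym.
    apply/is_hermitianmxP; rewrite expr0 scale1r map_mx_id // /A.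
    by apply/matrixP => i j; rewrite !mxE -{1}symM mxE.
  apply/mxOverP => i j; by rewrite mxE; apply/complex_realP; exists (M i j).
have /orthomx_spectralP AE := hermitian_normalmx hA.
have /mxOverP Dreal := hermitian_spectral_diag_real hA.
have Punit := spectral_unit A.
pose D := spectral_diag A; pose U := spectralmx A.
pose r i := complex.Re (D 0 i).
have Dr i : D 0 i = real_complex R (r i) by rewrite RRe_real // Dreal.
have cP : char_poly M = \prod_(x <- [seq r i | i <- enum 'I_n]) ('X - x%:P).
  apply: (map_inj_poly (fmorph_inj (real_complex R))); first by rewrite rmorph0.
  rewrite map_char_poly -/A rmorph_prod big_map big_enum /=.
  have -> : char_poly A = char_poly (diag_mx D).
    rewrite /char_poly [in LHS]/char_poly_mx {1}AE.
    have -> : 'X%:M - map_mx polyC (invmx (spectralmx A) *m diag_mx D *m spectralmx A)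
       = map_mx polyC (invmx (spectralmx A)) *m char_poly_mx (diag_mx D) *m map_mx polyC (spectralmx A).
      rewrite !map_mxM /char_poly_mx mulmxBr mulmxBl; congr (_ - _).
      by rewrite mul_mx_scalar -scalemxAl -map_mxM mulVmx // map_mx1 scalemx1.
    rewrite !det_mulmx mulrAC -det_mulmx -map_mxM mulVmx // map_mx1 det1.
    by rewrite mul1r.
  rewrite char_poly_trig ?diag_mx_is_trig //; apply: eq_bigr => i _.
  by rewrite rmorphB /= map_polyX map_polyC /= mxE eqxx mulr1n Dr.
have [_ eP] := eigenvaluesP symM.
have pe : perm_eq (eigenvalues M) [seq r i | i <- enum 'I_n].
  by apply: perm_eq_prod_XsubC; rewrite -eP cP.
rewrite (perm_big _ pe) big_map big_enum /=.
have mapg := @gamma_mx_conj _ M U r Punit _ k.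
apply: (fmorph_inj (real_complex R)); rewrite rmorph_sum /= -[RHS]trace_map_mx mapg; last first.
  by rewrite -/A {1}AE; congr (_ *m diag_mx _ *m _); apply/rowP => i; rewrite mxE Dr.
rewrite mxtrace_mulC mulmxA mulmxV // mul1mx mxtrace_diag.
by apply: eq_bigr => i _; rewrite mxE.
Qed.

End Spectrum.

Section Eigenvalues.
Variables (R : realType) (n d : nat) (G : 'M[bool]_n).
Hypotheses (rG : G \in regular_graphs n d) (d_gt2 : (2 < d)%N).
Local Open Scope ring_scope.

Let sq := Num.sqrt (d%:R - 1 : R).
Let M := sq^-1 *: adjacency R G.

Lemma sqrt_deg_gt0 : 0 < sq.
Proof. by rewrite sqrtr_gt0 subr_gt0 ltr1n ltnW. Qed.

Lemma adjacency_sym : M^T = M.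
Proof.
by have /regular_graphsP[_ sG _] := rG; apply/matrixP => i j; rewrite !mxE sG.
Qed.

Lemma cheb1_gamma k : cheb1 R d G k = sq ^+ k *: gamma_mx M k.
Proof.
have s0 := sqrt_deg_gt0.
have AE : adjacency R G = sq *: M by rewrite scalerA divff ?scale1r // gt_eqF.
have s2 : sq ^+ 2 = d%:R - 1 by rewrite sqr_sqrtr // subr_ge0 ler1n ltnW // ltnW.
suff: cheb1 R d G k = sq ^+ k *: gamma_mx M k /\
      cheb1 R d G k.+1 = sq ^+ k.+1 *: gamma_mx M k.+1 by case.
elim: k => [|k [IH0 IH1]]; first by rewrite /= expr0 scale1r expr1 -AE.
split=> //.
have -> : cheb1 R d G k.+2 = cheb1 R d G k.+1 *m adjacency R G - (d%:R - 1) *: cheb1 R d G k by [].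
have -> : gamma_mx M k.+2 = gamma_mx M k.+1 *m M - gamma_mx M k by [].
rewrite IH0 IH1 [X in _ *m X]AE -scalemxAl -scalemxAr !scalerA -s2 -exprD add2n -exprSr.
by rewrite scalerBr.
Qed.

(** For even k the summand (d - 2) n of the trace, divided by (d - 1)^(k/2) and spread over the n
    eigenvalues, is the constant in [Gamma]. *)
Lemma count_cnbw_eigenvalues k : (0 < k)%N ->
  (tcount k (cnbw G))%:R = sq ^+ k * \sum_(l <- eigenvalues M) Gamma d k l.
Proof.
move=> k0; rewrite (count_cnbw_trace R rG k0) cheb1_gamma mxtraceZ.
rewrite -(sum_eigenvalues_gamma k adjacency_sym).
have sz : size (eigenvalues M) = n.
  have [_ e] := eigenvaluesP adjacency_sym.
  have := size_char_poly M; rewrite e size_prod_XsubC; by case.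
have cst (c : R) (s : seq R) : \sum_(l <- s) c = c *+ size s.
  by elim: s => [|x s IH]; rewrite ?big_nil ?mulr0n // big_cons IH mulrS.
have -> : \sum_(l <- eigenvalues M) Gamma d k l = \sum_(l <- eigenvalues M) gamma l k +
   (if odd k then 0 else (d%:R - 2) / (d%:R - 1) ^+ k./2) *+ n.
  have cn (c : R) : c *+ n = \sum_(l <- eigenvalues M) c by rewrite cst sz.
  rewrite cn -big_split /=; apply: eq_bigr => l _.
  by rewrite /Gamma (gtn_eqF k0).
rewrite mulrDr; congr (_ + _); case: (boolP (odd k)) => ok; first by rewrite mul0rn mulr0.
have q0 : d%:R - 1 != 0 :> R by rewrite gt_eqF // subr_gt0 ltr1n ltnW.
have -> : sq ^+ k = (d%:R - 1) ^+ k./2.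
  rewrite -{1}[k]odd_double_half (negbTE ok) add0n -mul2n exprM sqr_sqrtr //.
  by rewrite subr_ge0 ler1n ltnW // ltnW.
rewrite -[_ / _ *+ n]mulr_natr; field.
by rewrite expf_neq0.
Qed.

(** Compare the two sides of the eigenvalue equation at an entry of largest modulus: each row of [M]
    has d entries 1 / sqrt (d - 1). *)
Lemma eigenvalue_bound l : l \in eigenvalues M -> `|l| <= d%:R / sq.
Proof.
move=> lM; have [_ eP] := eigenvaluesP adjacency_sym.
have : root (char_poly M) l by rewrite eP root_prod_XsubC.
rewrite -eigenvalue_root_char => /eigenvalueP[v vM v0].
have s0 := sqrt_deg_gt0.
have n0 : (0 < n)%N by case: (n) v v0 {vM} => // v; rewrite thinmx0 eqxx.
have i0 : 'I_n := Ordinal n0.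
pose i := [arg max_(j > i0) `|v 0 j|]%O.
have im j : `|v 0 j| <= `|v 0 i| by rewrite /i; case: arg_maxP => // i1 _; apply.
have vi : 0 < `|v 0 i|.
  rewrite lt_neqAle normr_ge0 andbT eq_sym; apply: contra v0 => /eqP vi0; apply/eqP/rowP => j.
  by apply/eqP; rewrite mxE -normr_le0 -vi0.
have := congr1 (fun w : 'rV_n => `|w 0 i|) vM; rewrite !mxE normrM => e.
rewrite -(ler_pM2r vi) -e; apply: le_trans (ler_norm_sum _ _ _) _.
apply: (@le_trans _ _ (\sum_j `|v 0 i| * (sq^-1 * (G i j)%:R))).
  apply: ler_sum => j _; have /regular_graphsP[_ sG _] := rG.
  rewrite !mxE normrM sG [`|sq^-1 * _|]ger0_norm; last by rewrite mulr_ge0 // invr_ge0 ltW.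
  by rewrite ler_wpM2r // mulr_ge0 // invr_ge0 ltW.
rewrite -mulr_sumr -mulr_sumr (deg_sum R rG) mulrC [sq^-1 * _]mulrC.
by [].
Qed.

End Eigenvalues.

From HB Require Import structures.
From mathcomp Require Import separable cyclic measurable_realfun.
From mathcomp Require cyclotomic.
(* From here on the names shared with [finset] are those of [classical_sets]. *)
From mathcomp Require Import fintype classical_sets.
Local Open Scope classical_set_scope.
Local Open Scope complex_scope.
Local Open Scope ring_scope.

(** * Power series *)

Section ComplexLimits.
Variable R : realType.
Local Notation C := (Cplx R).
Implicit Types (z w : C) (u v : nat -> C).

(** The norm on [Cplx R] takes its values in [Cplx R]; this is the same modulus as a real number. *)
Definition cabs z : R := complex.Re `|z|.

Lemma normrC_cabs z : `|z| = (cabs z)%:C.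
Proof. by rewrite /cabs (RRe_real (normr_real z)). Qed.

Lemma cabsE z : cabs z = Num.sqrt (complex.Re z ^+ 2 + complex.Im z ^+ 2).
Proof. by apply: complexI; rewrite -normrC_cabs normc_def. Qed.

Lemma cabs_ge0 z : 0 <= cabs z.
Proof. by rewrite -ler0c -normrC_cabs normr_ge0. Qed.

Lemma cabs0 : cabs 0 = 0. Proof. by rewrite /cabs normr0. Qed.
Lemma cabs1 : cabs 1 = 1. Proof. by rewrite /cabs normr1. Qed.

Lemma cabs_eq0 z : (cabs z == 0) = (z == 0).
Proof. by rewrite -(inj_eq (@complexI R)) -normrC_cabs normr_eq0. Qed.

Lemma cabsM z w : cabs (z * w) = cabs z * cabs w.
Proof. by apply: complexI; rewrite rmorphM /= -!normrC_cabs normrM. Qed.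

Lemma cabsD z w : cabs (z + w) <= cabs z + cabs w.
Proof. by rewrite -lecR rmorphD /= -!normrC_cabs ler_normD. Qed.

Lemma cabsN z : cabs (- z) = cabs z.
Proof. by rewrite /cabs normrN. Qed.

Lemma cabsB z w : cabs (z - w) <= cabs z + cabs w.
Proof. by rewrite -(cabsN w) cabsD. Qed.

Lemma cabsC z w : cabs (z - w) = cabs (w - z).
Proof. by rewrite -cabsN opprB. Qed.

Lemma cabsX z n : cabs (z ^+ n) = cabs z ^+ n.
Proof. by elim: n => [|n IH]; rewrite ?cabs1 // !exprS cabsM IH. Qed.

Lemma cabsV z : cabs z^-1 = (cabs z)^-1.
Proof. by apply: complexI; rewrite fmorphV /= -!normrC_cabs normfV. Qed.

Lemma cabs_real (r : R) : cabs r%:C = `|r|.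
Proof. by rewrite cabsE /= expr0n addr0 sqrtr_sqr. Qed.

Lemma cabs_nat n : cabs n%:R = n%:R.
Proof. by rewrite -(rmorph_nat (real_complex R)) cabs_real normr_nat. Qed.

Lemma cabs_sum (I : Type) (r : seq I) (P : pred I) (F : I -> C) :
  cabs (\sum_(i <- r | P i) F i) <= \sum_(i <- r | P i) cabs (F i).
Proof.
elim/big_rec2: _ => [|i y x _ h]; first by rewrite cabs0.
exact: le_trans (cabsD _ _) (lerD (lexx _) h).
Qed.

Lemma Re_le_cabs z : `|complex.Re z| <= cabs z.
Proof.
by rewrite cabsE -sqrtr_sqr ler_wsqrtr // lerDl sqr_ge0.
Qed.

Lemma Im_le_cabs z : `|complex.Im z| <= cabs z.
Proof.
by rewrite cabsE -sqrtr_sqr ler_wsqrtr // lerDr sqr_ge0.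
Qed.

Lemma cabs_le_ReIm z : cabs z <= `|complex.Re z| + `|complex.Im z|.
Proof.
rewrite {1}[z]complexE.
apply: le_trans (cabsD _ _) _; rewrite cabsM !cabs_real (_ : cabs 'i%C = 1) ?mul1r //.
by rewrite cabsE /= expr0n expr1n add0r sqrtr1.
Qed.

Lemma lt_normC z (e : R) : (`|z| < e%:C) = (cabs z < e).
Proof. by rewrite normrC_cabs ltcR. Qed.

Lemma le_normC z (e : R) : (`|z| <= e%:C) = (cabs z <= e).
Proof. by rewrite normrC_cabs lecR. Qed.

(** Convergence with real tolerances; those of the filter on [Cplx R] are positive elements of that
    field. *)
Definition clim u (l : C) : Prop :=
  forall e : R, 0 < e -> exists N, forall n, (N <= n)%N -> cabs (u n - l) < e.

Lemma climP u l : (u @ \oo --> l) <-> clim u l.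
Proof.
split=> [/cvgrPdist_lt h e e0|h].
  have /h[N _ hN] : 0 < e%:C :> C by rewrite ltcR.
  by exists N => n Nn; rewrite cabsC -lt_normC; exact: hN.
apply/cvgrPdist_lt => e e0.
have eE : e = (complex.Re e)%:C by rewrite RRe_real // gtr0_real.
have [|N hN] := h (complex.Re e); first by rewrite -ltcR -eE.
by exists N => // n /= Nn; rewrite eE lt_normC cabsC hN.
Qed.

Lemma clim_ext u v l : (forall n, u n = v n) -> clim u l -> clim v l.
Proof. by move=> h cu e /cu[N hN]; exists N => n /hN; rewrite h. Qed.

Lemma clim_cst z : clim (fun=> z) z.
Proof. by move=> e e0; exists 0%N => n _; rewrite subrr cabs0. Qed.

Lemma climD u v l m : clim u l -> clim v m -> clim (fun n => u n + v n) (l + m).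
Proof.
move=> hu hv e e0; have e2 : 0 < e / 2 by rewrite divr_gt0.
have [N1 h1] := hu _ e2; have [N2 h2] := hv _ e2; exists (maxn N1 N2) => n.
rewrite geq_max => /andP[/h1 {}h1 /h2 {}h2].
have -> : u n + v n - (l + m) = (u n - l) + (v n - m) by ring.
by apply: le_lt_trans (cabsD _ _) _; rewrite (splitr e) ltrD.
Qed.

Lemma climM z u l : clim u l -> clim (fun n => z * u n) (z * l).
Proof.
move=> hu e e0; have p : 0 < cabs z + 1 by rewrite ltr_wpDl // cabs_ge0.
have [N h] := hu (e / (cabs z + 1)) ltac:(by rewrite divr_gt0).
exists N => n /h hn; rewrite -mulrBr cabsM.
apply: (@le_lt_trans _ _ ((cabs z + 1) * cabs (u n - l))).
  by rewrite ler_wpM2r ?cabs_ge0 // lerDl.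
by rewrite mulrC -ltr_pdivlMr.
Qed.

Lemma climN u l : clim u l -> clim (fun n => - u n) (- l).
Proof.
move=> /(climM (-1)) h; rewrite -mulN1r; apply: clim_ext h => n; by rewrite mulN1r.
Qed.

Lemma climB u v l m : clim u l -> clim v m -> clim (fun n => u n - v n) (l - m).
Proof. by move=> hu /climN; exact: climD. Qed.

Lemma clim_le u l (B : R) : (forall n, cabs (u n) <= B) -> clim u l -> cabs l <= B.
Proof.
move=> h hu; apply/ler_addgt0Pr => e e0; have [N /(_ N (leqnn N)) hN] := hu e e0.
have -> : l = u N - (u N - l) by ring.
by apply: le_trans (cabsB _ _) _; rewrite lerD // ltW.
Qed.

Lemma clim_le_near u l (B : R) N :
  (forall n, (N <= n)%N -> cabs (u n) <= B) -> clim u l -> cabs l <= B.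
Proof.
move=> h hu; apply: (@clim_le (fun n => u (n + N)%N)) => [n|e e0].
  by apply: h; rewrite leq_addl.
have [M hM] := hu e e0; exists M => n Mn; apply: hM.
exact: leq_trans Mn (leq_addr _ _).
Qed.

Lemma clim_unique u l m : clim u l -> clim u m -> l = m.
Proof.
move=> hl hm; apply/eqP; rewrite -subr_eq0 -cabs_eq0 eq_le cabs_ge0 andbT.
by apply: clim_le (climB hl hm) => n; rewrite subrr cabs0.
Qed.

Lemma clim_sum (I : Type) (r : seq I) (F : I -> nat -> C) (l : I -> C) :
  (forall i, clim (F i) (l i)) -> clim (fun n => \sum_(i <- r) F i n) (\sum_(i <- r) l i).
Proof.
move=> h; elim: r => [|i r IH].
  by rewrite big_nil; apply: clim_ext (clim_cst _) => n; rewrite big_nil.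
rewrite big_cons; apply: clim_ext (climD (h i) IH) => n; by rewrite big_cons.
Qed.

Lemma clim_squeeze u l (b : nat -> R) : (forall n, cabs (u n - l) <= b n) ->
  b @ \oo --> (0 : R) -> clim u l.
Proof.
move=> h /cvgrPdist_lt b0 e e0; have [N _ hN] := b0 e e0; exists N => n Nn.
apply: le_lt_trans (h n) _; have := hN n Nn; rewrite /= sub0r normrN.
by apply: le_lt_trans; rewrite ler_norm.
Qed.

(** Absolute convergence, applied to real and imaginary parts. *)
Lemma csum_ex (a : nat -> C) (B : R) : (forall n, \sum_(0 <= k < n) cabs (a k) <= B) ->
  exists l, clim (fun n => \sum_(0 <= k < n) a k) l.
Proof.
move=> hB.
have cs : cvgn (series (fun k => cabs (a k))).
  apply: nondecreasing_is_cvgn.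
    by apply: nondecreasing_series => k _ _; exact: cabs_ge0.
  by exists B => _ [n _ <-]; exact: hB.
have cpart (p : C -> R) : (forall z, `|p z| <= cabs z) -> cvgn (series (fun k => p (a k))).
  move=> hp; apply: normed_cvg; apply: series_le_cvg cs => n; rewrite ?normr_ge0 ?cabs_ge0 //.
  exact: hp.
have /cvg_ex[x hx] := cpart _ Re_le_cabs; have /cvg_ex[y hy] := cpart _ Im_le_cabs.
exists (x +i* y) => e e0; have e2 : 0 < e / 2 by rewrite divr_gt0.
move/cvgrPdist_lt: hx => /(_ _ e2)[N1 _ h1]; move/cvgrPdist_lt: hy => /(_ _ e2)[N2 _ h2].
exists (maxn N1 N2) => n; rewrite geq_max => /andP[/h1 /= {}h1 /h2 /= {}h2].
apply: le_lt_trans (cabs_le_ReIm _) _; rewrite (splitr e) ltrD //.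
  rewrite distrC in h1; apply: le_lt_trans h1; rewrite le_eqVlt; apply/orP; left; apply/eqP.
  by congr (`|_|); rewrite raddfB /= /series /= raddf_sum.
rewrite distrC in h2; apply: le_lt_trans h2; rewrite le_eqVlt; apply/orP; left; apply/eqP.
by congr (`|_|); rewrite raddfB /= /series /= raddf_sum.
Qed.

Lemma csum_tail (a : nat -> C) l (b : nat -> R) : clim (fun n => \sum_(0 <= k < n) a k) l ->
  (forall N n, (N <= n)%N -> \sum_(N <= k < n) cabs (a k) <= b N) ->
  forall N, cabs (l - \sum_(0 <= k < N) a k) <= b N.
Proof.
move=> hl hb N.
have h2 := climB hl (clim_cst (\sum_(0 <= k < N) a k)).
apply: (clim_le_near (N := N)) h2 => n Nn.
rewrite (@big_cat_nat _ _ _ N) //= addrAC subrr add0r.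
exact: le_trans (cabs_sum _ _ _) (hb _ _ Nn).
Qed.

Lemma geom_tail (t : R) N n : 0 <= t < 1 -> (N <= n)%N ->
  \sum_(N <= k < n) t ^+ k <= t ^+ N / (1 - t).
Proof.
move=> /andP[t0 t1] Nn; have p : 0 < 1 - t by rewrite subr_gt0.
rewrite ler_pdivlMr //.
have -> : (\sum_(N <= k < n) t ^+ k) * (1 - t) = t ^+ N - t ^+ n.
  elim: n Nn => [|n IH]; first by rewrite leqn0 => /eqP ->; rewrite big_geq // mul0r subrr.
  rewrite leq_eqVlt => /orP[/eqP <-|]; first by rewrite big_geq // mul0r subrr.
  rewrite ltnS => Nn; rewrite big_nat_recr //= mulrDl IH // exprS; ring.
by rewrite gerBl exprn_ge0.
Qed.

Lemma geom_cvg0 (t B : R) : 0 <= t < 1 -> (fun N => B * t ^+ N / (1 - t)) @ \oo --> (0 : R).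
Proof.
move=> /andP[t0 t1].
have -> : (fun N => B * t ^+ N / (1 - t)) = geometric (B / (1 - t)) t.
  by apply/funext => N /=; rewrite mulrAC.
by apply: cvg_geometric; rewrite ger0_norm.
Qed.

End ComplexLimits.

(** * Coefficients and recentring of power series *)

Section PowerSeries.
Variable R : realType.
Local Notation C := (Cplx R).
Implicit Types (c d : nat -> C) (z w h l : C) (r s t B M : R).

Definition ps c z l : Prop := clim (fun n => \sum_(0 <= k < n) c k * z ^+ k) l.

Lemma prim_root_ex N : (0 < N)%N -> exists w : C, N.-primitive_root w.
Proof.
move=> N0; have [rs rsE] := closed_field_poly_normal ('X^N - 1 : {poly C}).
have m1 : lead_coef ('X^N - 1 : {poly C}) = 1 by apply/eqP; rewrite -monicE monicXnsubC.
rewrite m1 scale1r in rsE.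
have Nn : N%:R != 0 :> C by rewrite pnatr_eq0 -lt0n.
have sep : separable_poly ('X^N - 1 : {poly C}) by exact: cyclotomic.separable_Xn_sub_1.
have urs : uniq rs by rewrite -separable_prod_XsubC -rsE.
have szr : size rs = N.
  by have := size_XnsubC (1 : C) N0; rewrite rsE size_prod_XsubC => -[].
have /hasP[w _ wp] : has N.-primitive_root rs.
  apply: has_prim_root => //; last by rewrite szr.
  by apply/allP => w; rewrite -root_prod_XsubC -rsE.
by exists w.
Qed.

(** Orthogonality of characters; the exponent N - m stands for -m. *)
Lemma prim_root_sum N (w : C) k m : N.-primitive_root w -> (k < N)%N -> (m < N)%N ->
  \sum_(j < N) (w ^+ j) ^+ k * (w ^+ j) ^+ (N - m) = (N%:R : C) * (k == m)%:R.
Proof.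
move=> wp kN mN; have wN : w ^+ N = 1 by exact: prim_expr_order.
pose x := w ^+ (k + (N - m)).
rewrite (eq_bigr (fun j : 'I_N => x ^+ j)) => [|j _]; last first.
  by rewrite -exprD -!exprM mulnC.
case: (eqVneq k m) => [ekm|/eqP km].
  rewrite mulr1 (eq_bigr (fun=> 1)) ?sumr_const ?card_ord // => j _.
  by rewrite /x ekm subnKC ?(ltnW mN) // wN expr1n.
have x1 : x != 1.
  rewrite /x -(prim_order_dvd wp); apply/negP => /dvdnP[a ha]; apply: km.
  have : (a = 1)%N by nia.
  by move=> a1; rewrite a1 in ha; lia.
have xN : x ^+ N = 1 by rewrite /x -exprM mulnC exprM wN expr1n.
rewrite mulr0; apply/eqP; have := subrX1 x N; rewrite xN subrr => /esym/eqP.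
by rewrite mulf_eq0 subr_eq0 (negbTE x1).
Qed.

Lemma cabs_prim_root N (w : C) : N.-primitive_root w -> cabs w = 1.
Proof.
move=> wp; have N0 := prim_order_gt0 wp.
have := congr1 (@cabs R) (prim_expr_order wp); rewrite cabsX cabs1 => /eqP.
by rewrite pexpr_eq1 ?cabs_ge0 // => /eqP.
Qed.

Lemma ps_bounded c s : (forall z, cabs z < s -> exists l, ps c z l) ->
  forall r, 0 <= r < s -> exists B, forall m, cabs (c m) * r ^+ m <= B.
Proof.
move=> h r /andP[r0 rs]; have [|l hl] := h r%:C; first by rewrite cabs_real ger0_norm.
have [N hN] := hl 1 ltr01.
(* From [N] on, a term is the difference of two partial sums within 1 of the limit; the sum covers
   the earlier terms. *)
exists (2 + \sum_(0 <= k < N) cabs (c k) * r ^+ k) => m.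
have p k : 0 <= cabs (c k) * r ^+ k by rewrite mulr_ge0 ?cabs_ge0 ?exprn_ge0.
have s0 : 0 <= \sum_(0 <= k < N) cabs (c k) * r ^+ k by rewrite sumr_ge0.
case: (leqP N m) => Nm; last first.
  rewrite (bigD1_seq m) ?mem_index_iota ?iota_uniq ?Nm //=.
  apply: (@le_trans _ _ (cabs (c m) * r ^+ m + 0)); first by rewrite addr0.
  by rewrite addrCA lerD2l addr_ge0 // sumr_ge0.
apply: (@le_trans _ _ 2); last by rewrite lerDl.
have -> : cabs (c m) * r ^+ m = cabs (c m * r%:C ^+ m).
  by rewrite cabsM cabsX cabs_real ger0_norm.
have := hN m.+1 (leqW Nm); rewrite big_nat_recr //= => h1; have h2 := hN m Nm.
set S := \sum_(0 <= i < m) _ in h1 h2.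
have -> : c m * r%:C ^+ m = (S + c m * r%:C ^+ m - l) - (S - l) by ring.
apply: le_trans (cabsB _ _) _; rewrite -[2]/(1 + 1) lerD // ltW //.
Qed.

Lemma bounded_tail c r r' B N n : (forall m, cabs (c m) * r' ^+ m <= B) -> 0 <= r < r' ->
  (N <= n)%N -> \sum_(N <= k < n) cabs (c k) * r ^+ k <= B * (r / r') ^+ N / (1 - r / r').
Proof.
move=> hB /andP[r0 rr'] Nn; have r'0 : 0 < r' by exact: le_lt_trans rr'.
have B0 : 0 <= B by apply: le_trans (hB 0%N); rewrite mulr_ge0 ?cabs_ge0 ?exprn_ge0 // ltW.
have tt : 0 <= r / r' < 1 by rewrite divr_ge0 ?(ltW r'0) //= ltr_pdivrMr // mul1r.
apply: (@le_trans _ _ (B * \sum_(N <= k < n) (r / r') ^+ k)).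
  rewrite mulr_sumr; apply: ler_sum => k _.
  rewrite (_ : r ^+ k = r' ^+ k * (r / r') ^+ k); last first.
    by rewrite -exprMn mulrC divfK // gt_eqF.
  rewrite mulrA ler_wpM2r // exprn_ge0 //; by case/andP: tt.
by rewrite -mulrA ler_wpM2l // geom_tail.
Qed.

Lemma bounded_ps c s B z : (forall m, cabs (c m) * s ^+ m <= B) -> cabs z < s ->
  exists l, ps c z l.
Proof.
move=> hB zs; apply: (@csum_ex _ _ (B * (cabs z / s) ^+ 0 / (1 - cabs z / s))) => n.
rewrite (eq_bigr (fun k => cabs (c k) * cabs z ^+ k)) => [|k _]; last by rewrite cabsM cabsX.
by apply: bounded_tail => //; rewrite cabs_ge0.
Qed.

Lemma ps_tail c z l r r' B : (forall m, cabs (c m) * r' ^+ m <= B) -> cabs z <= r < r' ->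
  ps c z l -> forall N, cabs (l - \sum_(0 <= k < N) c k * z ^+ k) <= B * (r / r') ^+ N / (1 - r / r').
Proof.
move=> hB /andP[zr rr'] hl N.
apply: (csum_tail (b := fun N => B * (r / r') ^+ N / (1 - r / r')) hl) => N' n N'n.
apply: le_trans (bounded_tail hB _ N'n); last by rewrite rr' andbT (le_trans (cabs_ge0 _) zr).
apply: ler_sum => k _; rewrite cabsM cabsX ler_wpM2l ?cabs_ge0 //.
by rewrite lerXn2r ?nnegrE ?cabs_ge0 // (le_trans (cabs_ge0 _) zr).
Qed.

Lemma bernoulli_le (x : R) m : 0 <= x <= 1 -> 1 - m%:R * x <= (1 - x) ^+ m.
Proof.
move=> /andP[x0 x1]; elim: m => [|m IH]; first by rewrite mul0r subr0 expr0.
rewrite exprS; apply: (@le_trans _ _ ((1 - x) * (1 - m%:R * x))); last first.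
  by rewrite ler_wpM2l // subr_ge0.
rewrite -subr_ge0 -natr1 (_ : _ - _ = m%:R * (x * x)); last by ring.
by rewrite mulr_ge0 // mulr_ge0.
Qed.

(** Continuity of the power at s, by Bernoulli's inequality; Cauchy's inequality is first obtained
    on smaller circles. *)
Lemma power_limit_le (a s M : R) m : 0 <= a -> 0 < s ->
  (forall r, 0 < r < s -> a * r ^+ m <= M) -> a * s ^+ m <= M.
Proof.
move=> a0 s0 h; set K := a * s ^+ m.
have K0 : 0 <= K by rewrite mulr_ge0 // exprn_ge0 // ltW.
apply/ler_addgt0Pr => e e0.
pose x := Num.min (1 / 2) (e / (K * m%:R + 1)).
have p : 0 < K * m%:R + 1 by rewrite ltr_wpDl // mulr_ge0.
have x0 : 0 < x by rewrite /x lt_min !divr_gt0.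
have x1 : x <= 1 / 2 by rewrite /x ge_min lexx.
have xe : x <= e / (K * m%:R + 1) by rewrite /x ge_min lexx orbT.
have rr : 0 < s * (1 - x) < s.
  by rewrite mulr_gt0 //= ?gtr_pMr //; lra.
have := h _ rr; rewrite exprMn mulrA -/K => h1.
have := @bernoulli_le x m ltac:(lra) => h2.
have h3 : K * (1 - m%:R * x) <= M by apply: le_trans h1; rewrite ler_wpM2l.
have h4 : K * m%:R * x <= e.
  apply: (@le_trans _ _ (K * m%:R * (e / (K * m%:R + 1)))).
    by rewrite ler_wpM2l // mulr_ge0.
  rewrite mulrA ler_pdivrMr // mulrC ler_wpM2l ?(ltW e0) //.
  by rewrite lerDl.
have -> : K = K * (1 - m%:R * x) + K * m%:R * x by ring.
exact: lerD.
Qed.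

(* Averaging over roots of unity isolates one coefficient of a partial sum. *)
Lemma cauchy_ineq c (F : C -> C) s M : 0 < s ->
  (forall z, cabs z < s -> ps c z (F z)) -> (forall z, cabs z < s -> cabs (F z) <= M) ->
  forall m, cabs (c m) * s ^+ m <= M.
Proof.
move=> s0 hF hM m; apply: power_limit_le => //; first exact: cabs_ge0.
move=> r /andP[r0 rs].
have ex z : cabs z < s -> exists l, ps c z l by move=> /hF; exists (F z).
(* The intermediate radius makes the remainders of the series geometrically small on the circle of
   radius r. *)
pose r' := (r + s) / 2; have rr' : r < r' by rewrite /r'; lra.
have r's : 0 <= r' < s by rewrite /r'; lra.
have [B hB] := ps_bounded ex r's.
have tt : 0 <= r / r' < 1.
  by rewrite divr_ge0 ?ltr_pdivrMr ?mul1r //=; lra.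
apply/ler_addgt0Pr => e e0.
have /cvgrPdist_lt/(_ e e0)[N0 _ hN0] := geom_cvg0 B tt.
pose N := maxn N0 m.+1; have NN0 : (N0 <= N)%N by exact: leq_maxl.
have mN : (m < N)%N by exact: leq_maxr.
have Npos : (0 < N)%N by exact: leq_ltn_trans mN.
have tailN : B * (r / r') ^+ N / (1 - r / r') <= e.
  by have := hN0 N NN0; rewrite /= sub0r normrN => /ltW; apply: le_trans; rewrite ler_norm.
have [w wp] := prim_root_ex Npos; have w1 := cabs_prim_root wp.
pose zj (j : 'I_N) : C := r%:C * w ^+ j.
have zr j : cabs (zj j) = r by rewrite cabsM cabsX w1 expr1n mulr1 cabs_real gtr0_norm.
pose P z := \sum_(0 <= k < N) c k * z ^+ k.
have Pb j : cabs (P (zj j)) <= M + e.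
  have -> : P (zj j) = F (zj j) - (F (zj j) - P (zj j)) by ring.
  apply: le_trans (cabsB _ _) _; apply: lerD; first by apply: hM; rewrite zr.
  apply: le_trans tailN; apply: (ps_tail hB); first by rewrite zr lexx.
  by apply: hF; rewrite zr.
(* All indices of the partial sum are below N, so that only the m-th term survives the average over
   the N-th roots of unity. *)
have key : N%:R * (c m * r%:C ^+ m) = \sum_(j < N) P (zj j) * (w ^+ j) ^+ (N - m).
  rewrite /P; under eq_bigr do rewrite mulr_suml.
  rewrite exchange_big /= big_mkord (bigD1 (Ordinal mN)) //= [X in _ + X]big1 ?addr0.
    rewrite (eq_bigr (fun j : 'I_N => (c m * r%:C ^+ m) * ((w ^+ j) ^+ m * (w ^+ j) ^+ (N - m)))).
      by rewrite -mulr_sumr (prim_root_sum wp mN mN) eqxx mulr1 mulrC.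
    by move=> j _; rewrite /zj exprMn; ring.
  move=> k km; rewrite (eq_bigr (fun j : 'I_N => (c k * r%:C ^+ k) * ((w ^+ j) ^+ k * (w ^+ j) ^+ (N - m)))).
    rewrite -mulr_sumr (prim_root_sum wp (ltn_ord k) mN).
    by rewrite (_ : (nat_of_ord k == m) = false) ?mulr0 //; apply: contraNF km => /eqP e'; apply/eqP/val_inj.
  by move=> j _; rewrite /zj exprMn; ring.
have NR : 0 < N%:R :> R by rewrite ltr0n.
rewrite -(ler_pM2l NR).
have -> : N%:R * (cabs (c m) * r ^+ m) = cabs (N%:R * (c m * r%:C ^+ m)).
  by rewrite !cabsM cabs_nat cabsX cabs_real gtr0_norm.
rewrite key; apply: le_trans (cabs_sum _ _ _) _.
apply: (@le_trans _ _ (\sum_(j < N) (M + e))).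
  by apply: ler_sum => j _; rewrite cabsM !cabsX w1 !expr1n mulr1.
by rewrite sumr_const card_ord -[X in X <= _]mulr_natl.
Qed.

(** Cauchy's inequality for the difference, with the bound 0. *)
Lemma ps_unique c d (F : C -> C) s : 0 < s ->
  (forall z, cabs z < s -> ps c z (F z)) -> (forall z, cabs z < s -> ps d z (F z)) -> c =1 d.
Proof.
move=> s0 hc hd m.
have h z : cabs z < s -> ps (fun k => c k - d k) z 0.
  move=> zs; have := climB (hc z zs) (hd z zs); rewrite subrr; apply: clim_ext => n.
  by rewrite -sumrB; apply: eq_bigr => k _; rewrite mulrBl.
have := cauchy_ineq s0 h (M := 0) _ m; rewrite cabs0 => /(_ (fun _ _ => lexx _)).
rewrite pmulr_lle0 ?exprn_gt0 // => h1; apply/eqP.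
by rewrite -subr_eq0 -cabs_eq0 eq_le h1 cabs_ge0.
Qed.

Lemma binomial_part_le (a b : R) N m : 0 <= a -> 0 <= b ->
  \sum_(0 <= k < N) a ^+ (m - k) * b ^+ k *+ 'C(m, k) <= (a + b) ^+ m.
Proof.
move=> a0 b0; have p k : 0 <= a ^+ (m - k) * b ^+ k *+ 'C(m, k).
  by rewrite mulrn_wge0 // mulr_ge0 // exprn_ge0.
apply: (@le_trans _ _ (\sum_(0 <= k < maxn N m.+1) a ^+ (m - k) * b ^+ k *+ 'C(m, k))).
  rewrite [X in _ <= X](@big_cat_nat _ _ _ N) ?leq_maxl //=.
  by rewrite lerDl sumr_ge0.
rewrite (@big_cat_nat _ _ _ m.+1) ?leq_maxr //= [X in _ + X]big1_seq ?addr0.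
  by rewrite exprDn big_mkord.
by move=> k /andP[_]; rewrite mem_index_iota => /andP[mk _]; rewrite bin_small.
Qed.

(** The k-th Taylor coefficient at z, the sum over m of C(m, k) c_m z^(m-k). *)
Definition shifted c z (d : nat -> C) : Prop := forall k,
  clim (fun n => \sum_(0 <= m < n) c m * z ^+ (m - k) *+ 'C(m, k)) (d k).

(** The double series is dominated by the sum of |c_m| (|z| + |h|)^m, which allows the binomial
    expansions to be regrouped by powers of h. *)
Lemma ps_shift c s z : (forall r, 0 <= r < s -> exists B, forall m, cabs (c m) * r ^+ m <= B) ->
  cabs z < s -> exists2 d, shifted c z d &
    forall h l, cabs z + cabs h < s -> ps c (z + h) l -> ps d h l.
Proof.
move=> hb zs.
have exd k : exists dk, clim (fun n => \sum_(0 <= m < n) c m * z ^+ (m - k) *+ 'C(m, k)) dk.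
  pose eta := (s - cabs z) / 3; have eta0 : 0 < eta by rewrite /eta; lra.
  pose r := cabs z + eta; pose r' := cabs z + eta *+ 2.
  have r0 := cabs_ge0 z.
  have [|B hB] := hb r'; first by rewrite /r' mulr2n /eta; lra.
  have rr : 0 <= r < r' by rewrite /r /r' mulr2n; lra.
  apply: (@csum_ex _ _ (eta ^- k * (B * (r / r') ^+ 0 / (1 - r / r')))) => n.
  apply: le_trans (ler_wpM2l _ (bounded_tail hB rr (leq0n n))); last by rewrite invr_ge0 exprn_ge0 // ltW.
  rewrite mulr_sumr; apply: ler_sum => m _.
  have -> : cabs (c m * z ^+ (m - k) *+ 'C(m, k)) = cabs (c m) * (cabs z ^+ (m - k) *+ 'C(m, k)).
    by rewrite -mulr_natr cabsM cabsM cabsX cabs_nat -mulrA mulr_natr.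
  rewrite mulrCA ler_wpM2l ?cabs_ge0 // mulrC ler_pdivlMr ?exprn_gt0 // mulrnAl.
  apply: le_trans (binomial_part_le k.+1 m r0 (ltW eta0)).
  rewrite big_nat_recr //= lerDr sumr_ge0 // => i _.
  by rewrite mulrn_wge0 // mulr_ge0 // exprn_ge0 // ltW.
have [d hd] := choice exd; exists d => // h l zh hl.
pose rho := cabs z + cabs h; pose r' := (rho + s) / 2.
have rho0 : 0 <= rho by rewrite addr_ge0 // cabs_ge0.
have [|B hB] := hb r'; first by rewrite /r' /rho in rho0 *; lra.
have rr : 0 <= rho < r' by rewrite rho0 /=; rewrite /r' /rho; lra.
have tt : 0 <= rho / r' < 1.
  have r'0 : 0 < r' by case/andP: rr; exact: le_lt_trans.
  by rewrite divr_ge0 ?(ltW r'0) //= ltr_pdivrMr // mul1r; case/andP: rr.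
have diff N : cabs (\sum_(0 <= k < N) d k * h ^+ k - \sum_(0 <= m < N) c m * (z + h) ^+ m)
    <= B * (rho / r') ^+ N / (1 - rho / r').
  pose T m k := c m * z ^+ (m - k) *+ 'C(m, k) * h ^+ k.
  have l1 : clim (fun n => \sum_(0 <= k < N) \sum_(0 <= m < n) T m k) (\sum_(0 <= k < N) d k * h ^+ k).
    apply: clim_sum => k; rewrite mulrC.
    apply: clim_ext (climM (h ^+ k) (hd k)) => n; rewrite mulr_sumr; apply: eq_bigr => m _.
    by rewrite /T mulrC.
  have l2 := climB l1 (clim_cst (\sum_(0 <= m < N) c m * (z + h) ^+ m)).
  apply: (clim_le_near (N := N)) l2 => n Nn.
  have -> : \sum_(0 <= k < N) \sum_(0 <= m < n) T m k - \sum_(0 <= m < N) c m * (z + h) ^+ m =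
     \sum_(N <= m < n) \sum_(0 <= k < N) T m k.
    rewrite exchange_big_nat /= (@big_cat_nat _ _ _ N 0%N n) //= addrAC.
    rewrite [X in X - _](_ : _ = \sum_(0 <= m < N) c m * (z + h) ^+ m) ?subrr ?add0r //.
    apply: eq_big_nat => m /andP[_ mN].
    rewrite (@big_cat_nat _ _ _ m.+1) //= [X in _ + X]big1_seq ?addr0.
      rewrite exprDn mulr_sumr big_mkord; apply: eq_bigr => k _.
      by rewrite /T mulrnAl mulrnAr mulrA.
    move=> k /andP[_]; rewrite mem_index_iota => /andP[mk _].
    by rewrite /T bin_small // mulr0n mul0r.
  apply: le_trans (cabs_sum _ _ _) _; apply: le_trans (bounded_tail hB rr Nn).
  apply: ler_sum => m _; apply: le_trans (cabs_sum _ _ _) _.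
  apply: (@le_trans _ _ (cabs (c m) * \sum_(0 <= k < N) cabs z ^+ (m - k) * cabs h ^+ k *+ 'C(m, k))).
    rewrite mulr_sumr; apply: ler_sum => k _.
    rewrite /T -mulr_natr !cabsM !cabsX cabs_nat -[X in _ <= _ * X]mulr_natr le_eqVlt.
    by apply/orP; left; apply/eqP; ring.
  by rewrite ler_wpM2l ?cabs_ge0 // binomial_part_le ?cabs_ge0.
have l3 : clim (fun N => \sum_(0 <= k < N) d k * h ^+ k - \sum_(0 <= m < N) c m * (z + h) ^+ m) 0.
  by apply: clim_squeeze (geom_cvg0 B tt) => N; rewrite subr0; exact: diff.
have := climD l3 hl; rewrite add0r; apply: clim_ext => n; by rewrite subrK.
Qed.

End PowerSeries.

(** * Analytic continuation to a disc *)

Section Continuation.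
Variable R : realType.
Local Notation C := (Cplx R).
Implicit Types (c d : nat -> C) (z w h l : C) (r s t B M : R).

Definition expands (f : C -> C) z0 s : Prop :=
  exists c, forall h, cabs h < s -> ps c h (f (z0 + h)).

Lemma expands_le f z0 s s' : s' <= s -> expands f z0 s -> expands f z0 s'.
Proof. by move=> ss [c hc]; exists c => h hs; apply: hc; exact: lt_le_trans ss. Qed.

Lemma expands_shift f z0 z1 s : cabs z1 < s -> expands f z0 s -> expands f (z0 + z1) (s - cabs z1).
Proof.
move=> zs [c hc].
have ex z : cabs z < s -> exists l, ps c z l by move=> /hc; exists (f (z0 + z)).
have [d _ hd] := ps_shift (ps_bounded ex) zs.
exists d => h hs; have hs' : cabs z1 + cabs h < s by lra.
apply: hd => //; rewrite -addrA; apply: hc.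
exact: le_lt_trans (cabsD _ _) hs'.
Qed.

(** The recentred coefficients satisfy |d_k(z)| eps^k <= M by Cauchy's inequality. As functions of z
    they are power series with coefficients c_(j+k) C(j+k, k), so the inequality applies once more:
    |c_m| C(m, k) rho^(m-k) eps^k <= M. Summed over k with weights 2^-k, this bounds |c_m| (rho +
    eps/2)^m by 2 M. *)
Lemma ps_extend f c rho eps M : 0 < rho -> 0 < eps -> 0 <= M ->
  (forall z, cabs z < rho + eps -> cabs (f z) <= M) ->
  (forall z, cabs z < rho -> ps c z (f z)) ->
  (forall z, cabs z < rho -> expands f z eps) ->
  forall z, cabs z < rho + eps / 2 -> ps c z (f z).
Proof.
move=> r0 e0 M0 fM hc hex.
have ex z : cabs z < rho -> exists l, ps c z l by move=> /hc; exists (f z).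
have cb := ps_bounded ex.
have coef z d : cabs z < rho -> (forall h l, cabs z + cabs h < rho -> ps c (z + h) l -> ps d h l) ->
    forall h, cabs h < eps -> ps d h (f (z + h)).
  move=> zr hd; have [e he] := hex z zr.
  have m0 : 0 < Num.min (rho - cabs z) eps by rewrite lt_min e0 subr_gt0 zr.
  have de : d =1 e.
    apply: (@ps_unique _ _ _ (fun h => f (z + h)) _ m0) => h; rewrite lt_min => /andP[h1 h2].
      have h3 : cabs z + cabs h < rho by lra.
      by apply: hd => //; apply: hc; exact: le_lt_trans (cabsD _ _) h3.
    exact: he.
  move=> h hh; apply: clim_ext (he h hh) => n; apply: eq_bigr => k _; by rewrite de.
have dbound z d : cabs z < rho -> (forall h l, cabs z + cabs h < rho -> ps c (z + h) l -> ps d h l) ->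
    forall k, cabs (d k) * eps ^+ k <= M.
  move=> zr hd; apply: (@cauchy_ineq _ _ (fun h => f (z + h))) => //; first exact: coef.
  by move=> h hh; apply: fM; apply: le_lt_trans (cabsD _ _) _; lra.
have cbound m : cabs (c m) * (rho + eps / 2) ^+ m <= M * 2.
  have step k : (k <= m)%N -> cabs (c m) * (rho ^+ (m - k) *+ 'C(m, k)) <= M / eps ^+ k.
    move=> km.
    pose ck j : C := c (j + k)%N *+ 'C(j + k, k).
    (* The zero sequence outside the disc makes the choice total. *)
    have exd z : exists d, cabs z < rho -> shifted c z d /\
        forall h l, cabs z + cabs h < rho -> ps c (z + h) l -> ps d h l.
      case: (ltP (cabs z) rho) => [zr|_]; last by exists (fun=> 0).
      by have [d h1 h2] := ps_shift cb zr; exists d.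
    have [D hD] := choice exd.
    have := @cauchy_ineq _ ck (fun z => D z k) rho (M / eps ^+ k) r0 _ _ (m - k)%N.
    have -> : cabs (ck (m - k)%N) = cabs (c m) *+ 'C(m, k).
      by rewrite /ck subnK // -mulr_natr cabsM cabs_nat mulr_natr.
    rewrite mulrnAl -mulrnAr; apply.
      move=> z zr; have [/(_ k) hs _] := hD z zr.
      move=> e e1; have [N hN] := hs e e1; exists N => n Nn.
      have := hN (n + k)%N (leq_trans Nn (leq_addr _ _)).
      congr (cabs (_ - _) < e).
      rewrite (@big_cat_nat _ _ _ k) ?leq_addl //= big1_seq ?add0r.
        rewrite -{1}[k]add0n big_addn addnK; apply: eq_bigr => j _.
        by rewrite addnK -mulrnAl.
      by move=> j /andP[_]; rewrite mem_index_iota => /andP[_ jk]; rewrite bin_small.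
    move=> z zr; have [_ hd] := hD z zr.
    by rewrite ler_pdivlMr ?exprn_gt0 //; exact: (dbound z (D z) zr hd).
  rewrite exprDn mulr_sumr.
  apply: (@le_trans _ _ (\sum_(k < m.+1) M * (1 / 2) ^+ k)).
    apply: ler_sum => k _; have km : (k <= m)%N by rewrite -ltnS.
    have := step k km; rewrite ler_pdivlMr ?exprn_gt0 // => h1.
    rewrite -mulrnAl mulrA expr_div_n mulrA.
    rewrite (_ : M * (1 / 2) ^+ k = M / 2 ^+ k); last by rewrite expr_div_n expr1n mul1r.
    by rewrite ler_wpM2r // invr_ge0 exprn_ge0.
  rewrite -mulr_sumr ler_wpM2l // -(big_mkord xpredT (fun k => (1 / 2 : R) ^+ k)).
  apply: le_trans (geom_tail _ (leq0n _)) _; first by lra.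
  by rewrite expr0 ler_pdivrMr; lra.
have r1 : rho < rho + eps / 2 by lra.
move=> z zr; case: (ltP (cabs z) rho) => [|rz]; first exact: hc.
have [l hl] := bounded_ps cbound zr.
suff -> : f z = l by [].
(* The centre [z1] lies on the segment from 0 to z, inside the disc of radius rho and within eps of
   z; the recentred series of [c] and the local expansion of [f] agree there, and both reach z. *)
pose delta := (rho + eps / 2 - cabs z) / 2.
have d0 : 0 < delta by rewrite /delta; lra.
have z0 : 0 < cabs z by lra.
pose mu := Num.max 0 (rho - delta).
have mur : mu < rho by rewrite /mu gt_max r0 /=; lra.
have mu0 : 0 <= mu by rewrite /mu le_max lexx.
have mud : rho - delta <= mu by rewrite /mu le_max lexx orbT.
pose z1 := (mu / cabs z)%:C * z.
have c1 : cabs z1 = mu.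
  by rewrite cabsM cabs_real ger0_norm ?divr_ge0 ?cabs_ge0 // divfK // gt_eqF.
have c2 : cabs (z - z1) = cabs z - mu.
  have -> : z - z1 = (1 - mu / cabs z)%:C * z by rewrite rmorphB rmorph1 mulrBl mul1r.
  rewrite cabsM cabs_real ger0_norm ?mulrBl ?mul1r ?divfK ?gt_eqF //.
  by rewrite subr_ge0 ler_pdivrMr // mul1r; lra.
have z1r : cabs z1 < rho by rewrite c1.
have cb2 : forall r, 0 <= r < rho + eps / 2 -> exists B, forall m, cabs (c m) * r ^+ m <= B.
  apply: ps_bounded => w; exact: bounded_ps cbound.
have [d _ hd] := ps_shift cb2 (lt_trans z1r r1).
have h1 : ps d (z - z1) l.
  by apply: hd; [rewrite c1 c2; lra|rewrite addrC subrK].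
have h2 : ps d (z - z1) (f z).
  have := coef z1 d z1r _ (z - z1); rewrite [z1 + _]addrC subrK; apply; last by rewrite c2; rewrite /delta in mud; lra.
  by move=> h l' hh; apply: hd; lra.
exact: clim_unique h2 h1.
Qed.

(** Compactness: an expansion of radius s at a point gives one of radius s / 2 at all points within
    s / 2 of it. *)
Lemma uniform_expands (f : C -> C) rho b : 0 < rho -> rho < b ->
  (forall z, cabs z < b -> exists2 s, 0 < s & expands f z s) ->
  exists2 eps, 0 < eps & forall z, cabs z <= rho -> expands f z eps.
Proof.
move=> r0 rb hex.
(* The compact set is a square containing the disc; [Q] demands nothing at its points outside the
   disc. *)
pose K := `[- rho, rho]%classic `*` `[- rho, rho]%classic : set (R * R).
have cK : compact K by apply: compact_setX; exact: segment_compact.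
pose Q (i : nat) (p : R * R) : Prop := cabs (p.1 +i* p.2) <= rho -> expands f (p.1 +i* p.2) (i.+1%:R^-1).
have /(_ _ (\oo : set_system nat) Q _) := (compact_near_coveringP K).1 cK.
have dist (p p' : R * R) (e : R) : ball p e p' -> cabs ((p'.1 +i* p'.2) - (p.1 +i* p.2)) < e + e.
  move=> [h1 h2]; apply: le_lt_trans (cabs_le_ReIm _) _; apply: ltrD.
    by rewrite /ball /= distrC in h1.
  by rewrite /ball /= distrC in h2.
case.
  move=> p Kp; case: (ltP (cabs (p.1 +i* p.2)) b) => pb; last first.
    have e0 : 0 < (b - rho) / 2 by rewrite divr_gt0 // subr_gt0.
    exists (ball p ((b - rho) / 2), setT).
      by split; [exact: nbhsx_ballx|exact: filterT].
    move=> [p' i] /= [bp _] pr'; exfalso.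
    have := dist _ _ _ bp; rewrite cabsC => h1.
    have : cabs (p.1 +i* p.2) <= cabs ((p.1 +i* p.2) - (p'.1 +i* p'.2)) + cabs (p'.1 +i* p'.2).
      by rewrite -{1}[p.1 +i* p.2](subrK (p'.1 +i* p'.2)) cabsD.
    by rewrite /= in pr'; lra.
  have [s s0 hs] := hex _ pb.
  have e0 : 0 < s / 4 by rewrite divr_gt0.
  have [N hN] : exists N : nat, forall i, (N <= i)%N -> i.+1%:R^-1 <= s / 2 :> R.
    have s2 : 0 < s / 2 by rewrite divr_gt0.
    have [N _ hN] := near_infty_natSinv_lt (PosNum s2).
    by exists N => i Ni; apply: ltW; exact: hN.
  exists (ball p (s / 4), [set i | (N <= i)%N]).
    by split; [exact: nbhsx_ballx|exists N].
  move=> [p' i] /= [bp Ni] _.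
  have := dist _ _ _ bp => h1.
  apply: (expands_le (hN i Ni)).
  rewrite -[p'.1 +i* p'.2](subrK (p.1 +i* p.2)) addrC.
  apply: (@expands_le _ _ (s - cabs ((p'.1 +i* p'.2) - (p.1 +i* p.2)))); first by lra.
  by apply: expands_shift => //; lra.
move=> N _ hN; exists (N.+1%:R^-1); first by rewrite invr_gt0.
move=> z zr; have := hN N (leqnn N) (complex.Re z, complex.Im z).
rewrite /Q /=; have -> : complex.Re z +i* complex.Im z = z by case: z {zr}.
apply=> //; split=> /=; rewrite in_itv /= -ler_norml.
  exact: le_trans (Re_le_cabs z) zr.
exact: le_trans (Im_le_cabs z) zr.
Qed.

(** Take the supremum of the radii on which the series at 0 represents [f]. If it were below b, a
    uniform radius of expansion on the closed disc would let [ps_extend] go beyond it. *)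
Lemma taylor_on_disc (f : C -> C) b M : 0 < b ->
  (forall z, cabs z < b -> exists2 s, 0 < s & expands f z s) ->
  (forall z, cabs z < b -> cabs (f z) <= M) ->
  exists c, (forall z, cabs z < b -> ps c z (f z)) /\ forall m, cabs (c m) * b ^+ m <= M.
Proof.
move=> b0 hex hM.
have M0 : 0 <= M by apply: le_trans (cabs_ge0 _) (hM 0 _); rewrite cabs0.
have [s s0 [c hc]] : exists2 s, 0 < s & expands f 0 s by apply: hex; rewrite cabs0.
have {}hc z : cabs z < s -> ps c z (f z) by move=> /hc; rewrite add0r.
suff hb z : cabs z < b -> ps c z (f z).
  by exists c; split=> //; exact: cauchy_ineq hM.
pose S := [set r : R | 0 < r <= b /\ forall z, cabs z < r -> ps c z (f z)].
have S0 : S (Num.min s b).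
  split; first by rewrite lt_min s0 b0 /= ge_min lexx orbT.
  by move=> w; rewrite lt_min => /andP[/hc].
have hS : has_sup S by split; [exists (Num.min s b)|exists b => r [/andP[_ ?] _]].
pose rho := sup S.
have rho0 : 0 < rho.
  by apply: lt_le_trans (ub_le_sup hS.2 S0); rewrite lt_min s0.
have hrho w : cabs w < rho -> ps c w (f w).
  by move=> /(sup_gt hS.1)[r [_ hr] wr]; exact: hr.
case: (ltP rho b) => [rb|br]; last by move=> zb; apply: hrho; exact: lt_le_trans br.
have [eps e0 he] := uniform_expands rho0 rb hex.
pose eps' := Num.min eps (b - rho).
have e'0 : 0 < eps' by rewrite lt_min e0 subr_gt0.
have e'e : eps' <= eps by rewrite ge_min lexx.
have e'b : rho + eps' <= b by rewrite -lerBrDl ge_min lexx orbT.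
have hext : forall w, cabs w < rho + eps' / 2 -> ps c w (f w).
  apply: (ps_extend rho0 e'0 M0) => //.
    by move=> w hw; apply: hM; exact: lt_le_trans e'b.
  by move=> w /ltW/he; exact: expands_le.
have : S (rho + eps' / 2) by split=> //; lra.
by move=> /(ub_le_sup hS.2); rewrite -/rho; lra.
Qed.

End Continuation.

(** * Chebyshev expansion *)

Section ChebyshevRegrouping.
Variable R : realType.
Local Notation C := (Cplx R).
Implicit Types (x y s q : R) (c : nat -> C).

(* Coefficients of [x ^+ m] in the basis [gamma x k]: multiplication by [x] sends
   [gamma x k] to [gamma x k.+1 + gamma x `|k - 1|]. *)
Fixpoint power_coef (m k : nat) : R :=
  if m is m'.+1 then
    (if k is k'.+1 then power_coef m' k' else 0) + power_coef m' k.+1 +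
    (if k == 1%N then power_coef m' 0 else 0)
  else if k == 0%N then 1 / 2 else 0.

Lemma power_coef_ge0 m k : 0 <= power_coef m k.
Proof.
elim: m k => [|m IH] k /=; first by case: ifP => // _; rewrite divr_ge0.
by rewrite !addr_ge0 //; [case: k|case: ifP].
Qed.

Lemma power_coef_small m k : (m < k)%N -> power_coef m k = 0.
Proof.
elim: m k => [|m IH] k /=; first by case: k.
case: k => [//|k]; rewrite ltnS => mk; rewrite (IH k) // (IH k.+2) ?add0r; last by apply: (leq_trans mk); lia.
by case: k mk.
Qed.

(** Stated for any sequence with the Chebyshev recurrence, since it is used for [gamma x] and for
    s^k + s^-k at x = s + 1/s. *)
Lemma power_coef_sum x (g : nat -> R) m : g 0%N = 2 -> x * g 0%N = 2 * g 1%N ->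
  (forall k, x * g k.+1 = g k.+2 + g k) ->
  x ^+ m = \sum_(0 <= k < m.+1) power_coef m k * g k.
Proof.
move=> g0 xg0 xg; elim: m => [|m IH]; first by rewrite big_nat1 /= g0 expr0; field.
rewrite exprS IH mulr_sumr big_nat_recl //= [RHS]big_nat_recl //=.
under [X in _ = _ + X]eq_bigr do rewrite !mulrDl.
rewrite 2!big_split /=.
have -> : \sum_(0 <= i < m.+1) (if i.+1 == 1%N then power_coef m 0 else 0) * g i.+1 =
          power_coef m 0 * g 1%N.
  by rewrite big_nat_recl //= big1 ?addr0 // => i _; rewrite mul0r.
have -> : \sum_(0 <= i < m.+1) power_coef m i.+2 * g i.+1 =
          \sum_(0 <= i < m) power_coef m i.+2 * g i.+1.
  by rewrite big_nat_recr //= power_coef_small // mul0r addr0.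
have -> : \sum_(0 <= i < m.+1) power_coef m i * g i.+1 = power_coef m 0 * g 1%N +
          \sum_(0 <= i < m) power_coef m i.+1 * g i.+2 by rewrite big_nat_recl.
have -> : \sum_(0 <= i < m) x * (power_coef m i.+1 * g i.+1) =
   \sum_(0 <= i < m) power_coef m i.+1 * g i.+2 + \sum_(0 <= i < m) power_coef m i.+1 * g i.
  by rewrite -big_split /=; apply: eq_bigr => i _; rewrite mulrCA xg mulrDr.
have -> : \sum_(0 <= i < m) power_coef m i.+1 * g i = power_coef m 1 * g 0%N +
    \sum_(0 <= i < m) power_coef m i.+2 * g i.+1.
  have := erefl (\sum_(0 <= i < m.+1) power_coef m i.+1 * g i).
  rewrite {1}big_nat_recr //= power_coef_small // mul0r addr0 => ->.
  by rewrite big_nat_recl.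
by rewrite mulrCA xg0; ring.
Qed.

(** Evaluate at x = s + 1/s, where the k-th basis element is s^k + s^-k, and drop s^-k; all
    coefficients are nonnegative. *)
Lemma power_coef_pow_le s N m : 0 < s ->
  \sum_(0 <= k < N) power_coef m k * s ^+ k <= (s + s^-1) ^+ m.
Proof.
move=> s0; have sn : s != 0 by rewrite gt_eqF.
have p k : 0 <= power_coef m k * s ^+ k by rewrite mulr_ge0 ?power_coef_ge0 // exprn_ge0 // ltW.
rewrite (@power_coef_sum (s + s^-1) (fun k => s ^+ k + s^-1 ^+ k)); last first.
- move=> k; have e : s * s^-1 = 1 by rewrite divff.
  have -> : s ^+ k + s^-1 ^+ k = (s * s^-1) * (s ^+ k + s^-1 ^+ k) by rewrite e mul1r.
  by rewrite !exprS; ring.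
- by rewrite !expr0 !expr1; ring.
- by rewrite !expr0.
apply: (@le_trans _ _ (\sum_(0 <= k < m.+1) power_coef m k * s ^+ k)).
  apply: (@le_trans _ _ (\sum_(0 <= k < maxn N m.+1) power_coef m k * s ^+ k)).
    rewrite [X in _ <= X](@big_cat_nat _ _ _ N) ?leq_maxl //=.
    by rewrite lerDl sumr_ge0.
  rewrite (@big_cat_nat _ _ _ m.+1) ?leq_maxr //= [X in _ + X]big1_seq ?addr0 //.
  by move=> k /andP[_]; rewrite mem_index_iota => /andP[mk _]; rewrite power_coef_small // mul0r.
apply: ler_sum => k _; rewrite ler_wpM2l ?power_coef_ge0 // lerDl exprn_ge0 //.
by rewrite invr_ge0 ltW.
Qed.

Lemma gammaN x k : gamma (- x) k = (-1) ^+ k * gamma x k.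
Proof.
suff: gamma (- x) k = (-1) ^+ k * gamma x k /\ gamma (- x) k.+1 = (-1) ^+ k.+1 * gamma x k.+1 by case.
elim: k => [|k [IH0 IH1]]; first by rewrite !gamma0 !gamma1 expr0 mul1r expr1 mulN1r.
split=> //; rewrite !gammaSS IH0 IH1 !exprS; ring.
Qed.

(** On [-2, 2] the value is 2 cos (k theta). Beyond, by parity x > 2, and the value is w^k + w'^k
    for the two roots of w^2 = x w - 1, which are at most s. *)
Lemma gamma_le s x k : 1 <= s -> `|x| <= s + s^-1 -> `|gamma x k| <= 2 * s ^+ k.
Proof.
move=> s1 xs; have s0 : 0 < s by exact: lt_le_trans s1.
have sk : 1 <= s ^+ k by exact: exprn_ege1.
case: (lerP `|x| 2) => [x2|x2].
  have c1 : -1 <= x / 2 <= 1 by move: x2; rewrite ler_norml => /andP[? ?]; apply/andP; split; lra.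
  rewrite /gamma -(acosK c1) chebyshev_cos normrM ger0_norm // ler_pM2l //.
  apply: le_trans sk; rewrite ler_norml cos_geN1 cos_le1 //.
wlog x0 : x xs x2 / 0 <= x.
  move=> h; case: (lerP 0 x) => [/h|x0]; first exact.
  have := h (- x); rewrite normrN oppr_ge0 => /(_ xs x2 (ltW x0)).
  by rewrite gammaN normrM normrX normrN1 expr1n mul1r.
rewrite ger0_norm // in xs x2.
pose r := Num.sqrt (x ^+ 2 - 4).
have r2 : r ^+ 2 = x ^+ 2 - 4 by rewrite sqr_sqrtr //; nra.
have r0 : 0 <= r by exact: sqrtr_ge0.
have rx : r <= x by nra.
have rs : r <= s - s^-1.
  have si : s * s^-1 = 1 by rewrite divff // gt_eqF.
  have i0 : 0 < s^-1 by rewrite invr_gt0.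
  have i1 : s^-1 <= 1 by nra.
  have : x ^+ 2 - 4 <= (s - s^-1) ^+ 2 by nra.
  rewrite -r2 => h; rewrite -(@ler_sqr _ r) ?nnegrE //; lra.
pose w := (x + r) / 2; pose w' := (x - r) / 2.
have w0 : 0 <= w' by rewrite /w'; lra.
have ws : w <= s by rewrite /w; lra.
have w's : w' <= s by rewrite /w'; rewrite /w in ws; lra.
have w2 : w ^+ 2 = x * w - 1 by rewrite /w; nra.
have w'2 : w' ^+ 2 = x * w' - 1 by rewrite /w'; nra.
have gE j : gamma x j = w ^+ j + w' ^+ j.
  suff: gamma x j = w ^+ j + w' ^+ j /\ gamma x j.+1 = w ^+ j.+1 + w' ^+ j.+1 by case.
  elim: j => [|j [IH0 IH1]].
    by rewrite gamma0 gamma1 !expr0 !expr1 /w /w'; split=> //; field.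
  split=> //; rewrite gammaSS IH0 IH1.
  have -> : w ^+ j.+2 = w ^+ j * w ^+ 2 by rewrite -exprD addn2.
  have -> : w' ^+ j.+2 = w' ^+ j * w' ^+ 2 by rewrite -exprD addn2.
  rewrite w2 w'2 !exprS; ring.
have ww : 0 <= w by rewrite /w; lra.
rewrite gE ger0_norm ?addr_ge0 ?exprn_ge0 // mulr2n mulrDl !mul1r.
by rewrite lerD // lerXn2r // ?nnegrE // ltW.
Qed.

(** Two points are in play: q + 1/q for the size of the coefficients, and sqrt q + 1/sqrt q for the
    values of [gamma x]. Both are below b, so the rearrangement converges absolutely. *)
Lemma chebyshev_regroup c (f : C -> C) b (M q sq : R) : 0 <= M -> 1 < sq -> sq ^+ 2 = q ->
  q + q^-1 < b -> (forall m, cabs (c m) * b ^+ m <= M) ->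
  (forall z, cabs z < b -> ps c z (f z)) ->
  exists (al : nat -> C) (A : R), (forall k, cabs (al k) * q ^+ k <= A) /\
    forall x, `|x| <= sq + sq^-1 ->
      clim (fun N => \sum_(0 <= k < N) al k * (gamma x k)%:C) (f x%:C).
Proof.
move=> M0 s1 sE qb cM hf.
have s0 : 0 < sq by exact: lt_trans s1.
have q1 : 1 < q by rewrite -sE; nra.
have q0 : 0 < q by exact: lt_trans q1.
have qi0 : 0 < q^-1 by rewrite invr_gt0.
have b0 : 0 < b by lra.
have rr : 0 <= q + q^-1 < b by rewrite qb andbT; lra.
pose B := M * ((q + q^-1) / b) ^+ 0 / (1 - (q + q^-1) / b).
have part k n : \sum_(0 <= m < n) cabs (c m * (power_coef m k)%:C) <= B / q ^+ k.
  rewrite ler_pdivlMr ?exprn_gt0 // mulr_suml.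
  apply: le_trans (bounded_tail cM rr (leq0n n)); apply: ler_sum => m _.
  rewrite cabsM cabs_real ger0_norm ?power_coef_ge0 // -mulrA ler_wpM2l ?cabs_ge0 //.
  apply: le_trans (power_coef_pow_le k.+1 m q0); rewrite big_nat_recr //= lerDr sumr_ge0 // => i _.
  by rewrite mulr_ge0 ?power_coef_ge0 // exprn_ge0 // ltW.
have exal k : exists l, clim (fun n => \sum_(0 <= m < n) c m * (power_coef m k)%:C) l.
  exact: csum_ex (part k).
have [al hal] := choice exal; exists al, B; split=> [k|x xs].
  rewrite -ler_pdivlMr ?exprn_gt0 //; apply: clim_le (hal k) => n.
  exact: le_trans (cabs_sum _ _ _) (part k n).
set X := sq + sq^-1 in xs.
have X0 : 0 <= X by exact: le_trans (normr_ge0 _) xs.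
have XB : X <= q + q^-1.
  rewrite /X -sE -exprVn.
  have : sq * sq^-1 = 1 by rewrite divff // gt_eqF.
  have : 0 < sq^-1 by rewrite invr_gt0.
  set t := sq^-1 => t0 st; have t1 : t < 1 by nra.
  nra.
have Xb : 0 <= X < b by rewrite X0 /=; lra.
have tt : 0 <= X / b < 1 by rewrite divr_ge0 ?(ltW b0) //= ltr_pdivrMr // mul1r; case/andP: Xb.
have hx : ps c x%:C (f x%:C) by apply: hf; rewrite cabs_real; case/andP: Xb; lra.
have diff N : cabs (\sum_(0 <= k < N) al k * (gamma x k)%:C - \sum_(0 <= m < N) c m * x%:C ^+ m)
    <= (2 * M) * (X / b) ^+ N / (1 - X / b).
  pose T m k : C := c m * (power_coef m k)%:C * (gamma x k)%:C.
  have l1 : clim (fun n => \sum_(0 <= k < N) \sum_(0 <= m < n) T m k)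
                 (\sum_(0 <= k < N) al k * (gamma x k)%:C).
    apply: clim_sum => k; rewrite mulrC.
    apply: clim_ext (climM (gamma x k)%:C (hal k)) => n; rewrite mulr_sumr; apply: eq_bigr => m _.
    by rewrite /T mulrC.
  have l2 := climB l1 (clim_cst (\sum_(0 <= m < N) c m * x%:C ^+ m)).
  apply: (clim_le_near (N := N)) l2 => n Nn.
  have -> : \sum_(0 <= k < N) \sum_(0 <= m < n) T m k - \sum_(0 <= m < N) c m * x%:C ^+ m =
     \sum_(N <= m < n) \sum_(0 <= k < N) T m k.
    rewrite exchange_big_nat /= (@big_cat_nat _ _ _ N 0%N n) //= addrAC.
    rewrite [X in X - _](_ : _ = \sum_(0 <= m < N) c m * x%:C ^+ m) ?subrr ?add0r //.
    apply: eq_big_nat => m /andP[_ mN].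
    rewrite (@big_cat_nat _ _ _ m.+1) //= [X in _ + X]big1_seq ?addr0.
      rewrite -rmorphXn /= (@power_coef_sum x (gamma x) m (gamma0 x)).
      - by rewrite rmorph_sum mulr_sumr; apply: eq_bigr => k _; rewrite /T -mulrA -rmorphM.
      - by rewrite gamma0 gamma1 mulrC.
      - by move=> k; rewrite gammaSS subrK.
    move=> k /andP[_]; rewrite mem_index_iota => /andP[mk _].
    by rewrite /T power_coef_small // mulr0 mul0r.
  apply: le_trans (cabs_sum _ _ _) _.
  have -> : 2 * M * (X / b) ^+ N / (1 - X / b) = 2 * (M * (X / b) ^+ N / (1 - X / b)).
    by rewrite !mulrA.
  apply: le_trans (ler_wpM2l _ (bounded_tail cM Xb Nn)) => //.
  rewrite mulr_sumr; apply: ler_sum => m _; apply: le_trans (cabs_sum _ _ _) _.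
  apply: (@le_trans _ _ (2 * (cabs (c m) * \sum_(0 <= k < N) power_coef m k * sq ^+ k))).
    rewrite mulrCA mulr_sumr mulr_sumr; apply: ler_sum => k _.
    rewrite /T !cabsM !cabs_real (ger0_norm (power_coef_ge0 _ _)) -mulrA ler_wpM2l ?cabs_ge0 //.
    rewrite mulrCA ler_wpM2l ?power_coef_ge0 // gamma_le // ltW //.
  by rewrite ler_wpM2l // ler_wpM2l ?cabs_ge0 // power_coef_pow_le.
have l3 : clim (fun N => \sum_(0 <= k < N) al k * (gamma x k)%:C - \sum_(0 <= m < N) c m * x%:C ^+ m) 0.
  by apply: clim_squeeze (geom_cvg0 (2 * M) tt) => N; rewrite subr0; exact: diff.
have := climD l3 hx; rewrite add0r; apply: clim_ext => n; by rewrite subrK.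
Qed.

(** The semiaxes are rho + 1/(4 rho) and rho - 1/(4 rho). Dividing the coordinates by them turns the
    ellipse into the unit circle and sends the disc of the smaller semiaxis into the unit disc. *)
Lemma disc_in_ellipse (rho : R) (z : C) : 1 < 2 * rho -> cabs z < rho - (4 * rho)^-1 ->
  inside_bernstein_ellipse (2 * rho) z.
Proof.
move=> r1; have r0 : 0 < rho by lra.
set i4 := (4 * rho)^-1 => zb.
have r4 : rho * (4 * i4) = 1 by rewrite mulrA [rho * 4]mulrC divff // gt_eqF // mulr_gt0.
have i0 : 0 < i4 by rewrite invr_gt0 mulr_gt0.
pose A := rho + i4; pose B := rho - i4.
have B0 : 0 < B by exact: le_lt_trans (cabs_ge0 _) zb.
have AB : B <= A by rewrite /A /B; lra.
have A0 : 0 < A by exact: lt_le_trans AB.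
case: z zb => x y zb; pose u := x / A; pose v := y / B.
have xE : x = u * A by rewrite /u divfK // gt_eqF.
have yE : y = v * B by rewrite /v divfK // gt_eqF.
pose t := Num.sqrt (u ^+ 2 + v ^+ 2).
have t0 : 0 <= t by exact: sqrtr_ge0.
have t2 : t ^+ 2 = u ^+ 2 + v ^+ 2 by rewrite sqr_sqrtr // addr_ge0 // sqr_ge0.
have t1 : t < 1.
  move: zb; rewrite cabsE /= => zb.
  rewrite -(ltr_pM2r B0) mul1r; apply: le_lt_trans zb.
  rewrite -[t * B]ger0_norm ?mulr_ge0 ?(ltW B0) // -sqrtr_sqr ler_wsqrtr //.
  rewrite exprMn t2 mulrDl -!exprMn -yE lerD2r [X in _ <= X ^+ 2]xE ![(u * _) ^+ 2]exprMn ler_wpM2l ?sqr_ge0 //.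
  by rewrite lerXn2r // nnegrE ltW.
have circ (a c : R) : a ^+ 2 + c ^+ 2 = 1 ->
    exists2 w : C, bernstein_ellipse (2 * rho) w & w = (A * a) +i* (B * c).
  move=> ac; pose e : C := a +i* c; pose e' : C := a -i* c.
  have ee : e * e' = 1.
    by apply/eqP; rewrite eq_complex /=; apply/andP; split; apply/eqP; [rewrite -ac|]; ring.
  exists ((A * a) +i* (B * c)) => //; exists ((2 * rho)%:C * e).
    rewrite /= normrC_cabs; congr (_%:C).
    by rewrite cabsM cabs_real cabsE /= ac sqrtr1 mulr1 gtr0_norm // mulr_gt0.
  have en : e != 0 by apply: contra_eq_neq ee => ->; rewrite mul0r eq_sym oner_eq0.
  have rn : (2 * rho)%:C != 0 :> C by rewrite fmorph_eq0 gt_eqF // mulr_gt0.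
  have -> : ((2 * rho)%:C * e)^-1 = ((2 * i4)%:C * e').
    apply: (mulfI (x := (2 * rho)%:C * e)); first by rewrite mulf_neq0.
    rewrite divff ?mulf_neq0 // mulrACA ee mulr1 -rmorphM /=.
    have -> : 2 * rho * (2 * i4) = 1 by rewrite -[RHS]r4; ring.
    by rewrite rmorph1.
  apply: (mulIf (x := 2)); first by rewrite pnatr_eq0.
  rewrite divfK ?pnatr_eq0 // mulr_natr.
  apply/eqP; rewrite mulr2n eq_complex /=; apply/andP; split; apply/eqP; rewrite /A /B; ring.
(* At the centre any point of the ellipse does, with factor 0. *)
case: (eqVneq t 0) => [t00|tn].
  have [w hw _] := circ 1 0 ltac:(ring).
  exists 0, w => //; rewrite lexx ltr01; split=> //.
  have : u ^+ 2 + v ^+ 2 = 0 by rewrite -t2 t00 expr0n.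
  move=> /eqP; rewrite paddr_eq0 ?sqr_ge0 // !sqrf_eq0 => /andP[/eqP u0 /eqP v0].
  by rewrite xE yE u0 v0 !mul0r.
have [|w hw wE] := circ (u / t) (v / t).
  by rewrite ![(_ / t) ^+ 2]expr_div_n -mulrDl -t2 divff // sqrf_eq0.
exists t, w => //; rewrite t0 t1; split=> //; rewrite wE.
have divt (p c : R) : t * (p * (c / t)) = c * p by rewrite mulrCA [t * _]mulrC divfK // mulrC.
apply/eqP; rewrite eq_complex /= !mul0r subr0 addr0 !divt -xE -yE.
by rewrite !eqxx.
Qed.

(** rho is at least q^(3/2) >= 7/5 q, because q >= 2; the remaining 2/5 q exceeds 1/q + 1/(4
    rho). *)
Lemma ellipse_radius (d : nat) (alpha : R) : (3 <= d)%N -> 3 / 2 < alpha ->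
  let rho := (d%:R - 1) `^ alpha in let q := d%:R - 1 in
  1 < 2 * rho /\ q + q^-1 < rho - (4 * rho)^-1.
Proof.
move=> d3 al rho q.
have q2 : 2 <= q by move: d3; rewrite -(ler_nat R) /q; lra.
have q0 : 0 < q by exact: lt_le_trans q2.
pose s := Num.sqrt q.
have s2 : s ^+ 2 = q by rewrite sqr_sqrtr // ltW.
have s0 : 0 <= s by exact: sqrtr_ge0.
have s1 : 7 / 5 <= s by nra.
have rq : 7 / 5 * q <= rho.
  apply: (@le_trans _ _ (q `^ (3 / 2))); last by apply: ler_powR; [lra|exact: ltW].
  have -> : (3 / 2 : R) = 1 + 2^-1 by field.
  rewrite powRD; last by apply/implyP => _; rewrite gt_eqF.
  by rewrite powRr1 ?(ltW q0) // powR12_sqrt ?(ltW q0) // mulrC ler_wpM2l // ltW.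
have r0 : 0 < rho by lra.
split; first lra.
have i1 : (4 * rho)^-1 <= 1 / 8.
  by rewrite mul1r lef_pV2 ?posrE ?mulr_gt0 //; lra.
have i2 : q^-1 <= 1 / 2 by rewrite mul1r lef_pV2 ?posrE.
lra.
Qed.

(** [Gamma] differs from [gamma] by a constant for each even k > 0; these constants, weighted by the
    coefficients, sum to [ka], which the coefficient of [Gamma d 0] absorbs. As [gamma x 0] is 2,
    that coefficient becomes [2 * al' 0 - ka], and the decay is stated for k > 0. *)
Lemma gamma_expansion (d : nat) (alpha : R) (f : C -> C) : (3 <= d)%N -> 3 / 2 < alpha ->
  let rho : R := (d%:R - 1) `^ alpha in
  analytic_on (inside_bernstein_ellipse (2 * rho)) f ->
  (exists M : R, forall z, inside_bernstein_ellipse (2 * rho) z -> `|f z| <= M%:C) ->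
  exists (a : nat -> C) (A : R), (forall k, (0 < k)%N -> cabs (a k) * (d%:R - 1) ^+ k <= A) /\
    forall x, `|x| <= d%:R / Num.sqrt (d%:R - 1) ->
      clim (fun N => \sum_(0 <= k < N) a k * (Gamma d k x)%:C) (f x%:C).
Proof.
move=> d3 al rho fa [M fM]; have [r1 qb] := ellipse_radius d3 al.
rewrite -/rho in r1 qb; set q : R := d%:R - 1 in qb *.
have q2 : 2 <= q by move: d3; rewrite -(ler_nat R) /q; lra.
have q0 : 0 < q by exact: lt_le_trans q2.
set b := rho - _ in qb.
have qi0 : 0 < q^-1 by rewrite invr_gt0.
have b0 : 0 < b by lra.
have hex z : cabs z < b -> exists2 s : R, 0 < s & expands f z s.
  move=> /(disc_in_ellipse r1)/fa[c [r [r0 hc]]]; exists r => //; exists c => h hr.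
  have /climP : (\sum_(0 <= k < N) c k * ((z + h) - z) ^+ k) @[N --> \oo] --> f (z + h).
    by apply: hc; rewrite addrC addKr lt_normC.
  by rewrite addrC addKr.
have hM z : cabs z < b -> cabs (f z) <= M.
  by move=> /(disc_in_ellipse r1)/fM; rewrite le_normC.
have M0 : 0 <= M by apply: le_trans (cabs_ge0 _) (hM 0 _); rewrite cabs0.
have [c [hc cM]] := taylor_on_disc b0 hex hM.
pose sq := Num.sqrt q.
have sE : sq ^+ 2 = q by rewrite sqr_sqrtr // ltW.
have s0 : 0 <= sq by exact: sqrtr_ge0.
have s1 : 1 < sq by nra.
have sn : sq != 0 by rewrite gt_eqF //; lra.
have [al' [A [hA hal]]] := chebyshev_regroup M0 s1 sE qb cM hc.
pose cst k : R := if odd k then 0 else (d%:R - 2) / (d%:R - 1) ^+ k./2.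
have cst_le k : `|cst k| <= q.
  rewrite /cst; case: ifP => _; first by rewrite normr0 ltW.
  rewrite -/q ger0_norm; last first.
    rewrite divr_ge0 ?exprn_ge0 //; last exact: ltW.
    by move: q2; rewrite /q; lra.
  rewrite ler_pdivrMr ?exprn_gt0 //; apply: (@le_trans _ _ q); first by rewrite /q; lra.
  by rewrite ler_pMr // exprn_ege1 //; lra.
pose e k : C := if k == 0%N then 0 else al' k * (cst k)%:C.
have [ka hka] : exists l, clim (fun n => \sum_(0 <= k < n) e k) l.
  have tt : 0 <= q^-1 < 1 by rewrite ltW //= invf_lt1 //; lra.
  have A0 : 0 <= A by apply: le_trans (hA 0%N); rewrite mulr_ge0 ?cabs_ge0 // exprn_ge0 // ltW.
  apply: (@csum_ex _ _ (q * A * (q^-1 ^+ 0 / (1 - q^-1)))) => n.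
  apply: le_trans (ler_wpM2l _ (geom_tail tt (leq0n n))); last by rewrite mulr_ge0 // ltW.
  rewrite mulr_sumr; apply: ler_sum => k _; rewrite /e.
  have p : 0 <= q * A * q^-1 ^+ k by rewrite !mulr_ge0 ?exprn_ge0 // ltW.
  case: ifP => _; first by rewrite cabs0.
  rewrite cabsM cabs_real -mulrA mulrC ler_pM ?normr_ge0 ?cabs_ge0 //.
  by rewrite exprVn ler_pdivlMr ?exprn_gt0.
exists (fun k => if k == 0%N then 2 * al' 0%N - ka else al' k), A; split.
  by move=> k k0; rewrite (gtn_eqF k0).
move=> x xs; have {}xs : `|x| <= sq + sq^-1.
  rewrite (_ : sq + sq^-1 = d%:R / sq) //.
  have dE : d%:R = sq ^+ 2 + 1 by rewrite sE /q subrK.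
  by rewrite dE; field.
have h1 := climD (climD (hal x xs) hka) (clim_cst (- ka)).
rewrite addrK in h1.
move=> eps e0; have [N hN] := h1 eps e0; exists N.+1 => -[//|n]; rewrite ltnS => Nn.
have := hN n.+1 (leqW Nn); congr (cabs (_ - _) < _).
rewrite -big_split /= big_nat_recl //= [RHS]big_nat_recl //= gamma0 addr0.
rewrite (_ : Gamma d 0 x = 1) // [X in _ + X + _](_ : _ = \sum_(0 <= i < n) al' i.+1 * (Gamma d i.+1 x)%:C).
  rewrite rmorph1 mulr1 -(rmorph_nat (real_complex R)) /= [_ * al' _]mulrC addrAC; ring.
by apply: eq_bigr => i _; rewrite -mulrDr -rmorphD.
Qed.

End ChebyshevRegrouping.

(** * Random sequences *)

Section ComplexMeasurability.
Context {R : realType} {disp : measure_display} {T : measurableType disp}.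
Local Notation C := (Cplx R).

Lemma open_squareP (U : set C) (z : C) : open U -> U z -> exists2 e : R, 0 < e &
  forall w : C, `|complex.Re w - complex.Re z| < e -> `|complex.Im w - complex.Im z| < e -> U w.
Proof.
move=> oU Uz; have : nbhs z U by exact: open_nbhs_nbhs.
move=> /nbhs_ballP[e /= e0 he].
have eE : e = (complex.Re e)%:C by rewrite RRe_real // gtr0_real.
have r0 : 0 < complex.Re e by rewrite -ltcR -eE.
exists (complex.Re e / 2); first by rewrite divr_gt0.
move=> w h1 h2; apply: he; rewrite /ball /= eE lt_normC cabsC.
by apply: le_lt_trans (cabs_le_ReIm _) _; rewrite (splitr (complex.Re e)) !raddfB ltrD.
Qed.

(** Every open set is a countable union of squares with rational centre and size, and squares are
    pulled back through real and imaginary parts. *)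
Lemma complex_RV_ReIm (Y : T -> C) :
  measurable_fun [set: T] (fun t => complex.Re (Y t)) ->
  measurable_fun [set: T] (fun t => complex.Im (Y t)) -> complex_RV Y.
Proof.
move=> mR mI B bB.
have sq (a b r : R) : measurable (Y @^-1` [set w | `|complex.Re w - a| < r /\ `|complex.Im w - b| < r]).
  have -> : Y @^-1` [set w | `|complex.Re w - a| < r /\ `|complex.Im w - b| < r] =
     ([set: T] `&` (fun t => complex.Re (Y t)) @^-1` `]a - r, a + r[%classic) `&`
     ([set: T] `&` (fun t => complex.Im (Y t)) @^-1` `]b - r, b + r[%classic).
    apply/seteqP; split=> t /=; rewrite !in_itv /= !ltr_distl.
      by move=> [-> ->].
    by move=> [[_ ->] [_ ->]].
  by apply: measurableI; [apply: mR|apply: mI].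
pose S := [set B : set C | measurable (Y @^-1` B)].
suff : <<s [set U : set C | open U] >> `<=` S by apply.
apply: smallest_sub.
  split => [|A|A h].
  - by rewrite /S /= preimage_set0.
  - by rewrite /S /= setTD => mA; rewrite preimage_setC; exact: measurableC.
  - by rewrite /S /= preimage_bigcup; apply: bigcup_measurable => k _; exact: h.
move=> U oU; rewrite /S /=.
pose Q (p : rat * rat * rat) : set C :=
  [set w | `|complex.Re w - ratr p.1.1| < ratr p.2 /\ `|complex.Im w - ratr p.1.2| < ratr p.2].
have -> : U = \bigcup_n (if unpickle n is Some p then if `[< Q p `<=` U >] then Q p else set0 else set0).
  apply/seteqP; split=> [z Uz|z [n _]]; last first.
    by case: unpickle => // p; case: asboolP => // h; exact: h.
  have [e e0 he] := open_squareP oU Uz.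
  have e4 : 0 < e / 4 by rewrite divr_gt0.
  have [r] : exists r : rat, e / 4 < ratr r < e / 2.
    by have := @rat_in_itvoo R (e / 4) (e / 2) ltac:(lra) => -[r]; rewrite in_itv /=; exists r.
  move=> /andP[r1 r2].
  have near_rat (x : R) : exists p : rat, `|x - ratr p| < e / 4.
    have [p] := @rat_in_itvoo R (x - e / 4) (x + e / 4) ltac:(lra).
    by rewrite in_itv /= => hp; exists p; rewrite distrC ltr_distl.
  have [a ha] := near_rat (complex.Re z); have [b hb] := near_rat (complex.Im z).
  have E : unpickle (pickle ((a, b), r)) = Some ((a, b), r) by exact: pickleK.
  exists (pickle ((a, b), r)); [exact: I|rewrite E {E}].
  have QU : Q (a, b, r) `<=` U.
    move=> w /= [h1 h2]; apply: he.
      have -> : complex.Re w - complex.Re z = (complex.Re w - ratr a) - (complex.Re z - ratr a) by ring.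
      apply: le_lt_trans (ler_normB _ _) _; lra.
    have -> : complex.Im w - complex.Im z = (complex.Im w - ratr b) - (complex.Im z - ratr b) by ring.
    apply: le_lt_trans (ler_normB _ _) _; lra.
  by case: asboolP => // _; split; [exact: lt_trans r1|exact: lt_trans r1].
rewrite preimage_bigcup; apply: bigcup_measurable => n _.
case: (unpickle n) => [p|]; last by rewrite preimage_set0.
by case: asboolP => _; [exact: sq|rewrite preimage_set0].
Qed.

Lemma complex_RV_comp (Y : T -> C) (g : C -> R) : complex_RV Y -> continuous g ->
  measurable_fun [set: T] (fun t => g (Y t)).
Proof.
move=> mY /continuousP cg; apply: (measurability _ (RGenOpens.measurableE R)).
move=> _ [_ [a [b ->] <-]]; rewrite setTI.
apply: (mY (g @^-1` `]a, b[%classic)); apply: sub_sigma_algebra; apply: cg; exact: interval_open.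
Qed.

End ComplexMeasurability.

(** * Laws on sequences of integers *)

Section SequenceSpace.

Definition cyl (K : nat) (c : nat -> nat) : set (nat -> nat) :=
  [set v | forall j, (j < K)%N -> v j = c j].

(** Two cylinders are nested or disjoint; the empty set makes the class stable under
    intersection. *)
Definition cyls : set (set (nat -> nat)) := [set A | A = set0 \/ exists K c, A = cyl K c].

Lemma cyls_setI : setI_closed cyls.
Proof.
move=> A B [->|[K [c ->]]] [->|[K' [c' ->]]]; rewrite ?set0I ?setI0; try by left.
wlog KK : K K' c c' / (K <= K')%N.
  move=> h; case: (leqP K K') => [|/ltnW]; first exact: h.
  by rewrite setIC; exact: h.
case: (pselect (forall j, (j < K)%N -> c j = c' j)) => [e|ne].
  right; exists K', c'; apply/seteqP; split=> [v []//|v h]; split=> // j jK.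
  by rewrite e // h // (leq_trans jK).
left; apply/seteqP; split=> // v [h1 h2]; apply: ne => j jK.
by rewrite -h1 // h2 // (leq_trans jK).
Qed.

Local Notation S := (g_sigma_algebraType cyls).

Lemma cyl_measurable K c : measurable (cyl K c : set S).
Proof. by apply: sub_sigma_algebra; right; exists K, c. Qed.

Lemma coord_measurable j (A : set nat) : measurable ([set v | A (v j)] : set S).
Proof.
(* Unpickling enumerates all finite prefixes, continued by 0, so the event is a countable union of
   cylinders. *)
pose s n : nat -> nat := nth 0%N (odflt [::] (unpickle n)).
have -> : [set v | A (v j)] = \bigcup_n (if `[< A (s n j) >] then cyl j.+1 (s n) else set0).
  apply/seteqP; split=> [v Av|v [n _]]; last first.
    by case: asboolP => // As hv; rewrite /= hv.
  exists (pickle (mkseq v j.+1)) => //; rewrite /s pickleK /= nth_mkseq //.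
  by case: asboolP => // _ i ij; rewrite nth_mkseq.
apply: bigcup_measurable => n _; case: asboolP => _; first exact: cyl_measurable.
exact: measurable0.
Qed.

Context {R : realType}.

Lemma coord_measurable_fun j : measurable_fun [set: S] (fun v : S => (v j)%:R : R).
Proof.
move=> _ B _; rewrite setTI.
exact: (@coord_measurable j [set m | B m%:R]).
Qed.

Section Law.
Context {disp : measure_display} {T : measurableType disp}.
Variable P : probability T R.

(** Independence of the coordinates, with laws [p j], expressed on prefixes only. *)
Definition cyl_law (V : T -> nat -> nat) (p : nat -> nat -> R) : Prop := forall K c,
  measurable (V @^-1` cyl K c) /\ P (V @^-1` cyl K c) = (\prod_(j < K) p j (c j))%:E.

Lemma cyls_measurable_fun (V : T -> nat -> nat) :
  (forall K c, measurable (V @^-1` cyl K c)) -> measurable_fun [set: T] (V : T -> S).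
Proof.
move=> h; apply: (measurability _ (erefl : @measurable _ S = <<s cyls >>)).
move=> _ [_ [->|[K [c ->]]] <-]; rewrite setTI; last exact: h.
by rewrite preimage_set0; exact: measurable0.
Qed.

Lemma cyl_law_measurable V p : cyl_law V p -> measurable_fun [set: T] (V : T -> S).
Proof. by move=> h; apply: cyls_measurable_fun => K c; have [] := h K c. Qed.

End Law.

(** Cylinders generate the sigma-algebra and are stable under intersection. *)
Lemma cyl_law_unique (d1 d2 : measure_display) (T1 : measurableType d1) (T2 : measurableType d2)
    (P1 : probability T1 R) (P2 : probability T2 R) (V1 : T1 -> nat -> nat) (V2 : T2 -> nat -> nat) p :
  cyl_law P1 V1 p -> cyl_law P2 V2 p ->
  forall B : set S, measurable B -> P1 (V1 @^-1` B) = P2 (V2 @^-1` B).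
Proof.
move=> h1 h2 B mB.
have m1 := cyl_law_measurable h1; have m2 := cyl_law_measurable h2.
pose F1 : {mfun T1 >-> S} := HB.pack (V1 : T1 -> S) (isMeasurableFun.Build _ _ _ _ (V1 : T1 -> S) m1).
pose F2 : {mfun T2 >-> S} := HB.pack (V2 : T2 -> S) (isMeasurableFun.Build _ _ _ _ (V2 : T2 -> S) m2).
have c0 : cyl 0 (fun=> 0%N) = setT by apply/seteqP; split.
apply: (@g_sigma_algebra_measure_unique _ R S cyls _ (fun=> cyl 0 (fun=> 0%N)) _ _
   (pushforward P1 F1) (pushforward P2 F2)) => //.
- by move=> A [->|[K [c ->]]]; [exact: measurable0|exact: cyl_measurable].
- by move=> i; right; exists 0%N, (fun=> 0%N).
- by apply/seteqP; split=> // v _; exists 0%N.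
- exact: cyls_setI.
- move=> A [->|[K [c ->]]]; first by rewrite !measure0.
  exact: etrans (h1 K c).2 (esym (h2 K c).2).
- move=> k; rewrite c0; change (P1 setT < +oo)%E.
  by rewrite probability_setT ltry.
Qed.

End SequenceSpace.
Notation seqs := (g_sigma_algebraType cyls).

(** * Weighted sums of walk counts *)

Section WeightedSum.
Variables (R : realType).
Local Notation C := (Cplx R).
Variable w : nat -> C.

(* Coordinate [j] of [v] counts the cycles of length [j + 3]. *)
Definition walk_count (k : nat) (v : nat -> nat) : nat :=
  (\sum_(j <- divisors k | 2 < j) 2 * j * v (j - 3))%N.

Definition weighted N (v : nat -> nat) : C := \sum_(1 <= k < N) w k * (walk_count k v)%:R.

Definition abs_weighted N (v : nat -> nat) : R := \sum_(1 <= k < N) cabs (w k) * (walk_count k v)%:R.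

(** The bound is an integer so that the set is a countable union of measurable sets. *)
Definition summable : set (nat -> nat) := [set v | exists B : nat, forall N, abs_weighted N v <= B%:R].

(** The value 0 off the summable sequences keeps [total] everywhere defined and measurable. *)
Definition total (v : nat -> nat) : C :=
  if `[< summable v >] then xget 0 [set l | clim (weighted^~ v) l] else 0.

Lemma weighted_cvg v : summable v -> exists l, clim (weighted^~ v) l.
Proof.
move=> [B hB]; pose a k : C := if k == 0%N then 0 else w k * (walk_count k v)%:R.
have [|l hl] := @csum_ex _ a B%:R.
  move=> n; apply: le_trans (hB n); case: n => [|n]; first by rewrite /abs_weighted !big_geq.
  rewrite big_nat_recl // {1}/a eqxx cabs0 add0r /abs_weighted big_add1 /=.
  by apply: ler_sum => k _; rewrite /a /= cabsM cabs_nat.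
exists l => e e0; have [N hN] := hl e e0; exists N.+1 => -[//|n] Nn.
have := hN n.+1 (ltnW Nn); congr (cabs (_ - _) < _).
by rewrite big_nat_recl // {1}/a eqxx add0r /weighted big_add1.
Qed.

Lemma total_clim v : summable v -> clim (weighted^~ v) (total v).
Proof.
move=> sv; rewrite /total; case: asboolP => // _.
by case: xgetP => [l -> //|h]; have [l hl] := weighted_cvg sv; case: (h l).
Qed.

Lemma walk_countD k u v : walk_count k (fun j => u j + v j)%N = (walk_count k u + walk_count k v)%N.
Proof. by rewrite /walk_count -big_split /=; apply: eq_bigr => j _; rewrite mulnDr. Qed.

Lemma summableD u v : summable u -> summable v -> summable (fun j => u j + v j)%N.
Proof.
move=> [B hB] [B' hB']; exists (B + B')%N => N; rewrite natrD.
apply: le_trans (lerD (hB N) (hB' N)); rewrite -big_split /=; apply: ler_sum => k _.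
by rewrite walk_countD natrD mulrDr.
Qed.

Lemma totalD u v : summable u -> summable v -> total (fun j => u j + v j)%N = total u + total v.
Proof.
move=> su sv; apply: clim_unique (total_clim (summableD su sv)) _.
apply: clim_ext (climD (total_clim su) (total_clim sv)) => n.
by rewrite -big_split /=; apply: eq_bigr => k _; rewrite walk_countD natrD mulrDr.
Qed.

Lemma walk_count_measurable k : measurable_fun [set: seqs] (fun v : seqs => (walk_count k v)%:R : R).
Proof.
have -> : (fun v : seqs => (walk_count k v)%:R : R) =
   (fun v => \sum_(j <- [seq j <- divisors k | (2 < j)%N]) (2 * j)%:R * (v (j - 3)%N)%:R).
  apply/funext => v; rewrite big_filter natr_sum; apply: eq_bigr => j _.
  by rewrite natrM.
apply: measurable_sum => j; apply: measurable_funM => //; exact: coord_measurable_fun.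
Qed.

Lemma summable_measurable : measurable (summable : set seqs).
Proof.
have -> : summable = \bigcup_B \bigcap_N [set v | abs_weighted N v <= B%:R].
  apply/seteqP; split=> [v [B hB]|v [B _ hB]]; first by exists B => // N _; exact: hB.
  by exists B => N; exact: hB.
apply: bigcup_measurable => B _; apply: bigcap_measurable => // N _.
have mf : measurable_fun [set: seqs] (fun v : seqs => abs_weighted N v).
  apply: measurable_sum => k; apply: measurable_funM => //; exact: walk_count_measurable.
have -> : [set v | abs_weighted N v <= B%:R] = [set: seqs] `&` (fun v : seqs => abs_weighted N v) @^-1` `]-oo, B%:R].
  by apply/seteqP; split=> v /=; rewrite in_itv /=; [|case].
exact: mf.
Qed.

Lemma Re_mul_nat (z : C) n : complex.Re (z * n%:R) = complex.Re z * n%:R.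
Proof. by case: z => x y; rewrite -(rmorph_nat (real_complex R)) /= mulr0 subr0. Qed.

Lemma Im_mul_nat (z : C) n : complex.Im (z * n%:R) = complex.Im z * n%:R.
Proof. by case: z => x y; rewrite -(rmorph_nat (real_complex R)) /= mulr0 add0r. Qed.

(** [h] stands for the real or the imaginary part; the partial sums, set to 0 off the summable
    sequences, converge pointwise. *)
Lemma total_part_measurable (h : {additive C -> R}) :
  (forall z, `|h z| <= cabs z) -> (forall z n, h (z * n%:R) = h z * n%:R) ->
  measurable_fun [set: seqs] (fun v : seqs => h (total v)).
Proof.
move=> hle hn; pose H N (v : seqs) := if `[< summable v >] then h (weighted N v) else 0.
apply: (@measurable_fun_cvg _ _ _ _ H) => [N|v _].
  apply: measurable_fun_ifT => //.
  - apply: (@measurable_fun_bool _ _ _ _ true) => //.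
    rewrite (_ : _ @^-1` _ = summable) ?setTI; first exact: summable_measurable.
    by apply/seteqP; split=> v /= /asboolP.
  - have -> : (fun v : seqs => h (weighted N v)) =
       (fun v => \sum_(k <- index_iota 1 N) h (w k) * (walk_count k v)%:R).
      by apply/funext => v; rewrite raddf_sum; apply: eq_bigr => k _; exact: hn.
    by apply: measurable_sum => k; apply: measurable_funM => //; exact: walk_count_measurable.
rewrite /H; case: asboolP => sv; last first.
  by rewrite /total; case: asboolP => // _; rewrite raddf0; exact: cvg_cst.
apply/cvgrPdist_lt => e e0; have [N hN] := total_clim sv e0; exists N => // n Nn /=.
by rewrite distrC -raddfB; exact: le_lt_trans (hle _) (hN n Nn).
Qed.

Lemma total_complex_RV (disp : measure_display) (T : measurableType disp) (V : T -> nat -> nat) :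
  measurable_fun [set: T] (V : T -> seqs) -> complex_RV (fun t => total (V t)).
Proof.
move=> mV; apply: complex_RV_ReIm.
  by apply: (measurableT_comp (total_part_measurable (@Re_le_cabs R) Re_mul_nat) mV).
by apply: (measurableT_comp (total_part_measurable (@Im_le_cabs R) Im_mul_nat) mV).
Qed.

Lemma total_borel (B : set C) : borel R B -> measurable ((total @^-1` B) : set seqs).
Proof. exact: (@total_complex_RV _ seqs id (@measurable_id _ _ _)). Qed.

End WeightedSum.

(** * Independent integers from one uniform variable *)

Section UniformDigits.
Variables (R : realType) (p : nat -> nat -> R).
Hypotheses (p_gt0 : forall j m, 0 < p j m)
  (p_sum : forall j, \sum_(0 <= i < n) p j i @[n --> \oo] --> (1 : R)).

Definition cumul j n : R := \sum_(0 <= i < n) p j i.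

Lemma cumulS j n : cumul j n.+1 = cumul j n + p j n.
Proof. by rewrite /cumul big_nat_recr. Qed.

Lemma cumul_ge0 j n : 0 <= cumul j n.
Proof. by apply: sumr_ge0 => i _; exact: ltW. Qed.

Lemma cumul_le j m n : (m <= n)%N -> cumul j m <= cumul j n.
Proof.
move=> mn; rewrite /cumul [X in _ <= X](@big_cat_nat _ _ _ m) //= lerDl sumr_ge0 // => i _.
exact: ltW.
Qed.

Lemma cumul_le1 j n : cumul j n <= 1.
Proof.
apply/ler_addgt0Pr => e e0; have /cvgrPdist_lt/(_ e e0)[N _ hN] := p_sum j.
apply: le_trans (cumul_le j (leq_maxr N n)) _.
have := hN (maxn N n) (leq_maxl _ _); rewrite /= -/(cumul _ _) ltr_distlC => /andP[_].
lra.
Qed.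

(** The index of the interval that contains x when [0, 1[ is cut into consecutive pieces of lengths
    [p j m]. *)
Definition digit j (x : R) : nat := xget 0%N [set m | cumul j m <= x < cumul j m.+1].

Lemma digitP j x m : 0 <= x < 1 -> digit j x = m <-> cumul j m <= x < cumul j m.+1.
Proof.
move=> /andP[x0 x1].
have ex : exists n, x < cumul j n.+1.
  have e0 : 0 < 1 - x by rewrite subr_gt0.
  have /cvgrPdist_lt/(_ _ e0)[N _ hN] := p_sum j.
  exists N; have := hN N.+1 (leqnSn N); rewrite /= -/(cumul _ _) ltr_distlC.
  move=> /andP[]; lra.
have [n hn] : exists n, cumul j n <= x < cumul j n.+1.
  case: (ex_minnP ex) => n hn mn; exists n; rewrite hn andbT.
  case: n hn mn => [|n] hn mn; first by rewrite /cumul big_geq.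
  by rewrite leNgt; apply/negP => /mn; rewrite ltnn.
have uniq a b : cumul j a <= x < cumul j a.+1 -> cumul j b <= x < cumul j b.+1 -> (a <= b)%N.
  move=> /andP[ha _] /andP[_ hb]; rewrite leqNgt; apply/negP => /(cumul_le j) h.
  by have := lt_le_trans hb (le_trans h ha); rewrite ltxx.
rewrite /digit; case: xgetP => [a _ ha|h]; last by case: (h n).
split=> [<- //|hm]; apply/eqP; rewrite eqn_leq.
by rewrite (uniq a m ha hm) (uniq m a hm ha).
Qed.

(** The place of x inside the interval selected by its first j digits, rescaled to [0, 1[. *)
Fixpoint position j (x : R) : R :=
  if j is i.+1 then (position i x - cumul i (digit i (position i x))) / p i (digit i (position i x))
  else x.

(** Outside [0, 1[, which the restricted measure ignores, all digits are 0. *)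
Definition digits (x : R) (j : nat) : nat := if 0 <= x < 1 then digit j (position j x) else 0%N.

Section Prefix.
Variable c : nat -> nat.

Fixpoint lo K : R := if K is K'.+1 then lo K' + (\prod_(j < K') p j (c j)) * cumul K' (c K') else 0.
Local Notation len K := (\prod_(j < K) p j (c j)).

(** Inside the interval of a prefix the position is affine in x, so fixing the next digit cuts out a
    subinterval, shorter by the factor [p K (c K)]. *)
Lemma digits_prefix K x : 0 <= x < 1 ->
  ((forall j, (j < K)%N -> digits x j = c j) <-> lo K <= x < lo K + len K) /\
  ((forall j, (j < K)%N -> digits x j = c j) -> position K x = (x - lo K) / len K).
Proof.
move=> x01.
elim: K => [|K [IH1 IH2]].
  by rewrite big_ord0 /= add0r x01 subr0 divr1.
have l0 : 0 < len K by apply: prodr_gt0.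
set L := len K in l0 IH1 IH2 *.
have E : len K.+1 = L * p K (c K) by rewrite big_ord_recr.
have pc := p_gt0 K (c K).
have c1 := cumul_le1 K (c K).+1; have c0 := cumul_ge0 K (c K).
rewrite cumulS in c1; rewrite E.
have F1 : cumul K (c K) * L >= 0 by rewrite mulr_ge0 // ltW.
have key : (forall j, (j < K)%N -> digits x j = c j) ->
    (digits x K = c K <-> lo K.+1 <= x < lo K.+1 + L * p K (c K)) /\
    (digits x K = c K -> position K.+1 x = (x - lo K.+1) / (L * p K (c K))).
  move=> hK; have pE := IH2 hK; have /andP[x1 x2] := IH1.1 hK.
  have y01 : 0 <= position K x < 1.
    by rewrite pE divr_ge0 ?subr_ge0 ?(ltW l0) //= ltr_pdivrMr // mul1r ltrBlDl.
  rewrite /digits x01 digitP // cumulS pE /= -/L; split.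
    rewrite ler_pdivlMr // ltr_pdivrMr // lerBrDl ltrBlDl [_ * L]mulrC [_ * L]mulrC mulrDr addrA.
    by [].
  move=> hd; have -> : digit K (position K x) = c K by apply/digitP => //; rewrite cumulS pE.
  by rewrite pE; field; rewrite !gt_eqF.
split; last by move=> hK; apply: (key _).2; [move=> j jK; apply: hK; exact: leqW|exact: hK].
split=> [hK|hx].
  by apply/(key _).1; [move=> j jK; apply: hK; exact: leqW|exact: hK].
have hK : forall j, (j < K)%N -> digits x j = c j.
  apply/IH1; move: hx; rewrite /= -/L => /andP[h1 h2].
  apply/andP; split; first by apply: le_trans h1; rewrite lerDl mulrC.
  apply: lt_le_trans h2 _; rewrite -addrA lerD2l -mulrDr -[X in _ <= X]mulr1 ler_pM2l //.
move=> j; rewrite ltnS leq_eqVlt => /orP[/eqP ->|]; last exact: hK.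
exact/(key hK).1.
Qed.

Lemma prefix_sub K : 0 <= lo K /\ lo K + len K <= 1.
Proof.
elim: K => [|K [h1 h2]]; first by rewrite /= big_ord0 add0r.
have l0 : 0 < len K by apply: prodr_gt0.
rewrite big_ord_recr /=; split; first by rewrite addr_ge0 // mulr_ge0 ?cumul_ge0 // ltW.
apply: le_trans h2; rewrite -addrA lerD2l -mulrDr -[X in _ <= X]mulr1 ler_pM2l //.
by rewrite -cumulS cumul_le1.
Qed.

End Prefix.

Definition unit_lebesgue :=
  mrestr (@lebesgue_measure R) (measurable_itv `[0, 1[).

HB.instance Definition _ := Measure.on unit_lebesgue.

Lemma unit_lebesgue_setT : unit_lebesgue setT = 1%E.
Proof.
rewrite /unit_lebesgue /mrestr setTI lebesgue_measure_itv /= lte_fin ltr01.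
by rewrite -EFinB subr0.
Qed.

HB.instance Definition _ := Measure_isProbability.Build _ _ _ unit_lebesgue unit_lebesgue_setT.

Lemma digits_law : cyl_law (unit_lebesgue : probability _ R) digits p.
Proof.
move=> K c; pose I := `[lo c K, lo c K + \prod_(j < K) p j (c j)[%classic.
have [l0 l1] := prefix_sub c K.
have pp : 0 < \prod_(j < K) p j (c j) by apply: prodr_gt0.
have eI : digits @^-1` cyl K c `&` `[0, 1[ = I.
  apply/seteqP; split=> [x [hx]|x].
    rewrite /= in_itv /= => x01; rewrite /I /= in_itv /=.
    exact/(digits_prefix c K x01).1.
  rewrite /I /= in_itv /= => hx.
  have x01 : 0 <= x < 1 by move: hx => /andP[]; lra.
  by rewrite in_itv /= x01; split=> //; apply/(digits_prefix c K x01).1.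
split; last first.
  transitivity (@lebesgue_measure R I); first by rewrite -eI.
  rewrite lebesgue_measure_itv /= lte_fin ltrDl pp.
  by rewrite -EFinB addrC addKr.
(* The complement of [0, 1[, where all digits are 0, is added entirely or not at all. *)
have -> : digits @^-1` cyl K c = I `|` (if `[< forall j, (j < K)%N -> c j = 0%N >] then ~` `[0, 1[ else set0).
  rewrite -eI; apply/seteqP; split=> [x hx|x].
    case: (boolP (0 <= x < 1)) => x01; first by left; split=> //; rewrite /= in_itv.
    right; case: asboolP => [_|[]]; first by rewrite /= in_itv /=; exact/negP.
    by move=> j jK; rewrite -(hx j jK) /digits (negbTE x01).
  move=> [[]//|]; case: asboolP => // h; rewrite /= in_itv /= => /negP x01 j jK.
  by rewrite /digits (negbTE x01) h.
apply: measurableU; first exact: measurable_itv.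
by case: asboolP => _; [apply: measurableC; exact: measurable_itv|exact: measurable0].
Qed.

End UniformDigits.

Section Poisson.
Variable R : realType.
Implicit Types x y : R.

Lemma poisson_pmf_gt0 x m : 0 < x -> 0 < poisson_pmf x m.
Proof.
move=> x0; rewrite /poisson_pmf x0 mulr_gt0 ?expR_gt0 // mulr_gt0 ?exprn_gt0 // invr_gt0 ltr0n fact_gt0.
Qed.

Lemma poisson_pmf_sum x : 0 < x -> \sum_(0 <= i < n) poisson_pmf x i @[n --> \oo] --> (1 : R).
Proof.
move=> x0.
have -> : (fun n => \sum_(0 <= i < n) poisson_pmf x i) = (fun n => series (exp_coeff x) n * expR (- x)).
  apply/funext => n; rewrite /series /= mulr_suml; apply: eq_bigr => i _.
  by rewrite /poisson_pmf x0.
rewrite -(expRxMexpNx_1 x); apply: cvgM; last exact: cvg_cst.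
exact: is_cvg_series_exp_coeff.
Qed.

(** The binomial theorem, divided by c!. *)
Lemma poisson_pmf_conv x y c : 0 < x -> 0 < y ->
  \sum_(a < c.+1) poisson_pmf x a * poisson_pmf y (c - a) = poisson_pmf (x + y) c.
Proof.
move=> x0 y0; rewrite /poisson_pmf x0 y0 addr_gt0 // addrC exprDn opprD expRD.
rewrite -mulrA mulr_suml; apply: eq_bigr => a _.
have ac : (a <= c)%N by rewrite -ltnS.
have -> : y ^+ (c - a) * x ^+ a *+ 'C(c, a) = y ^+ (c - a) * x ^+ a * (c`!%:R / (a`!%:R * (c - a)`!%:R)).
  rewrite -mulr_natr; congr (_ * _); rewrite -(bin_fact ac) !natrM; field.
  by rewrite !pnatr_eq0 -!lt0n !fact_gt0.
by field; rewrite !pnatr_eq0 -!lt0n !fact_gt0.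
Qed.

Lemma poisson_sequence (lam : nat -> R) : (forall j, 0 < lam j) ->
  exists (disp : measure_display) (T : measurableType disp) (P : probability T R)
         (V : T -> nat -> nat), cyl_law P V (fun j => poisson_pmf (lam j)).
Proof.
move=> lam0.
by do 4!eexists; apply: (@digits_law R (fun j => poisson_pmf (lam j))) => j *;
  [exact: poisson_pmf_gt0|exact: poisson_pmf_sum].
Qed.

End Poisson.

(** * Sums and independent copies of sequences *)

Section Products.
Variable R : realType.

Lemma measure_finT (d : measure_display) (T : measurableType d) (P : probability T R)
    (I : finType) (E : I -> set T) : (forall i, measurable (E i)) -> trivIset setT E ->
  P (\bigcup_i E i) = (\sum_i P (E i))%E.
Proof.
move=> mE tE; rewrite measure_fin_bigcup //; last exact: finite_finset.
rewrite fsbig_finite; last exact: finite_finset.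
apply: perm_big; apply: uniq_perm; [exact: finmap.fset_uniq|exact: index_enum_uniq|].
move=> i; rewrite mem_index_enum in_fset_set ?in_setT //; exact: finite_finset.
Qed.

Section Sum.
Context {d1 d2 : measure_display} {T1 : measurableType d1} {T2 : measurableType d2}.
Variables (P1 : probability T1 R) (P2 : probability T2 R).
Variables (V1 : T1 -> nat -> nat) (V2 : T2 -> nat -> nat) (p1 p2 : nat -> nat -> R).
Hypotheses (h1 : cyl_law P1 V1 p1) (h2 : cyl_law P2 V2 p2).

(** The event splits according to the values of the first sequence on the K coordinates, finitely
    many since they are bounded by [c]; distributivity turns the sum of products into a product of
    sums. *)
Lemma cyl_law_sum : cyl_law ((P1 \x P2)%E : probability (T1 * T2)%type R)
  (fun t j => V1 t.1 j + V2 t.2 j)%N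
  (fun j c => \sum_(a < c.+1) p1 j a * p2 j (c - a)%N).
Proof.
move=> K c.
pose B := (\max_(j < K) c j).+1.
have cB (j : 'I_K) : (c j < B)%N by rewrite ltnS; exact: (leq_bigmax j).
pose ext (a : {ffun 'I_K -> 'I_B}) (j : nat) : nat := if insub j is Some i then a i else 0%N.
have extE a (j : 'I_K) : ext a j = a j by rewrite /ext valK.
pose E (a : {ffun 'I_K -> 'I_B}) : set (T1 * T2) :=
  if [forall j : 'I_K, a j <= c j]%N
  then (V1 @^-1` cyl K (ext a)) `*` (V2 @^-1` cyl K (fun j => c j - ext a j)%N) else set0.
have mE a : measurable (E a).
  rewrite /E; case: ifP => _; last exact: measurable0.
  by apply: measurableX; [exact: (h1 _ _).1|exact: (h2 _ _).1].
have tE : trivIset setT E.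
  apply/trivIsetP => a b _ _ ab; apply/seteqP; split=> // t [].
  rewrite /E; case: ifP => // _; case: ifP => // _ [ha _] [hb _].
  case/eqP: ab; apply/ffunP => j; apply: val_inj => /=; rewrite -!extE.
  by rewrite -(ha j (ltn_ord j)) -(hb j (ltn_ord j)).
have eE : (fun (t : T1 * T2) j => V1 t.1 j + V2 t.2 j)%N @^-1` cyl K c = \bigcup_a E a.
  apply/seteqP; split=> [t ht|t [a _]].
    have ht' (j : 'I_K) : (V1 t.1 j + V2 t.2 j = c j)%N by exact: ht.
    have lt (j : 'I_K) : (V1 t.1 j < B)%N by apply: leq_ltn_trans (cB j); rewrite -ht' leq_addr.
    exists [ffun j => Ordinal (lt j)] => //; rewrite /E; case: ifP => [_|/negP[]]; last first.
      by apply/forallP => j; rewrite ffunE /= -ht' leq_addr.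
    have e j (jK : (j < K)%N) : ext [ffun j => Ordinal (lt j)] j = V1 t.1 j.
      by rewrite -[j]/(val (Ordinal jK)) extE ffunE.
    split=> j jK /=; rewrite e //.
    by rewrite -(ht' (Ordinal jK)) /= addKn.
  rewrite /E; case: ifP => // /forallP ac [ha hb] j jK /=.
  rewrite (ha j jK) (hb j jK) subnKC //.
  by have := ac (Ordinal jK); rewrite -extE.
split; first by rewrite eE; apply: fin_bigcup_measurable => //; exact: finite_finset.
rewrite eE measure_finT //.
pose F (j : 'I_K) (a : 'I_B) : R := if (a <= c j)%N then p1 j a * p2 j (c j - a)%N else 0.
have -> : \prod_(j < K) \sum_(a < (c j).+1) p1 j a * p2 j (c j - a)%N = \prod_(j < K) \sum_a F j a.
  apply: eq_bigr => j _; rewrite (big_ord_widen B (fun a => p1 j a * p2 j (c j - a)%N) (cB j)).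
  by rewrite big_mkcond; apply: eq_bigr => a _; rewrite /F /= ltnS.
rewrite bigA_distr_bigA /= -sumEFin; apply: eq_bigr => a _; rewrite /E.
case: ifP => [/forallP ac|/negbT].
  rewrite product_measure1E; [|exact: (h1 _ _).1|exact: (h2 _ _).1].
  apply: etrans (congr2 mule (h1 _ _).2 (h2 _ _).2) _.
  rewrite -EFinM -big_split /=; congr (_%:E); apply: eq_bigr => j _.
  by rewrite /F ac extE.
rewrite negb_forall => /existsP[j hj]; rewrite measure0 (bigD1 j) //=.
by rewrite /F (negbTE hj) mul0r.
Qed.

End Sum.

(** [V] is indexed by [nat] and the product formula concerns the indices below [m] only, which makes
    it easy to add one more copy. *)
Definition iid_law (m : nat) (d0 d : measure_display) (T0 : measurableType d0) (T : measurableType d)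
    (P0 : probability T0 R) (P : probability T R) (V0 : T0 -> nat -> nat)
    (V : nat -> T -> nat -> nat) : Prop :=
  (forall i, measurable_fun [set: T] (V i : T -> seqs)) /\
  forall B : nat -> set seqs, (forall i, measurable (B i)) ->
    P (\bigcap_(i in [set i | (i < m)%N]) V i @^-1` B i) = (\prod_(i < m) P0 (V0 @^-1` B i))%E.

(** Each further copy lives on a new factor of a product space; under sums of independent Poisson
    variables the parameters add. *)
Lemma poisson_copies (lam : nat -> R) (d0 : measure_display) (T0 : measurableType d0)
    (P0 : probability T0 R) (V0 : T0 -> nat -> nat) (m : nat) : (forall j, 0 < lam j) ->
  cyl_law P0 V0 (fun j => poisson_pmf (lam j)) ->
  exists (disp : measure_display) (T : measurableType disp) (P : probability T R)
         (V : nat -> T -> nat -> nat), iid_law m.+1 P0 P V0 V /\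
    cyl_law P (fun t j => \sum_(i < m.+1) V i t j)%N (fun j => poisson_pmf (m.+1%:R * lam j)).
Proof.
move=> lam0 h0; have mV0 := cyl_law_measurable h0.
elim: m => [|m [disp [T [P [V [[mV jV] sV]]]]]].
  exists d0, T0, P0, (fun _ => V0); split.
    split=> // B mB; rewrite big_ord_recl big_ord0 mule1; congr (P0 _).
    apply/seteqP; split=> [t /(_ 0%N)|t h]; first exact.
    by move=> i /=; rewrite ltnS leqn0 => /eqP ->.
  move=> K c; have [h1 h2] := h0 K c.
  rewrite (_ : (fun (t : T0) j => \sum_(i < 1) V0 t j)%N = V0); last first.
    by apply/funext => t; apply/funext => j; rewrite big_ord_recl big_ord0 addn0.
  by split=> //; rewrite h2; congr (_%:E); apply: eq_bigr => j _; rewrite mul1r.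
pose W i (t : T * T0) : nat -> nat := if (i < m.+1)%N then V i t.1 else V0 t.2.
exists _, (T * T0)%type, ((P \x P0)%E : probability (T * T0)%type R), W; split.
  split=> [i|B mB].
    case: (boolP (i < m.+1)%N) => im.
      rewrite (_ : W i = V i \o fst); last by apply/funext => t; rewrite /W im.
      by apply: (measurableT_comp (mV i)); exact: measurable_fst.
    rewrite (_ : W i = V0 \o snd); last by apply/funext => t; rewrite /W (negbTE im).
    by apply: (measurableT_comp mV0); exact: measurable_snd.
  have -> : \bigcap_(i in [set i | (i < m.+2)%N]) W i @^-1` B i =
     (\bigcap_(i in [set i | (i < m.+1)%N]) V i @^-1` B i) `*` (V0 @^-1` B m.+1).
    apply/seteqP; split=> [t h|t [ha hb]].
      split=> [i /= im|]; first by have := h i (leqW im); rewrite /W /= im.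
      by have := h m.+1 (leqnn _); rewrite /W /= ltnn.
    move=> i /=; rewrite ltnS leq_eqVlt => /orP[/eqP ->|im]; first by rewrite /W /= ltnn.
    by rewrite /W /= im; exact: ha.
  have mm i (A : set seqs) : measurable A -> measurable (V i @^-1` A).
    by move=> mA; have := mV i measurableT A mA; rewrite setTI.
  apply: etrans (product_measure1E _ _ _ _) _.
  - by apply: bigcap_measurable => [|i _]; [exists 0%N|exact: mm].
  - by have := mV0 measurableT (B m.+1) (mB _); rewrite setTI.
  - by rewrite [in RHS]big_ord_recr; congr (_ * _)%E; exact: jV.
move=> K c; have [a1 a2] := cyl_law_sum sV h0 K c.
have e : (fun (t : T * T0) j => \sum_(i < m.+2) W i t j)%N =
   (fun (t : T * T0) j => \sum_(i < m.+1) V i t.1 j + V0 t.2 j)%N.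
  apply/funext => t; apply/funext => j; rewrite big_ord_recr /= {2}/W ltnn; congr (_ + _)%N.
  by apply: eq_bigr => i _; rewrite /W ltn_ord.
rewrite e; split=> //; rewrite a2; congr (_%:E); apply: eq_bigr => j _.
rewrite poisson_pmf_conv ?mulr_gt0 //; congr (poisson_pmf _ _).
by rewrite -[m.+2%:R]natr1 mulrDl mul1r.
Qed.

End Products.

(** * Joint law of the cycle counts *)

Lemma alternating_binomial (R : realType) (y N : nat) :
  \sum_(r < N.+1) (-1) ^+ r * 'C(y.+1, r)%:R = (-1) ^+ N * 'C(y, N)%:R :> R.
Proof.
elim: N => [|N IH]; first by rewrite big_ord_recr big_ord0 /= add0r !bin0.
rewrite big_ord_recr /= IH binS natrD exprS; ring.
Qed.

(** Partial alternating sums of a row of Pascal's triangle reduce to a single binomial coefficient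
    of the preceding row. *)
Lemma indicator_binomial_le (R : realType) (y N : nat) :
  `|(y == 0%N)%:R - \sum_(r < N) (-1) ^+ r * 'C(y, r)%:R| <= 'C(y, N)%:R :> R.
Proof.
case: N => [|N]; first by rewrite big_ord0 subr0 bin0; case: (y == _); rewrite ?normr1 ?normr0.
case: y => [|y].
  rewrite big_ord_recl /= big1 => [|i _]; last by rewrite bin0n /= mulr0.
  by rewrite bin0 !expr0 mulr1 addr0 subrr normr0.
rewrite alternating_binomial /= sub0r normrN normrM normrX normrN1 expr1n mul1r normr_nat.
by rewrite ler_nat binS leq_addl.
Qed.

(* Bonferroni: the inclusion-exclusion sum for [x = c] truncated at [N] errs by at most
   the first omitted term. *)
Lemma indicator_ffact_le (R : realType) (x c N : nat) :
  `|(x == c)%:R - \sum_(r < N) (-1) ^+ r * (x ^_ (c + r))%:R / (c`! * r`!)%:R| <=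
  (x ^_ (c + N))%:R / (c`! * N`!)%:R :> R.
Proof.
case: (ltnP x c) => xc.
  rewrite (ltn_eqF xc) big1 ?subr0 ?normr0 ?divr_ge0 // => r _.
  by rewrite ffact_small ?mulr0 ?mul0r // ltn_addr.
have e r : (x ^_ (c + r))%:R / (c`! * r`!)%:R = 'C(x, c)%:R * 'C(x - c, r)%:R :> R.
  have fE : (x ^_ (c + r) = x ^_ c * (x - c) ^_ r)%N.
    elim: r => [|r IH]; first by rewrite addn0 muln1.
    by rewrite addnS !ffactnSr IH mulnA subnDA.
  rewrite fE -!bin_ffact !natrM; field.
  by rewrite !pnatr_eq0 -!lt0n !fact_gt0.
have -> : (x == c)%:R = 'C(x, c)%:R * ((x - c)%N == 0%N)%:R :> R.
  rewrite subn_eq0; case: (eqVneq x c) => [->|ne]; first by rewrite leqnn binn mulr1.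
  by rewrite (_ : (x <= c)%N = false) ?mulr0 //; apply/negbTE; rewrite -ltnNge ltn_neqAle eq_sym ne.
rewrite e (eq_bigr (fun r : 'I_N => 'C(x, c)%:R * ((-1) ^+ r * 'C(x - c, r)%:R))).
  by rewrite -mulr_sumr -mulrBr normrM normr_nat ler_wpM2l // indicator_binomial_le.
by move=> r _; rewrite -mulrA e mulrCA.
Qed.

Lemma cvg_sum_seq (R : realType) (F : set_system nat) {FF : Filter F} (I : Type) (r : seq I)
    (f : I -> nat -> R) (l : I -> R) : (forall i, f i n @[n --> F] --> l i) ->
  \sum_(i <- r) f i n @[n --> F] --> \sum_(i <- r) l i.
Proof.
move=> h; elim: r => [|i r IH].
  rewrite big_nil (_ : (fun n => _) = fun=> 0); first exact: cvg_cst.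
  by apply/funext => n; rewrite big_nil.
rewrite big_cons (_ : (fun n => _) = fun n => f i n + \sum_(i <- r) f i n).
  exact: cvgD.
by apply/funext => n; rewrite big_cons.
Qed.

Section FactorialMoments.
Variables (R : realType) (d : nat).
Hypothesis d_gt2 : (2 < d)%N.

Lemma regular_meanD n (f g : 'M[bool]_n -> R) :
  regular_mean d (fun G => f G + g G) = regular_mean d f + regular_mean d g.
Proof. by rewrite /regular_mean big_split mulrDl. Qed.

Lemma regular_meanZ n (c : R) (f : 'M[bool]_n -> R) :
  regular_mean d (fun G => c * f G) = c * regular_mean d f.
Proof. by rewrite /regular_mean -mulr_sumr mulrA. Qed.

Lemma regular_meanB n (f g : 'M[bool]_n -> R) :
  regular_mean d (fun G => f G - g G) = regular_mean d f - regular_mean d g.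
Proof. by rewrite /regular_mean sumrB mulrBl. Qed.

Lemma regular_mean_sum n (I : Type) (r : seq I) (Q : pred I) (f : I -> 'M[bool]_n -> R) :
  regular_mean d (fun G => \sum_(i <- r | Q i) f i G) = \sum_(i <- r | Q i) regular_mean d (f i).
Proof. by rewrite /regular_mean exchange_big mulr_suml. Qed.

Lemma eq_regular_mean n (f g : 'M[bool]_n -> R) :
  (forall G, G \in regular_graphs n d -> f G = g G) -> regular_mean d f = regular_mean d g.
Proof. by move=> h; rewrite /regular_mean; congr (_ / _); apply: eq_bigr. Qed.

Lemma regular_mean_cst n (c : R) : (0 < #|regular_graphs n d|)%N ->
  regular_mean d (fun _ : 'M[bool]_n => c) = c.
Proof.
move=> N0; rewrite /regular_mean sumr_const -[c *+ _]mulr_natr mulfK //.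
by rewrite pnatr_eq0 -lt0n.
Qed.

Lemma regular_mean_norm n (f : 'M[bool]_n -> R) :
  `|regular_mean d f| <= regular_mean d (fun G => `|f G|).
Proof.
rewrite /regular_mean normrM [`|_^-1|]ger0_norm ?invr_ge0 // ler_wpM2r ?invr_ge0 //.
exact: ler_norm_sum.
Qed.

Definition parity_filter : set_system nat := within [set n | odd d ==> ~~ odd n] \oo.

Global Instance parity_filter_filter : Filter parity_filter.
Proof. exact: within_filter. Qed.

Lemma parity_filter_large N : \forall n \near parity_filter, (N <= n)%N /\ (0 < #|regular_graphs n d|)%N.
Proof.
exists (maxn N (2 * d).+1) => // n /=; rewrite geq_max => /andP[Nn dn] par.
by split=> //; apply: regular_graphs_gt0 par => //; lia.
Qed.

Lemma falling_mean_cvg ks : all (fun k => 2 < k)%N ks ->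
  regular_mean d (fun G : 'M[bool]_n => (falling_counts G ks)%:R : R) @[n --> parity_filter]
    --> (d%:R - 1 : R) ^+ sumn ks.
Proof.
move=> k2; have [C hC] := mean_falling_close R d_gt2 k2.
apply/cvgrPdist_lt => e e0.
pose N0 := (2 * (2 * sumn ks + 6 + 2 * (d.+1 * d)))%N.
have [M hM] : exists M : nat, `|C| / e < M%:R by exists (Num.truncn (`|C| / e)).+1; exact: truncnS_gt.
near=> n.
have [nN ng] : (maxn N0 M.+1 <= n)%N /\ (0 < #|regular_graphs n d|)%N.
  by near: n; exact: parity_filter_large.
have n0 : (0 < n)%N by lia.
rewrite distrC; apply: le_lt_trans (hC n n0 ng _) _; first by rewrite -/N0; nia.
apply: le_lt_trans (ler_norm _) _; rewrite normrM normfV normr_nat ltr_pdivrMr ?ltr0n //.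
rewrite mulrC -ltr_pdivrMr //; apply: lt_le_trans hM _; rewrite ler_nat; lia.
Unshelve. all: by end_near. Qed.

Lemma falling_counts_nseq n (G : 'M[bool]_n) r j ks : j \notin ks ->
  falling_counts G (nseq r j ++ ks) =
  ((2 * j) ^ r * (cycle_number G j) ^_ r * falling_counts G ks)%N.
Proof.
move=> jk; elim: r => [|r IH]; first by rewrite /= expn0 !mul1n.
have cm : count_mem j (nseq r j ++ ks) = r.
  by rewrite count_cat count_nseq /= eqxx mul1n (count_memPn jk) addn0.
by rewrite /= cm IH expnS ffactnSr; ring.
Qed.

Definition cycle_rate (j : nat) : R := (d%:R - 1) ^+ j / (2 * j)%:R.

(** [W] carries the other variables. The indicator is replaced by its truncated inclusion-exclusion
    sum, with an error whose mean is at most a quantity tending to w lam^(c+N) / (c! N!); this limit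
    is small for large N. *)
Lemma factorial_moment_cvg (W : forall n, 'M[bool]_n -> R) (X : forall n, 'M[bool]_n -> nat)
    (w lam : R) (c : nat) : (forall n G, 0 <= W n G) -> 0 < lam ->
  (forall r, regular_mean d (fun G : 'M[bool]_n => W n G * (X n G ^_ r)%:R) @[n --> parity_filter]
     --> w * lam ^+ r) ->
  regular_mean d (fun G : 'M[bool]_n => W n G * (X n G == c)%:R) @[n --> parity_filter]
     --> w * poisson_pmf lam c.
Proof.
move=> W0 lam0 hr.
pose u N : R := \sum_(r < N) (-1) ^+ r * (w * lam ^+ (c + r)) / (c`! * r`!)%:R.
pose err N : R := w * lam ^+ (c + N) / (c`! * N`!)%:R.
have uE N : u N = w * lam ^+ c / c`!%:R * series (exp_coeff (- lam)) N.
  rewrite /u /series /= big_mkord mulr_sumr; apply: eq_bigr => r _.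
  rewrite /exp_coeff /= [(- lam) ^+ r]exprNn exprD natrM; field.
  by rewrite !pnatr_eq0 -!lt0n !fact_gt0.
have errE N : err N = w * lam ^+ c / c`!%:R * exp_coeff lam N.
  rewrite /err /exp_coeff /= exprD natrM; field.
  by rewrite !pnatr_eq0 -!lt0n !fact_gt0.
have ulim : u @ \oo --> w * poisson_pmf lam c.
  rewrite /poisson_pmf lam0.
  have -> : w * (lam ^+ c / c`!%:R * expR (- lam)) = w * lam ^+ c / c`!%:R * expR (- lam) by ring.
  rewrite (funext uE); apply: cvgM; [exact: cvg_cst|exact: is_cvg_series_exp_coeff].
have errlim : err @ \oo --> (0 : R).
  rewrite (funext errE) -[X in _ --> X](mulr0 (w * lam ^+ c / c`!%:R)).
  by apply: cvgM; [exact: cvg_cst|exact: cvg_exp_coeff].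
apply/cvgrPdist_lt => e e0; have e4 : 0 < e / 4 by rewrite divr_gt0.
move/cvgrPdist_lt: ulim => /(_ _ e4)[N1 _ h1]; move/cvgrPdist_lt: errlim => /(_ _ e4)[N2 _ h2].
pose N := maxn N1 N2; have {}h1 := h1 N (leq_maxl _ _); have {}h2 := h2 N (leq_maxr _ _).
rewrite /= in h1 h2; rewrite sub0r normrN in h2.
pose un n : R := \sum_(r < N) (-1) ^+ r * regular_mean d (fun G : 'M[bool]_n => W n G * (X n G ^_ (c + r))%:R) / (c`! * r`!)%:R.
pose en n : R := regular_mean d (fun G : 'M[bool]_n => W n G * (X n G ^_ (c + N))%:R) / (c`! * N`!)%:R.
have cu : un n @[n --> parity_filter] --> u N.
  apply: cvg_sum_seq => r; apply: cvgM; [apply: cvgM; [exact: cvg_cst|exact: hr]|exact: cvg_cst].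
have ce : en n @[n --> parity_filter] --> err N by apply: cvgM; [exact: hr|exact: cvg_cst].
have dif n : `|regular_mean d (fun G : 'M[bool]_n => W n G * (X n G == c)%:R) - un n| <= en n.
  have -> : un n = regular_mean d (fun G : 'M[bool]_n => W n G *
      \sum_(r < N) (-1) ^+ r * (X n G ^_ (c + r))%:R / (c`! * r`!)%:R).
    rewrite /un (eq_regular_mean (g := fun G => \sum_(r < N) ((-1) ^+ r / (c`! * r`!)%:R) *
       (W n G * (X n G ^_ (c + r))%:R))); last first.
      by move=> G _; rewrite mulr_sumr; apply: eq_bigr => r _; ring.
    by rewrite regular_mean_sum; apply: eq_bigr => r _; rewrite regular_meanZ; ring.
  rewrite -regular_meanB; apply: le_trans (regular_mean_norm _) _.
  have -> : en n = regular_mean d (fun G : 'M[bool]_n => W n G * ((X n G ^_ (c + N))%:R / (c`! * N`!)%:R)).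
    rewrite /en mulrC -regular_meanZ; apply: eq_regular_mean => G _; ring.
  apply: regular_mean_le => G _; rewrite -mulrBr normrM (ger0_norm (W0 n G)) ler_wpM2l //.
  exact: indicator_ffact_le.
move/cvgrPdist_lt: cu => /(_ _ e4) cu; move/cvgrPdist_lt: ce => /(_ _ e4) ce.
near=> n.
have c1 : `|u N - un n| < e / 4 by near: n.
have c2 : `|err N - en n| < e / 4 by near: n.
have c3 := dif n.
set m := regular_mean _ _ in c3 *.
have -> : w * poisson_pmf lam c - m = (w * poisson_pmf lam c - u N) + (u N - un n) - (m - un n) by ring.
apply: le_lt_trans (ler_normB _ _) _.
have c4 := ler_normD (w * poisson_pmf lam c - u N) (u N - un n).
have c5 : en n < e / 4 + e / 4.
  have -> : en n = err N - (err N - en n) by ring.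
  by apply: le_lt_trans (ler_norm _) _; apply: le_lt_trans (ler_normB _ _) _; exact: ltrD.
lra.
Unshelve. all: by end_near. Qed.

(** Lengths in [js] enter as indicators and those in [ks] as falling factorials, so that the
    induction can turn one length after the other from the second form into the first. *)
Lemma joint_count_cvg (js : seq nat) (c : nat -> nat) (ks : seq nat) : uniq js ->
  all (fun k => 2 < k)%N js -> all (fun k => 2 < k)%N ks -> {in js, forall j, j \notin ks} ->
  regular_mean d (fun G : 'M[bool]_n => (\prod_(j <- js) (cycle_number G j == c j)%:R) *
     (falling_counts G ks)%:R : R) @[n --> parity_filter]
    --> \prod_(j <- js) poisson_pmf (cycle_rate j) (c j) * (d%:R - 1) ^+ sumn ks.
Proof.
elim: js ks => [|j js IH] ks /=.
  move=> _ _ k2 _; rewrite big_nil mul1r.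
  under eq_fun do under [in X in regular_mean _ X]eq_fun do rewrite big_nil mul1r.
  exact: falling_mean_cvg.
move=> /andP[jjs ujs] /andP[j2 js2] k2 jks.
have jk : j \notin ks by apply: jks; rewrite mem_head.
have q0 : 0 < d%:R - 1 :> R by rewrite subr_gt0 ltr1n ltnW.
have j20 : 0 < (2 * j)%:R :> R by rewrite ltr0n muln_gt0 /= (ltn_trans _ j2).
have lam0 : 0 < cycle_rate j by rewrite divr_gt0 // exprn_gt0.
pose W n (G : 'M[bool]_n) : R := (\prod_(j <- js) (cycle_number G j == c j)%:R) * (falling_counts G ks)%:R.
have W0 n (G : 'M[bool]_n) : 0 <= W n G by rewrite mulr_ge0 // prodr_ge0.
have -> : \prod_(j0 <- j :: js) poisson_pmf (cycle_rate j0) (c j0) * (d%:R - 1) ^+ sumn ks =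
   (\prod_(j <- js) poisson_pmf (cycle_rate j) (c j) * (d%:R - 1) ^+ sumn ks) * poisson_pmf (cycle_rate j) (c j).
  by rewrite big_cons; ring.
have := @factorial_moment_cvg W (fun n G => cycle_number G j)
  (\prod_(j <- js) poisson_pmf (cycle_rate j) (c j) * (d%:R - 1) ^+ sumn ks) _ (c j) W0 lam0.
have -> : (fun n => regular_mean d (fun G : 'M[bool]_n => W n G * (cycle_number G j == c j)%:R)) =
  (fun n => regular_mean d (fun G : 'M[bool]_n => (\prod_(j0 <- j :: js) (cycle_number G j0 == c j0)%:R) *
     (falling_counts G ks)%:R)).
  by apply/funext => n; apply: eq_regular_mean => G _; rewrite /W big_cons; ring.
apply=> r.
(* r copies of j in front of [ks] stand for the r-th factorial moment of the number of j-cycles. *)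
have := IH (nseq r j ++ ks) ujs js2 _ _.
rewrite all_cat k2 all_nseq j2 orbT => /(_ isT).
have dj : {in js, forall j0, j0 \notin nseq r j ++ ks}.
  move=> i ijs; rewrite mem_cat mem_nseq negb_or negb_and (jks i) ?in_cons ?ijs ?orbT // andbT.
  by apply/orP; right; apply: contraNneq jjs => <-.
move=> /(_ dj) h.
pose A n := regular_mean d (fun G : 'M[bool]_n => \prod_(j0 <- js) (cycle_number G j0 == c j0)%:R *
     (falling_counts G (nseq r j ++ ks))%:R) : R.
have -> : (fun n => regular_mean d (fun G : 'M[bool]_n => W n G * (cycle_number G j ^_ r)%:R)) =
  (fun n => A n * ((2 * j)%:R ^+ r)^-1).
  apply/funext => n; rewrite mulrC -regular_meanZ; apply: eq_regular_mean => G _.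
  rewrite falling_counts_nseq // /W !natrM natrX natrM; field.
  by rewrite expf_neq0 // -natrM gt_eqF.
have -> : \prod_(j0 <- js) poisson_pmf (cycle_rate j0) (c j0) * (d%:R - 1) ^+ sumn ks * cycle_rate j ^+ r =
  \prod_(j0 <- js) poisson_pmf (cycle_rate j0) (c j0) * (d%:R - 1) ^+ sumn (nseq r j ++ ks) * ((2 * j)%:R ^+ r)^-1.
  by rewrite sumn_cat sumn_nseq exprD /cycle_rate expr_div_n -exprM; ring.
by apply: cvgM; [exact: h|exact: cvg_cst].
Qed.

End FactorialMoments.

(** * Poisson tails and infinite divisibility *)

Section QuadraticGeometric.
Variable R : realType.
Implicit Types (t A : R) (g : nat -> R).

(** Multiplication by 1 - t undoes the inner summation, up to a boundary term of favourable sign. *)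
Lemma partial_sum_geom g t n : (forall i, 0 <= g i) -> 0 <= t < 1 ->
  \sum_(0 <= k < n) (\sum_(0 <= i < k.+1) g i) * t ^+ k <= (\sum_(0 <= k < n) g k * t ^+ k) / (1 - t).
Proof.
move=> g0 /andP[t0 t1]; rewrite ler_pdivlMr ?subr_gt0 //.
have -> : (\sum_(0 <= k < n) (\sum_(0 <= i < k.+1) g i) * t ^+ k) * (1 - t) =
   \sum_(0 <= k < n) g k * t ^+ k - t ^+ n * \sum_(0 <= i < n) g i.
  elim: n => [|n IH]; first by rewrite !big_geq // mul0r mulr0 subrr.
  rewrite [in LHS]big_nat_recr //= mulrDl IH [in RHS]big_nat_recr //= exprS.
  rewrite [\sum_(0 <= i < n.+1) g i]big_nat_recr //=; ring.
by rewrite gerBl mulr_ge0 ?exprn_ge0 // sumr_ge0.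
Qed.

(** Partial summation leads from 1 to k + 1, and from there to a triangular number, which is at
    least (k + 1)^2 / 2; each passage costs a factor 1 / (1 - t). *)
Lemma square_geom_sum t n : 0 <= t < 1 ->
  \sum_(0 <= k < n) (k.+1%:R ^+ 2) * t ^+ k <= 2 / (1 - t) / (1 - t) / (1 - t).
Proof.
move=> tt; have /andP[t0 t1] := tt; have p : 0 < 1 - t by rewrite subr_gt0.
have i0 : 0 <= (1 - t)^-1 by rewrite invr_ge0 ltW.
have tk k : 0 <= t ^+ k by exact: exprn_ge0.
have s0 : \sum_(0 <= k < n) 1 * t ^+ k <= 1 / (1 - t).
  by under eq_bigr do rewrite mul1r; exact: geom_tail.
have s1 : \sum_(0 <= k < n) k.+1%:R * t ^+ k <= 1 / (1 - t) / (1 - t).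
  apply: le_trans (ler_wpM2r i0 s0); apply: le_trans (partial_sum_geom n (fun=> ler01) tt).
  by apply: ler_sum => k _; rewrite sumr_const_nat subn0.
have s2 := le_trans (partial_sum_geom n (fun k => ler0n R k.+1) tt) (ler_wpM2r i0 s1).
rewrite mul1r in s2; rewrite -!mulrA mulrC -ler_pdivrMr // mulr_suml !mulrA.
apply: le_trans s2; apply: ler_sum => k _.
rewrite mulrAC ler_wpM2r // ler_pdivrMr //.
elim: k => [|k IH]; first by rewrite big_nat1 expr1n mul1r ler1n.
rewrite big_nat_recr //= mulrDl; apply: le_trans (lerD IH (lexx _)).
by rewrite -!natrX -natrM -natrD ler_nat; lia.
Qed.

(** [tau] is to majorise the tails of the graph statistic and of its limit alike. *)
Lemma square_geom_tail A t : 0 <= A -> 0 <= t < 1 -> exists tau : nat -> R,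
  (forall K n, (K <= n)%N -> \sum_(K <= k < n) A * (k.+1%:R ^+ 2 * t ^+ k) <= tau K) /\
  tau @ \oo --> (0 : R).
Proof.
move=> A0 tt; pose u k : R := A * (k.+1%:R ^+ 2 * t ^+ k).
have u0 k : 0 <= u k by rewrite mulr_ge0 // mulr_ge0 ?exprn_ge0 //; case/andP: tt.
have nd : nondecreasing_seq (series u) by apply: nondecreasing_series => k _ _; exact: u0.
have ub n : series u n <= A * (2 / (1 - t) / (1 - t) / (1 - t)).
  by rewrite /series /= -mulr_sumr ler_wpM2l // square_geom_sum.
have cs : cvgn (series u).
  by apply: nondecreasing_is_cvgn nd _; eexists => _ [n _ <-]; exact: ub.
exists (fun K => limn (series u) - series u K); split.
  move=> K n Kn; have := nondecreasing_cvgn_le nd cs n.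
  rewrite {1}/series /= (@big_cat_nat _ _ _ K) //= -/(series u K) lerBrDl; exact: le_trans.
rewrite -(subrr (limn (series u))); apply: cvgB; [exact: cvg_cst|exact: cs].
Qed.

End QuadraticGeometric.

Section PoissonMoments.
Variable R : realType.
Context {disp : measure_display} {T : measurableType disp}.
Variables (P : probability T R) (V : T -> nat -> nat) (lam : nat -> R).
Hypotheses (lam_gt0 : forall j, 0 < lam j) (hV : cyl_law P V (fun j => poisson_pmf (lam j))).

Let pi_le1 j n : \sum_(0 <= i < n) poisson_pmf (lam j) i <= 1.
Proof.
apply: (@cumul_le1 R (fun j => poisson_pmf (lam j))) => [i m|i]; first exact: poisson_pmf_gt0.
exact: poisson_pmf_sum.
Qed.

Lemma coord_event_measurable j (A : set nat) : measurable (V @^-1` [set v | A (v j)]).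
Proof.
have := cyl_law_measurable hV measurableT (coord_measurable j A).
by rewrite setTI.
Qed.

(** The earlier coordinates are first bounded by B, which leaves a finite union of cylinders; then B
    tends to infinity. *)
Lemma marginal_le j m : (P (V @^-1` [set v | v j = m]) <= (poisson_pmf (lam j) m)%:E)%E.
Proof.
pose E B := V @^-1` [set v | v j = m /\ forall i, (i < j)%N -> (v i < B)%N].
have E_union B : E B.+1 = \bigcup_(a : {ffun 'I_j -> 'I_B.+1})
    V @^-1` cyl j.+1 (fun i => if insub i is Some k then a k : nat else m).
  apply/seteqP; split=> [t [tm tB]|t [a _ ht]].
    exists [ffun i : 'I_j => inord (V t i)] => // i; rewrite ltnS leq_eqVlt => /orP[/eqP ->|ij].
      by rewrite insubN ?ltnn.
    by rewrite insubT ffunE /= inordK // tB.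
  split=> [|i ij]; first by rewrite /= (ht j (ltnSn j)) insubN ?ltnn.
  by rewrite (ht i (leqW ij)) insubT /=.
have mE B : measurable (E B.+1).
  by rewrite E_union; apply: fin_bigcup_measurable => [|a _]; [exact: finite_finset|exact: (hV _ _).1].
have PE B : (P (E B.+1) <= (poisson_pmf (lam j) m)%:E)%E.
  rewrite E_union measure_finT; last 2 first.
  - by move=> a; exact: (hV _ _).1.
  - apply/trivIsetP => a b _ _ ab; apply/seteqP; split=> // t [ha hb].
    case/eqP: ab; apply/ffunP => i; apply: val_inj => /=.
    have := ha i (leqW (ltn_ord i)); rewrite (hb i (leqW (ltn_ord i))) valK.
    by move=> ->.
  rewrite (eq_bigr (fun a : {ffun 'I_j -> 'I_B.+1} =>
     (\prod_(i < j) poisson_pmf (lam i) (a i) * poisson_pmf (lam j) m)%:E)); last first.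
    move=> a _; apply: etrans (hV _ _).2 _; rewrite big_ord_recr /= insubN ?ltnn //.
    by congr (_ * _)%:E; apply: eq_bigr => i _; rewrite valK.
  rewrite sumEFin lee_fin -mulr_suml -(bigA_distr_bigA (fun i (k : 'I_B.+1) => poisson_pmf (lam (val i)) k)).
  rewrite ler_piMl ?poisson_pmf_ge0 //; apply: prodr_ile1 => i _.
  rewrite sumr_ge0 => [|k _]; last exact: poisson_pmf_ge0.
  by rewrite -(big_mkord xpredT (poisson_pmf (lam i))) pi_le1.
have U : \bigcup_B E B.+1 = V @^-1` [set v | v j = m].
  apply/seteqP; split=> [t [B _ [] //]|t tm].
  exists (\sum_(i < j) V t i)%N => //; split=> // i ij.
  by rewrite ltnS (bigD1 (Ordinal ij)) //= leq_addr.
have mU : measurable (\bigcup_B E B.+1) by exact: bigcup_measurable.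
have nd : {homo (fun B => E B.+1) : n k / (n <= k)%N >-> (n <= k)%O}.
  move=> a b ab; apply/subsetPset => t [tm tB]; split=> // i ij.
  exact: leq_trans (tB i ij) _.
have cv := @nondecreasing_cvg_mu _ _ _ P _ mE mU nd.
rewrite -U -(cvg_lim _ cv) //; apply: lime_le; first by apply/cvg_ex; eexists; exact: cv.
by apply: nearW => B; exact: PE.
Qed.

(** Split by the value m and use m p(m) = lam p(m - 1). *)
Lemma coord_mean_le j : (\int[P]_t ((V t j)%:R)%:E <= (lam j)%:E)%E.
Proof.
pose f m (t : T) : \bar R := (m%:R * \1_(V @^-1` [set v | v j = m]) t)%:E.
have mA m := coord_event_measurable j [set m].
have f0 m t : (0 <= f m t)%E by rewrite lee_fin mulr_ge0.
have mf m : measurable_fun [set: T] (f m).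
  by apply/measurable_EFinP; apply: measurable_funM => //; apply: measurable_indic; exact: mA.
have -> : (\int[P]_t ((V t j)%:R)%:E = \int[P]_t (\sum_(m <oo) f m t))%E.
  apply: eq_integral => t _; rewrite (nneseries_split _ (V t j).+1) //.
  rewrite add0n big_nat_recr //= big1_seq ?add0e; last first.
    move=> m /andP[_]; rewrite mem_index_iota => /andP[_ hm].
    by rewrite /f indicE memNset ?mulr0 //= => e; rewrite e ltnn in hm.
  rewrite eseries0 ?adde0; last first.
    by move=> m hm _; rewrite /f indicE memNset ?mulr0 //= => e; rewrite e ltnn in hm.
  by rewrite /f indicE mem_set // mulr1.
rewrite integral_nneseries //.
have fE m : (\int[P]_t f m t <= (m%:R * poisson_pmf (lam j) m)%:E)%E.
  rewrite /f; under eq_integral do rewrite EFinM.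
  rewrite ge0_integralZl_EFin //; last first.
    by apply/measurable_EFinP; apply: measurable_indic; exact: mA.
  have mAm : measurable (V @^-1` [set v | v j = m]) := mA m.
  rewrite integral_indic // setIT EFinM lee_wpmul2l ?lee_fin //; exact: marginal_le.
apply: lime_le.
  by apply: is_cvg_nneseries => m _ _; exact: integral_ge0.
apply: nearW => N; apply: (@le_trans _ _ (\sum_(0 <= m < N) (m%:R * poisson_pmf (lam j) m)%:E)%E).
  exact: lee_sum.
rewrite sumEFin lee_fin.
case: N => [|N]; first by rewrite big_geq // ltW.
rewrite big_nat_recl // mul0r add0r.
rewrite (eq_bigr (fun i => lam j * poisson_pmf (lam j) i)).
  by rewrite -mulr_sumr ler_piMr // ltW.
move=> i _; rewrite /poisson_pmf lam_gt0 exprS factS natrM; field.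
by rewrite pnatr_eq0 -lt0n fact_gt0 nat1r pnatr_eq0.
Qed.

End PoissonMoments.

(** * Mean tails of the weighted sums *)

Section WeightedTails.
Variables (R : realType) (d : nat) (w : nat -> Cplx R) (A t : R).
Hypotheses (d_gt2 : (2 < d)%N) (A_ge0 : 0 <= A) (t01 : 0 <= t < 1)
  (w_le : forall k, (0 < k)%N -> cabs (w k) * (d%:R - 1) ^+ k <= A * t ^+ k).
Variable tau : nat -> R.
Hypothesis tau_le : forall K n, (K <= n)%N -> \sum_(K <= k < n) A * (k.+1%:R ^+ 2 * t ^+ k) <= tau K.

Let q_ge1 : 1 <= d%:R - 1 :> R.
Proof. by move: d_gt2; rewrite -(ltr_nat R) => h; lra. Qed.

Lemma cycle_rate_gt0 j : (0 < j)%N -> 0 < cycle_rate R d j.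
Proof.
move=> j0; rewrite divr_gt0 ?exprn_gt0 //; first exact: lt_le_trans q_ge1.
by rewrite ltr0n muln_gt0.
Qed.

Lemma size_divisors_le k : (0 < k)%N -> (size (divisors k) <= k)%N.
Proof.
move=> k0; rewrite -[X in (_ <= X)%N](size_iota 1); apply: uniq_leq_size.
  exact: divisors_uniq.
move=> j; rewrite -dvdn_divisors // => jk; rewrite mem_iota add1n ltnS.
by rewrite (dvdn_gt0 k0 jk) dvdn_leq.
Qed.

(** Extended real, so that its mean is defined before summability is known. *)
Definition tail_weight K (v : nat -> nat) : \bar R :=
  (\sum_(n <oo) (cabs (w (n + K)) * (walk_count (n + K) v)%:R)%:E)%E.

Lemma tail_term_ge0 k v : 0 <= cabs (w k) * (walk_count k v)%:R.
Proof. by rewrite mulr_ge0 // cabs_ge0. Qed.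

Lemma tail_weight_ge K N v : (K <= N)%N ->
  ((\sum_(K <= k < N) cabs (w k) * (walk_count k v)%:R)%:E <= tail_weight K v)%E.
Proof.
move=> KN; rewrite /tail_weight.
have := @nneseries_lim_ge R (fun n => (cabs (w (n + K)) * (walk_count (n + K) v)%:R)%:E) xpredT 0 (N - K)%N.
move=> h; apply: le_trans (h _); last by move=> n _ _; rewrite lee_fin tail_term_ge0.
by rewrite sumEFin lee_fin -{1}[K]add0n big_addn.
Qed.

Lemma total_weighted_le K v : (0 < K)%N -> summable w v ->
  ((cabs (total w v - weighted w K v))%:E <= tail_weight K v)%E.
Proof.
move=> K0 sv; have h N : (K <= N)%N -> weighted w N v - weighted w K v =
    \sum_(K <= k < N) w k * (walk_count k v)%:R.
  move=> KN; have -> : weighted w N v = weighted w K v + \sum_(K <= k < N) w k * (walk_count k v)%:R.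
    by rewrite /weighted -big_cat_nat.
  by rewrite addrC addKr.
case E : (tail_weight K v) => [r| |]; last 2 first.
- by rewrite leey.
- have := tail_weight_ge v (leqnn K); rewrite E big_geq //.
rewrite lee_fin.
apply: (clim_le_near (N := K)) (climB (total_clim sv) (clim_cst (weighted w K v))) => N KN.
rewrite h //; apply: le_trans (cabs_sum _ _ _) _.
have := tail_weight_ge v KN; rewrite E lee_fin; apply: le_trans.
by apply: ler_sum => k _; rewrite cabsM cabs_nat.
Qed.

Lemma tail_weight_summable v : tail_weight 1 v \is a fin_num -> summable w v.
Proof.
case E : (tail_weight 1 v) => [r| |] // _.
exists (Num.truncn r).+1 => N; apply: (@le_trans _ _ r); last by apply: ltW; exact: truncnS_gt.
rewrite -lee_fin -E; case: N => [|N]; last exact: tail_weight_ge.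
have := tail_weight_ge v (leqnn 1); rewrite big_geq // /abs_weighted big_geq //.
Qed.

Lemma tail_weight_measurable K : measurable_fun [set: seqs] (tail_weight K : seqs -> \bar R).
Proof.
apply: ge0_emeasurable_sum => [n v _ _|n _]; first by rewrite lee_fin tail_term_ge0.
by apply/measurable_EFinP; apply: measurable_funM => //; exact: walk_count_measurable.
Qed.

Context {disp : measure_display} {T : measurableType disp}.
Variables (P : probability T R) (V : T -> nat -> nat) (lam : nat -> R).
Hypotheses (lam_gt0 : forall j, 0 < lam j) (lam_le : forall j, lam j <= cycle_rate R d (j + 3))
  (hV : cyl_law P V (fun j => poisson_pmf (lam j))).

(** A divisor j contributes 2 j times at most its cycle rate, that is at most q^j <= q^k with q = d
    - 1, and there are at most k divisors. Parameters below the cycle rates are allowed because the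
    m-th parts of the limit have smaller ones. *)
Lemma walk_count_mean k : (0 < k)%N ->
  (\int[P]_x ((walk_count k (V x))%:R)%:E <= (k%:R * (d%:R - 1) ^+ k)%:E)%E.
Proof.
move=> k0; have mV := cyl_law_measurable hV.
have mc j : measurable_fun [set: T] (fun x => (V x j)%:R : R).
  exact: (measurableT_comp (coord_measurable_fun j) mV).
have -> : (\int[P]_x ((walk_count k (V x))%:R)%:E =
   \int[P]_x (\sum_(j <- [seq j <- divisors k | (2 < j)%N]) ((2 * j)%:R%:E * ((V x (j - 3)%N)%:R)%:E)))%E.
  apply: eq_integral => x _; rewrite big_filter natr_sum -sumEFin; apply: eq_bigr => j _.
  by rewrite natrM EFinM.
rewrite ge0_integral_sum //; last first.
  by move=> j; apply: emeasurable_funM => //; exact/measurable_EFinP.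
apply: (@le_trans _ _ (\sum_(j <- [seq j <- divisors k | (2 < j)%N]) ((d%:R - 1) ^+ k)%:E)%E).
  rewrite big_seq [X in (_ <= X)%E]big_seq; apply: lee_sum => j; rewrite mem_filter => /andP[j2].
  rewrite -dvdn_divisors // => /dvdn_leq -/(_ k0) jk.
  rewrite ge0_integralZl_EFin //; last exact/measurable_EFinP.
  apply: (@le_trans _ _ ((2 * j)%:R%:E * (cycle_rate R d j)%:E)%E).
    rewrite lee_wpmul2l ?lee_fin //; apply: le_trans (coord_mean_le lam_gt0 hV _) _.
    by rewrite lee_fin -{2}(subnK j2); exact: lam_le.
  rewrite -EFinM lee_fin /cycle_rate mulrC divfK; last by rewrite pnatr_eq0 -lt0n muln_gt0 /= (ltn_trans _ j2).
  exact: ler_weXn2l.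
rewrite sumEFin lee_fin big_const_seq count_predT iter_addr_0 -[_ ^+ k *+ _]mulr_natl ler_wpM2r ?exprn_ge0 ?(le_trans ler01 q_ge1) // ler_nat.
by apply: leq_trans (size_divisors_le k0); rewrite size_filter count_size.
Qed.

Lemma tail_weight_integral K : (0 < K)%N -> (\int[P]_x tail_weight K (V x) <= (tau K)%:E)%E.
Proof.
move=> K0; have mV := cyl_law_measurable hV.
have mw k : measurable_fun [set: T] (fun x => (walk_count k (V x))%:R : R).
  exact: (measurableT_comp (@walk_count_measurable R k) mV).
rewrite /tail_weight integral_nneseries //; last 2 first.
- by move=> n; apply/measurable_EFinP; exact: measurable_funM.
- by move=> n x _; rewrite lee_fin tail_term_ge0.
apply: lime_le.
  by apply: is_cvg_nneseries => n _ _; apply: integral_ge0 => x _; rewrite lee_fin tail_term_ge0.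
apply: nearW => N.
apply: (@le_trans _ _ (\sum_(0 <= n < N) (A * ((n + K).+1%:R ^+ 2 * t ^+ (n + K)))%:E)%E).
  apply: lee_sum => n _; set k := (n + K)%N.
  have k0 : (0 < k)%N by rewrite /k addn_gt0 K0 orbT.
  under eq_integral do rewrite EFinM.
  rewrite ge0_integralZl_EFin ?cabs_ge0 //; last exact/measurable_EFinP.
  apply: (@le_trans _ _ ((cabs (w k))%:E * (k%:R * (d%:R - 1) ^+ k)%:E)%E).
    by rewrite lee_wpmul2l ?lee_fin ?cabs_ge0 // walk_count_mean.
  rewrite -EFinM lee_fin mulrCA.
  apply: (@le_trans _ _ (k%:R * (A * t ^+ k))); first by rewrite ler_wpM2l // w_le.
  rewrite mulrCA ler_wpM2l // ler_wpM2r ?exprn_ge0 //; first by case/andP: t01.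
  by rewrite -natrX ler_nat; nia.
rewrite sumEFin lee_fin; apply: le_trans (tau_le (leq_addl N K)).
by rewrite -{3}[K]add0n big_addn addnK.
Qed.

(** A nonnegative variable of finite mean is finite almost surely. *)
Lemma summable_ae : P (V @^-1` ~` summable w) = 0%E.
Proof.
have mV := cyl_law_measurable hV.
have mZ : measurable_fun [set: T] (fun x => tail_weight 1 (V x)).
  exact: (measurableT_comp (tail_weight_measurable 1) mV).
have iZ : P.-integrable setT (fun x => tail_weight 1 (V x)).
  apply/integrableP; split=> //.
  apply: le_lt_trans (ltry (tau 1)); apply: le_trans (tail_weight_integral (ltnSn 0)).
  rewrite le_eqVlt; apply/orP; left; apply/eqP; apply: eq_integral => x _; rewrite gee0_abs //.
  by apply: nneseries_ge0 => n _ _; rewrite lee_fin tail_term_ge0.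
have [N [mN N0 hN]] := integrable_ae measurableT iZ.
have mS : measurable (V @^-1` ~` summable w).
  have := mV measurableT _ (measurableC (summable_measurable w)); rewrite setTI //.
apply/eqP; rewrite eq_le measure_ge0 andbT -N0; apply: le_measure; rewrite ?inE //.
apply: subset_trans hN => x /= ns h; apply: ns; apply: tail_weight_summable; exact: h.
Qed.

End WeightedTails.

Section TotalSums.
Variables (R : realType) (w : nat -> Cplx R).

Lemma walk_count0 k : walk_count k (fun=> 0%N) = 0%N.
Proof. by rewrite /walk_count big1 // => j _; rewrite muln0. Qed.

Lemma summable0 : summable w (fun=> 0%N).
Proof. by exists 0%N => N; rewrite /abs_weighted big1 // => k _; rewrite walk_count0 mulr0. Qed.

Lemma total0 : total w (fun=> 0%N) = 0.
Proof.
apply: clim_unique (total_clim summable0) _; apply: clim_ext (clim_cst 0) => N.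
by rewrite /weighted big1 // => k _; rewrite walk_count0 mulr0.
Qed.

Lemma total_sum m (V : nat -> nat -> nat) : (forall i, (i < m)%N -> summable w (V i)) ->
  summable w (fun j => \sum_(i < m) V i j)%N /\
  total w (fun j => \sum_(i < m) V i j)%N = \sum_(i < m) total w (V i).
Proof.
elim: m => [|m IH] h.
  rewrite (_ : (fun j => _) = fun=> 0%N); last by apply/funext => j; rewrite big_ord0.
  by rewrite big_ord0 total0; split=> //; exact: summable0.
have [|s1 t1] := IH; first by move=> i im; apply: h; exact: leqW.
rewrite (_ : (fun j => _) = fun j => (\sum_(i < m) V i j + V m j)%N); last first.
  by apply/funext => j; rewrite big_ord_recr.
have sm := h m (ltnSn m).
by split; [exact: summableD|rewrite totalD // big_ord_recr t1].
Qed.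

End TotalSums.

Lemma measure_eq_ae (R : realType) (disp : measure_display) (T : measurableType disp)
    (P : probability T R) (A B N : set T) : measurable A -> measurable B -> measurable N ->
  P N = 0%E -> (forall t, ~ N t -> A t <-> B t) -> P A = P B.
Proof.
move=> mA mB mN N0 h; apply/eqP; rewrite eq_le; apply/andP; split.
  apply: (@le_trans _ _ (P (B `|` N))).
    apply: le_measure; rewrite ?inE //; first exact: measurableU.
    by move=> t At; case: (pselect (N t)) => [Nt|nN]; [right|left; apply/h].
  have h2 : (P (B `|` N) <= P B + P N)%E by exact: measureU2.
  by rewrite N0 adde0 in h2.
apply: (@le_trans _ _ (P (A `|` N))).
  apply: le_measure; rewrite ?inE //; first exact: measurableU.
  by move=> t At; case: (pselect (N t)) => [Nt|nN]; [right|left; apply/h].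
have h2 : (P (A `|` N) <= P A + P N)%E by exact: measureU2.
by rewrite N0 adde0 in h2.
Qed.

Section InfiniteDivisibility.
Variables (R : realType) (d : nat) (w : nat -> Cplx R) (A t : R).
Hypotheses (d_gt2 : (2 < d)%N) (A_ge0 : 0 <= A) (t01 : 0 <= t < 1)
  (w_le : forall k, (0 < k)%N -> cabs (w k) * (d%:R - 1) ^+ k <= A * t ^+ k).
Context {disp : measure_display} {T : measurableType disp}.
Variables (P : probability T R) (V : T -> nat -> nat).
Hypothesis hV : cyl_law P V (fun j => poisson_pmf (cycle_rate R d (j + 3))).

(** The sum of the copies has the law of [V] by uniqueness on cylinders, and [total] is additive
    where all copies are summable, that is almost surely. *)
Lemma total_infinitely_divisible : infinitely_divisible P (fun x => total w (V x)).
Proof.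
case=> // m _.
have [tau [tau_le _]] := square_geom_tail A_ge0 t01.
pose lam j := cycle_rate R d (j + 3) / m.+1%:R.
have m0 : 0 < m.+1%:R :> R by rewrite ltr0n.
have rate0 j : 0 < cycle_rate R d (j + 3) by apply: cycle_rate_gt0 => //; rewrite addn3.
have lam0 j : 0 < lam j by rewrite divr_gt0.
have lamle j : lam j <= cycle_rate R d (j + 3).
  by rewrite ler_pdivrMr // ler_peMr ?ler1n // ltW.
have [d0 [T0 [P0 [V0 h0]]]] := poisson_sequence lam0.
have [d' [T' [P' [V' [[mV' jV'] sV']]]]] := poisson_copies m lam0 h0.
have N0 : P0 (V0 @^-1` ~` summable w) = 0%E := summable_ae d_gt2 A_ge0 t01 w_le tau_le lam0 lamle h0.
have marg i B : (i < m.+1)%N -> measurable (B : set seqs) -> P' (V' i @^-1` B) = P0 (V0 @^-1` B).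
  move=> im mB; pose B' k := if k == i then B else setT.
  have mB' k : measurable (B' k : set seqs) by rewrite /B'; case: ifP.
  have -> : V' i @^-1` B = \bigcap_(k in [set k | (k < m.+1)%N]) V' k @^-1` B' k.
    apply/seteqP; split=> [x Bx k _ /=|x /(_ i im)]; last by rewrite /B' /= eqxx.
    by rewrite /B'; case: eqP => // ->.
  rewrite jV' // (bigD1 (Ordinal im)) //= {1}/B' eqxx big1 ?mule1 // => k ki.
  rewrite /B' (_ : (nat_of_ord k == i) = false); last by apply: contraNF ki => /eqP e; apply/eqP/val_inj.
  by rewrite preimage_setT probability_setT.
pose X (i : 'I_m.+1) x : Cplx R := total w (V' i x).
have mX i : complex_RV (X i) by exact: total_complex_RV.
exists d', T', P', X; split.
- exact: mX.
- move=> s us _ B mB.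
  (* The sets given for the indices in [s] are completed by the whole space. *)
  pose B' k : set seqs := if [exists i : 'I_m.+1, (nat_of_ord i == k) && (i \in s)]
     then (total w @^-1` B (inord k)) else setT.
  have mB' k : measurable (B' k) by rewrite /B'; case: ifP => // _; exact: total_borel.
  have B'E (i : 'I_m.+1) : B' i = if i \in s then total w @^-1` B i else setT.
    rewrite /B' inord_val; congr (if _ then _ else _).
    apply/existsP/idP => [[k /andP[/eqP e ks]]|si]; first by rewrite -(val_inj e).
    by exists i; rewrite eqxx.
  have -> : \bigcap_(i in [set` s]) X i @^-1` B i = \bigcap_(k in [set k | (k < m.+1)%N]) V' k @^-1` B' k.
    apply/seteqP; split=> [x hx k /= km|x hx i /= si].
      have := hx (Ordinal km); rewrite -[k]/(nat_of_ord (Ordinal km)) B'E.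
      by case: ifP => // si /(_ si).
    by have := hx i (ltn_ord i); rewrite /= B'E si.
  rewrite jV' // (eq_bigr (fun i : 'I_m.+1 => if i \in s then P' (X i @^-1` B i) else 1%E)); last first.
    move=> i _; rewrite B'E; case: ifP => _; last by rewrite preimage_setT probability_setT.
    by rewrite -(marg i) //; exact: total_borel.
  by rewrite -big_mkcond /= -big_uniq.
- move=> i j B mB.
  have mB' : measurable ((total w @^-1` B) : set seqs) by exact: total_borel.
  exact: etrans (marg i _ (ltn_ord i) mB') (esym (marg j _ (ltn_ord j) mB')).
move=> B mB.
have mB' : measurable ((total w @^-1` B) : set seqs) by exact: total_borel.
have e : cyl_law P' (fun x j => \sum_(i < m.+1) V' i x j)%N (fun j => poisson_pmf (cycle_rate R d (j + 3))).
  move=> K c; have [h1 h2] := sV' K c; split=> //; rewrite h2; congr (_%:E).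
  by apply: eq_bigr => j _; rewrite /lam mulrC divfK // gt_eqF.
rewrite -[LHS]/(P (V @^-1` (total w @^-1` B))) (cyl_law_unique hV e mB').
(* The null event that some copy is not summable. *)
pose N := ~` \bigcap_(i in [set i | (i < m.+1)%N]) V' i @^-1` summable w.
have mS i : measurable (V' i @^-1` summable w).
  by have := mV' i measurableT _ (summable_measurable w); rewrite setTI.
have mI : measurable (\bigcap_(i in [set i | (i < m.+1)%N]) V' i @^-1` summable w).
  by apply: bigcap_measurable => //; exists 0%N.
have P01 : P0 (V0 @^-1` summable w) = 1%E.
  have mC : measurable (V0 @^-1` ~` summable w).
    by have := cyl_law_measurable h0 measurableT (measurableC (summable_measurable w)); rewrite setTI.
  have pC : P0 (~` (V0 @^-1` ~` summable w)) = (1 - P0 (V0 @^-1` ~` summable w))%E.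
    exact: probability_setC.
  by rewrite -preimage_setC setCK N0 sube0 in pC.
apply: (@measure_eq_ae _ _ _ _ _ _ N).
- by have := cyl_law_measurable e measurableT mB'; rewrite setTI.
- have mRe : measurable_fun [set: seqs] (fun v : seqs => complex.Re (total w v)).
    exact: (total_part_measurable w (@Re_le_cabs R) (@Re_mul_nat R)).
  have mIm : measurable_fun [set: seqs] (fun v : seqs => complex.Im (total w v)).
    exact: (total_part_measurable w (@Im_le_cabs R) (@Im_mul_nat R)).
  apply: (@complex_RV_ReIm _ _ _ (fun x => \sum_(i < m.+1) X i x)) => //.
    rewrite (_ : (fun x => _) = fun x => \sum_(i < m.+1) complex.Re (X i x)); last first.
      by apply/funext => x; rewrite raddf_sum.
    apply: measurable_sum => i.
    exact: (measurableT_comp mRe (mV' i)).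
  rewrite (_ : (fun x => _) = fun x => \sum_(i < m.+1) complex.Im (X i x)); last first.
    by apply/funext => x; rewrite raddf_sum.
  apply: measurable_sum => i.
  exact: (measurableT_comp mIm (mV' i)).
- exact: measurableC.
- have pC : P' N = (1 - P' (\bigcap_(i in [set i | (i < m.+1)%N]) V' i @^-1` summable w))%E.
    exact: probability_setC.
  rewrite pC jV' => [|i]; last exact: summable_measurable.
  by rewrite big1 ?subee // => i _; exact: P01.
move=> x nN.
have [_ E] : summable w (fun j => \sum_(i < m.+1) V' i x j)%N /\
    total w (fun j => \sum_(i < m.+1) V' i x j)%N = \sum_(i < m.+1) total w (V' i x).
  apply: (total_sum (V := fun i => V' i x)) => i im; apply: contrapT => ns.
  by apply: nN => /(_ i im).
by rewrite /preimage /= E.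
Qed.

End InfiniteDivisibility.

(** * Convergence in law *)

Section Modulus.
Variable R : realType.
Local Notation C := (Cplx R).
Variables (g : C -> R) (M : R).
Hypotheses (g_cont : continuous g) (g_le : forall z, `|g z| <= M).

Lemma continuous_cabs z (e : R) : 0 < e ->
  exists2 r : R, 0 < r & forall w, cabs (w - z) < r -> `|g w - g z| < e.
Proof.
move=> e0; have gz : g @ z --> g z by exact: g_cont.
move/cvgrPdist_lt: gz => /(_ e e0).
move=> /nbhs_ballP[r /= r0 hr].
have rE : r = (complex.Re r)%:C by rewrite RRe_real // gtr0_real.
exists (complex.Re r); first by rewrite -ltcR -rE.
move=> w wz; rewrite distrC; apply: hr; rewrite /ball /= rE lt_normC cabsC.
exact: wz.
Qed.

(** Compactness of a square around the disc gives one radius for all centres. *)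
Lemma uniform_continuous_disc (rho e : R) : 0 < e -> exists2 r : R, 0 < r &
  forall z w, cabs z <= rho -> cabs (w - z) < r -> `|g w - g z| < e.
Proof.
move=> e0.
pose K := `[- rho, rho]%classic `*` `[- rho, rho]%classic : set (R * R).
have cK : compact K by apply: compact_setX; exact: segment_compact.
pose Q (i : nat) (p : R * R) : Prop :=
  forall w : C, cabs (w - (p.1 +i* p.2)) < i.+1%:R^-1 -> `|g w - g (p.1 +i* p.2)| < e.
have /(_ _ (\oo : set_system nat) Q _) := (compact_near_coveringP K).1 cK.
have dist (p p' : R * R) (r : R) : ball p r p' -> cabs ((p'.1 +i* p'.2) - (p.1 +i* p.2)) < r + r.
  move=> [h1 h2]; apply: le_lt_trans (cabs_le_ReIm _) _; apply: ltrD.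
    by rewrite /ball /= distrC in h1.
  by rewrite /ball /= distrC in h2.
case.
  move=> p Kp; have e2 : 0 < e / 2 by rewrite divr_gt0.
  have [s s0 hs] := continuous_cabs (p.1 +i* p.2) e2.
  have s4 : 0 < s / 4 by rewrite divr_gt0.
  have s2 : 0 < s / 2 by rewrite divr_gt0.
  have [N _ hN] := near_infty_natSinv_lt (PosNum s2).
  exists (ball p (s / 4), [set i | (N <= i)%N]).
    by split; [exact: nbhsx_ballx|exists N].
  move=> [p' i] /= [bp Ni] w wp.
  have h1 := dist _ _ _ bp; have h2 : i.+1%:R^-1 < s / 2 := hN i Ni.
  have a1 : `|g w - g (p.1 +i* p.2)| < e / 2.
    apply: hs; have -> : w - (p.1 +i* p.2) = (w - (p'.1 +i* p'.2)) + ((p'.1 +i* p'.2) - (p.1 +i* p.2)) by ring.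
    apply: le_lt_trans (cabsD _ _) _.
    by apply: lt_le_trans (ltrD (lt_trans wp h2) h1) _; lra.
  have a2 : `|g (p'.1 +i* p'.2) - g (p.1 +i* p.2)| < e / 2 by apply: hs; lra.
  have -> : g w - g (p'.1 +i* p'.2) = (g w - g (p.1 +i* p.2)) - (g (p'.1 +i* p'.2) - g (p.1 +i* p.2)) by ring.
  apply: le_lt_trans (ler_normB _ _) _; lra.
move=> N _ hN; exists (N.+1%:R^-1); first by rewrite invr_gt0.
move=> z w zr; have := hN N (leqnn N) (complex.Re z, complex.Im z).
rewrite /Q /=; have -> : complex.Re z +i* complex.Im z = z by case: z {zr}.
apply; split=> /=; rewrite in_itv /= -ler_norml.
  exact: le_trans (Re_le_cabs z) zr.
exact: le_trans (Im_le_cabs z) zr.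
Qed.

(** If |z| > 2 M / eta or |z - w| >= r, one of the last two terms already reaches 2 M; otherwise
    uniform continuity on a disc applies. After taking means, only first moments are left on the
    right. *)
Lemma bounded_modulus (e eta : R) : 0 < e -> 0 < eta -> exists2 L : R, 0 <= L &
  forall z w, `|g z - g w| <= e + eta * cabs z + L * cabs (z - w).
Proof.
move=> e0 eta0; have M0 : 0 <= M by apply: le_trans (g_le 0).
have [r r0 hr] := uniform_continuous_disc (2 * M / eta) e0.
have i0 : 0 < r^-1 by rewrite invr_gt0.
exists (2 * M / r); first by rewrite divr_ge0 ?mulr_ge0 // ltW.
move=> z w; have c0 := cabs_ge0 (z - w); have z0 := cabs_ge0 z.
have b : `|g z - g w| <= 2 * M.
  by apply: le_trans (ler_normB _ _) _; rewrite mulr2n mulrDl mul1r lerD.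
have p1 : 0 <= eta * cabs z by rewrite mulr_ge0 // ltW.
have p2 : 0 <= 2 * M / r * cabs (z - w) by rewrite mulr_ge0 // divr_ge0 ?mulr_ge0 // ltW.
case: (lerP (cabs z) (2 * M / eta)) => [zr|zr].
  case: (ltP (cabs (z - w)) r) => wr.
    have := hr z w zr; rewrite [cabs (w - z)]cabsC [`|g w - g z|]distrC => /(_ wr); lra.
  have : 2 * M <= 2 * M / r * cabs (z - w) by rewrite mulrAC ler_pdivlMr // ler_wpM2l // mulr_ge0.
  lra.
have : 2 * M <= eta * cabs z by rewrite [eta * _]mulrC -ler_pdivrMr //; exact: ltW.
lra.
Qed.

End Modulus.

(** * Integrals of bounded functions *)

Section BoundedMeans.
Context {R : realType} {disp : measure_display} {T : measurableType disp}.
Variable P : probability T R.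

Lemma bounded_integrable (f : T -> R) (M : R) : measurable_fun setT f ->
  (forall x, `|f x| <= M) -> P.-integrable setT (EFin \o f).
Proof.
move=> mf fM; apply: measurable_bounded_integrable => //.
  by rewrite (le_lt_trans (probability_le1 P measurableT)) // ltry.
exists M; split; first by rewrite num_real.
by move=> x xM t _ /=; exact: le_trans (fM t) (ltW xM).
Qed.

Lemma Rintegral_bounded_sum (I : Type) (r : seq I) (f : I -> T -> R) (M : I -> R) :
  (forall i, measurable_fun setT (f i)) -> (forall i x, `|f i x| <= M i) ->
  \int[P]_x (\sum_(i <- r) f i x) = \sum_(i <- r) \int[P]_x f i x.
Proof.
move=> mf fM; elim: r => [|i r IH].
  rewrite big_nil (_ : (fun x => _) = fun=> 0); last by apply/funext => x; rewrite big_nil.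
  by rewrite Rintegral_cst // mul0r.
rewrite big_cons -IH -RintegralD //.
- by congr (Rintegral _ _ _); apply/funext => x; rewrite big_cons.
- exact: bounded_integrable (fM i).
- apply: (@bounded_integrable _ (\sum_(i <- r) M i)); first exact: measurable_sum.
  by move=> x; apply: le_trans (ler_norm_sum _ _ _) _; apply: ler_sum.
Qed.

Lemma Rintegral_indic_prob (c : R) (A : set T) : measurable A ->
  \int[P]_x (c * \1_A x) = c * fine (P A).
Proof.
move=> mA; rewrite RintegralZl //; last first.
  by apply: (@bounded_integrable _ 1) => [|x]; rewrite ?measurable_indic // indicE; case: (_ \in _); rewrite ?normr1 ?normr0.
by rewrite /Rintegral integral_indic // setIT.
Qed.

Lemma Rintegral_dist_le (f h b : T -> R) (M : R) : measurable_fun setT f -> measurable_fun setT h ->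
  measurable_fun setT b -> (forall x, `|f x| <= M) -> (forall x, `|h x| <= M) -> (forall x, `|b x| <= M) ->
  (forall x, `|f x - h x| <= b x) -> `|\int[P]_x f x - \int[P]_x h x| <= \int[P]_x b x.
Proof.
move=> mf mh mb fM hM bM fh.
have i1 := bounded_integrable mf fM; have i2 := bounded_integrable mh hM.
have mB : measurable_fun setT (fun x => f x - h x) by exact: measurable_funB.
have bB x : `|f x - h x| <= M + M by apply: le_trans (ler_normB _ _) _; exact: lerD.
rewrite -RintegralB //; apply: le_trans (le_normr_Rintegral _ _) _ => //.
  exact: bounded_integrable bB.
apply: le_Rintegral => //.
- apply: (@bounded_integrable _ (M + M)) => [|x]; last by rewrite normr_id.
  by apply: measurableT_comp => //; exact: normr_measurable.
- exact: bounded_integrable bM.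
Qed.

End BoundedMeans.

(** * Functions of finitely many cycle counts *)

Section BoxLimit.
Variables (R : realType) (d : nat).
Hypothesis d_gt2 : (2 < d)%N.

Definition cycle_counts n (G : 'M[bool]_n) (j : nat) : nat := cycle_number G (j + 3).

Variables (K : nat) (h : (nat -> nat) -> R) (H : R).
Hypotheses (h_le : forall v, `|h v| <= H)
  (h_local : forall u v, (forall j, (j < K)%N -> u j = v j) -> h u = h v).

Let rate j := cycle_rate R d (j + 3).
Let rate_gt0 j : 0 < rate j.
Proof. by apply: cycle_rate_gt0 => //; rewrite addn3. Qed.

Section Box.
Variable B : nat.
Implicit Type a : {ffun 'I_K -> 'I_B}.

Definition extend a (j : nat) : nat := if insub j is Some i then a i : nat else 0%N.

Lemma extendE a (j : 'I_K) : extend a j = a j.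
Proof. by rewrite /extend valK. Qed.

(** The indicator of a cylinder, as the product to which [joint_count_cvg] applies. *)
Definition hits a (v : nat -> nat) : R := \prod_(j < K) (v j == extend a j)%:R.

Lemma hitsE a v : hits a v = (v \in cyl K (extend a))%:R.
Proof.
case: (boolP (v \in _)) => [/set_mem hv|/negP hv].
  by rewrite /hits big1 // => j _; rewrite (hv j) // eqxx.
case: (pselect (exists j : 'I_K, v j != extend a j)) => [[j hj]|hn].
  by rewrite /hits (bigD1 j) //= (negbTE hj) mul0r.
case: hv; apply: mem_set => j jK; apply/eqP; apply: contrapT => /negP hj.
by apply: hn; exists (Ordinal jK).
Qed.

(** A point of the box is hit by exactly one [a], and both sides vanish; any other point is hit by
    none, and the right side is H. *)
Lemma box_approx v :
  `|h v - \sum_a h (extend a) * hits a v| <= H * (1 - \sum_a hits a v).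
Proof.
have H0 : 0 <= H by apply: le_trans (h_le v).
case: (pselect (forall j, (j < K)%N -> (v j < B)%N)) => [hv|nv].
  pose a0 : {ffun 'I_K -> 'I_B} := [ffun j : 'I_K => Ordinal (hv j (ltn_ord j))].
  have e0 j : (j < K)%N -> v j = extend a0 j.
    by move=> jK; rewrite -[j]/(nat_of_ord (Ordinal jK)) extendE ffunE.
  have h0 : hits a0 v = 1 by rewrite hitsE mem_set.
  have ha a : a != a0 -> hits a v = 0.
    move=> ne; rewrite hitsE memNset // => hva; case/eqP: ne; apply/ffunP => j; apply: val_inj.
    by rewrite /= -extendE -(hva j (ltn_ord j)) (e0 j (ltn_ord j)) extendE.
  rewrite (bigD1 a0) //= big1 => [|a /ha ->]; last by rewrite mulr0.
  rewrite [\sum_a hits a v](bigD1 a0) //= [\sum_(i | i != a0) _]big1 => [|a /ha //].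
  by rewrite h0 !addr0 mulr1 (h_local e0) !subrr normr0 mulr0.
have ha a : hits a v = 0.
  rewrite hitsE memNset // => hva; apply: nv => j jK; rewrite (hva j jK).
  by rewrite -[j]/(nat_of_ord (Ordinal jK)) extendE.
rewrite big1 => [|a _]; last by rewrite ha mulr0.
by rewrite [\sum_a hits a v]big1 // !subr0 mulr1.
Qed.

Definition box_mass : R := \sum_a \prod_(j < K) poisson_pmf (rate j) (extend a j).

Lemma hits_mean_cvg a :
  regular_mean d (fun G : 'M[bool]_n => hits a (cycle_counts G)) @[n --> parity_filter d]
    --> \prod_(j < K) poisson_pmf (rate j) (extend a j).
Proof.
have := @joint_count_cvg R d d_gt2 [seq (j + 3)%N | j <- iota 0 K] (fun i => extend a (i - 3)%N) [::].
rewrite map_inj_uniq ?iota_uniq; last by move=> x y /addIn.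
move=> /(_ isT); rewrite all_map => /(_ _ isT).
have -> : \prod_(j <- [seq (j + 3)%N | j <- iota 0 K]) poisson_pmf (cycle_rate R d j) (extend a (j - 3)%N) =
   \prod_(j < K) poisson_pmf (rate j) (extend a j).
  by rewrite big_map -{1}[K]subn0 -/(index_iota 0 K) big_mkord; apply: eq_bigr => j _; rewrite addnK.
rewrite /= expr0 mulr1; set L := \prod_(j < K) _.
have -> : (fun n => regular_mean d (fun G : 'M[bool]_n =>
     \prod_(j <- [seq (j + 3)%N | j <- iota 0 K]) (cycle_number G j == extend a (j - 3)%N)%:R * 1%:R : R)) =
  (fun n => regular_mean d (fun G : 'M[bool]_n => hits a (cycle_counts G))).
  apply/funext => n; apply: eq_regular_mean => G _.
  rewrite mulr1 big_map -{1}[K]subn0 -/(index_iota 0 K) big_mkord; apply: eq_bigr => j _.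
  by rewrite addnK.
apply.
- by apply/allP => j _ /=; rewrite addn3.
- by move=> j _.
Qed.

Lemma box_massE : box_mass = \prod_(j < K) \sum_(0 <= m < B) poisson_pmf (rate j) m.
Proof.
under eq_bigr do rewrite big_mkord.
rewrite (bigA_distr_bigA (fun (j : 'I_K) (m : 'I_B) => poisson_pmf (rate j) m)) /=.
by apply: eq_bigr => a _; apply: eq_bigr => j _; rewrite extendE.
Qed.

End Box.

Lemma box_mass_cvg : box_mass B @[B --> \oo] --> (1 : R).
Proof.
rewrite (_ : (fun B => _) = fun B => \prod_(j < K) \sum_(0 <= m < B) poisson_pmf (rate j) m); last first.
  by apply/funext => B; exact: box_massE.
elim: K => [|k IH].
  by under eq_fun do rewrite big_ord0; exact: cvg_cst.
pose F B : R := \prod_(j < k) \sum_(0 <= m < B) poisson_pmf (rate j) m.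
pose G B : R := \sum_(0 <= m < B) poisson_pmf (rate k) m.
rewrite (_ : (fun B => _) = F \* G); last by apply/funext => B; rewrite big_ord_recr.
have c : (F \* G) B @[B --> \oo] --> (1 * 1 : R) by apply: cvgM; [exact: IH|exact: poisson_pmf_sum].
by rewrite mulr1 in c.
Qed.

Context {disp : measure_display} {T : measurableType disp}.
Variables (P : probability T R) (V : T -> nat -> nat).
Hypotheses (hV : cyl_law P V (fun j => poisson_pmf (rate j)))
  (mh : measurable_fun [set: T] (fun x => h (V x))).

(** [box_approx] integrated; the mean of each [hits a] is the probability of a cylinder. *)
Lemma box_limit B : `|\int[P]_x h (V x) - \sum_(a : {ffun 'I_K -> 'I_B}) h (extend a) *
   \prod_(j < K) poisson_pmf (rate j) (extend a j)| <= H * (1 - box_mass B).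
Proof.
have mc a : measurable (V @^-1` cyl K (@extend B a)) := (hV K (extend a)).1.
have hE a x : hits a (V x) = \1_(V @^-1` cyl K (@extend B a)) x by rewrite hitsE indicE.
have pE a : fine (P (V @^-1` cyl K (@extend B a))) = \prod_(j < K) poisson_pmf (rate j) (extend a j).
  by rewrite (hV K (extend a)).2.
have mi (c : R) (a : {ffun 'I_K -> 'I_B}) : measurable_fun [set: T] (fun x => c * hits a (V x)).
  rewrite (_ : (fun x => _) = fun x => c * \1_(V @^-1` cyl K (@extend B a)) x); last first.
    by apply/funext => x; rewrite hE.
  by apply: measurable_funM => //; exact: measurable_indic.
have ib (a : {ffun 'I_K -> 'I_B}) x : `|hits a (V x)| <= 1.
  by rewrite hitsE; case: (_ \in _); rewrite ?normr1 ?normr0.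
have icb (c : R) (a : {ffun 'I_K -> 'I_B}) x : `|c * hits a (V x)| <= `|c|.
  by rewrite normrM ler_piMr.
have Isum (c : {ffun 'I_K -> 'I_B} -> R) : \int[P]_x (\sum_a c a * hits a (V x)) =
    \sum_a c a * \prod_(j < K) poisson_pmf (rate j) (extend a j).
  rewrite (@Rintegral_bounded_sum _ _ _ P _ _ _ (fun a => `|c a|)) //.
  apply: eq_bigr => a _; rewrite -pE -Rintegral_indic_prob //.
  by congr (Rintegral _ _ _); apply/funext => x; rewrite hE.
have massE : \int[P]_x (H * (1 - \sum_(a : {ffun 'I_K -> 'I_B}) 1 * hits a (V x))) = H * (1 - box_mass B).
  have bs x : `|\sum_(a : {ffun 'I_K -> 'I_B}) 1 * hits a (V x)| <= \sum_(a : {ffun 'I_K -> 'I_B}) 1.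
    by apply: le_trans (ler_norm_sum _ _ _) _; apply: ler_sum => a _; rewrite mul1r.
  have ms : measurable_fun [set: T] (fun x => \sum_(a : {ffun 'I_K -> 'I_B}) 1 * hits a (V x)).
    exact: measurable_sum.
  have ims := bounded_integrable P ms bs.
  have i1 : P.-integrable setT (EFin \o (fun=> 1 : R)).
    by apply: (@bounded_integrable _ _ _ _ _ 1) => // x; rewrite normr1.
  rewrite RintegralZl //.
    rewrite RintegralB // Isum Rintegral_cst // mul1r.
    have -> : fine (P setT) = 1 by rewrite probability_setT.
    by rewrite /box_mass; congr (_ * (1 - _)); apply: eq_bigr => a _; rewrite mul1r.
  apply: (@bounded_integrable _ _ _ _ _ (1 + \sum_(a : {ffun 'I_K -> 'I_B}) 1)).
    exact: measurable_funB.
  by move=> x; apply: le_trans (ler_normB _ _) _; rewrite normr1 lerD2l.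
rewrite -massE -(Isum (fun a => h (extend a))).
pose S : R := \sum_(a : {ffun 'I_K -> 'I_B}) 1.
have S0 : 0 <= S by exact: sumr_ge0.
have bS x : `|\sum_(a : {ffun 'I_K -> 'I_B}) 1 * hits a (V x)| <= S.
  by apply: le_trans (ler_norm_sum _ _ _) _; apply: ler_sum => a _; rewrite mul1r.
have H0 : 0 <= H by apply: le_trans (h_le (fun=> 0%N)).
apply: (@Rintegral_dist_le _ _ _ _ _ _ _ (H * (1 + S))) => //.
- by apply: measurable_sum.
- by apply: measurable_funM => //; apply: measurable_funB => //; apply: measurable_sum.
- by move=> x; apply: le_trans (h_le _) _; rewrite ler_peMr // lerDl.
- move=> x; apply: (@le_trans _ _ (H * S)); last by rewrite ler_wpM2l // lerDr.
  apply: le_trans (ler_norm_sum _ _ _) _; rewrite mulr_sumr; apply: ler_sum => a _.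
  by rewrite mulr1; apply: le_trans (icb _ _ _) (h_le _).
- move=> x; rewrite normrM ger0_norm // ler_wpM2l //.
  by apply: le_trans (ler_normB _ _) _; rewrite normr1 lerD2l.
move=> x; under [X in _ <= _ * (1 - X)]eq_bigr do rewrite mul1r.
exact: box_approx.
Qed.

(** The point probabilities in the box converge, hence so does the mass of the box. As the limit has
    mass nearly 1 in a large box, the cycle counts have it too for large n, which takes the place of
    a tightness argument. *)
Lemma local_mean_cvg :
  regular_mean d (fun G : 'M[bool]_n => h (cycle_counts G)) @[n --> parity_filter d]
    --> \int[P]_x h (V x).
Proof.
have H0 : 0 <= H by apply: le_trans (h_le (fun=> 0%N)).
apply/cvgrPdist_lt => e e0; have e8 : 0 < e / 8 by rewrite divr_gt0.
have [B hB] : exists B, H * (1 - box_mass B) < e / 8.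
  have p : 0 < e / 8 / (H + 1) by rewrite divr_gt0 // ltr_wpDl.
  have /cvgrPdist_lt/(_ _ p)[N _ hN] := box_mass_cvg.
  exists N; have := hN N (leqnn N); rewrite /= ltr_pdivlMr ?ltr_wpDl // => h1.
  apply: le_lt_trans h1; apply: (@le_trans _ _ (H * `|1 - box_mass N|)).
    by rewrite ler_wpM2l // ler_norm.
  by rewrite mulrC ler_wpM2l // lerDl.
have lim := box_limit B.
pose Sn n : R := \sum_(a : {ffun 'I_K -> 'I_B}) h (extend a) *
   regular_mean d (fun G : 'M[bool]_n => hits a (cycle_counts G)).
pose Mn n : R := \sum_(a : {ffun 'I_K -> 'I_B}) regular_mean d (fun G : 'M[bool]_n => hits a (cycle_counts G)).
have cS : Sn n @[n --> parity_filter d] --> \sum_(a : {ffun 'I_K -> 'I_B}) h (extend a) *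
   \prod_(j < K) poisson_pmf (rate j) (extend a j).
  by apply: cvg_sum_seq => a; apply: cvgM; [exact: cvg_cst|exact: hits_mean_cvg].
have cM : Mn n @[n --> parity_filter d] --> box_mass B.
  by apply: cvg_sum_seq => a; exact: hits_mean_cvg.
have e8H : 0 < e / 8 / (H + 1) by rewrite divr_gt0 // ltr_wpDl.
move/cvgrPdist_lt: cS => /(_ _ e8) cS; move/cvgrPdist_lt: cM => /(_ _ e8H) cM.
near=> n.
have [_ ng] : (0 <= n)%N /\ (0 < #|regular_graphs n d|)%N.
  by near: n; exact: parity_filter_large.
have a1 : `|Sn n - regular_mean d (fun G : 'M[bool]_n => h (cycle_counts G))| <= H * (1 - Mn n).
  have -> : Sn n = regular_mean d (fun G : 'M[bool]_n =>
      \sum_(a : {ffun 'I_K -> 'I_B}) h (extend a) * hits a (cycle_counts G)).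
    by rewrite regular_mean_sum; apply: eq_bigr => a _; rewrite regular_meanZ.
  rewrite distrC -regular_meanB; apply: le_trans (regular_mean_norm _ _) _.
  have -> : H * (1 - Mn n) = regular_mean d (fun G : 'M[bool]_n =>
      H * (1 - \sum_(a : {ffun 'I_K -> 'I_B}) hits a (cycle_counts G))).
    by rewrite regular_meanZ regular_meanB regular_mean_cst // regular_mean_sum.
  by apply: regular_mean_le => G _; exact: box_approx.
have a2 : `|\sum_(a : {ffun 'I_K -> 'I_B}) h (extend a) *
   \prod_(j < K) poisson_pmf (rate j) (extend a j) - Sn n| < e / 8 by near: n.
have a3 : H * `|box_mass B - Mn n| <= e / 8.
  have h1 : `|box_mass B - Mn n| < e / 8 / (H + 1) by near: n.
  rewrite ltr_pdivlMr ?ltr_wpDl // in h1; apply: le_trans (ltW h1).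
  by rewrite mulrC ler_wpM2l // lerDl.
have a4 : H * (1 - Mn n) <= e / 8 + e / 8.
  have -> : H * (1 - Mn n) = H * (1 - box_mass B) + H * (box_mass B - Mn n) by ring.
  apply: lerD; first exact: ltW.
  by apply: le_trans a3; rewrite ler_wpM2l // ler_norm.
move: lim a2; set L := \sum_a _ => lim a2.
set m := regular_mean _ _ in a1 *.
have -> : \int[P]_x h (V x) - m = (\int[P]_x h (V x) - L) + (L - Sn n) + (Sn n - m) by ring.
apply: le_lt_trans (ler_normD _ _) _.
have := ler_normD (\int[P]_x h (V x) - L) (L - Sn n).
lra.
Unshelve. all: by end_near. Qed.

End BoxLimit.

(** * The linear statistic and its truncations *)

Section Statistic.
Variables (R : realType) (d : nat) (f : Cplx R -> Cplx R) (a : nat -> Cplx R) (A : R).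
Local Notation C := (Cplx R).
Local Notation q := (d%:R - 1 : R).
Local Notation sq := (Num.sqrt (d%:R - 1 : R)).
Hypotheses (d_gt2 : (2 < d)%N) (a_le : forall k, (0 < k)%N -> cabs (a k) * q ^+ k <= A)
  (f_exp : forall x : R, `|x| <= d%:R / sq ->
     clim (fun N => \sum_(0 <= k < N) a k * (Gamma d k x)%:C) (f x%:C)).

Definition walk_weight k : C := a k / (q `^ (k%:R / 2))%:C.

Let q_ge2 : 2 <= q.
Proof. by move: d_gt2; rewrite -(ler_nat R); lra. Qed.

Let q_gt0 : 0 < q. Proof. exact: lt_le_trans q_ge2. Qed.

Let sq_gt0 : 0 < sq. Proof. by rewrite sqrtr_gt0. Qed.

Let sq_inv : 0 <= sq^-1 < 1.
Proof.
rewrite invr_ge0 ltW //= invf_lt1 //.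
have s2 : sq ^+ 2 = q by rewrite sqr_sqrtr // ltW.
have s0 := sq_gt0; have q2 := q_ge2; nra.
Qed.

Let A_ge0 : 0 <= A.
Proof. by apply: le_trans (a_le (ltnSn 0)); rewrite mulr_ge0 ?cabs_ge0 // exprn_ge0 // ltW. Qed.

Lemma powR_half k : q `^ (k%:R / 2) = sq ^+ k.
Proof.
by rewrite mulrC powRrM powR12_sqrt ?(ltW q_gt0) // powR_mulrn // sqrtr_ge0.
Qed.

Lemma walk_weight_le k : (0 < k)%N -> cabs (walk_weight k) * q ^+ k <= A * sq^-1 ^+ k.
Proof.
move=> k0; rewrite /walk_weight powR_half cabsM cabsV cabs_real ger0_norm ?exprn_ge0 ?sqrtr_ge0 //.
by rewrite mulrAC exprVn ler_wpM2r ?invr_ge0 ?exprn_ge0 ?sqrtr_ge0 // a_le.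
Qed.

(* Absorbs the constants of [mean_cnbw_le]. *)
Definition mean_const : R := (2 * d * d * d.-1 + 4 + 4 * (d.+1 * d))%:R.

Lemma mean_const_ge1 : 1 <= mean_const.
Proof. by rewrite ler1n; lia. Qed.

Lemma walk_weight_const_le k : (0 < k)%N ->
  cabs (walk_weight k) * q ^+ k <= A * mean_const * sq^-1 ^+ k.
Proof.
move=> k0; apply: le_trans (walk_weight_le k0) _; rewrite ler_wpM2r ?exprn_ge0 //.
by rewrite ler_peMr // mean_const_ge1.
Qed.

(** The decay of a_k cancels the growth q^k of the mean, and the normalisation q^(-k/2) remains to
    make the bound summable. *)
Lemma mean_cnbw_square_le n k : (0 < k)%N -> (0 < #|regular_graphs n d|)%N ->
  cabs (walk_weight k) * regular_mean d (fun G : 'M[bool]_n => (tcount k (cnbw G))%:R : R) <=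
  A * mean_const * (k.+1%:R ^+ 2 * sq^-1 ^+ k).
Proof.
move=> k0 ng.
apply: (@le_trans _ _ (cabs (walk_weight k) * (mean_const * k.+1%:R ^+ 2 * q ^+ k))).
  rewrite ler_wpM2l ?cabs_ge0 //; apply: le_trans (mean_cnbw_le R d_gt2 k0 ng) _.
  rewrite ler_wpM2r ?exprn_ge0 ?(ltW q_gt0) // -natrX -natrM ler_nat.
  set z := (k.+1 ^ 2)%N.
  have z1 : (k.+1 <= z)%N by rewrite /z expnS expn1 leq_pmull.
  have z0 : (0 < z)%N by exact: leq_trans z1.
  have key (x c m r : nat) : (r <= z -> x * z * c + 4 * r + m <= (x * c + 4 + m) * z)%N.
    move=> rz; rewrite !mulnDl mulnAC; apply: leq_add; last by rewrite leq_pmulr.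
    by rewrite leq_add2l leq_mul2l rz orbT.
  exact: key.
rewrite [X in X <= _](_ : _ = (cabs (walk_weight k) * q ^+ k) * (mean_const * k.+1%:R ^+ 2)); last by ring.
rewrite [X in _ <= X](_ : _ = (A * sq^-1 ^+ k) * (mean_const * k.+1%:R ^+ 2)); last by ring.
rewrite ler_wpM2r ?walk_weight_le // mulr_ge0 ?exprn_ge0 //.
Qed.

Lemma size_eigenvalues n (M : 'M[R]_n) : M^T = M -> size (eigenvalues M) = n.
Proof.
move=> sM; have [_ e] := eigenvaluesP sM.
have := size_char_poly M; rewrite e size_prod_XsubC; by case.
Qed.

Definition walk_sum n (G : 'M[bool]_n) N : C :=
  \sum_(1 <= k < N) walk_weight k * (tcount k (cnbw G))%:R.

(** Sum the expansion over the eigenvalues; the terms k = 0 add up to n a_0, which the statistic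
    subtracts. *)
Lemma statistic_clim n (G : 'M[bool]_n) : G \in regular_graphs n d ->
  clim (walk_sum G) (linear_statistic f (a 0%N) d G).
Proof.
move=> rG; pose M := sq^-1 *: adjacency R G.
have sM : M^T = M by exact: adjacency_sym rG.
(* The value 0 beyond the bound makes [F l] converge for every l; no eigenvalue lies there. *)
pose F (l : R) N : C := if `|l| <= d%:R / sq then \sum_(0 <= k < N) a k * (Gamma d k l)%:C else 0.
pose L (l : R) : C := if `|l| <= d%:R / sq then f l%:C else 0.
have cF l : clim (F l) (L l).
  by rewrite /F /L; case: ifP => [/f_exp //|_]; exact: clim_cst.
have evb l : l \in eigenvalues M -> `|l| <= d%:R / sq by exact: eigenvalue_bound rG d_gt2 l.
have := climB (clim_sum (eigenvalues M) cF) (clim_cst (n%:R * a 0%N)).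
have -> : \sum_(l <- eigenvalues M) L l - n%:R * a 0%N = linear_statistic f (a 0%N) d G.
  rewrite /linear_statistic -/M; congr (_ - _); apply: eq_big_seq => l /evb hl.
  by rewrite /L hl.
move=> h e e0; have [N hN] := h e e0; exists N.+1 => -[//|m] Nm.
have := hN m.+1 (ltnW Nm); congr (cabs (_ - _) < _).
have -> : \sum_(l <- eigenvalues M) F l m.+1 =
    \sum_(l <- eigenvalues M) \sum_(0 <= k < m.+1) a k * (Gamma d k l)%:C.
  by apply: eq_big_seq => l /evb hl; rewrite /F hl.
rewrite exchange_big /= big_nat_recl //= /walk_sum big_add1 /= addrAC.
have -> : \sum_(l <- eigenvalues M) a 0%N * (Gamma d 0 l)%:C = n%:R * a 0%N.
  rewrite -mulr_sumr mulrC; congr (_ * _); rewrite -{2}(size_eigenvalues sM).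
  rewrite (eq_bigr (fun=> 1)) => [|l _]; last by rewrite /Gamma eqxx rmorph1.
  by rewrite big_const_seq count_predT iter_addr_0.
rewrite subrr add0r; apply: eq_bigr => k _.
have := @count_cnbw_eigenvalues R n d G rG d_gt2 k.+1 (ltn0Sn k); rewrite -/M => tE.
rewrite -mulr_sumr -[(tcount _ _)%:R](rmorph_nat (real_complex R)) /= tE rmorphM /=.
rewrite /walk_weight powR_half -mulrA mulKf ?rmorph_sum //.
by rewrite fmorph_eq0 expf_neq0 // gt_eqF.
Qed.

Lemma walk_count_cycles n (G : 'M[bool]_n) k : G \in regular_graphs n d ->
  walk_count k (cycle_counts G) = (\sum_(j <- divisors k | 2 < j) tcount j (is_cycle G))%N.
Proof.
move=> rG; apply: eq_bigr => j j2; rewrite (tcount_cycles rG j2) /cycle_counts.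
by rewrite subnK.
Qed.

Definition branch_const K : R := \sum_(1 <= k < K) cabs (walk_weight k) * ((2 * d) ^ k * k`!)%:R.

Variable tau : nat -> R.
Hypothesis tau_le : forall K n, (K <= n)%N ->
  \sum_(K <= k < n) A * mean_const * (k.+1%:R ^+ 2 * sq^-1 ^+ k) <= tau K.

Let bad n (G : 'M[bool]_n) k : R := (tcount k (fun t => cnbw G t && branching t))%:R.

(** Below K only branching walks separate closed walks from repeated cycles; from K on the walks are
    kept as they are. *)
Lemma walk_sum_dist n (G : 'M[bool]_n) K N : (0 < n)%N -> G \in regular_graphs n d ->
  (0 < K <= N)%N -> cabs (walk_sum G N - weighted walk_weight K (cycle_counts G)) <=
  \sum_(1 <= k < K) cabs (walk_weight k) * bad G k +
  \sum_(K <= k < N) cabs (walk_weight k) * (tcount k (cnbw G))%:R.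
Proof.
move=> n0 rG /andP[K0 KN]; have x0 : 'I_n := Ordinal n0.
have -> : walk_sum G N - weighted walk_weight K (cycle_counts G) =
   \sum_(1 <= k < K) walk_weight k * ((tcount k (cnbw G))%:R - (walk_count k (cycle_counts G))%:R) +
   \sum_(K <= k < N) walk_weight k * (tcount k (cnbw G))%:R.
  rewrite /walk_sum (@big_cat_nat _ _ _ K) //= /weighted addrAC -sumrB; congr (_ + _).
  by apply: eq_bigr => k _; rewrite mulrBr.
apply: le_trans (cabsD _ _) _; apply: lerD; apply: le_trans (cabs_sum _ _ _) _; last first.
  by apply: ler_sum => k _; rewrite cabsM cabs_nat.
apply: ler_sum_nat => k /andP[k0 _]; rewrite cabsM ler_wpM2l ?cabs_ge0 //.
have [] := cnbw_decomp x0 k0 rG; rewrite -walk_count_cycles // => lo hi.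
by rewrite -natrB // cabs_nat ler_nat leq_subLR.
Qed.

(** The walk sums approximate the statistic, and as there are finitely many graphs on n vertices,
    one [N] serves for all of them. *)
Lemma mean_truncation n K : (0 < K)%N -> (0 < n)%N -> (0 < #|regular_graphs n d|)%N ->
  (2 * (2 * K + 2 * (d.+1 * d)) <= n * d)%N ->
  regular_mean d (fun G : 'M[bool]_n =>
    cabs (linear_statistic f (a 0%N) d G - weighted walk_weight K (cycle_counts G))) <=
  branch_const K / n%:R + tau K.
Proof.
move=> K0 n0 ng nK.
have part N : (K <= N)%N -> regular_mean d (fun G : 'M[bool]_n =>
    cabs (walk_sum G N - weighted walk_weight K (cycle_counts G))) <= branch_const K / n%:R + tau K.
  move=> KN; apply: le_trans (regular_mean_le (fun G rG => walk_sum_dist n0 rG _)) _.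
    by rewrite K0 KN.
  rewrite regular_meanD !regular_mean_sum; apply: lerD.
    rewrite /branch_const mulr_suml; apply: ler_sum_nat => k /andP[k0 kK].
    rewrite regular_meanZ -mulrA ler_wpM2l ?cabs_ge0 //.
    by apply: (mean_branching_le R d_gt2) => //; apply: leq_trans nK; lia.
  apply: le_trans (tau_le KN); apply: ler_sum_nat => k /andP[Kk _].
  by rewrite regular_meanZ; apply: mean_cnbw_square_le => //; exact: leq_trans Kk.
apply/ler_addgt0Pr => e e0.
have exN (G : 'M[bool]_n) : exists N, G \in regular_graphs n d ->
    forall m, (N <= m)%N -> cabs (walk_sum G m - linear_statistic f (a 0%N) d G) < e.
  case: (boolP (G \in regular_graphs n d)) => [rG|_]; last by exists 0%N.
  by have [N hN] := statistic_clim rG e0; exists N.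
have [Nf hNf] := choice exN.
pose N := maxn K (\max_(G : 'M[bool]_n) Nf G).
have NG G : (Nf G <= N)%N by rewrite leq_max (leq_bigmax G) orbT.
apply: (@le_trans _ _ (regular_mean d (fun G : 'M[bool]_n =>
    cabs (walk_sum G N - weighted walk_weight K (cycle_counts G)) + e))).
  apply: regular_mean_le => G rG; have h := hNf G rG N (NG G).
  have -> : linear_statistic f (a 0%N) d G - weighted walk_weight K (cycle_counts G) =
    (walk_sum G N - weighted walk_weight K (cycle_counts G)) - (walk_sum G N - linear_statistic f (a 0%N) d G).
    by ring.
  by apply: le_trans (cabsB _ _) _; rewrite lerD2l ltW.
by rewrite regular_meanD regular_mean_cst // lerD2r part // leq_maxl.
Qed.

Lemma weighted_local K u v : (forall j, (j < K)%N -> u j = v j) ->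
  weighted walk_weight K u = weighted walk_weight K v.
Proof.
move=> uv; apply: eq_big_nat => k /andP[k0 kK]; congr (_ * _%:R).
rewrite /walk_count big_seq_cond [RHS]big_seq_cond; apply: eq_bigr => j.
rewrite -dvdn_divisors // => /andP[/dvdn_leq -/(_ k0) jk j2].
by rewrite uv //; lia.
Qed.

Context {disp : measure_display} {T : measurableType disp}.
Variables (P : probability T R) (V : T -> nat -> nat).
Hypothesis hV : cyl_law P V (fun j => poisson_pmf (cycle_rate R d (j + 3))).
Hypothesis tau_cvg : tau @ \oo --> (0 : R).

Lemma weighted_complex_RV K : complex_RV (fun x => weighted walk_weight K (V x)).
Proof.
have mV := cyl_law_measurable hV.
have mw k : measurable_fun [set: T] (fun x => (walk_count k (V x))%:R : R).
  exact: (measurableT_comp (@walk_count_measurable R k) mV).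
apply: complex_RV_ReIm.
  rewrite (_ : (fun x => _) = fun x => \sum_(k <- index_iota 1 K) complex.Re (walk_weight k) * (walk_count k (V x))%:R).
    by apply: measurable_sum => k; exact: measurable_funM.
  by apply/funext => x; rewrite raddf_sum; apply: eq_bigr => k _; exact: Re_mul_nat.
rewrite (_ : (fun x => _) = fun x => \sum_(k <- index_iota 1 K) complex.Im (walk_weight k) * (walk_count k (V x))%:R).
  by apply: measurable_sum => k; exact: measurable_funM.
by apply/funext => x; rewrite raddf_sum; apply: eq_bigr => k _; exact: Im_mul_nat.
Qed.

Let Y x : C := total walk_weight (V x).

Let c_ge0 : 0 <= A * mean_const.
Proof. by rewrite mulr_ge0 // (le_trans ler01 mean_const_ge1). Qed.

Let rate_gt0 j : 0 < cycle_rate R d (j + 3).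
Proof. by apply: cycle_rate_gt0 => //; rewrite addn3. Qed.

Lemma summable_null : P (V @^-1` ~` summable walk_weight) = 0%E.
Proof.
exact: (summable_ae d_gt2 c_ge0 sq_inv walk_weight_const_le tau_le rate_gt0 (fun=> lexx _) hV).
Qed.

Lemma summable_null_measurable : measurable (V @^-1` ~` summable walk_weight).
Proof.
have := cyl_law_measurable hV measurableT (measurableC (summable_measurable walk_weight)).
by rewrite setTI.
Qed.

Lemma Y_complex_RV : complex_RV Y.
Proof. exact: (total_complex_RV walk_weight (cyl_law_measurable hV)). Qed.

(** The modulus of [g] is integrated: |Y| and its distance to the truncation are at most the tails
    from 1 and from K, off the null set where the counts are not summable. *)
Lemma limit_truncation (g : C -> R) (M e eta L : R) K : continuous g -> (forall z, `|g z| <= M) ->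
  0 <= e -> 0 <= eta -> 0 <= L -> (0 < K)%N ->
  (forall z w, `|g z - g w| <= e + eta * cabs z + L * cabs (z - w)) ->
  `|\int[P]_x g (Y x) - \int[P]_x g (weighted walk_weight K (V x))| <= e + eta * tau 1 + L * tau K.
Proof.
move=> gc gM e0 eta0 L0 K0 gm.
have mV := cyl_law_measurable hV.
have m1 := complex_RV_comp Y_complex_RV gc.
have m2 := complex_RV_comp (weighted_complex_RV K) gc.
have i1 := bounded_integrable P m1 (fun x => gM _).
have i2 := bounded_integrable P m2 (fun x => gM _).
have mB := measurable_funB m1 m2.
have bB x : `|g (Y x) - g (weighted walk_weight K (V x))| <= M + M.
  by apply: le_trans (ler_normB _ _) _; exact: lerD.
rewrite -RintegralB //; apply: le_trans (le_normr_Rintegral _ _) _ => //.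
  exact: (bounded_integrable P mB bB).
pose tw J x : \bar R := tail_weight walk_weight J (V x).
have tw0 J x : (0 <= tw J x)%E by apply: nneseries_ge0 => k _ _; rewrite lee_fin tail_term_ge0.
have mt J : measurable_fun [set: T] (tw J).
  exact: (measurableT_comp (tail_weight_measurable walk_weight J) mV).
have it J : (0 < J)%N -> (\int[P]_x tw J x <= (tau J)%:E)%E.
  by move=> J0; apply: (tail_weight_integral d_gt2 c_ge0 sq_inv walk_weight_const_le tau_le rate_gt0 (fun=> lexx _) hV).
have mn : measurable_fun [set: T] (fun x => `|g (Y x) - g (weighted walk_weight K (V x))|).
  by apply: measurableT_comp => //; exact: normr_measurable.
have le : (\int[P]_x (`|g (Y x) - g (weighted walk_weight K (V x))|)%:E <=
   (e + eta * tau 1 + L * tau K)%:E)%E.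
  apply: (@le_trans _ _ (\int[P]_x (e%:E + eta%:E * tw 1%N x + L%:E * tw K x))%E).
    apply: ae_ge0_le_integral => //.
    - exact/measurable_EFinP.
    - by move=> x _; rewrite !adde_ge0 ?mule_ge0 ?lee_fin.
    - apply: emeasurable_funD; first apply: emeasurable_funD => //.
        by apply: emeasurable_funM.
      by apply: emeasurable_funM.
    exists (V @^-1` ~` summable walk_weight); split.
    - exact: summable_null_measurable.
    - exact: summable_null.
    move=> x /= nh sx; apply: nh => _.
    apply: (@le_trans _ _ (e + eta * cabs (Y x) + L * cabs (Y x - weighted walk_weight K (V x)))%:E).
      by rewrite lee_fin; exact: gm.
    rewrite !EFinD !EFinM; apply: leeD; first apply: leeD => //.
      apply: lee_wpmul2l; first by rewrite lee_fin.
      have := total_weighted_le (ltnSn 0) sx; rewrite /weighted big_geq // subr0; exact.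
    by apply: lee_wpmul2l; [rewrite lee_fin|exact: total_weighted_le].
  have mz J (b : R) : measurable_fun [set: T] (fun x => b%:E * tw J x)%E by apply: emeasurable_funM.
  have z0 J (b : R) x : 0 <= b -> (0 <= b%:E * tw J x)%E by move=> b0; rewrite mule_ge0 ?lee_fin.
  rewrite ge0_integralD //; last 3 first.
  - by move=> x _; rewrite adde_ge0 ?lee_fin // z0.
  - exact: emeasurable_funD.
  - by move=> x _; exact: z0.
  rewrite ge0_integralD //; last first.
  - by move=> x _; exact: z0.
  rewrite !ge0_integralZl_EFin // integral_cst // [X in (e%:E * X)%E](_ : _ = 1%E); last exact: probability_setT.
  rewrite mule1 !EFinD !EFinM.
  by rewrite leeD // ?leeD // lee_wpmul2l ?lee_fin // it.
have fn : (\int[P]_x (`|g (Y x) - g (weighted walk_weight K (V x))|)%:E)%E \is a fin_num.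
  by rewrite ge0_fin_numE ?(le_lt_trans le) ?ltry // integral_ge0 // => x _; rewrite lee_fin.
by rewrite /Rintegral -lee_fin fineK.
Qed.

Lemma statistic_cvg_in_law : regular_cvg_in_law d (linear_statistic f (a 0%N) d) P Y.
Proof.
move=> g gc [M gM].
have M0 : 0 <= M by apply: le_trans (gM 0).
have mY := complex_RV_comp Y_complex_RV gc.
have iY := bounded_integrable P mY (fun x => gM _).
have EE : ('E_P[fun x => g (Y x)])%E = (\int[P]_x g (Y x))%:E.
  by rewrite unlock /Rintegral fineK //; exact: integrable_fin_num iY.
rewrite EE; apply/fine_cvgP; split; first by apply: nearW.
apply/cvgrPdist_lt => e e0; pose ep := e / 16.
have ep0 : 0 < ep by rewrite divr_gt0.
have t1 : 0 <= tau 1 by apply: le_trans (tau_le (leqnn 1)); rewrite big_geq.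
(* The order of the choices: eta for the first moment, then L for eta, K for L, and finally n for
   K. *)
pose eta := ep / (tau 1 + 1).
have eta0 : 0 < eta by rewrite divr_gt0 // ltr_wpDl.
have etat : eta * tau 1 <= ep.
  by rewrite /eta mulrAC ler_pdivrMr ?ltr_wpDl // ler_wpM2l ?(ltW ep0) // lerDl.
have [L L0 hL] := bounded_modulus gc gM ep0 eta0.
have [K K0 LK] : exists2 K, (0 < K)%N & L * tau K <= ep.
  have p : 0 < ep / (L + 1) by rewrite divr_gt0 // ltr_wpDl.
  have /cvgrPdist_lt/(_ _ p)[N _ hN] := tau_cvg.
  exists N.+1 => //; have := hN N.+1 (leqnSn N); rewrite /= sub0r normrN ltr_pdivlMr ?ltr_wpDl // => h1.
  apply: le_trans (ltW h1); rewrite mulrC.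
  apply: (@le_trans _ _ (`|tau N.+1| * L)); first by rewrite ler_wpM2r // ler_norm.
  by rewrite ler_wpM2l // lerDl.
have lim := limit_truncation gc gM (ltW ep0) (ltW eta0) L0 K0 hL.
have hloc u v : (forall j, (j < K)%N -> u j = v j) ->
    g (weighted walk_weight K u) = g (weighted walk_weight K v).
  by move=> uv; rewrite (weighted_local uv).
have mK := complex_RV_comp (weighted_complex_RV K) gc.
have cK := local_mean_cvg d_gt2 (h := fun v => g (weighted walk_weight K v)) (fun v => gM _) hloc hV mK.
move/cvgrPdist_lt: cK => /(_ _ ep0) cK.
pose N0 := (2 * (2 * K + 2 * (d.+1 * d)))%N.
pose N1 := (Num.truncn (L * branch_const K / ep)).+1.
near=> n.
have [nN ng] : (maxn N0 N1 <= n)%N /\ (0 < #|regular_graphs n d|)%N.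
  by near: n; exact: parity_filter_large.
have n0 : (0 < n)%N by apply: leq_trans nN; rewrite leq_max orbT.
have nR : 0 < n%:R :> R by rewrite ltr0n.
have a1 : `|\int[P]_x g (weighted walk_weight K (V x)) -
    regular_mean d (fun G : 'M[bool]_n => g (weighted walk_weight K (cycle_counts G)))| < ep by near: n.
have hn J : (0 < J <= K)%N -> (2 * (2 * J + 2 * (d.+1 * d)) <= n * d)%N.
  move=> /andP[_ JK]; apply: (@leq_trans n); last by rewrite leq_pmulr // (ltn_trans _ d_gt2).
  by apply: leq_trans (leq_trans (leq_maxl _ _) nN); rewrite /N0 leq_mul2l leq_add2r leq_mul2l JK orbT.
have a2 : `|regular_mean d (fun G : 'M[bool]_n => g (linear_statistic f (a 0%N) d G)) -
    regular_mean d (fun G : 'M[bool]_n => g (weighted walk_weight K (cycle_counts G)))| <=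
    ep + eta * tau 1 + L * (branch_const K / n%:R + tau K).
  rewrite -regular_meanB; apply: le_trans (regular_mean_norm _ _) _.
  apply: le_trans (regular_mean_le (fun G rG => hL _ _)) _.
  rewrite !regular_meanD !regular_meanZ regular_mean_cst //; apply: lerD; first apply: lerD => //.
    rewrite ler_wpM2l ?(ltW eta0) //.
    (* With K = 1 the truncation is empty, and the estimate bounds the first moment of the
       statistic. *)
    have := @mean_truncation n 1 (ltnSn 0) n0 ng (hn 1%N _); rewrite /branch_const big_geq // mul0r add0r.
    under eq_regular_mean => G _ do rewrite /weighted big_geq // subr0.
    by apply; rewrite K0.
  by rewrite ler_wpM2l //; apply: mean_truncation => //; apply: hn; rewrite K0 leqnn.
have a3 : L * (branch_const K / n%:R) <= ep.
  rewrite mulrA ler_pdivrMr // [ep * _]mulrC -ler_pdivrMr //.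
  apply: le_trans (ltW (truncnS_gt _)) _; rewrite ler_nat.
  exact: leq_trans (leq_maxr _ _) nN.
rewrite mulrDr in a2.
set m := regular_mean _ _ in a2 *; set mK' := regular_mean _ _ in a1 a2.
set I1 := \int[P]_x g (Y x) in lim *; set I2 := \int[P]_x _ in lim a1.
change (`|I1 - m| < e).
(* The three differences cost at most 3, 1 and 4 times [ep]. *)
have -> : I1 - m = (I1 - I2) + (I2 - mK') - (m - mK') by ring.
apply: le_lt_trans (ler_normB _ _) _; have := ler_normD (I1 - I2) (I2 - mK').
rewrite /ep in a1 a2 a3 lim etat LK *; lra.
Unshelve. all: by end_near. Qed.

End Statistic.

Theorem theorem16 (R : realType) (d : nat) (alpha : R)
    (f : Cplx R -> Cplx R) :
  (3 <= d)%N ->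
  3 / 2 < alpha ->
  let rho : R := (d%:R - 1) `^ alpha in
  analytic_on (inside_bernstein_ellipse (2 * rho)) f ->
  (exists M : R, forall z, inside_bernstein_ellipse (2 * rho) z ->
     `|f z| <= M%:C) ->
  exists a : nat -> Cplx R,
    (forall x : R, -2 <= x <= 2 ->
       (\sum_(0 <= k < N) a k * (Gamma d k x)%:C) @[N --> \oo] --> f x%:C) /\
    (forall (disp : measure_display) (T : measurableType disp)
            (P : probability T R) (C : nat -> {RV P >-> nat}),
       limit_cycle_counts d C ->
       exists Y : T -> Cplx R,
         [/\ complex_RV Y,
             {ae P, forall t,
               (\sum_(1 <= k < N) a k / ((d%:R - 1) `^ (k%:R / 2))%:C
                                  * (CNBW C k t)%:R) @[N --> \oo] --> Y t},
             infinitely_divisible P Y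
           & regular_cvg_in_law d (linear_statistic f (a 0%N) d) P Y]).
Proof.
move=> d3 al rho fa fb; have [a [A [a_le f_exp]]] := gamma_expansion d3 al fa fb.
have q2 : 2 <= d%:R - 1 :> R by move: d3; rewrite -(ler_nat R); lra.
set sq := Num.sqrt (d%:R - 1 : R) in f_exp.
have s2 : sq ^+ 2 = d%:R - 1 by rewrite sqr_sqrtr //; lra.
have s0 : 0 <= sq by exact: sqrtr_ge0.
have s1 : 1 < sq by nra.
exists a; split.
  move=> x x2; apply/climP; apply: f_exp.
  (* The interval [-2, 2] lies inside the range of the expansion: 2 <= d / sq, because d = sq^2 +
     1. *)
  apply: (@le_trans _ _ 2); first by rewrite ler_norml.
  rewrite ler_pdivlMr ?(lt_trans ltr01) //.
  have -> : d%:R = sq ^+ 2 + 1 by rewrite s2 subrK.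
  nra.
move=> disp T P C [ind pmf C1 C2].
have A0 : 0 <= A.
  by apply: le_trans (a_le 1%N (ltnSn 0)); rewrite mulr_ge0 ?cabs_ge0 // exprn_ge0 //; lra.
have tt : 0 <= sq^-1 < 1 by rewrite invr_ge0 s0 /= invf_lt1 // (lt_trans ltr01).
have cc : 0 <= A * mean_const R d by rewrite mulr_ge0 // (le_trans ler01 (mean_const_ge1 R d)).
have [tau [tau_le tau_cvg]] := square_geom_tail cc tt.
(* The sequence starts with the 3-cycles; [C 1] and [C 2] vanish. *)
pose V (t : T) (j : nat) : nat := C (j + 3)%N t.
have hV : cyl_law P V (fun j => poisson_pmf (cycle_rate R d (j + 3))).
  move=> K c; pose B i : set nat := [set c (i - 3)%N].
  have e : V @^-1` cyl K c = \bigcap_(i in [set` [seq (j + 3)%N | j <- iota 0 K]]) C i @^-1` B i.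
    apply/seteqP; split=> [t ht i /= /mapP[j]|t ht j jK].
      by rewrite mem_iota => /andP[_ jK] ->; rewrite /B /= addnK; exact: ht.
    have := ht (j + 3)%N; rewrite /B /= addnK; apply; apply/mapP; exists j => //.
    by rewrite mem_iota add0n.
  split.
    rewrite e; apply: fin_bigcap_measurable => // i _.
    by have := @measurable_funPT _ _ _ _ (C i) measurableT (B i) I; rewrite setTI.
  rewrite e ind.
  - rewrite big_map -{1}[K]subn0 -/(index_iota 0 K) big_mkord -prodEFin.
    apply: eq_bigr => j _; rewrite /B addnK.
    by apply: etrans (pmf _ _ _) _; rewrite ?addn3.
  - by rewrite map_inj_uniq ?iota_uniq // => x y /addIn.
  - by move=> i /mapP[j _ ->]; rewrite /= addn3.
  - by [].
exists (fun t => total (walk_weight d a) (V t)); split.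
- exact: (total_complex_RV _ (cyl_law_measurable hV)).
- exists (V @^-1` ~` summable (walk_weight d a)); split.
  + exact: summable_null_measurable hV.
  + exact: (summable_null d3 a_le tau_le hV).
  move=> t /= nt st; apply: nt; apply/climP.
  apply: clim_ext (total_clim st) => N; apply: eq_big_nat => k /andP[k0 _].
  congr (_ * _%:R); rewrite /CNBW /walk_count big_mkcond big_seq [RHS]big_seq.
  apply: eq_bigr => j; rewrite -dvdn_divisors // => jk.
  case: ifP => [j2|/negbT]; first by rewrite /V subnK.
  (* The divisors 1 and 2 contribute nothing, as [C 1] and [C 2] are 0. *)
  have := dvdn_gt0 k0 jk; case: j {jk} => [//|[|[|//]]] _ _; rewrite ?C1 ?C2 muln0 //.
- exact: (total_infinitely_divisible d3 cc tt (walk_weight_const_le d3 a_le) hV).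
- exact: (statistic_cvg_in_law d3 a_le f_exp tau_le hV tau_cvg).
Qed.
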